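(* Let $\Omega\subset\mathbb{R}^n$ be a bounded domain, $\mathfrak{K}>0$, $M_0>0$, $1<q<\infty$, $0<\lambda\le\Lambda$, and let $w\in A_q$ with $[w]_{A_q}\le M_0$. Let $\mathbb{A}$ be a measurable symmetric matrix-valued function on $\Omega$ satisfying $\lambda|\xi|^2\le\langle\mathbb{A}(x)\xi,\xi\rangle\le\Lambda|\xi|^2$ for all $x\in\Omega$, $\xi\in\mathbb{R}^n$. Let $\mathbf{f}\in L^q_{w,loc}(\Omega;\mathbb{R}^n)$ and let $u\in W^{1,q}_{w,loc}(\Omega)$ be a weak solution of $$\mathrm{div}\,\mathbb{A}(x)\nabla u=\mathrm{div}\,\mathbf{f}(x)\quad\text{in }\Omega.$$ Then there exist constants $\delta_0>0$, $M>2$ and $C>0$, depending only on $\lambda,\Lambda,n,q$ and $M_0$, such that, whenever $\mathbb{A}$ is $(\delta,\mathfrak{K})$-BMO with $\delta\le\delta_0$, it holds that $$\int_{B_d(x_0)}|\nabla u|^q\,w(x)\,dx\le C\int_{B_{2d}(x_0)}\Big(|\mathbf{f}|^q+\Big|\frac{u}{d}\Big|^q\Big)w(x)\,dx$$ for all $d\le\mathfrak{K}/M$ and $x_0\in\Omega$ with $B_{Md}(x_0)\subset\Omega$.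
   Context: Dimension $n\ge2$. For $1<q<\infty$, a nonnegative $w\in L^1_{loc}(\mathbb{R}^n)$ belongs to $A_q$ if $[w]_{A_q}:=\sup_{B}\big(\frac1{|B|}\int_B w\,dx\big)\big(\frac1{|B|}\int_B w^{-1/(q-1)}dx\big)^{q-1}<\infty$, the supremum over all balls $B\subset\mathbb{R}^n$. $L^q_w(\Omega)$ is the space of measurable $f$ with $\int_\Omega|f|^q w\,dx<\infty$; $W^{1,q}_w(\Omega)$ is the space of $u\in L^q_w(\Omega)$ whose weak gradient is in $L^q_w(\Omega)$; the subscript $loc$ means membership on every $\Omega'\Subset\Omega$. Weak solution means $\int_\Omega\langle\mathbb{A}\nabla u,\nabla\psi\rangle dx=\int_\Omega\langle\mathbf{f},\nabla\psi\rangle dx$ for all $\psi\in C_c^\infty(\Omega)$. $\mathbb{A}$ is $(\delta,\mathfrak{K})$-BMO if $\|\mathbb{A}\|_{*,\mathfrak{K}}:=\sup_{x\in\overline\Omega}\sup_{0<\rho<\mathfrak{K}}\frac{1}{|B_\rho(x)\cap\Omega|}\int_{B_\rho(x)\cap\Omega}|\mathbb{A}-\langle\mathbb{A}\rangle_{B_\rho(x)\cap\Omega}|\,dy<\delta$, where $\langle g\rangle_D=\frac1{|D|}\int_D g$. *)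

(* Defs.v *)
From HB Require Import structures.
From mathcomp Require Import all_boot all_order all_algebra.
From mathcomp Require Import all_classical all_reals all_analysis.

Set Implicit Arguments.
Unset Strict Implicit.
Unset Printing Implicit Defensive.
Import Order.TTheory GRing.Theory Num.Theory.
Import numFieldNormedType.Exports.

Local Open Scope classical_set_scope.
Local Open Scope ring_scope.

(* The n-fold product of the Lebesgue measure of R, on the Borel sets of R^n. *)

Section lebesgue_step.
Context (R : realType) (n : nat).
Local Notation RB := (measurableTypeR R).
Local Notation m := (@lebesgue_measure R).
Variable mu : {sigma_finite_measure set (n.-tuple RB) -> \bar R}.

Definition tuple_cons (p : RB * n.-tuple RB) : n.+1.-tuple RB :=
  [tuple of p.1 :: p.2].

Lemma measurable_tuple_cons : measurable_fun [set: RB * n.-tuple RB] tuple_cons.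
Proof. exact: (measurable_cons measurable_fst measurable_snd). Qed.

Definition lebesgue_step : set (n.+1.-tuple RB) -> \bar R :=
  pushforward (m \x mu)%E tuple_cons.

Let step0 : lebesgue_step set0 = 0%E.
Proof. by rewrite /lebesgue_step /pushforward preimage_set0 measure0. Qed.

Let step_ge0 A : (0 <= lebesgue_step A)%E.
Proof. by rewrite /lebesgue_step /pushforward measure_ge0. Qed.

Let step_sigma_additive : semi_sigma_additive lebesgue_step.
Proof.
move=> F mF tF mUF; rewrite /lebesgue_step /pushforward preimage_bigcup.
have mT := measurable_tuple_cons.
apply: measure_semi_sigma_additive.
- by move=> k; rewrite -[X in measurable X]setTI; exact: mT.
- apply/trivIsetP => /= i j _ _ ij; rewrite -preimage_setI.
  by move/trivIsetP : tF => /(_ _ _ _ _ ij) ->//; rewrite preimage_set0.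
- by rewrite -preimage_bigcup -[X in measurable X]setTI; exact: mT.
Qed.

HB.instance Definition _ := isMeasure.Build _ _ _
  lebesgue_step step0 step_ge0 step_sigma_additive.

Let step_sigma_finite : sigma_finite setT lebesgue_step.
Proof.
have /sigma_finiteP[G [TG ndG Goo]] := sigma_finiteT m.
have /sigma_finiteP[H [TH ndH Hoo]] := sigma_finiteT mu.
have TGH : setT = \bigcup_k (G k `*` H k).
  rewrite -setXTT TG TH predeqE => -[x t]; split.
    move=> [/= [k _ Gx] [l _ Ht]]; exists (maxn k l) => //; split => /=.
      by move: x Gx; exact/subsetPset/ndG/leq_maxl.
    by move: t Ht; exact/subsetPset/ndH/leq_maxr.
  by move=> [k _ []/= ? ?]; split; exists k.
pose g (t : n.+1.-tuple RB) : RB * n.-tuple RB := (thead t, [tuple of behead t]).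
have mg : measurable_fun setT g.
  apply: measurable_fun_pair => /=.
    exact: measurable_tnth.
  exact: measurable_behead.
have gK p : g (tuple_cons p) = p.
  by case: p => x t; congr (_, _); apply/val_inj.
exists (fun k => g @^-1` (G k `*` H k)).
  apply/seteqP; split=> // t _.
  by have [k _ GHk] : (\bigcup_k (G k `*` H k)) (g t); [rewrite -TGH|exists k].
move=> k; have [mG Gk] := Goo k; have [mH Hk] := Hoo k; split.
  by rewrite -[X in measurable X]setTI; apply: mg => //; exact: measurableX.
rewrite /lebesgue_step /pushforward -comp_preimage.
rewrite (_ : g \o tuple_cons = id); last by apply/funext => p; exact: gK.
by rewrite preimage_id product_measure1E// lte_mul_pinfty// ge0_fin_numE.
Qed.

HB.instance Definition _ := Measure_isSigmaFinite.Build _ _ _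
  lebesgue_step step_sigma_finite.

End lebesgue_step.

Fixpoint tuple_lebesgue (R : realType) (n : nat) :
    {sigma_finite_measure set (n.-tuple (measurableTypeR R)) -> \bar R} :=
  match n with
  | 0 => @dirac _ (0.-tuple (measurableTypeR R)) [tuple] R
  | n'.+1 => lebesgue_step (tuple_lebesgue R n')
  end.

(* The completed Lebesgue measure on 'rV[R]_n.  Its sigma-algebra, carried by
   the copy [euclid R n] of 'rV[R]_n, is that of the Lebesgue measurable sets,
   obtained by the Caratheodory criterion. *)

Section lebesgue.
Context (R : realType) (n : nat).

Definition row_of_tuple (t : n.-tuple (measurableTypeR R)) : 'rV[R]_n := \row_i tnth t i.

Definition lebesgue_outer (A : set 'rV[R]_n) : \bar R :=
  (tuple_lebesgue R n)^*%mu (row_of_tuple @^-1` A).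

Let outer0 : lebesgue_outer set0 = 0%E.
Proof. by rewrite /lebesgue_outer preimage_set0 outer_measure0. Qed.

Let outer_ge0 A : (0 <= lebesgue_outer A)%E.
Proof. exact: outer_measure_ge0. Qed.

Let le_outer : {homo lebesgue_outer : A B / A `<=` B >-> (A <= B)%E}.
Proof. by move=> A B AB; apply: le_outer_measure => t; exact: AB. Qed.

Let outer_sigma_subadditive : sigma_subadditive lebesgue_outer.
Proof.
move=> F; rewrite /lebesgue_outer preimage_bigcup.
exact: outer_measure_sigma_subadditive.
Qed.

HB.instance Definition _ := isOuterMeasure.Build R 'rV[R]_n lebesgue_outer
  outer0 outer_ge0 le_outer outer_sigma_subadditive.

Definition euclid := caratheodory_type lebesgue_outer.

HB.instance Definition _ := Measurable.on euclid.

Definition lebesgue : set euclid -> \bar R := lebesgue_outer.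

Let lebesgue0 : lebesgue set0 = 0%E.
Proof. exact: outer0. Qed.

Let lebesgue_ge0 A : (0 <= lebesgue A)%E.
Proof. exact: outer_ge0. Qed.

Let lebesgue_sigma_additive : semi_sigma_additive lebesgue.
Proof. exact: caratheodory_measure_sigma_additive. Qed.

HB.instance Definition _ := isMeasure.Build _ _ _
  lebesgue lebesgue0 lebesgue_ge0 lebesgue_sigma_additive.

End lebesgue.

Section euclidean.
Context (R : realType) (n : nat).
Implicit Types (x y v w : 'rV[R]_n) (r : R).

Definition dotv v w : R := \sum_i v 0 i * w 0 i.

Definition normv v : R := Num.sqrt (dotv v v).

(* The norm of 'rV[R]_n in the library is the sup norm; it induces the same
   topology, but its balls are cubes. *)
Definition eball x r : set 'rV[R]_n := [set y | normv (y - x) < r].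

Definition frobenius (A : 'M[R]_n) : R :=
  Num.sqrt (\sum_i \sum_j A i j ^+ 2).

End euclidean.

Section weighted_spaces.
Context (R : realType) (n : nat).
Implicit Types (D : set 'rV[R]_n) (w u : 'rV[R]_n -> R)
  (F : 'rV[R]_n -> 'rV[R]_n) (q : R).

Local Notation mu := (@lebesgue R n).

Definition lmeasurable D (f : 'rV[R]_n -> R) : Prop :=
  measurable_fun (D : set (euclid R n)) (f : euclid R n -> R).

(* D' is an open set compactly contained in D *)
Definition compactly_in (D' D : set 'rV[R]_n) : Prop :=
  [/\ open D', compact (closure D') & closure D' `<=` D].

Definition L1loc D u : Prop :=
  lmeasurable D u /\
  forall D', compactly_in D' D -> (\int[mu]_(x in D') `|u x|%:E < +oo)%E.

Definition average D (g : 'rV[R]_n -> \bar R) : \bar R :=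
  ((\int[mu]_(x in D) g x) / mu D)%E.

(* The power of w is taken in the extended reals, with 0^-1 = +oo; the real
   power function of the library would give 0 where w vanishes. The product of
   0 and +oo is 0, which is only relevant for w = 0 almost everywhere. *)
Definition Aq_const q w : \bar R := ereal_sup
  [set (average (eball z.1 z.2) (fun x => (w x)%:E) *
        average (eball z.1 z.2) (fun x => ((w x `^ (q - 1)^-1)%:E)^-1)
          `^ (q - 1))%E
  | z in [set z : 'rV[R]_n * R | 0 < z.2]].

Definition Aq q w : Prop :=
  [/\ forall x, 0 <= w x, L1loc setT w & (Aq_const q w < +oo)%E].

Definition Lqw q w D u : Prop :=
  lmeasurable D u /\
  (\int[mu]_(x in D) (`|u x| `^ q * w x)%:E < +oo)%E.

Definition Lqw_vec q w D F : Prop :=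
  (forall i, lmeasurable D (fun x => F x 0 i)) /\
  (\int[mu]_(x in D) (normv (F x) `^ q * w x)%:E < +oo)%E.

Definition Lqw_vec_loc q w D F : Prop :=
  forall D', compactly_in D' D -> Lqw_vec q w D' F.

Definition partial (i : 'I_n) u : 'rV[R]_n -> R :=
  fun x => 'D_(delta_mx 0 i) u x.

Definition gradient u : 'rV[R]_n -> 'rV[R]_n :=
  fun x => \row_i partial i u x.

Fixpoint Ck (k : nat) u : Prop :=
  match k with
  | 0 => continuous u
  | k'.+1 => continuous u /\
      forall i : 'I_n,
        (forall x, derivable u x (delta_mx 0 i)) /\ Ck k' (partial i u)
  end.

Definition test_function D (phi : 'rV[R]_n -> R) : Prop :=
  [/\ forall k, Ck k phi,
      compact (closure [set x | phi x != 0]) &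
      closure [set x | phi x != 0] `<=` D].

Definition weak_gradient D u F : Prop :=
  [/\ L1loc D u,
      forall i, L1loc D (fun x => F x 0 i) &
      forall phi, test_function D phi -> forall i,
        \int[mu]_(x in D) (u x * partial i phi x) =
        - \int[mu]_(x in D) (F x 0 i * phi x)].

Definition W1qw q w D u : Prop :=
  Lqw q w D u /\ exists F, weak_gradient D u F /\ Lqw_vec q w D F.

Definition W1qw_loc q w D u : Prop :=
  forall D', compactly_in D' D -> W1qw q w D' u.

End weighted_spaces.

Section elliptic_equation.
Context (R : realType) (n : nat).
Implicit Types (D : set 'rV[R]_n) (A : 'rV[R]_n -> 'M[R]_n)
  (F Du : 'rV[R]_n -> 'rV[R]_n).

Local Notation mu := (@lebesgue R n).

Definition bounded_domain D : Prop :=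
  [/\ open D, connected D, D !=set0 & bounded_set D].

(* vectors are rows, so that v *m A^T is the product of A with v *)
Definition mulv (A : 'M[R]_n) (v : 'rV[R]_n) : 'rV[R]_n := v *m A^T.

Definition elliptic_coefficients (lam Lam : R) D A : Prop :=
  [/\ forall i j, lmeasurable D (fun x => A x i j),
      forall x, D x -> (A x)^T = A x &
      forall x xi, D x -> lam * normv xi ^+ 2 <= dotv (mulv (A x) xi) xi
                          <= Lam * normv xi ^+ 2].

(* Du stands for the weak gradient of the solution *)
Definition weak_solution D A F Du : Prop :=
  forall psi, test_function D psi ->
    \int[mu]_(x in D) dotv (mulv (A x) (Du x)) (gradient psi x) =
    \int[mu]_(x in D) dotv (F x) (gradient psi x).

Definition mx_average D A : 'M[R]_n :=
  \matrix_(i, j) ((\int[mu]_(y in D) A y i j) / fine (mu D)).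

Definition BMO_norm D (K : R) A : \bar R := ereal_sup
  [set average (eball z.1 z.2 `&` D)
         (fun y => (frobenius (A y - mx_average (eball z.1 z.2 `&` D) A))%:E)
  | z in [set z : 'rV[R]_n * R | closure D z.1 /\ 0 < z.2 < K]].

Definition is_BMO D (delta K : R) A : Prop := (BMO_norm D K A < delta%:E)%E.

End elliptic_equation.

(* Main.v *)
(** By absorption over the balls of radius between d and 2d, it suffices to
    bound the weighted L^q norm of the gradient on a small cube by a small
    multiple of its norm on a larger ball plus the contributions of f and u.
    Freezing the coefficients at their average A on a ball, the gradient is the
    sum of an average of itself over that ball and of the singular integral
    operator given by the second derivatives of the fundamental solution of
    div (A grad), applied to f + (A - a) Du. The weak (1,1) bound of that
    operator, the smallness of the mean oscillation of a and the reverse Hoelder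
    inequality for A_q weights make the level sets of the gradient small, in
    Lebesgue measure and hence in weighted measure; a stopping-time (good
    lambda) argument sums over the levels. *)
From HB Require Import structures.
From mathcomp Require Import all_boot all_order all_algebra.
From mathcomp Require Import all_classical all_reals all_analysis measurable_realfun.
From mathcomp Require Import ring lra.
(* after MathComp-Analysis, which also defines a [compactly_in] *)
Require Import Defs.

Set Implicit Arguments.
Unset Strict Implicit.
Unset Printing Implicit Defensive.
Import Order.TTheory GRing.Theory Num.Theory.
Import numFieldNormedType.Exports.
Local Open Scope classical_set_scope.
Local Open Scope ring_scope.

Local Notation mfun := (measurable_fun setT).
Local Notation le_via X := (@le_trans _ _ X).
Local Notation sub_id := (@subset_refl _ _).
Local Notation ge0 f := (forall x, 0 <= f x).
Local Notation mfunM := measurable_funM.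
Local Notation mfunD := measurable_funD.
Local Notation mT_comp := measurableT_comp.

(** The solution is only known in a weighted space with any [q > 1], so for [q < 2] no energy
    inequality for [u] and no comparison problem in [L^2] are at hand. The proof rests instead on an
    identity tested with explicit smooth kernels, which asks for no more than the local
    integrability given by the [A_q] condition. No principal value is taken: the fundamental
    solution is smoothed below scale [e] by a profile in the quadratic form of the inverse matrix,
    and the difference of two scales is smooth with compact support, so bounds uniform in [e]
    suffice. Its [L^2] bound comes from integration by parts and ellipticity instead of the Fourier
    transform. Replacing weighted by unweighted averages uses some exponent [s < q]; the room for it
    comes from the dual weight. Dyadic cells suit sup-norm balls while the statement has Euclidean
    ones, which puts powers of [n] into the constants and leads to [M = 2 n + 1]. Absorption
    requires the gradient to have finite weighted norm on the larger ball; for this the given [Du]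
    has to be identified almost everywhere with the local weak gradients that membership of [u] in
    the Sobolev space provides. *)

Ltac pos := lazymatch goal with
 | |- is_true (_ <= _%:E)%E => rewrite lee_fin;pos
 | |- is_true (_ < _%:E)%E => rewrite lte_fin;pos
 | |- is_true (0 < _ * _) => apply:mulr_gt0;pos
 | |- is_true (0 < _ + _) => solve [apply:addr_gt0;pos | apply:ltr_wpDl;pos | apply:ltr_wpDr;pos]
 | |- is_true (0 < _ ^+ _) => apply:exprn_gt0;pos
 | |- is_true (0 < _ ^-1) => rewrite invr_gt0;pos
 | |- is_true (0 < _ `^ _) => apply:powR_gt0;pos
 | |- is_true (0 < `|_|) => rewrite normr_gt0;pos
 | |- is_true (0 < _%:R) => solve [exact:ltr0Sn | rewrite ltr0n;trivial]
 | |- is_true (0 <= _ * _) => apply:mulr_ge0;pos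
 | |- is_true (0 <= _ + _) => apply:addr_ge0;pos
 | |- is_true (0 <= _ ^+ _) => solve [apply:exprn_ge0;pos | exact:sqr_ge0]
 | |- is_true (0 <= _ ^-1) => rewrite invr_ge0;pos
 | |- is_true (0 <= _ `^ _) => exact:powR_ge0
 | |- is_true (0 <= `|_|) => exact:normr_ge0
 | |- is_true (0 <= _%:R) => exact:ler0n
 | |- is_true (0 <= \1_ _ _) => rewrite indicE;exact:ler0n
 | |- is_true (_ != 0) => solve [trivial | apply:lt0r_neq0;pos]
 | |- (_ == 0) = false => apply:gt_eqF;pos
 | |- is_true (0 < ?c) => solve [trivial | exact:ltr01 | is_var c;unfold c;pos
   | match c with ?f _ => is_var f;unfold f;pos end]
 | |- is_true (0 <= ?c) => solve [trivial | exact:ler01 | apply:ltW;pos | is_var c;unfold c;pos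
   | match c with ?f _ => is_var f;unfold f;pos end]
 | |- _ => solve [trivial | apply:ltW;pos]
 end.

Lemma le_of_eq d (T : porderType d) (x y : T) : (x = y -> x <= y)%O.
by move=> ->. Qed.

Lemma measurable_gt d (T : measurableType d) (R : realType) (f : T -> R) (c : R) : mfun f ->
 measurable [set x | (c < f x)%R].
move=> mf;rewrite (_ : [set x | _] = f @^-1` `]c, +oo[).
 by rewrite -[X in measurable X]setTI;exact:mf measurableT _ (measurable_itv _).
by apply/seteqP;split => x /=;rewrite in_itv /= andbT.
Qed.

(** * Translations and boxes for the product Lebesgue measure *)

Section tuple_measure.
Context (R : realType).
Local Notation RB := (measurableTypeR R).
Local Notation m := (@lebesgue_measure R).
Local Notation T n := (n.-tuple RB).

(** The translated measure agrees with Lebesgue measure on half-open intervals, and these determine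
    it. *)
Lemma lebesgue_measure_shift (a : R) (A : set RB) : measurable A ->
 m ((fun x : RB => (x : R) + a : RB) @^-1` A) = m A.
have mf : mfun (fun x : RB => (x : R) + a : RB).
 exact:mfunD.
move=> mA;rewrite -[LHS]/(pushforward m (fun x : RB => (x : R) + a : RB) A).
apply/esym/lebesgue_measure_unique => //= _ [[c d]] _ <-.
rewrite /pushforward.
have -> : ((fun x => x + a) @^-1` `]c, d]) = `]c - a, d - a]%classic.
 by apply/seteqP;split=> x /=;rewrite !in_itv/= ltrBlDr lerBrDr.
rewrite !lebesgue_measure_itv/= !lte_fin ltrD2r;case: ifP => // _.
by rewrite !EFinB;congr (_%:E);ring.
Qed.

Lemma ge0_integral_shift (a : R) (f : RB -> \bar R) :
 mfun f -> (forall x, (0 <= f x)%E) ->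
 (\int[m]_x f ((x : R) + a)%R = \int[m]_x f x)%E.
move=> mf f0.
have mg : mfun (fun x : RB => (x : R) + a : RB).
 exact:mfunD.
pose g : RB -> RB := fun x : RB => (x : R) + a : RB.
rewrite -[LHS]/(\int[m]_(x in g @^-1` setT) (f \o g) x)%E.
rewrite -ge0_integral_pushforward//.
by apply:eq_measure_integral => A mA _;exact:lebesgue_measure_shift.
Qed.

Definition shift_tuple n (v t : T n) : T n :=
 [tuple tnth t i + tnth v i | i < n].

Lemma measurable_shift_tuple n (v : T n) : mfun (shift_tuple v).
apply/measurable_fun_tnthP => i.
rewrite (_ : _ \o _ = fun t => tnth t i + tnth v i);last first.
 by apply/funext => t /=;rewrite tnth_mktuple.
apply:mfunD => //;exact:measurable_tnth.
Qed.

Lemma shift_tuple_cons n (v : T n.+1) p :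
 shift_tuple v (tuple_cons p) =
 tuple_cons (p.1 + thead v : RB, shift_tuple [tuple of behead v] p.2).
case: p => x t;apply:eq_from_tnth => i;rewrite tnth_mktuple.
case: (unliftP ord0 i) => [j ->|->];last pos.
rewrite /tuple_cons !tnthS tnth_mktuple tnth_behead/=;congr (_ + tnth v _).
by apply/val_inj;rewrite /= inordK// ltnS.
Qed.

(** Induction on the dimension: slicing along the first coordinate, a shift moves the slices by its
    tail, which the induction hypothesis ignores, and the slicing variable by its head, which
    one-dimensional invariance ignores. *)
Lemma tuple_lebesgue_shift n (v : T n) (A : set (T n)) : measurable A ->
 tuple_lebesgue R n (shift_tuple v @^-1` A) = tuple_lebesgue R n A.
elim: n v A => [v A mA|n IH v A mA].
 congr (tuple_lebesgue R 0 _);apply/seteqP;split=> t /=.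
  by rewrite (tuple0 t) (tuple0 (shift_tuple v _)).
 by rewrite (tuple0 t) (tuple0 (shift_tuple v _)).
rewrite /= /lebesgue_step /pushforward /=.
set B := tuple_cons (n:=n) @^-1` A.
have mB : measurable B.
 by rewrite -[B]setTI;apply:measurable_tuple_cons.
have E x : xsection (tuple_cons (n:=n) @^-1` (shift_tuple v @^-1` A)) x =
  shift_tuple [tuple of behead v] @^-1` xsection B (x + thead v).
 by apply/seteqP;split=> t;rewrite /xsection /= !in_setE /= /B/= shift_tuple_cons.
rewrite /product_measure1/=.
pose h (x : RB) := tuple_lebesgue R n (xsection B x).
transitivity (\int[m]_x h (x + thead v)%R)%E.
 by apply:eq_integral => x _;rewrite E IH//;exact:measurable_xsection.
by rewrite ge0_integral_shift//;exact:measurable_fun_xsection.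
Qed.

Lemma tuple_lebesgue_box n (I : 'I_n -> interval R) :
 tuple_lebesgue R n [set t : T n | forall i, tnth t i \in I i] =
 (\prod_(i < n) m [set` I i])%E.
elim: n I => [I|n IH I].
 by rewrite big_ord0 /= diracE mem_set//=;case.
rewrite big_ord_recl /= /lebesgue_step /pushforward /=.
rewrite (_ : _ @^-1` _ = [set` I ord0] `*`
  [set t : T n | forall i, tnth t i \in I (lift ord0 i)]);last first.
 apply/seteqP;split=> -[x t] /=.
  move=> h;split=> /=;first by have := h ord0;rewrite tnth0.
  by move=> i;have := h (lift ord0 i);rewrite tnthS.
 move=> [/= h0 h] i;case: (unliftP ord0 i) => [j ->|->].
  by rewrite tnthS;exact:h.
 by pos.
rewrite product_measure1E ?IH//.
rewrite (_ : [set _ | _] = \bigcap_i ((@tnth n RB)^~ i @^-1` [set` I (lift ord0 i)]));last first.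
 by apply/seteqP;split=> t h;[move=> i _;exact:h|move=> i;exact:h].
apply:fin_bigcap_measurable => // i _.
rewrite -[X in measurable X]setTI;apply:measurable_tnth => //.
Qed.
End tuple_measure.

Lemma countable_bigcup_measurable d (T : sigmaRingType d) (I : countType)
  (F : I -> set T) :
 (forall i, measurable (F i)) -> measurable (\bigcup_i F i).
move=> mF;pose G k := if unpickle k is Some i then F i else set0.
have -> : \bigcup_i F i = \bigcup_k G k.
 apply/seteqP;split=> x [i _ Fi].
  by exists (pickle i) => //;rewrite /G pickleK.
 by move: Fi;rewrite /G;case: unpickle => // j Fj;exists j.
by apply:bigcup_measurable => k _;rewrite /G;case: unpickle.
Qed.

Lemma cvg0_ex_le (R : realType) (u : nat -> \bar R) (e : R) :
 u @ \oo --> 0%E -> 0 < e -> exists K, (u K <= e%:E)%E.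
move=> u0 e0;have h : \forall k \near \oo, (u k < e%:E)%E.
 apply:(u0 [set x | (x < e%:E)%E]);apply:open_nbhs_nbhs;split;last pos.
 exact:open_ereal_lt_ereal.
by case: h => K _ /(_ K (leqnn K)) h;exists K;exact/ltW.
Qed.

Lemma open_bigcap_ord (T : topologicalType) (F : nat -> set T) K :
 (forall k, open (F k)) -> open (\bigcap_(k in `I_K) F k).
move=> oF;elim: K => [|K IH].
 rewrite (_ : \bigcap_(_ in _) _ = setT);first exact:openT.
 by apply/seteqP;split.
rewrite (_ : \bigcap_(_ in _) _ = \bigcap_(k in `I_K) F k `&` F K);first exact:openI.
apply/seteqP;split=> x h.
 by split=> [k /= kK|];apply:h => //=;exact:ltnW.
by move=> k /=;rewrite ltnS leq_eqVlt => /predU1P[->|];[case: h|move=> kK;apply:h.1].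
Qed.

(** * Lebesgue measure of row vectors: open sets, translations, outer regularity *)

Section euclid_measure.
Context (R : realType) (n : nat).
Local Notation RB := (measurableTypeR R).
Local Notation T := (n.-tuple RB).
Local Notation V := 'rV[R]_n.
Local Notation E := (euclid R n).
Local Notation mu := (@lebesgue R n).
Local Notation outer := (@lebesgue_outer R n).

Definition tuple_of_row (x : V) : T := [tuple x 0 i | i < n].

Lemma row_of_tupleK : cancel (@row_of_tuple R n) tuple_of_row.
by move=> t;apply:eq_from_tnth => i;rewrite tnth_mktuple mxE. Qed.

Lemma tuple_of_rowK : cancel tuple_of_row (@row_of_tuple R n).
by move=> x;apply/rowP => i;rewrite mxE tnth_mktuple. Qed.

(** Pulled back to tuples, the Caratheodory criterion is that of the outer measure of the Borel
    product measure, which every Borel set satisfies. *)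
Lemma euclid_measurable (A : set V) :
 measurable (@row_of_tuple R n @^-1` A) -> measurable (A : set E).
move=> mA;rewrite -[measurable _]/(caratheodory_measurable outer A) => X.
rewrite /lebesgue_outer !preimage_setI preimage_setC.
exact:(@caratheodory_measurable_mu_ext _ R T (tuple_lebesgue R n)).
Qed.

Lemma lebesgueE (A : set V) : measurable (@row_of_tuple R n @^-1` A) ->
 mu A = tuple_lebesgue R n (@row_of_tuple R n @^-1` A).
by move=> mA;rewrite /lebesgue /lebesgue_outer measurable_mu_extE. Qed.

Lemma measurable_coord_preimage (i : 'I_n) (B : set RB) : measurable B ->
 measurable (@row_of_tuple R n @^-1` [set x | B (x 0 i)]).
move=> mB;rewrite (_ : _ @^-1` _ = (@tnth n RB ^~ i) @^-1` B).
 by rewrite -[X in measurable X]setTI;apply:measurable_tnth.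
by apply/seteqP;split=> t /=;rewrite mxE.
Qed.

Definition box (I : 'I_n -> interval R) : set V :=
 [set x | forall i, x 0 i \in I i].

Lemma measurable_box_preimage I : measurable (@row_of_tuple R n @^-1` box I).
rewrite (_ : _ @^-1` _ =
  \bigcap_i (@row_of_tuple R n @^-1` [set x | [set` I i] (x 0 i)])).
 by apply:fin_bigcap_measurable => // i _;exact:measurable_coord_preimage.
by apply/seteqP;split=> t h;[move=> i _;exact:h|move=> i;exact:h].
Qed.

Lemma measurable_box I : measurable (box I : set E).
by apply:euclid_measurable;exact:measurable_box_preimage. Qed.

Lemma lebesgue_box I :
 mu (box I) = (\prod_(i < n) @lebesgue_measure R [set` I i])%E.
rewrite lebesgueE;last exact:measurable_box_preimage.
rewrite -tuple_lebesgue_box;congr (tuple_lebesgue R n _).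
by apply/seteqP;split=> t h i;have := h i;rewrite ?mxE.
Qed.

Lemma ball_box (x : V) (r : R) : 0 < r ->
 ball x r = box (fun i => `]x 0 i - r, x 0 i + r[).
move=> r0;apply/seteqP;split=> [y [_ h] i|y h].
 by have := h ord0 i;rewrite /ball/= in_itv/= ltr_distlC.
by split=> // i j;rewrite ord1 /ball/= ltr_distlC;have := h j;rewrite in_itv.
Qed.

(** Sup-norm balls are open boxes, and those with rational centre and radius [1/(k+1)] are countably
    many; this is what makes open sets Borel for the product structure. *)
Lemma open_rational_cover (U : set V) : open U -> U = \bigcup_(z in [set z : 'rV[rat]_n * nat |
  ball (map_mx ratr z.1 : V) z.2.+1%:R^-1 `<=` U])
  ball (map_mx ratr z.1 : V) z.2.+1%:R^-1.
move=> oU;apply/seteqP;split=> [x Ux|x [z zU zx]];last exact:zU.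
have [e /= e0 eU] : exists2 e : R, 0 < e & ball x e `<=` U.
 by have /nbhs_ballP[e /= e0 eU] := open_nbhs_nbhs (conj oU Ux);exists e.
pose k := Num.truncn (2 / e);pose r : R := k.+1%:R^-1.
have r0 : 0 < r by pos.
have re : r + r <= e.
 have : 2 / e < k.+1%:R by exact:truncnS_gt.
 rewrite ltr_pdivrMr// /r => h.
 rewrite -mulr2n -[X in X <= _]mulr_natl ler_pdivrMr ?ltr0n//.
 by rewrite ltW// mulrC.
have h i : exists q : rat, ratr q \in `]x 0 i - r, x 0 i + r[.
 by apply:rat_in_itvoo;rewrite ltrD2l gtrN.
pose c : 'rV[rat]_n := \row_i xchoose (h i).
have xc : ball x r (map_mx ratr c : V).
 by rewrite ball_box// => i;rewrite !mxE;exact:(xchooseP (h i)).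
exists (c, k) => /=;last exact:ball_sym.
move=> y cy;apply:eU;apply:le_ball re _ _.
exact:ball_triangle xc cy.
Qed.

Lemma measurable_open_preimage (U : set V) : open U ->
 measurable (@row_of_tuple R n @^-1` U).
move=> /open_rational_cover ->;rewrite preimage_bigcup bigcup_mkcond.
apply:countable_bigcup_measurable => z;case: ifPn => // _.
by rewrite ball_box//;exact:measurable_box_preimage.
Qed.

Lemma open_meas (U : set V) : open U -> measurable (U : set E).
by move=> oU;apply:euclid_measurable;exact:measurable_open_preimage. Qed.

Lemma cont_meas (D : set E) (f : V -> R) : continuous f ->
 measurable_fun D (f : E -> R).
move=> cf mD;apply:(measurability (@RGenOInfty.G R)).
 exact:RGenOInfty.measurableE.
move=> _ [_ [a ->] <-];apply:measurableI;first exact:mD.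
apply:open_meas;apply:open_comp;first by move=> x _;exact:cf.
exact:interval_open.
exact:mD.
Qed.

Lemma measurable_coordE (D : set E) i : measurable_fun D (fun x : E => (x : V) 0 i : R).
by apply:cont_meas => x;exact:coord_continuous. Qed.

Lemma mu_ball (x : V) (r : R) : 0 < r -> mu (ball x r) = ((2 * r) ^+ n)%:E.
move=> r0;rewrite ball_box// lebesgue_box.
under eq_bigr => i _.
 rewrite lebesgue_measure_itv /= lte_fin ltrD2l gtrN// -EFinB.
 rewrite (_ : x 0 i + r - (x 0 i - r) = 2 * r);last by ring.
over.
by rewrite prodEFin prodr_const card_ord.
Qed.

(** Translating a countable Borel cover gives a cover of the same cost, and the inverse translation
    gives the reverse inequality. As this holds for arbitrary sets, translations also preserve the
    Caratheodory criterion. *)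
Lemma lebesgue_outer_shift (v : V) (A : set V) :
 outer ((fun x : V => x + v) @^-1` A) = outer A.
suff le (v' : V) (B : set V) : (outer ((fun x => (x + v')%R) @^-1` B) <= outer B)%E.
 apply/eqP;rewrite eq_le le/=.
 rewrite -[A in (outer A <= _)%E](_ : (fun x => x - v)%R @^-1` ((fun x => x + v)%R @^-1` A) = A).
  exact:le.
 by apply/seteqP;split=> x /=;rewrite subrK.
apply:le_ereal_inf => _ [F [mF BF] <-].
pose G k := shift_tuple (tuple_of_row v') @^-1` F k.
exists G;last first.
 by apply:eq_eseriesr => k _;exact:tuple_lebesgue_shift.
split=> [k|t Bt].
 by rewrite -[X in measurable X]setTI;apply:measurable_shift_tuple.
have : (\bigcup_k F k) (shift_tuple (tuple_of_row v') t).
 apply:BF => /=;rewrite (_ : row_of_tuple _ = row_of_tuple t + v')//.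
 by apply/rowP => i;rewrite !mxE !tnth_mktuple.
by move=> [k _ Fk];exists k.
Qed.

Lemma measurable_shift_preimage (v : V) (A : set E) : measurable A ->
 measurable ((fun x : V => x + v) @^-1` A : set E).
move=> mA;rewrite -[measurable _]/(caratheodory_measurable outer ((fun x => x + v) @^-1` A)) => X;pose Y := (fun x : V => x - v) @^-1` X.
have XY : X = (fun x => x + v) @^-1` Y.
 by apply/seteqP;split=> x;rewrite /Y /= addrK.
have : outer Y = (outer (Y `&` A) + outer (Y `&` ~` A))%E := mA Y.
rewrite -(lebesgue_outer_shift v Y).
rewrite -(lebesgue_outer_shift v (Y `&` A)) -(lebesgue_outer_shift v (Y `&` ~` A)).
by rewrite !preimage_setI preimage_setC -XY.
Qed.

Lemma measurable_shiftE (v : V) : mfun (fun x : E => (x : V) + v : E).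
by move=> _ A mA;rewrite setTI;exact:measurable_shift_preimage. Qed.

Lemma ge0_integral_shiftE (v : V) (f : E -> \bar R) : mfun f ->
 (forall x, (0 <= f x)%E) ->
 (\int[mu]_x f ((x : V) + v)%R = \int[mu]_x f x)%E.
move=> mf f0;pose g : E -> E := fun x => (x : V) + v : E.
have mg : mfun g by exact:measurable_shiftE.
rewrite -[LHS]/(\int[mu]_(x in g @^-1` setT) (f \o g) x)%E.
rewrite -ge0_integral_pushforward//.
by apply:eq_measure_integral => A mA _;exact:lebesgue_outer_shift.
Qed.

Lemma bigcup_ball0 : \bigcup_k ball (0 : V) k.+1%:R = setT.
apply/seteqP;split=> // x _;exists (Num.truncn `|x|) => //.
by rewrite -ball_normE /ball_/= sub0r normrN truncnS_gt.
Qed.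

Let sigma_finite_lebesgue : sigma_finite setT mu.
exists (fun k => ball 0 k.+1%:R);first by rewrite bigcup_ball0.
move=> k;split;first by apply/open_meas/ball_open.
by rewrite mu_ball// ltry.
Qed.

HB.instance Definition _ := Measure_isSigmaFinite.Build _ _ _ mu sigma_finite_lebesgue.

Section regularity.
Variable N : nat.
Local Notation BN := (ball (0 : V) N.+1%:R).
Local Notation pre := (@row_of_tuple R n).

Let mBN : measurable (BN : set E).
exact/open_meas/ball_open. Qed.

Let muBN (A : set V) : measurable (A : set E) -> (mu (A `&` BN) < +oo)%E.
move=> mA;rewrite (@le_lt_trans _ _ (mu BN))//.
 by apply:le_measure;rewrite ?inE//;exact:measurableI.
by rewrite mu_ball// ltry.
Qed.

(** Regularity with the closed inner set replaced by its open complement [W], which makes the notion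
    symmetric under complementation. The overlap is measured inside the ball [BN] only, so that all
    measures are finite and continuity from above applies. *)
Definition regular_set (A : set V) := measurable (A : set E) /\
 forall e : R, 0 < e -> exists U W : set V,
  [/\ open U, open W, A `<=` U, ~` A `<=` W &
   (mu (U `&` W `&` BN) <= e%:E)%E].

Lemma regular_setC B : regular_set B -> regular_set (~` B).
move=> [mB h];split;first exact:(@measurableC _ E).
move=> e /h[U [W [oU oW BU BW UW]]];exists W, U.
by rewrite setCK (setIC W).
Qed.

Lemma regular_set_bigcup (F : (set V)^nat) :
 (forall k, regular_set (F k)) -> regular_set (\bigcup_k F k).
move=> rF;have mF k : measurable (F k : set E) by case: (rF k).
have mUF : measurable (\bigcup_k F k : set E) by exact:bigcup_measurable.
split=> // e e0.
have /choice[UW hUW] : forall k, exists UW : set V * set V,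
  [/\ open UW.1, open UW.2, F k `<=` UW.1, ~` F k `<=` UW.2 &
   (mu (UW.1 `&` UW.2 `&` BN) <= (e / 2 / (2 ^ k.+1)%:R)%:E)%E].
 move=> k;have [_ /(_ (e / 2 / (2 ^ k.+1)%:R))] := rF k.
 by case=> [|U [W h]];[rewrite !divr_gt0// ltr0n expn_gt0|exists (U, W)].
pose U := \bigcup_k (UW k).1.
pose D k : set E := (\bigcup_j F j `\` \bigcup_(j < k) F j) `&` BN.
have mD k : measurable (D k).
 apply:measurableI => //;apply:measurableD => //.
 exact:bigcup_measurable.
have Dto0 : mu \o D @ \oo --> 0%E.
 have <- : mu (\bigcap_k D k) = 0%E.
  rewrite (_ : \bigcap_k _ = set0) ?measure0//.
  apply/seteqP;split=> // x Dx.
  have [[[j _ Fj] _] _] := Dx 0%N I.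
  by have [[_ nF] _] := Dx j.+1 I;apply:nF;exists j => /=.
 apply:nonincreasing_cvg_mu => //.
 - by apply:muBN;apply:measurableD => //;exact:bigcup_measurable.
 - exact:bigcap_measurable.
 - move=> k l kl;apply/subsetPset => x [[Ft nF] Bx];split=> //.
  split=> // -[j /= jk Fj];apply:nF.
  by exists j => //=;exact:leq_trans kl.
have [K DK] : exists K, (mu (D K) <= (e / 2)%:E)%E.
 by apply:cvg0_ex_le Dto0 _;rewrite divr_gt0.
(* Only finitely many of the sets [(UW k).2] may be intersected if [W] is to stay open; the part of
   the union missed by the first [K] sets is [D K], small by continuity from above. *)
pose W := \bigcap_(k in `I_K) (UW k).2.
have oU : open U by apply:bigcup_open => k _;have [] := hUW k.
have oW : open W.
 by apply:open_bigcap_ord => k;have [] := hUW k.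
exists U, W;split => //.
- by move=> t [k _ Ft];exists k => //;have [_ _ + _ _] := hUW k;apply.
- move=> t nF k _;have [_ _ _ + _] := hUW k;apply => Ft;apply:nF.
 by exists k.
pose G k : set E := (UW k).1 `&` (UW k).2 `&` BN.
have mG k : measurable (G k).
 by have [? ? _ _ _] := hUW k;apply:measurableI => //;apply:open_meas;exact:openI.
have sub : U `&` W `&` BN `<=` \bigcup_k G k `|` D K.
 move=> x [[[k _ Uk] Wx] Bx].
 have [Fx|nFx] := pselect ((\bigcup_k F k) x);last first.
  left;exists k => //;split=> //;split=> //.
  by have [_ _ _ + _] := hUW k;apply => Fk;apply:nFx;exists k.
 have [[j /= jK Fj]|nFK] := pselect ((\bigcup_(j < K) F j) x).
  left;exists j => //;split=> //;split;last exact:Wx.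
  by have [_ _ + _ _] := hUW j;apply.
 by right;split.
rewrite (le_trans (le_measure mu _ _ sub))// ?inE.
- by apply:measurableI => //;apply:open_meas;exact:openI.
- by apply:measurableU => //;exact:bigcup_measurable.
rewrite (le_trans (measureU2 _ _ _))//;first exact:bigcup_measurable.
rewrite [leRHS](_ : _ = (e / 2)%:E + (e / 2)%:E)%E;last first.
 by rewrite -EFinD -splitr.
apply:leeD => //.
apply:le_trans (measure_sigma_subadditive _ _ _ sub_id) _ => //.
 exact:bigcup_measurable.
apply:le_trans (epsilon_trick0 _ _) => //.
 apply:lee_nneseries => // k _.
 by have [_ _ _ _] := hUW k.
by pos.
Qed.

(** The admissible [B] form a sigma-algebra, so half-lines suffice. For []a, +oo[] the complement is
    enlarged to []-oo, a + 1/(K+1)[], and the overlapping slab decreases to the empty set. *)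
Lemma regular_set_coord (i : 'I_n) (B : set RB) : measurable B ->
 regular_set [set x | B (x 0 i)].
pose P := [set B : set R | regular_set [set x | B (x 0 i)]].
have PC A : P A -> P (~` A) by move=> /regular_setC.
have PU (F : (set R)^nat) : (forall k, P (F k)) -> P (\bigcup_k F k).
 move=> h;have := regular_set_bigcup h;rewrite /P /=.
 by congr regular_set;apply/seteqP;split=> x [k _ ?];exists k.
have Py a : P `]a, +oo[%classic.
 have ocoord (A : set R) : open A -> open [set x : V | A (x 0 i)].
  by move=> oA;apply:open_comp => // x _;exact:coord_continuous.
 have oU : open [set x : V | `]a, +oo[%classic (x 0 i)].
  exact:ocoord;exact:interval_open.
 split;first exact:open_meas.
 move=> e e0.
 pose D k : set E := [set x : V | `]a, a + k.+1%:R^-1[%classic (x 0 i)] `&` BN.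
 have mD k : measurable (D k).
  apply:measurableI => //;apply:open_meas;apply:ocoord.
  exact:interval_open.
 have Dto0 : mu \o D @ \oo --> 0%E.
  have <- : mu (\bigcap_k D k) = 0%E.
   rewrite (_ : \bigcap_k _ = set0) ?measure0//.
   apply/seteqP;split=> // x Dx.
   have [] := Dx (Num.truncn (x 0 i - a)^-1) I;rewrite /= in_itv/= => /andP[ax].
   rewrite -ltrBlDl -[X in X < _]invrK ltf_pV2 ?posrE//.
    by rewrite ltNge (ltW (truncnS_gt _)).
   by rewrite invr_gt0 subr_gt0.
  apply:nonincreasing_cvg_mu => //.
  - by apply:muBN;apply:open_meas;apply:ocoord;exact:interval_open.
  - exact:bigcap_measurable.
  - move=> k l kl;apply/subsetPset => x [Ft Bx];split=> //.
   move: Ft;rewrite /= !in_itv/= => /andP[->/=] /lt_le_trans;apply.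
   by rewrite lerD2l lef_pV2 ?posrE// ler_nat.
 have [K DK] : exists K, (mu (D K) <= e%:E)%E.
  exact:cvg0_ex_le Dto0 e0.
 exists [set x : V | `]a, +oo[%classic (x 0 i)].
 exists [set x : V | `]-oo, (a + K.+1%:R^-1)[%classic (x 0 i)];split=> //.
 - exact:ocoord;exact:interval_open.
 - move=> x /=;rewrite !in_itv/= andbT => /negP;rewrite -leNgt => /le_lt_trans;apply.
  by rewrite ltrDl invr_gt0.
 - rewrite (le_trans _ DK)// le_eqVlt;apply/orP;left;apply/eqP.
  congr (mu _);apply/seteqP;split=> x /= [h Bx];split=> //;move: h;
  by rewrite !in_itv/= andbT => /andP.
rewrite RGenOInfty.measurableE => mB.
suff h : <<s @RGenOInfty.G R >> `<=` P by exact:h mB.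
apply:smallest_sub.
 split=> //.
 - have := PU _ (fun k => Py (- k%:R));rewrite (_ : \bigcup_k _ = setT).
   by move/PC;rewrite setCT.
  apply/seteqP;split=> // x _;exists (Num.truncn (- x)).+1 => //=.
  by rewrite in_itv/= andbT ltrNl truncnS_gt.
 - by move=> A;rewrite setTD;exact:PC.
by move=> _ [a ->];exact:Py.
Qed.

Lemma measurable_regular (A : set V) : measurable (pre @^-1` A) ->
 regular_set A.
pose P := [set B : set T | regular_set (tuple_of_row @^-1` B)].
move=> mA;suff : P (pre @^-1` A).
 rewrite /P/= (_ : tuple_of_row @^-1` _ = A)//.
 by apply/seteqP;split=> x;rewrite /= tuple_of_rowK.
have PC B : P B -> P (~` B) by move=> /regular_setC.
have PU (F : (set T)^nat) : (forall k, P (F k)) -> P (\bigcup_k F k).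
 by move=> /regular_set_bigcup;pos.
suff h : measurable `<=` P by exact:h mA.
apply:smallest_sub.
 split=> //;last by move=> B;rewrite setTD;exact:PC.
 rewrite /P/=;split;first exact:(@measurable0 _ E).
 move=> e e0;exists set0, setT;split=> //.
 - exact:openT.
 - by rewrite !set0I measure0 lee_fin ltW.
move=> B /=;rewrite -bigcup_seq => -[i _ [C mC <-]].
rewrite setTI;rewrite /P /=.
have := regular_set_coord i mC.
by congr regular_set;apply/seteqP;split=> x;rewrite /= tnth_mktuple.
Qed.
End regularity.

(** A Borel cover attains the outer measure up to [e / 2]; its enlargement to an open set is made
    separately on each ball, with errors adding up to [e / 2]. The set [A] may be arbitrary. *)
Lemma lebesgue_outer_open (A : set V) (e : R) : 0 < e -> (outer A < +oo)%E ->
 exists U : set V, [/\ open U, A `<=` U & (mu U <= outer A + e%:E)%E].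
move=> e0 Aoo.
have Afin : outer A \is a fin_num by rewrite ge0_fin_numE// outer_measure_ge0.
have e20 : 0 < e / 2 by pos.
have [_ [F [mF AF] <-] Fe] := lb_ereal_inf_adherent e20 Afin.
pose B : set V := \bigcup_k tuple_of_row @^-1` F k.
have mF' k : measurable (@row_of_tuple R n @^-1` (tuple_of_row @^-1` F k)).
 rewrite (_ : _ @^-1` _ = F k)//.
 by apply/seteqP;split=> t;rewrite /= row_of_tupleK.
have mB' : measurable (@row_of_tuple R n @^-1` B).
 by rewrite preimage_bigcup;exact:bigcup_measurable.
have mB : measurable (B : set E) by exact:euclid_measurable.
have AB : A `<=` B.
 move=> x Ax;have : (\bigcup_k F k) (tuple_of_row x).
  by apply:AF;rewrite /= tuple_of_rowK.
 by move=> [k _ Fk];exists k.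
have muB : (mu B <= outer A + (e / 2)%:E)%E.
 apply:le_trans (ltW Fe).
 rewrite lebesgueE// preimage_bigcup.
 apply:le_trans (measure_sigma_subadditive _ _ _ sub_id) _ => //.
 apply:le_of_eq;apply:eq_eseriesr => k _.
 congr (tuple_lebesgue R n _).
 by apply/seteqP;split=> t;rewrite /= row_of_tupleK.
have /choice[UW hUW] : forall N, exists UW : set V * set V,
  [/\ open UW.1, open UW.2, B `<=` UW.1, ~` B `<=` UW.2 &
   (mu (UW.1 `&` UW.2 `&` ball (0%R : V) N.+1%:R) <= (e / 2 / (2 ^ N.+1)%:R)%:E)%E].
 move=> N;have [_ /(_ (e / 2 / (2 ^ N.+1)%:R))] := measurable_regular N mB'.
 by case=> [|U [W h]];[rewrite !divr_gt0// ltr0n expn_gt0|exists (U, W)].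
have oball k : open ((UW k).1 `&` ball (0%R : V) k.+1%:R).
 by apply:openI;[have [] := hUW k|exact:ball_open].
exists (\bigcup_k ((UW k).1 `&` ball 0 k.+1%:R));split.
- exact:bigcup_open => k _.
- move=> x /AB Bx;have [k _ xk] : (\bigcup_k ball 0 k.+1%:R) x.
  by rewrite bigcup_ball0.
 by exists k => //;split => //;have [_ _ + _ _] := hUW k;apply.
pose G k : set E := (UW k).1 `&` (UW k).2 `&` ball (0%R : V) k.+1%:R.
have mG k : measurable (G k).
 have [? ? _ _ _] := hUW k;apply:open_meas.
 by apply:openI;[exact:openI|exact:ball_open].
have sub : \bigcup_k ((UW k).1 `&` ball (0%R : V) k.+1%:R) `<=` B `|` \bigcup_k G k.
 move=> x [k _ [Ux xk]];have [Bx|nBx] := pselect (B x);[by left|right].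
 by exists k => //;split=> //;split=> //;have [_ _ _ + _] := hUW k;apply.
rewrite (le_trans (le_measure mu _ _ sub))// ?inE.
- by apply:open_meas;apply:bigcup_open.
- by apply:measurableU => //;exact:bigcup_measurable.
rewrite (le_trans (measureU2 _ _ _))//;first exact:bigcup_measurable.
rewrite [in leRHS](splitr e) EFinD addeA;apply:leeD => //.
apply:le_trans (measure_sigma_subadditive _ _ _ sub_id) _ => //.
 exact:bigcup_measurable.
apply:le_trans (epsilon_trick0 _ _) => //;last exact:ltW.
apply:lee_nneseries => // k _.
by have [_ _ _ _] := hUW k.
Qed.

End euclid_measure.

Lemma ge0_integral_bigcup_le d (T : measurableType d) (R : realType)
  (mu : {measure set T -> \bar R}) (F : (set T)^nat) (f : T -> \bar R) :
 (forall k, measurable (F k)) -> mfun f ->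
 (forall x, (0 <= f x)%E) ->
 (\int[mu]_(x in \bigcup_k F k) f x <= \sum_(k <oo) \int[mu]_(x in F k) f x)%E.
move=> mF mf f0;have mG k : measurable (seqDU F k).
 by apply:measurableD => //;apply:bigsetU_measurable.
rewrite (seqDU_bigcup_eq F) ge0_integral_bigcup//;last exact:measurable_funS mf.
apply:lee_nneseries => [k _ _|k _];first exact:integral_ge0.
apply:ge0_subset_integral => //;first exact:measurable_funS mf.
exact:subDsetl.
Qed.

(** * Hoelder's inequality, series and comparison of integrals *)

Section integral_bounds.
Context d (T : measurableType d) (R : realType) (mu : {measure set T -> \bar R}).

Lemma hoelder_bound (D : set T) (f g : T -> R) (p q A B : R) :
 measurable D -> mfun f -> mfun g ->
 ge0 f -> ge0 g ->
 0 < p -> 0 < q -> p^-1 + q^-1 = 1 -> 0 <= A -> 0 <= B ->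
 (\int[mu]_(x in D) (f x `^ p)%:E <= A%:E)%E ->
 (\int[mu]_(x in D) (g x `^ q)%:E <= B%:E)%E ->
 (\int[mu]_(x in D) (f x * g x)%:E <= (A `^ p^-1 * B `^ q^-1)%:E)%E.
move=> mD mf mg f0 g0 p0 q0 pq A0 B0 fA gB.
pose f' x := f x * \1_D x;pose g' x := g x * \1_D x.
have mf' : mfun f' by apply:mfunM => //;exact:measurable_indic.
have mg' : mfun g' by apply:mfunM => //;exact:measurable_indic.
have := hoelder mu mf' mg' p0 q0 pq;rewrite Lnorm1 unlock => h.
have E (h' : T -> R) (s : R) : (0 < s) -> (forall x, 0 <= h' x) ->
  (\int[mu]_x `|(h' x * \1_D x)%:E| `^ s = \int[mu]_(x in D) (h' x `^ s)%:E)%E.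
 move=> s0 h0;rewrite [RHS]integral_mkcond;apply:eq_integral => x _.
 rewrite patchE indicE;case: ifPn => xD.
  by rewrite mulr1 abse_EFin poweR_EFin ger0_norm.
 by rewrite mulr0 abse0 poweR_EFin powR0// gt_eqF.
have -> : (\int[mu]_(x in D) (f x * g x)%:E = \int[mu]_x `|(EFin \o (f' \* g')%R) x|)%E.
 rewrite integral_mkcond;apply:eq_integral => x _.
 rewrite patchE /f' /g' /= indicE;case: ifPn => xD.
  by rewrite !mulr1 ger0_norm// mulr_ge0.
 by rewrite !mulr0 normr0.
apply:le_trans h _ => /=;rewrite !E// EFinM -!poweR_EFin.
apply:lee_pmul;rewrite ?poweR_ge0//.
- apply:gt0_ler_poweR => //;first pos.
  by rewrite in_itv/= leey andbT;apply:integral_ge0 => x _;rewrite lee_fin powR_ge0.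
 by rewrite in_itv/= leey andbT lee_fin.
- apply:gt0_ler_poweR => //;first pos.
  by rewrite in_itv/= leey andbT;apply:integral_ge0 => x _;rewrite lee_fin powR_ge0.
 by rewrite in_itv/= leey andbT lee_fin.
Qed.

Lemma nneseries_geometric_le (u : nat -> \bar R) (c z : R) :
 0 <= c -> 0 <= z < 1 -> (forall j, (0 <= u j)%E) ->
 (forall j, (u j <= (c * z ^+ j)%:E)%E) ->
 (\sum_(j <oo) u j <= (c / (1 - z))%:E)%E.
move=> c0 /andP[z0 z1] u0 uz;apply:lime_le;first exact:is_cvg_nneseries.
apply:nearW => N;apply:(le_via (\sum_(0 <= j < N) (c * z ^+ j)%:E)%E).
 exact:lee_sum => j _.
rewrite sumEFin lee_fin -mulr_sumr ler_wpM2l//.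
rewrite big_mkord -[leRHS]mul1r ler_pdivlMr ?subr_gt0//.
have := subrX1 z N;rewrite -[1 - z]opprB mulrN mulrC => <-.
by rewrite opprB gerBl exprn_ge0.
Qed.

Lemma nneseries_ge_term (u : nat -> \bar R) j : (forall i, (0 <= u i)%E) ->
 (u j <= \sum_(i <oo) u i)%E.
move=> u0;rewrite (nneseries_split 0 j.+1)//= add0n big_nat_recr//=.
by rewrite -addeA addeCA leeDl// adde_ge0 ?sume_ge0 ?nneseries_ge0.
Qed.

Lemma emeasurable_mul_indic (D A : set T) (f : T -> \bar R) : measurable A ->
 mfun f -> measurable_fun D (fun x => (f x * (\1_A x)%:E)%E).
move=> mA mf;apply:(@measurable_funS _ _ _ _ setT) => //.
apply:emeasurable_funM => //;apply/measurable_EFinP;exact:measurable_indic.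
Qed.

Lemma int_subset (A B : set T) (f : T -> \bar R) :
 measurable A -> measurable B -> mfun f ->
 (forall x, (0 <= f x)%E) -> A `<=` B ->
 (\int[mu]_(x in A) f x <= \int[mu]_(x in B) f x)%E.
move=> mA mB mf f0 AB;apply:ge0_subset_integral => //.
exact:measurable_funS mf.
Qed.

Lemma int_le (D : set T) (f g : T -> \bar R) :
 measurable D -> mfun f -> mfun g ->
 (forall x, (0 <= f x)%E) -> (forall x, D x -> (f x <= g x)%E) ->
 (\int[mu]_(x in D) f x <= \int[mu]_(x in D) g x)%E.
move=> mD mf mg f0 fg;apply:ge0_le_integral => //;first exact:measurable_funS mf.
exact:measurable_funS mg.
Qed.

Lemma int_ge0T (D : set T) (f : T -> \bar R) :
 (forall x, (0 <= f x)%E) -> (0 <= \int[mu]_(x in D) f x)%E.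
by move=> f0;apply:integral_ge0. Qed.

Lemma mEFin (D : set T) (f : T -> R) :
 mfun f -> measurable_fun D (fun x => (f x)%:E).
by move=> mf;apply/measurable_EFinP;exact:measurable_funS mf.
Qed.

Lemma integral_gt0 (D : set T) (f : T -> R) : measurable D ->
 mfun f -> (forall x, 0 < f x) -> (0 < mu D)%E ->
 (0 < \int[mu]_(x in D) (f x)%:E)%E.
move=> mD mf f0 muD.
rewrite lt_neqAle eq_sym int_ge0T ?andbT;last by move=> x;pos.
apply/eqP => I0.
have [+ _] := ae_eq_integral_abs mu mD (mEFin (D := D) mf).
move=> /(_ _)[|N [mN N0 sN]].
 by rewrite -I0;apply:eq_integral => x _;rewrite abse_EFin ger0_norm// ltW.
have : (mu D <= mu N)%E.
 apply:le_measure;rewrite ?inE// => x Qx;apply:sN => /= /(_ Qx) [] /eqP.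
 by rewrite gt_eqF.
by rewrite N0 leNgt muD.
Qed.

Lemma integral_setU_real (A B : set T) (f : T -> R) : measurable A -> measurable B ->
 mfun f -> ge0 f -> A `&` B = set0 ->
 (\int[mu]_(x in A `|` B) (f x)%:E =
  \int[mu]_(x in A) (f x)%:E + \int[mu]_(x in B) (f x)%:E)%E.
move=> mA mB mf f0 AB;apply:ge0_integral_setU => //.
- exact:mEFin.
- by move=> x _;pos.
- by rewrite disj_set2E AB.
Qed.

Lemma integral_mul_indic (D A : set T) (f : T -> \bar R) :
 (\int[mu]_(x in D) (f x * (\1_A x)%:E) = \int[mu]_(x in D `&` A) f x)%E.
rewrite integral_mkcondr;apply:eq_integral => x _.
by rewrite patchE indicE;case: ifP;rewrite ?mule1 ?mule0.
Qed.

End integral_bounds.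

(** * Inequalities between real powers *)

Section powR_facts.
Context (R : realType).
Implicit Types a b c x y : R.

Lemma powRK a p : 0 <= a -> p != 0 -> (a `^ p) `^ p^-1 = a.
by move=> a0 p0;rewrite -powRrM mulfV// powRr1. Qed.

Lemma powRVK a p : 0 <= a -> p != 0 -> (a `^ p^-1) `^ p = a.
by move=> a0 p0;rewrite -powRrM mulVf// powRr1. Qed.

Lemma ler_powRl p a b : 0 <= p -> 0 <= a -> a <= b -> a `^ p <= b `^ p.
by move=> p0 a0 ab;apply:ge0_ler_powR;rewrite ?nnegrE// (le_trans a0).
Qed.

Lemma ler_powR_inv p a b : 0 < p -> 0 <= a -> 0 <= b -> a `^ p <= b `^ p -> a <= b.
move=> p0 a0 b0 ab;rewrite -(powRK a0 (lt0r_neq0 p0)) -(powRK b0 (lt0r_neq0 p0)).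
by apply:ler_powRl => //;rewrite ?invr_ge0 ?powR_ge0// ltW.
Qed.
Lemma powR_div a b p : 0 <= a -> 0 <= b -> (a / b) `^ p = a `^ p / b `^ p.
move=> a0 b0;rewrite powRM ?invr_ge0//;congr (_ * _).
by rewrite -powR_inv1// -powRrM mulN1r powRN.
Qed.
(** Arithmetic of the [A_q] comparison: with [a = |A|], [rn = |Q|] and [SA], [S] the dual masses of
    [A] and [Q], Hoelder's inequality on [A] is multiplied by the [A_q] condition on [Q]. *)
Lemma Aq_lower_real (a rn W wA S SA M q : R) : 1 < q -> 0 <= a -> 0 < rn ->
 0 <= W -> 0 <= wA -> 0 <= SA -> SA <= S -> a `^ q <= wA * SA `^ (q - 1) ->
 W * S `^ (q - 1) <= M * rn `^ q -> (a / rn) `^ q * W <= M * wA.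
move=> q1 a0 rn0 W0 wA0 SA0 SAS h Aq.
have sA : SA `^ (q - 1) <= S `^ (q - 1) by apply:ler_powRl => //;rewrite subr_ge0 ltW.
rewrite powR_div ?(ltW rn0)// mulrAC ler_pdivrMr ?powR_gt0//.
apply:(le_via (wA * (W * S `^ (q - 1)))).
 apply:(le_via (wA * SA `^ (q - 1) * W));first by rewrite ler_wpM2r.
 by rewrite -mulrA ler_wpM2l// mulrC ler_wpM2l.
apply:(le_via (wA * (M * rn `^ q)));first exact:ler_wpM2l Aq.
by apply:le_of_eq;ring.
Qed.

(** The counterpart for the dual weight, which satisfies the condition with the conjugate exponent
    [q / (q - 1)] and the constant [M^(1/(q-1))]. *)
Lemma Aq_dual_lower_real (a rn W wA S SA M q : R) : 1 < q -> 0 <= a -> 0 < rn ->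
 0 < W -> 0 < S -> 0 <= SA -> wA <= W -> a `^ q <= wA * SA `^ (q - 1) -> 0 <= M ->
 W * S `^ (q - 1) <= M * rn `^ q ->
 (a / rn) `^ (q / (q - 1)) * S <= M `^ (q - 1)^-1 * SA.
move=> q1 a0 rn0 W0 S0 SA0 wAW h M0 Aq.
have q10 : 0 < q - 1 by rewrite subr_gt0.
apply:(@ler_powR_inv (q - 1)) => //.
- by pos.
- by pos.
rewrite (powRM (q - 1) (powR_ge0 _ _) (ltW S0)) (powRM (q - 1) (powR_ge0 _ _) SA0).
rewrite -!powRrM divfK ?gt_eqF// mulVf ?gt_eqF// (powRr1 M0).
rewrite (powR_div _ a0 (ltW rn0)) mulrAC ler_pdivrMr ?powR_gt0//.
rewrite -(ler_pM2l W0).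
apply:(le_via ((W * SA `^ (q - 1)) * (W * S `^ (q - 1)))).
 apply:(le_via (a `^ q * (W * S `^ (q - 1)))).
  by apply:le_of_eq;ring.
 apply:ler_wpM2r;first pos.
 by apply:le_trans h _;rewrite ler_wpM2r ?powR_ge0.
apply:(le_via ((W * SA `^ (q - 1)) * (M * rn `^ q))).
 by apply:ler_wpM2l => //;rewrite mulr_ge0 ?powR_ge0// ltW.
by apply:le_of_eq;ring.
Qed.
Lemma powR_hoelder_real (C l rn a p p' : R) : 0 < p -> 0 < p' -> p^-1 + p'^-1 = 1 ->
 0 <= C -> 0 <= l -> 0 < rn -> 0 <= a ->
 (C * l `^ p * rn) `^ p^-1 * a `^ p'^-1 = C `^ p^-1 * (a / rn) `^ p'^-1 * (l * rn).
move=> p0 p'0 pp' C0 l0 rn0 a0;have rn0' := ltW rn0.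
rewrite (powR_div _ a0 rn0') !powRM ?mulr_ge0 ?powR_ge0// powRK ?gt_eqF//.
have -> : rn `^ p^-1 = rn / rn `^ p'^-1.
 have rnE : rn = rn `^ p^-1 * rn `^ p'^-1.
  by rewrite -powRD ?pp' ?powRr1// (gt_eqF rn0) implybT.
 by rewrite [X in X / _]rnE mulfK// gt_eqF// powR_gt0.
by field;rewrite gt_eqF// powR_gt0.
Qed.
Lemma powR_split_real a w p s' c k : 0 <= a -> p * s' = c * k ->
 (a * w `^ (- p)) `^ s' = (w `^ (- c)) `^ k * a `^ s'.
move=> a0 pc;rewrite (powRM _ a0 (powR_ge0 _ _)) mulrC.
by rewrite -(powRrM w (- p)) -(powRrM w (- c)) !mulNr pc.
Qed.

Lemma Aq_avg_real (W S rn M q : R) : 0 < rn -> 0 <= S ->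
 W * S `^ (q - 1) <= M * rn `^ q -> W * (S / rn) `^ (q - 1) <= M * rn.
move=> rn0 S0 h;rewrite (powR_div _ S0 (ltW rn0)) mulrA ler_pdivrMr ?powR_gt0//.
rewrite (le_trans h)// -mulrA -{2}(powRr1 (ltW rn0)) -powRD;last by rewrite (gt_eqF rn0) implybT.
by rewrite (_ : 1 + (q - 1) = q)//;ring.
Qed.

Lemma prod_bound_real (P C A r' W L Ms r1 rn : R) : 0 <= P -> 0 <= C -> 0 <= A -> 0 <= r' ->
 W * L <= Ms * r1 -> r1 * r' = rn -> P * W * (C * L * A * r') <= Ms * C * A * P * rn.
move=> P0 C0 A0 r0 h <-.
have -> : P * W * (C * L * A * r') = (P * C * A * r') * (W * L) by ring.
have -> : Ms * C * A * P * (r1 * r') = (P * C * A * r') * (Ms * r1) by ring.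
by apply:ler_wpM2l h;rewrite !mulr_ge0.
Qed.

(** Bookkeeping of exponents for [sub_weight_bound]. Here [l] is the mean of the dual weight; the
    relation [k / s' = (q - 1) / s] turns its power into [l^((q-1)/s)], which is exactly what the
    [A_q] condition pairs with [W^(1/s)]. *)
Lemma powR_sub_weight_real (Cs l rn al Ph W M q s s' k k' : R) :
 0 < s -> 0 < s' -> 0 < k -> 0 < k' -> s^-1 + s'^-1 = 1 -> k^-1 + k'^-1 = 1 ->
 k / s' = (q - 1) / s -> 0 <= Cs -> 0 < l -> 0 < rn -> 0 <= al -> 0 <= Ph -> 0 <= W ->
 0 <= M -> W * l `^ (q - 1) <= M * rn ->
 (Ph * W) `^ s^-1 * ((Cs * l `^ (k * k) * rn) `^ k^-1 * (al * rn) `^ k'^-1) `^ s'^-1 <=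
 M `^ s^-1 * (Cs `^ k^-1) `^ s'^-1 * (al `^ (k'^-1 * s'^-1)) * Ph `^ s^-1 * rn.
move=> s0 s'0 k0 k'0 ss' kk' kq C0 l0 rn0 al0 Ph0 W0 M0 h.
have rn0' := ltW rn0;have l0' := ltW l0.
have rnD p p' : p^-1 + p'^-1 = 1 -> rn `^ p^-1 * rn `^ p'^-1 = rn.
 by move=> pp';rewrite -powRD ?pp' ?powRr1// (gt_eqF rn0) implybT.
have -> : (Cs * l `^ (k * k) * rn) `^ k^-1 * (al * rn) `^ k'^-1 =
  Cs `^ k^-1 * l `^ k * al `^ k'^-1 * rn.
 rewrite !powRM ?mulr_ge0 ?powR_ge0// -powRrM mulfK ?gt_eqF//.
 by rewrite -[in RHS](rnD _ _ kk');ring.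
rewrite !powRM ?mulr_ge0 ?powR_ge0//.
have -> : (l `^ k) `^ s'^-1 = (l `^ (q - 1)) `^ s^-1 by rewrite -!powRrM kq.
have h' : W `^ s^-1 * (l `^ (q - 1)) `^ s^-1 <= M `^ s^-1 * rn `^ s^-1.
 rewrite -!powRM ?powR_ge0//;apply:ler_powRl => //;first pos.
 by pos.
rewrite (_ : al `^ (k'^-1 * s'^-1) = (al `^ k'^-1) `^ s'^-1);last exact:powRrM.
apply:prod_bound_real h' (rnD _ _ ss');exact:powR_ge0.
Qed.

Lemma ler_powR_le1 a p : 0 <= a <= 1 -> 1 <= p -> a `^ p <= a.
move=> /andP[a0 a1] p1;have [->|an0] := eqVneq a 0;first by rewrite powR0// gt_eqF// (lt_le_trans ltr01).
have {a0 an0}a0 : 0 < a by rewrite lt_neqAle eq_sym an0.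
have -> : p = 1 + (p - 1) by ring.
rewrite powRD;last by rewrite (gt_eqF a0) implybT.
rewrite powRr1 ?(ltW a0)// ger_pMr//.
have p10 : 0 <= p - 1 by rewrite subr_ge0.
by apply:(le_trans (ler_powRl p10 (ltW a0) a1));rewrite powR1.
Qed.
End powR_facts.

(** * Flat functions and a class of smooth functions of one variable *)

Section flat.
Context (R : realType).
Implicit Types (m : nat) (x a : R) (f : R -> R).

(** The extra factor [x^-1 ^+ m] makes the family generated by [exp(-1/x)] closed under
    differentiation, up to linear combinations. *)
Definition flat m x : R := if x <= 0 then 0 else expR (- x^-1) * x^-1 ^+ m.

Lemma flat_le0 m x : x <= 0 -> flat m x = 0.
by rewrite /flat => ->. Qed.

Lemma flatE m x : 0 < x -> flat m x = expR (- x^-1) * x^-1 ^+ m.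
by rewrite /flat leNgt => ->. Qed.

Lemma flat_gt0 m x : 0 < x -> 0 < flat m x.
move=> x0;rewrite flatE// mulr_gt0 ?expR_gt0// exprn_gt0// invr_gt0//.
Qed.

Lemma flat_ge0 m x : 0 <= flat m x.
by case: (leP x 0) => [/flat_le0 ->//|/(flat_gt0 m)/ltW]. Qed.

(** The exponential dominates [(x^-1 / (m+1))^(m+1)]. Applied to [flat m.+1], which is the
    difference quotient of [flat m] at the origin, the bound gives the vanishing derivative
    there. *)
Lemma flat_small m x : 0 < x -> flat m x <= m.+1%:R ^+ m.+1 * x.
move=> x0;rewrite flatE//.
have e0 : (x^-1 / m.+1%:R) ^+ m.+1 <= expR (x^-1).
 rewrite -[X in expR X](@divfK _ (m.+1%:R : R)) ?pnatr_eq0//.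
 rewrite expRM_natr lerXn2r// ?nnegrE ?expR_ge0//;first pos.
 by apply:le_trans (expR_ge1Dx _);rewrite lerDr.
rewrite expRN ler_pdivrMl ?expR_gt0//.
have := ler_wpM2r _ e0 => /(_ (m.+1%:R ^+ m.+1 * x)) h.
apply:le_trans (h _);last pos.
apply:le_of_eq.
rewrite expr_div_n mulrA divfK ?expf_neq0 ?pnatr_eq0//.
by rewrite exprSr -mulrA mulVf ?mulr1// gt_eqF.
Qed.

Lemma is_derive_flat m x : is_derive x 1 (flat m) (flat m.+2 x - m%:R * flat m.+1 x).
have [x0|x0|->] := ltgtP x 0.
- rewrite !flat_le0 ?(ltW x0)// mulr0 subr0.
 apply:(@near_eq_is_derive _ _ _ (cst 0)).
 near=> y;rewrite flat_le0// ltW//;near: y;exact:lt_nbhsl.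
- apply:(@near_eq_is_derive _ _ _ (fun y : R => expR (- y^-1) * y^-1 ^+ m : R)).
  near=> y;rewrite flatE//;near: y;exact:lt_nbhsr.
 have xn0 : x != 0 by pos.
 have dV : is_derive x 1 (fun y : R => y^-1) (- x ^- 2).
  have := @is_deriveV R id x 1 1 xn0 (is_derive_id _ _).
  by rewrite scaler1.
 have dE : is_derive x 1 (fun y : R => expR (- y^-1)) (expR (- x^-1) * x ^- 2).
  have dN : is_derive x 1 (fun y : R => - y^-1) (x ^- 2).
   by apply:is_derive_eq (is_deriveN dV) _;rewrite opprK.
  exact:(is_derive1_comp (is_derive_expR _) dN).
 have dX : is_derive x 1 (fun y : R => y^-1 ^+ m) (m%:R * x^-1 ^+ m.-1 * (- x ^- 2)).
  rewrite (_ : (fun _ => _) = (fun y : R => y^-1) ^+ m);last first.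
   by apply/funext => y;rewrite exprfctE.
  apply:is_derive_eq (is_deriveX m dV) _.
  by pos.
 apply:is_derive_eq (is_deriveM dE dX) _.
 rewrite !flatE// /GRing.scale/=.
 case: m dX => [|m] _ /=;first by rewrite !mul0r mulr0 add0r subr0 expr0 mul1r exprVn.
 have -> : x ^- 2 = x^-1 * x^-1 by rewrite -invfM -expr2.
 by rewrite !exprS;move: (expR _) => e;ring.
- rewrite !flat_le0// mulr0 subr0.
 have lim0 : (fun h : R => h^-1 *: ((flat m \o shift 0) (h *: 1) - flat m 0)) @ 0^' --> (0 : R).
  apply/cvgrPdist_le => e e0;near=> h.
  rewrite sub0r normrN /= addr0 (@flat_le0 m 0)// subr0 /GRing.scale/= mulr1.
  have [h0|h0] := leP h 0;first by rewrite flat_le0// mulr0 normr0 ltW.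
  rewrite ger0_norm ?mulr_ge0 ?invr_ge0 ?flat_ge0 ?(ltW h0)//.
  have -> : h^-1 * flat m h = flat m.+1 h.
   by rewrite !flatE// exprS mulrCA.
  apply:le_trans (flat_small _ h0) _.
  rewrite -ler_pdivlMl ?exprn_gt0//;apply/ltW.
  apply:le_lt_trans (ler_norm _) _;near: h.
  by apply:dnbhs0_lt;rewrite mulr_gt0// invr_gt0 exprn_gt0.
 split;first by apply/cvg_ex;exists 0.
 exact:cvg_lim lim0.
Unshelve. all: by end_near. Qed.

Inductive smooth1 : (R -> R) -> Prop :=
| smooth1_cst c : smooth1 (fun=> c)
| smooth1_id : smooth1 (fun x => x)
| smooth1_flat m : smooth1 (flat m)
| smooth1_add f g of smooth1 f & smooth1 g : smooth1 (fun x => f x + g x)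
| smooth1_mul f g of smooth1 f & smooth1 g : smooth1 (fun x => f x * g x)
| smooth1_inv f of smooth1 f & (forall x, f x != 0) : smooth1 (fun x => (f x)^-1)
| smooth1_affine a b f of smooth1 f : smooth1 (fun x => f (a * x + b))
| smooth1_pow a f of smooth1 f & (forall x, x < 1 -> f x = 0) :
  smooth1 (fun x => x `^ a * f x).

Lemma smooth1_derive f : smooth1 f ->
 exists2 df, smooth1 df & forall x, is_derive x 1 f (df x).
elim=> {f}.
- move=> c;exists (fun=> 0) => [|x];[exact:smooth1_cst|exact:is_derive_cst].
- exists (fun=> 1) => [|x];[exact:smooth1_cst|exact:is_derive_id].
- move=> m;exists (fun x => flat m.+2 x + (- m%:R) * flat m.+1 x) => [|x].
  apply:smooth1_add;first exact:smooth1_flat.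
  by apply:smooth1_mul;[exact:smooth1_cst|exact:smooth1_flat].
 by rewrite mulNr;exact:is_derive_flat.
- move=> f g _ [df sf Df] _ [dg sg Dg];exists (fun x => df x + dg x);first exact:smooth1_add.
 by move=> x;exact:is_deriveD.
- move=> f g sf0 [df sf Df] sg0 [dg sg Dg].
 exists (fun x => f x * dg x + g x * df x);first by apply:smooth1_add;exact:smooth1_mul.
 by move=> x;exact:is_deriveM.
- move=> f sf0 [df sf Df] f0;exists (fun x => (-1 * (f x)^-1) * (f x)^-1 * df x).
  apply:smooth1_mul => //;apply:smooth1_mul;last exact:smooth1_inv.
  by apply:smooth1_mul;[exact:smooth1_cst|exact:smooth1_inv].
 move=> x;apply:is_derive_eq (is_deriveV (f0 x) (Df x)) _.
 by rewrite /GRing.scale/= mulN1r !mulNr -invfM expr2.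
- move=> a b f sf0 [df sf Df];exists (fun x => df (a * x + b) * a).
  by apply:smooth1_mul;[exact:smooth1_affine|exact:smooth1_cst].
 move=> x;have Da : is_derive x 1 (fun x => a * x + b) a.
  apply:is_derive_eq (is_deriveD (is_deriveM (is_derive_cst a x 1) (is_derive_id x 1)) (is_derive_cst b x 1)) _.
  by rewrite /GRing.scale/= !mulr0 mulr1 !addr0.
 exact:is_derive1_comp.
- move=> a f sf0 [df sf Df] f0.
 have df0 x : x < 1 -> df x = 0.
  move=> x1;have h : is_derive x 1 f 0.
   apply:(@near_eq_is_derive _ _ _ (cst 0)).
   by near=> y;rewrite f0//;near: y;exact:lt_nbhsl.
  by rewrite -(@derive_val _ _ _ _ _ _ _ (Df x)) (@derive_val _ _ _ _ _ _ _ h).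
 exists (fun x => a * (x `^ (a - 1) * f x) + x `^ a * df x).
  apply:smooth1_add;last exact:smooth1_pow.
  by apply:smooth1_mul;[exact:smooth1_cst|exact:smooth1_pow].
 move=> x;have [x1|x1] := ltP x 1.
  rewrite f0// df0// !mulr0 addr0;apply:(@near_eq_is_derive _ _ _ (cst 0)).
  by near=> y;rewrite f0 ?mulr0//;near: y;exact:lt_nbhsl.
 have x0 : 0 < x by rewrite (lt_le_trans _ x1).
 apply:is_derive_eq (is_deriveM (is_derive1_powR a x0) (Df x)) _.
 by rewrite /GRing.scale/=;ring.
Unshelve. all: by end_near. Qed.

Lemma smooth1_continuous f : smooth1 f -> continuous f.
move=> /smooth1_derive[df _ h] x;apply:differentiable_continuous.
by apply/derivable1_diffP;have [] := h x.
Qed.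

End flat.

(** * The radial profile of the regularised fundamental solution *)

Section profile.
Context (R : realType).
Implicit Types (x s a : R) (f df : R -> R).

Lemma is_derive_val f x d1 d2 : is_derive x 1 f d1 -> is_derive x 1 f d2 -> d1 = d2.
by move=> h1 h2;rewrite -(@derive_val _ _ _ _ _ _ _ h1) (@derive_val _ _ _ _ _ _ _ h2).
Qed.

Lemma is_derive_loc_cst f df c (U : set R) : open U -> (forall x, U x -> f x = c) ->
 (forall x, is_derive x 1 f (df x)) -> forall x, U x -> df x = 0.
move=> oU fc hf x Ux;apply:(is_derive_val (hf x)).
apply:(@near_eq_is_derive _ _ _ (cst c : R -> R)).
by near=> y;rewrite fc//;near: y;exact:open_nbhs_nbhs.
Unshelve. all: by end_near. Qed.

Lemma is_derive_affine f (d a b x : R) : is_derive (a * x + b) 1 f d ->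
 is_derive x 1 (fun x => f (a * x + b)) (d * a).
have da : is_derive x 1 (fun x : R => a * x + b) a.
 apply:is_derive_eq (is_deriveD (is_deriveM (is_derive_cst a x 1) (is_derive_id x 1)) (is_derive_cst b x 1)) _.
 by rewrite /GRing.scale/= !mulr0 mulr1 !addr0.
by move=> df;exact:is_derive1_comp.
Qed.

(** Smooth transition from 0 on [x <= 0] to 1 on [x >= 1]; the denominator is positive because one
    of [x] and [1 - x] is. *)
Definition step x : R := flat 0 x * (flat 0 x + flat 0 (-1 * x + 1))^-1.

Definition step' x : R := (flat 2 x * flat 0 (-1 * x + 1) + flat 0 x * flat 2 (-1 * x + 1))
 * (flat 0 x + flat 0 (-1 * x + 1))^-1 ^+ 2.

Lemma step_den_gt0 x : 0 < flat 0 x + flat 0 (-1 * x + 1).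
have [x0|x0] := leP x 0.
 by rewrite (flat_le0 _ x0) add0r flat_gt0//;lra.
by rewrite ltr_wpDr ?flat_ge0// flat_gt0.
Qed.

Lemma smooth1_step : smooth1 step.
apply:smooth1_mul;first exact:smooth1_flat.
apply:smooth1_inv => [|x];last by rewrite gt_eqF// step_den_gt0.
by apply:smooth1_add;[|apply:smooth1_affine];exact:smooth1_flat.
Qed.

Lemma is_derive_step x : is_derive x 1 step (step' x).
have d1 : is_derive x 1 (flat 0) (flat 2 x).
 by apply:is_derive_eq (is_derive_flat 0 x) _;rewrite mul0r subr0.
have d2 : is_derive x 1 (fun x : R => flat 0 (-1 * x + 1)) (- flat 2 (-1 * x + 1)).
 have d3 : is_derive (-1 * x + 1) 1 (flat 0) (flat 2 (-1 * x + 1)).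
  by apply:is_derive_eq (is_derive_flat 0 _) _;rewrite mul0r subr0.
 by apply:is_derive_eq (is_derive_affine d3) _;rewrite mulrN1.
have den0 : flat 0 x + flat 0 (-1 * x + 1) != 0 by rewrite gt_eqF// step_den_gt0.
have d4 := @is_deriveV R (fun x => flat 0 x + flat 0 (-1 * x + 1)) x _ 1 den0 (is_deriveD d1 d2).
apply:is_derive_eq (is_deriveM d1 d4) _.
rewrite /step' /GRing.scale/=.
move: (flat 0 x) (flat 0 _) (flat 2 x) (flat 2 _) den0 => p q r s pq0.
by field.
Qed.

Lemma step_le0 x : x <= 0 -> step x = 0.
by move=> x0;rewrite /step flat_le0// mul0r. Qed.

Lemma step_ge1 x : 1 <= x -> step x = 1.
move=> x1;have h := step_den_gt0 x;rewrite /step.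
rewrite (@flat_le0 _ 0 (-1 * x + 1)) in h *;last lra.
by rewrite addr0 divff// gt_eqF//;rewrite addr0 in h.
Qed.

Lemma step_bound x : 0 <= step x <= 1.
rewrite /step divr_ge0 ?flat_ge0 ?(ltW (step_den_gt0 _))//=.
by rewrite ler_pdivrMr ?step_den_gt0// mul1r lerDl flat_ge0.
Qed.

Lemma step'_ge0 x : 0 <= step' x.
by rewrite mulr_ge0 ?exprn_ge0 ?invr_ge0 ?(ltW (step_den_gt0 _))// addr_ge0// mulr_ge0// flat_ge0. Qed.

Lemma step'_gt0 x : 0 < x < 1 -> 0 < step' x.
move=> /andP[x0 x1].
by rewrite mulr_gt0 ?exprn_gt0 ?invr_gt0 ?step_den_gt0// ltr_wpDr ?mulr_gt0 ?flat_gt0//;lra || (rewrite mulr_ge0// flat_ge0).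
Qed.

Lemma smooth1_ext f g : smooth1 f -> (forall x, f x = g x) -> smooth1 g.
by move=> sf fg;rewrite (_ : g = f)//;apply/funext => x. Qed.

Lemma smooth1_der f df : smooth1 f -> (forall x, is_derive x 1 f (df x)) -> smooth1 df.
move=> /smooth1_derive[g sg hg] hf;apply:smooth1_ext sg _ => x.
exact:is_derive_val (hg x) (hf x).
Qed.

Lemma smooth1_bounded f : smooth1 f -> (forall x, x < 1 -> f x = 0) ->
 (forall x, 2 < x -> f x = 0) -> exists2 C, 0 < C & forall x, `|f x| <= C.
move=> sf f1 f2.
have cf : {within `[1, 2 : R], continuous (fun x => `|f x|)}.
 apply:continuous_subspaceT => x;apply:cvg_norm;exact:smooth1_continuous.
have l12 : (1 : R) <= 2 by rewrite ler1n.
have [c _ hc] := EVT_max l12 cf.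
exists (`|f c| + 1) => [|x];first pos.
have [x1|x1] := ltP x 1;first by rewrite f1// normr0 addr_ge0.
have [x2|x2] := ltP 2 x;first by rewrite f2// normr0 addr_ge0.
by apply:le_trans (hc _ _) _;rewrite ?lerDl// in_itv/= x1.
Qed.

Definition profile (n : nat) (b b1 b2 h h1 : R -> R) (C c : R) : Prop :=
 [/\ [/\ smooth1 b, smooth1 b1, smooth1 b2, smooth1 h & smooth1 h1],
   [/\ forall x, is_derive x 1 b (b1 x), forall x, is_derive x 1 b1 (b2 x),
     forall x, is_derive x 1 h (h1 x) & forall x, h x = n%:R * b x + 2 * x * b1 x],
   [/\ forall x, x <= 1 -> b x = 0, forall x, 2 <= x -> b x = x `^ (- (n%:R / 2)),
     forall x, 0 < x -> `|b x| <= C * x `^ (- (n%:R / 2)),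
     forall x, 0 < x -> `|b1 x| <= C * x `^ (- (n%:R / 2) - 1) &
     forall x, 0 < x -> `|b2 x| <= C * x `^ (- (n%:R / 2) - 2)],
   [/\ forall x, 0 <= h x <= C, forall x, `|h1 x| <= C,
     forall x, x <= 1 -> h x = 0, forall x, 2 <= x -> h x = 0 &
     forall x, 4/3 <= x <= 5/3 -> c <= h x] &
   0 < C /\ 0 < c].

Lemma profile_exists (n : nat) : exists (b b1 b2 h h1 : R -> R) (C c : R),
 profile n b b1 b2 h h1 C c.
pose a : R := - (n%:R / 2).
pose e x : R := step (1 * x + - 1).
pose e1 x : R := step' (1 * x + - 1).
have se : smooth1 e by apply:smooth1_affine;exact:smooth1_step.
have de x : is_derive x 1 e (e1 x).
 by apply:is_derive_eq (is_derive_affine (is_derive_step _)) _;rewrite mulr1.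
have se1 : smooth1 e1 := smooth1_der se de.
have [e2 se2 de1] := smooth1_derive se1.
have e0 x : x <= 1 -> e x = 0 by move=> x1;apply:step_le0;lra.
have e11 x : 2 <= x -> e x = 1 by move=> x1;apply:step_ge1;lra.
have eb x : 0 <= e x <= 1 := step_bound _.
have e1z x : x < 1 -> e1 x = 0.
 apply:(is_derive_loc_cst (@open_lt R 1) _ de) => y /= y1;apply:e0;exact:ltW.
have e1z' x : 2 < x -> e1 x = 0.
 by apply:(is_derive_loc_cst (@open_gt R 2) _ de) => y /= y1;apply:e11;exact:ltW.
have e2z x : x < 1 -> e2 x = 0 by apply:(is_derive_loc_cst (@open_lt R 1) e1z de1).
have e2z' x : 2 < x -> e2 x = 0 by apply:(is_derive_loc_cst (@open_gt R 2) e1z' de1).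
pose b x := x `^ a * e x.
have sb : smooth1 b by apply:smooth1_pow => // x /ltW /e0.
pose b1 x := a * (x `^ (a - 1) * e x) + x `^ a * e1 x.
have sb1 : smooth1 b1.
 apply:smooth1_add;last exact:smooth1_pow.
 by apply:smooth1_mul;[exact:smooth1_cst|apply:smooth1_pow => // x /ltW /e0].
have pow_der p f df : (forall x, x < 1 -> f x = 0) -> (forall x, is_derive x 1 f (df x)) ->
  forall x, is_derive x 1 (fun x => x `^ p * f x) (p * (x `^ (p - 1) * f x) + x `^ p * df x).
 move=> f0 Df x;have df0 := is_derive_loc_cst (@open_lt R 1) f0 Df.
 have [x1|x1] := ltP x 1.
  rewrite f0// df0// !mulr0 addr0;apply:(@near_eq_is_derive _ _ _ (cst 0 : R -> R)).
  by near=> y;rewrite f0 ?mulr0//;near: y;exact:lt_nbhsl.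
 have x0 : 0 < x by rewrite (lt_le_trans _ x1).
 apply:is_derive_eq (is_deriveM (is_derive1_powR p x0) (Df x)) _.
 by rewrite /GRing.scale/=;ring.
have db x : is_derive x 1 b (b1 x) by apply:pow_der => // y /ltW /e0.
pose b2 x := a * ((a - 1) * (x `^ (a - 1 - 1) * e x) + x `^ (a - 1) * e1 x) +
  (a * (x `^ (a - 1) * e1 x) + x `^ a * e2 x).
have db1 x : is_derive x 1 b1 (b2 x).
 apply:is_deriveD;last exact:pow_der.
 have h := pow_der (a - 1) _ _ (fun x h => e0 x (ltW h)) de x.
 apply:is_derive_eq (is_deriveM (is_derive_cst a x 1) h) _.
 by rewrite /GRing.scale/= mulr0 addr0.
have sb2 : smooth1 b2 := smooth1_der sb1 db1.
pose h x := n%:R * b x + 2 * x * b1 x.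
have sh : smooth1 h.
 apply:smooth1_add;first by apply:smooth1_mul => //;exact:smooth1_cst.
 by apply:smooth1_mul => //;apply:smooth1_mul;[exact:smooth1_cst|exact:smooth1_id].
(* The derivative of the power cancels [n b], as [n = -2 a]; what remains is the derivative of the
   cut-off, nonnegative and supported in [[1, 2]]. *)
have hE x : 1 <= x -> h x = 2 * (x `^ (a + 1) * e1 x).
 move=> x1;have x0 : 0 < x by rewrite (lt_le_trans _ x1).
 rewrite /h /b /b1.
 have -> : x `^ a = x `^ (a - 1) * x by rewrite -{3}(powRr1 (ltW x0)) -powRD ?subrK// (gt_eqF x0) implybT.
 have -> : x `^ (a + 1) = x `^ (a - 1) * x * x.
  by rewrite -{3 4}(powRr1 (ltW x0)) -!powRD ?subrK// (gt_eqF x0) implybT.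
 have -> : (n%:R : R) = - 2 * a by rewrite /a;field.
 by move: (x `^ _) (e x) (e1 x) => p u v;ring.
have h0 x : x <= 1 -> h x = 0.
 rewrite le_eqVlt => /predU1P[->|x1].
  rewrite hE//.
  suff -> : e1 1 = 0 by rewrite !mulr0.
  by rewrite /e1 mul1r subrr /step' (@flat_le0 _ 0 0)// (@flat_le0 _ 2 0)// !mul0r addr0 mul0r.
 by rewrite /h /b /b1 e0 ?(ltW x1)// e1z// !(mulr0, addr0).
have h2 x : 2 <= x -> h x = 0.
 rewrite le_eqVlt => /predU1P[<-|x1].
  rewrite hE ?ler1n//.
  suff -> : e1 2 = 0 by rewrite !mulr0.
  rewrite /e1 mul1r /step' (@flat_le0 _ 0 (-1 * _ + 1)) ?(@flat_le0 _ 2 (-1 * _ + 1));[|lra|lra].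
  by rewrite !mulr0 addr0 mul0r.
 by rewrite hE ?e1z' ?mulr0// ltW// (lt_trans _ x1)// ltr1n.
have h_ge0 x : 0 <= h x.
 have [x1|x1] := leP x 1;first by rewrite h0.
 by rewrite hE ?(ltW x1)// mulr_ge0// mulr_ge0 ?powR_ge0// step'_ge0.
have [h1 sh1 dh] := smooth1_derive sh.
have h1z x : x < 1 -> h1 x = 0.
 by apply:(is_derive_loc_cst (@open_lt R 1) _ dh) => y /= y1;apply:h0;exact:ltW.
have h1z' x : 2 < x -> h1 x = 0.
 by apply:(is_derive_loc_cst (@open_gt R 2) _ dh) => y /= y1;apply:h2;exact:ltW.
have [C1 C10 hC1] := smooth1_bounded sh (fun x k => h0 x (ltW k)) (fun x k => h2 x (ltW k)).
have [C2 C20 hC2] := smooth1_bounded sh1 h1z h1z'.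
have sxe1 : smooth1 (fun x => x * e1 x) by apply:smooth1_mul => //;exact:smooth1_id.
have sxe2 : smooth1 (fun x => x * (x * e2 x)) by do 2!(apply:smooth1_mul;first exact:smooth1_id).
have [|//|C3 C30 hC3] := smooth1_bounded sxe1.
- by move=> x x1;rewrite e1z// mulr0.
- by move=> x x1;rewrite e1z'// mulr0.
have [|//|C4 C40 hC4] := smooth1_bounded sxe2.
- by move=> x x1;rewrite e2z// !mulr0.
- by move=> x x1;rewrite e2z'// !mulr0.
have [c c0 hc] : exists2 c, 0 < c & forall x, 4/3 <= x <= 5/3 -> c <= h x.
 have ch : {within `[4/3, 5/3 : R], continuous h}.
  by apply:continuous_subspaceT => x;exact:smooth1_continuous.
 have l12 : (4/3 : R) <= 5/3 by lra.
 have [m mI hm] := EVT_min l12 ch.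
 move: mI;rewrite in_itv/= => /andP[m1 m2].
 exists (h m);last by move=> x xI;apply:hm;rewrite in_itv.
 have m3 : 1 <= m by lra.
 by rewrite hE// mulr_gt0// mulr_gt0 ?powR_gt0//;[lra|apply:step'_gt0;lra].
pose A := `|a|;pose C := C1 + C2 + (1 + A + C3) + (A * ((A + 1) + C3) + (A * C3 + C4)).
have A0 : 0 <= A by pos.
have ab x : `|e x| <= 1 by have /andP[e1' e2'] := eb x;rewrite ger0_norm.
have pw x p : 0 < x -> x `^ (p - 1) * x = x `^ p.
 by move=> x0;rewrite -{2}(powRr1 (ltW x0)) -powRD ?subrK// (gt_eqF x0) implybT.
have Cq : 0 <= A * ((A + 1) + C3) + (A * C3 + C4).
 by pos.
exists b, b1, b2, h, h1, C, c;split=> //.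
- split=> //.
 + by move=> x x1;rewrite /b e0// mulr0.
 + by move=> x x2;rewrite /b e11// mulr1.
 + move=> x x0;rewrite normrM mulrC (ger0_norm (powR_ge0 _ _)) -/a.
  apply:ler_wpM2r;first exact:powR_ge0.
  by apply:le_trans (ab x) _;rewrite /C;lra.
 + move=> x x0;rewrite -/a /b1 -(pw x a x0).
  rewrite (_ : _ + _ = (a * e x + x * e1 x) * x `^ (a - 1));last by move: (x `^ _) => p;ring.
  rewrite normrM (ger0_norm (powR_ge0 _ _));apply:ler_wpM2r;first exact:powR_ge0.
  apply:le_trans (ler_normD _ _) _;rewrite normrM.
  have k3 := hC3 x;have k4 : A * `|e x| <= A by rewrite -[leRHS]mulr1 ler_wpM2l.
  by rewrite -/A /C;lra.
 + move=> x x0;rewrite -/a /b2 -(pw x a x0) -(pw x (a - 1) x0).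
  have -> : a - 2 = a - 1 - 1 by ring.
  rewrite (_ : _ + _ = (a * ((a - 1) * e x + x * e1 x) + (a * (x * e1 x) + x * (x * e2 x))) * x `^ (a - 1 - 1));last by move: (x `^ _) => p;ring.
  rewrite normrM (ger0_norm (powR_ge0 _ _));apply:ler_wpM2r;first exact:powR_ge0.
  have k3 := hC3 x;have k4 := hC4 x;have k0 := ab x.
  have k5 : `|(a - 1) * e x + x * e1 x| <= A + 1 + C3.
   apply:le_trans (ler_normD _ _) _;apply:lerD => //;rewrite normrM.
   have : `|a - 1| <= A + 1 by apply:le_trans (ler_normB _ _) _;rewrite normr1.
   by move=> k;apply:le_trans k;rewrite -[leRHS]mulr1 ler_wpM2l.
  have k6 : `|a * ((a - 1) * e x + x * e1 x)| <= A * (A + 1 + C3).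
   by rewrite normrM;apply:ler_wpM2l.
  have k7 : `|a * (x * e1 x)| <= A * C3 by rewrite normrM;apply:ler_wpM2l.
  apply:le_trans (ler_normD _ _) _.
  have k8 := ler_normD (a * (x * e1 x)) (x * (x * e2 x)).
  have : 0 <= 1 + A + C3 by pos.
  by rewrite /C;lra.
- have Cp : 0 <= (1 + A + C3) + (A * ((A + 1) + C3) + (A * C3 + C4)).
  by pos.
 split=> //.
 + move=> x;rewrite h_ge0/=;have := hC1 x;rewrite ger0_norm// => k.
  apply:le_trans k _;rewrite /C;lra.
 + by move=> x;apply:le_trans (hC2 x) _;rewrite /C;lra.
- split=> //.
 have Cp : 0 <= (1 + A + C3) + (A * ((A + 1) + C3) + (A * C3 + C4)).
  by pos.
 by pos;lra.
Unshelve. all: by end_near. Qed.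

End profile.

(** * Real-valued integrals and Fubini's theorem under a product majorant *)

Section real_integral.
Context d (T : measurableType d) (R : realType) (mu : {measure set T -> \bar R}).
Implicit Types (f g : T -> R).

Definition Lint f : Prop := mu.-integrable setT (EFin \o f).
Definition ig f : R := \int[mu]_x f x.

Lemma Lint_meas f : Lint f -> mfun f.
by move=> /measurable_int/measurable_EFinP. Qed.

Lemma ig_EFin f : Lint f -> (\int[mu]_x (f x)%:E = (ig f)%:E)%E.
by move=> fi;rewrite /ig /Rintegral fineK//;exact:integrable_fin_num fi. Qed.

Lemma Lint_dom f g : mfun f -> (forall x, `|f x| <= g x) -> Lint g -> Lint f.
move=> mf fg;apply:le_integrable => //;first exact/measurable_EFinP.
by move=> x _;rewrite /= lee_fin (le_trans (fg x))// ler_norm.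
Qed.

Lemma Lint_lty f : mfun f -> ge0 f ->
 (\int[mu]_x (f x)%:E < +oo)%E -> Lint f.
move=> mf f0 h;apply/integrableP;split;first exact/measurable_EFinP.
apply:le_lt_trans h;apply:le_of_eq.
by apply:eq_integral => x _;rewrite /= ger0_norm.
Qed.

Lemma LintD f g : Lint f -> Lint g -> Lint (fun x => f x + g x).
by move=> fi gi;have := integrableD measurableT fi gi. Qed.

Lemma LintZ c f : Lint f -> Lint (fun x => c * f x).
by move=> fi;have := integrableZl measurableT c fi. Qed.

Lemma LintB f g : Lint f -> Lint g -> Lint (fun x => f x - g x).
by move=> fi gi;have := integrableB measurableT fi gi. Qed.

Lemma Lint0 : Lint (fun=> 0).
exact:integrable0. Qed.

Lemma Lint_sum m (f : 'I_m -> T -> R) : (forall i, Lint (f i)) -> Lint (fun x => \sum_i f i x).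
elim: m f => [|m IH] f fi.
 rewrite (_ : (fun _ => _) = fun=> 0);first exact:Lint0.
 by apply/funext => x;rewrite big_ord0.
rewrite (_ : (fun _ => _) = fun x => \sum_(i < m) f (widen_ord (leqnSn m) i) x + f ord_max x).
 by apply:LintD => //;exact:IH.
by apply/funext => x;rewrite big_ord_recr.
Qed.

Lemma Lint_abs f : Lint f -> Lint (fun x => `|f x|).
by move=> fi;have := integrable_abse fi. Qed.

Lemma Lint_mulb M f g : Lint f -> mfun g -> (forall x, `|g x| <= M) ->
 Lint (fun x => f x * g x).
move=> fi mg gM;apply:(@Lint_dom _ (fun x => M * `|f x|));last exact/LintZ/Lint_abs.
 by apply:mfunM => //;exact:Lint_meas.
by move=> x;rewrite normrM mulrC ler_wpM2r.
Qed.

Lemma igD f g : Lint f -> Lint g -> ig (fun x => f x + g x) = ig f + ig g.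
by move=> fi gi;rewrite /ig RintegralD. Qed.

Lemma igB f g : Lint f -> Lint g -> ig (fun x => f x - g x) = ig f - ig g.
by move=> fi gi;rewrite /ig RintegralB. Qed.

Lemma igZ c f : Lint f -> ig (fun x => c * f x) = c * ig f.
by move=> fi;rewrite /ig RintegralZl. Qed.

Lemma ig0 : ig (fun=> 0) = 0.
by rewrite /ig /Rintegral integral0. Qed.

Lemma ig_sum m (f : 'I_m -> T -> R) : (forall i, Lint (f i)) ->
 ig (fun x => \sum_i f i x) = \sum_i ig (f i).
elim: m f => [|m IH] f fi.
 rewrite big_ord0 -[RHS]ig0;congr ig.
 by apply/funext => x;rewrite big_ord0.
rewrite (_ : (fun _ => _) = fun x => \sum_(i < m) f (widen_ord (leqnSn m) i) x + f ord_max x).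
 rewrite igD//;last exact:Lint_sum.
 by rewrite IH// big_ord_recr.
by apply/funext => x;rewrite big_ord_recr.
Qed.

Lemma ig_ge0 f : ge0 f -> 0 <= ig f.
by move=> f0;apply:Rintegral_ge0 => x _. Qed.

Lemma ig_le f g : Lint f -> Lint g -> (forall x, f x <= g x) -> ig f <= ig g.
by move=> fi gi fg;apply:le_Rintegral => // x _. Qed.

Lemma ig_abs f : Lint f -> `|ig f| <= ig (fun x => `|f x|).
by move=> fi;apply:le_normr_Rintegral. Qed.

Lemma Lint_indic_lty (D : set T) : measurable D -> (mu D < +oo)%E ->
 Lint (\1_D : T -> R) /\ ig \1_D = fine (mu D).
move=> mD Doo;split.
 apply:Lint_lty => //;by rewrite ?integral_indic ?setIT.
by rewrite /ig /Rintegral integral_indic// setIT.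
Qed.

Lemma ig_lty f : mfun f -> ge0 f -> forall c,
 (\int[mu]_x (f x)%:E <= c%:E)%E -> Lint f /\ ig f <= c.
move=> mf f0 c h;have fi : Lint f by apply:Lint_lty => //;rewrite (le_lt_trans h)// ltry.
by split=> //;rewrite -lee_fin -ig_EFin.
Qed.

End real_integral.

Lemma Rintegral_ig d (T : measurableType d) (R : realType) (mu : {measure set T -> \bar R})
  (D : set T) (g h : T -> R) : (forall x, D x -> g x = h x) ->
 (forall x, ~ D x -> h x = 0) -> \int[mu]_(x in D) g x = ig mu h.
move=> gh h0;rewrite /ig /Rintegral;congr fine.
rewrite integral_mkcond;apply:eq_integral => x _;rewrite patchE.
by case: ifPn => [/set_mem/gh->//|/negP xD];rewrite h0// => Dx;apply:xD;exact:mem_set.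
Qed.

Section swap.
Context d1 d2 (T1 : measurableType d1) (T2 : measurableType d2) (R : realType).
Variables (m1 : {sigma_finite_measure set T1 -> \bar R}) (m2 : {sigma_finite_measure set T2 -> \bar R}).
Variables (F : T1 -> T2 -> R) (a : T1 -> R) (b : T2 -> R).
Hypothesis mF : mfun (fun z : T1 * T2 => F z.1 z.2).
Hypothesis Fab : forall x y, `|F x y| <= a x * b y.
Hypothesis ai : Lint m1 a.
Hypothesis bi : Lint m2 b.

Let mF1 x : mfun (F x).
exact:(mT_comp mF (measurable_pair1 x)). Qed.

Let mF2 y : mfun (F^~ y).
exact:(mT_comp mF (measurable_pair2 y)). Qed.

Lemma swap_Lint1 x : Lint m2 (F x).
by apply:Lint_dom (Fab x) _ => //;exact:LintZ. Qed.

Lemma swap_Lint2 y : Lint m1 (F^~ y).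
apply:(@Lint_dom _ _ _ _ _ (fun x => b y * a x)) => //;last exact:LintZ.
by move=> x;rewrite mulrC.
Qed.

Let Fi : (m1 \x m2)%E.-integrable setT (fun z : T1 * T2 => (F z.1 z.2)%:E).
apply/integrable12ltyP;first exact/measurable_EFinP.
pose B := ig m2 (fun y => `|b y|).
apply:(@le_lt_trans _ _ (\int[m1]_x (B * `|a x|)%:E)%E);last first.
 by rewrite ig_EFin ?ltry//;apply:LintZ;exact:Lint_abs.
have mF' : mfun (fun z : T1 * T2 => (`|F z.1 z.2|)%:E).
 by apply/measurable_EFinP;apply:mT_comp.
apply:ge0_le_integral => //=.
- by move=> x _;apply:integral_ge0.
- have F0 (z : T1 * T2) : (0 <= (`|F z.1 z.2|)%:E)%E by pos.
 exact:(measurable_fun_fubini_tonelli_F _ mF' F0).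
- apply/measurable_EFinP;apply:mfunM => //.
 by apply:mT_comp => //;exact:Lint_meas ai.
move=> x _;rewrite (ig_EFin (Lint_abs (swap_Lint1 x))) lee_fin mulrC.
have bi' := Lint_abs bi;rewrite -igZ//;apply:ig_le;[exact/Lint_abs/swap_Lint1|exact:LintZ|].
by move=> y;rewrite -normrM;apply:le_trans (ler_norm _).
Qed.

Lemma swap_Lint : Lint m1 (fun x => ig m2 (F x)).
have := integrable_fubini_F Fi;apply:eq_integrable => // x _.
by rewrite /fubini_F/= ig_EFin//;exact:swap_Lint1.
Qed.

Lemma ig_swap : ig m1 (fun x => ig m2 (F x)) = ig m2 (fun y => ig m1 (F^~ y)).
have := Fubini Fi => /= h;rewrite /ig /Rintegral;congr fine.
transitivity (\int[m1]_x \int[m2]_y (F x y)%:E)%E.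
 by apply:eq_integral => x _;rewrite ig_EFin//;exact:swap_Lint1.
rewrite h;apply:eq_integral => y _.
by rewrite ig_EFin//;exact:swap_Lint2.
Qed.

End swap.

Lemma integralD_real d (T : measurableType d) (R : realType) (mu : {measure set T -> \bar R})
  (D : set T) (f g : T -> R) : measurable D -> mfun f -> mfun g ->
 ge0 f -> ge0 g ->
 (\int[mu]_(x in D) (f x + g x)%:E = \int[mu]_(x in D) (f x)%:E + \int[mu]_(x in D) (g x)%:E)%E.
move=> mD mf mg f0 g0;under eq_integral do rewrite EFinD.
apply:ge0_integralD => //.
- by move=> x _;pos.
- exact:mEFin.
- by move=> x _;pos.
- exact:mEFin.
Qed.

Lemma integralZ_real d (T : measurableType d) (R : realType) (mu : {measure set T -> \bar R})
  (D : set T) (f : T -> R) (c : R) : measurable D -> mfun f ->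
 ge0 f -> 0 <= c ->
 (\int[mu]_(x in D) (c * f x)%:E = c%:E * \int[mu]_(x in D) (f x)%:E)%E.
move=> mD mf f0 c0;under eq_integral do rewrite EFinM.
apply:(ge0_integralZl_EFin mu mD _ _ c0);last exact:mEFin.
by move=> x _;pos.
Qed.

Lemma powR_exprn (R : realType) (a g : R) j : 0 <= a -> (a ^+ j) `^ g = (a `^ g) ^+ j.
move=> a0;elim: j => [|j ih];first by rewrite !expr0 powR1.
by rewrite !exprS powRM ?exprn_ge0// ih.
Qed.

(** * Weighted Jensen inequality and summation over levels *)

Section level_sums.
Context d (T : measurableType d) (R : realType) (mu : {measure set T -> \bar R}).
Implicit Types (v Z w X : T -> R) (D : set T).

(** Hoelder's inequality for the factors [X w^(1/p)] and [w^(1-1/p)]. *)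
Lemma jensen_weight (D : set T) X w (p A B : R) : measurable D -> mfun X ->
 mfun w -> ge0 X -> ge0 w -> 1 < p ->
 0 <= A -> 0 <= B -> (\int[mu]_(x in D) (X x `^ p * w x)%:E <= A%:E)%E ->
 (\int[mu]_(x in D) (w x)%:E <= B%:E)%E ->
 (\int[mu]_(x in D) (X x * w x)%:E <= (A `^ p^-1 * B `^ (1 - p^-1))%:E)%E.
move=> mD mX mw X0 w0 p1 A0 B0 hA hB.
have p0 : 0 < p by exact:lt_trans p1.
have c0 : 0 < 1 - p^-1 by rewrite subr_gt0 invf_lt1.
have := @hoelder_bound _ _ R mu D (fun x => X x * w x `^ p^-1) (fun x => w x `^ (1 - p^-1)) p (1 - p^-1)^-1 A B mD.
have mpw a : mfun (fun x => w x `^ a).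
 exact:(mT_comp (measurable_powR a) mw).
have E1 : (fun x => ((X x * w x `^ p^-1) `^ p)%:E) = (fun x => (X x `^ p * w x)%:E).
 apply/funext => x;congr _%:E;rewrite powRM ?powR_ge0//;congr (_ * _).
 by apply:powRVK;[exact:w0|rewrite gt_eqF].
have E2 : (fun x => ((w x `^ (1 - p^-1)) `^ (1 - p^-1)^-1)%:E) = (fun x => (w x)%:E).
 by apply/funext => x;congr _%:E;apply:powRK;[exact:w0|rewrite gt_eqF].
have E3 : (fun x => (X x * w x `^ p^-1 * w x `^ (1 - p^-1))%:E) = (fun x => (X x * w x)%:E).
 apply/funext => x;congr _%:E;rewrite -mulrA;congr (_ * _).
 have [->|wn] := eqVneq (w x) 0;first by rewrite powR0 ?mul0r// invr_eq0 gt_eqF.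
 have e : p^-1 + (1 - p^-1) = 1 by rewrite addrC subrK.
 rewrite -powRD;last by rewrite wn implybT.
 by rewrite e powRr1.
rewrite E1 E2 E3 invrK;apply => //.
- exact:mfunM.
- by move=> x;rewrite mulr_ge0 ?powR_ge0.
- by move=> x;rewrite powR_ge0.
- by rewrite invr_gt0.
- by rewrite addrC subrK.
Qed.

(** The terms grow geometrically, so the sum of those below [Y] is governed by the last one. *)
Lemma geometric_cut (a be Y : R) (J : nat) : 0 < a -> 1 < be -> 0 <= Y ->
 \sum_(j < J) (if a * be ^+ j < Y then a * be ^+ j else 0) <= Y * (be / (be - 1)).
move=> a0 be1 Y0;have b1 : 0 < be - 1 by rewrite subr_gt0.
have be0 : 0 < be by exact:lt_trans be1.
pose S J := \sum_(j < J) (if a * be ^+ j < Y then a * be ^+ j else 0).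
have S1 K : S K <= a * be ^+ K / (be - 1).
 elim: K => [|K ih];first by rewrite /S big_ord0 expr0 mulr1 divr_ge0// ltW.
 rewrite /S big_ord_recr /=;apply:(le_via (a * be ^+ K / (be - 1) + a * be ^+ K)).
  by apply:lerD;[exact:ih|case: ifP => // _;rewrite mulr_ge0 ?exprn_ge0 ?ltW].
 rewrite exprS ler_pdivlMr// mulrDl divfK ?gt_eqF//.
 by apply:le_of_eq;ring.
elim: J => [|J ih];first by rewrite big_ord0 mulr_ge0// divr_ge0 ?ltW.
rewrite big_ord_recr /=;case: ifP => h;last by rewrite addr0;exact:ih.
have := S1 J.+1;rewrite /S big_ord_recr /= h => /le_trans;apply.
rewrite exprSr !mulrA;apply:ler_wpM2r;first by rewrite invr_ge0 ltW.
by apply:ler_wpM2r;exact:ltW.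
Qed.

Lemma nneseries_le (u : nat -> R) (c : R) : (forall j, 0 <= u j) ->
 (forall J, \sum_(j < J) u j <= c) -> (\sum_(j <oo) (u j)%:E <= c%:E)%E.
move=> u0 h;apply:lime_le;first by apply:is_cvg_nneseries => j _ _;rewrite lee_fin.
by apply:nearW => J;rewrite /= sumEFin lee_fin big_mkord.
Qed.

Lemma dyadic_level (a y : R) : 0 < a -> a < y -> exists j : nat, a * 2 ^+ j < y <= a * 2 ^+ j.+1.
move=> a0 ay;have e : exists N : nat, y <= a * 2 ^+ N.
 have [N hN] : exists N : nat, y / a < N%:R.
  by exists (Num.truncn (y / a)).+1;exact:truncnS_gt.
 exists N;rewrite mulrC -ler_pdivrMr//;apply:(le_trans (ltW hN)).
 by rewrite -natrX ler_nat ltnW// ltn_expl.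
have [N hN mN] := ex_minnP e;case: N hN mN => [|N] hN mN.
 by move: hN;rewrite expr0 mulr1 leNgt ay.
by exists N;rewrite hN andbT ltNge;apply/negP => /mN;rewrite ltnn.
Qed.

(** Layer-cake summation of a good lambda inequality. Between consecutive levels [v] is at most
    [2 C5 l_j]; after exchanging sum and integral, the powers [l_j^(q-s)] over the levels with
    [l_j^s < Z] add up to a multiple of [Z^((q-s)/s)], which is where [s < q] enters. *)
Lemma sum_levels (D : set T) v Z w (q s kap l1 C5 : R) : measurable D ->
 mfun v -> mfun Z -> mfun w ->
 ge0 v -> ge0 Z -> ge0 w ->
 0 < s < q -> 0 <= kap -> 0 < l1 -> 0 < C5 ->
 (forall j, (\int[mu]_(x in D `&` [set x | (C5 * (l1 * 2 ^+ j) < v x)%R]) (w x)%:E <=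
   (kap / (l1 * 2 ^+ j) `^ s)%:E *
   \int[mu]_x (Z x * w x * \1_[set x | ((l1 * 2 ^+ j) `^ s < Z x)%R] x)%:E)%E) ->
 (\int[mu]_(x in D `&` [set x | (C5 * l1 < v x)%R]) (v x `^ q * w x)%:E <=
  (kap * (2 * C5) `^ q * (2 `^ (q - s) / (2 `^ (q - s) - 1)))%:E *
  \int[mu]_x (Z x `^ (q / s) * w x)%:E)%E.
move=> mD mv mZ mw v0 Z0 w0 /andP[s0 sq] kap0 l10 C50 H.
have q0 : 0 < q by exact:lt_trans sq.
have g0 : 0 < q - s by rewrite subr_gt0.
pose l j := l1 * 2 ^+ j.
have l0 j : 0 < l j by rewrite mulr_gt0// exprn_gt0.
pose Ev j : set T := [set x | (C5 * l j < v x)%R].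
pose EZ j : set T := [set x | (l j `^ s < Z x)%R].
have mEv j : measurable (Ev j).
 exact:measurable_gt mv.
have mEZ j : measurable (EZ j).
 exact:measurable_gt mZ.
pose c j := (2 * C5 * l j) `^ q.
have c0 j : 0 <= c j by exact:powR_ge0.
pose F j x : R := c j * (w x * \1_(Ev j) x).
have F0 j x : 0 <= F j x by rewrite !mulr_ge0// indicE.
have mwE j : mfun (fun x => w x * \1_(Ev j) x) := mfunM mw (measurable_indic (mEv j)).
have mF j : mfun (F j) := mfunM (measurable_cst (c j)) (mwE j).
have mvq : mfun (fun x => v x `^ q * w x).
 exact:mfunM (mT_comp (measurable_powR q) mv) mw.
have mZq : mfun (fun x => Z x `^ (q / s) * w x).
 exact:mfunM (mT_comp (measurable_powR (q / s)) mZ) mw.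
have vq0 x : 0 <= v x `^ q * w x by pos.
have m0 : measurable (D `&` [set x | (C5 * l1 < v x)%R]).
 by apply:measurableI => //;have := mEv 0%N;rewrite /Ev /l expr0 mulr1.
apply:(le_via (\int[mu]_(x in D) (\sum_(j <oo) (F j x)%:E))%E).
 have mS : mfun (fun x => (\sum_(j <oo) (F j x)%:E)%E).
  apply:(ge0_emeasurable_sum (P := xpredT)) => [j x _ _|j _];first pos.
  exact:mEFin.
 have S0 x : (0 <= \sum_(j <oo) (F j x)%:E)%E by apply:nneseries_ge0 => j _ _;rewrite lee_fin.
 apply:le_trans (int_subset mu m0 mD mS S0 (@subIsetl _ _ _)).
 apply:(int_le mu m0 _ mS);first exact:mEFin.
  by move=> x;rewrite lee_fin.
 move=> x [_ xv].
 have [j /andP[h1 h2]] := dyadic_level (mulr_gt0 C50 l10) xv.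
 have Fj : ((v x `^ q * w x)%:E <= (F j x)%:E)%E.
  rewrite lee_fin /F indicE mem_set;last by rewrite /Ev /= /l mulrA.
  rewrite mulr1;apply:ler_wpM2r => //;apply:(ler_powRl (ltW q0)) => //.
  by apply:(le_trans h2);rewrite /l exprS le_eqVlt;apply/orP;left;apply/eqP;ring.
 by apply:(le_trans Fj);apply:(nneseries_ge_term (u := fun j => (F j x)%:E)) => i;rewrite lee_fin.
rewrite integral_nneseries//;last 2 first.
- by move=> j;exact:mEFin.
- by move=> j x _;rewrite lee_fin.
pose G j x : R := c j * (kap / l j `^ s) * (Z x * w x * \1_(EZ j) x).
have ck0 j : 0 <= c j * (kap / l j `^ s) by pos.
have G0 j x : 0 <= G j x by rewrite mulr_ge0// ?mulr_ge0// indicE.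
have mZw j : mfun (fun x => Z x * w x * \1_(EZ j) x).
 exact:mfunM (mfunM mZ mw) (measurable_indic (mEZ j)).
have mG j : mfun (G j) := mfunM (measurable_cst _) (mZw j).
apply:(le_via (\sum_(j <oo) \int[mu]_x (G j x)%:E)%E).
 apply:lee_nneseries => [j _ _|j _];first by apply:int_ge0T => x;rewrite lee_fin.
 have -> : (\int[mu]_(x in D) (F j x)%:E = (c j)%:E * \int[mu]_(x in D `&` Ev j) (w x)%:E)%E.
  under eq_integral do rewrite EFinM.
  rewrite (ge0_integralZl_EFin mu mD _ _ (c0 j));last 2 first.
  - by move=> x _;rewrite lee_fin mulr_ge0// indicE.
  - exact:mEFin.
  by under eq_integral do rewrite EFinM;rewrite (integral_mul_indic mu D (Ev j) (fun x => (w x)%:E)).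
 have -> : (\int[mu]_x (G j x)%:E = (c j)%:E * ((kap / l j `^ s)%:E * \int[mu]_x (Z x * w x * \1_(EZ j) x)%:E))%E.
  under eq_integral do rewrite EFinM.
  rewrite (ge0_integralZl_EFin mu measurableT _ _ (ck0 j));last 2 first.
  - by move=> x _;rewrite lee_fin !mulr_ge0// indicE.
  - exact:mEFin.
  by rewrite EFinM muleA.
 by apply:lee_wpmul2l;[rewrite lee_fin|exact:H].
rewrite -integral_nneseries//;last 2 first.
- by move=> j;exact:mEFin.
- by move=> j x _;rewrite lee_fin.
set K := kap * _ * _.
have b1 : 1 < (2 : R) `^ (q - s).
 have := gt0_ltr_powR g0 (ltac:(by rewrite nnegrE) : (1 : R) \is Num.nneg) (ltac:(by rewrite nnegrE) : (2 : R) \is Num.nneg) (ltac:(by rewrite ltr1n) : (1 : R) < 2).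
 by rewrite powR1.
have K0 : 0 <= K.
 by rewrite !mulr_ge0 ?powR_ge0// invr_ge0 subr_ge0 ltW.
rewrite -(ge0_integralZl_EFin mu measurableT _ _ K0);last 2 first.
- by move=> x _;rewrite lee_fin mulr_ge0// powR_ge0.
- exact:mEFin.
apply:(int_le mu measurableT).
- apply:(ge0_emeasurable_sum (P := xpredT)) => [j x _ _|j _];first pos.
 exact:mEFin.
- exact:(mEFin (mfunM (measurable_cst K) mZq)).
- by move=> x;apply:nneseries_ge0 => j _ _;rewrite lee_fin.
move=> x _;rewrite -EFinM;apply:nneseries_le => [j|J];first exact:G0.
pose Y := Z x `^ ((q - s) / s).
have Y0 : 0 <= Y by exact:powR_ge0.
have a0 : 0 < l1 `^ (q - s) by pos.
have := geometric_cut J a0 b1 Y0.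
have lg j : l j `^ (q - s) = l1 `^ (q - s) * (2 `^ (q - s)) ^+ j.
 rewrite /l powRM ?exprn_ge0 ?(ltW l10)//;congr (_ * _).
 exact:powR_exprn.
move=> hg;have KW : 0 <= kap * (2 * C5) `^ q * (Z x * w x) by pos.
have := ler_wpM2l KW hg;rewrite mulr_sumr => h.
apply:(le_via (\sum_(j < J) kap * (2 * C5) `^ q * (Z x * w x) *
  (if l1 `^ (q - s) * (2 `^ (q - s)) ^+ j < Y then l1 `^ (q - s) * (2 `^ (q - s)) ^+ j else 0))).
 apply:ler_sum => j _;rewrite -lg /G indicE.
 have [/set_mem xE|xE] := boolP (x \in EZ j);last first.
  by rewrite !mulr0 mulr_ge0//;case: ifP => // _;exact:powR_ge0.
 have lY : l j `^ (q - s) < Y.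
  have -> : l j `^ (q - s) = (l j `^ s) `^ ((q - s) / s).
   by rewrite -powRrM mulrCA divff ?mulr1// gt_eqF.
  apply:gt0_ltr_powR => //;first by rewrite divr_gt0.
  by pos.
  by rewrite nnegrE.
 rewrite lY mulr1 /c (powRM q (mulr_ge0 (ler0n R 2) (ltW C50)) (ltW (l0 j))).
 have -> : l j `^ (q - s) = l j `^ q / l j `^ s.
  by rewrite powRB// gt_eqF// l0.
 by apply:le_of_eq;ring.
apply:(le_trans h);rewrite /K.
have ZY : Z x * Y = Z x `^ (q / s).
 have [->|zn] := eqVneq (Z x) 0;first by rewrite mul0r powR0// gt_eqF// divr_gt0.
 rewrite /Y -{1}(powRr1 (Z0 x)) -powRD ?zn ?implybT//;congr (_ `^ _).
 by rewrite mulrBl divff ?gt_eqF// addrC subrK.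
by rewrite -ZY le_eqVlt;apply/orP;left;apply/eqP;ring.
Qed.

End level_sums.

(** * Elementary arithmetic isolated from the estimates *)

Lemma exprVnS (R : realType) (x : R) n : x ^- n.+1 = x ^- n * x^-1.
by rewrite exprSr invfM. Qed.

Lemma indic_mul_le (R : realType) (T : Type) (B : set T) (x : T) (r : R) : 0 <= r -> \1_B x * r <= r.
by move=> r0;rewrite indicE;case: (_ \in _);rewrite ?mul1r// mul0r. Qed.

Lemma ler_term_sum (R : numDomainType) m (I : 'I_m -> R) l : (forall k, 0 <= I k) -> I l <= \sum_k I k.
by move=> I0;rewrite (bigD1 l)//= lerDl sumr_ge0. Qed.

(** Young's inequality has been applied with weight [lam / 2] on [Ij], so that half of [lam * S] is
    absorbed on the left. *)
Lemma energy_real (R : realFieldType) (lam Th S X T0 Ij Ik G : R) : 0 < lam ->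
 lam * S <= X -> X <= (2 * lam)^-1 * T0 + lam / 2 * Ij -> Ij <= S -> Ik <= S ->
 T0 <= Th ^+ 2 * G -> Ik <= (Th / lam) ^+ 2 * G.
move=> lam0 e1 e2 IS IkS T;apply:(le_trans IkS).
have e4 : lam / 2 * Ij <= lam / 2 * S by rewrite ler_wpM2l// divr_ge0// ltW.
have e3 : lam / 2 * S <= (2 * lam)^-1 * T0 by move: ((2 * lam)^-1 * T0) e2 => p e2;lra.
rewrite expr_div_n mulrAC ler_pdivlMr ?exprn_gt0//;apply:le_trans T.
have l2 : 0 <= 2 * lam by pos.
have := ler_wpM2l l2 e3;rewrite [leRHS]mulrA mulfV ?mul1r;last pos.
by apply:le_trans;apply:le_of_eq;field.
Qed.

Lemma half_real (R : realFieldType) (p q s : R) : p <= s -> 2 * s <= q -> p <= q / 2.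
lra. Qed.

Lemma gap_real (R : realFieldType) (m e : R) : 2 * m * (e / 4) + e / 2 * m = e * m.
lra. Qed.

Lemma gap_real2 (R : realFieldType) (c m u uj e : R) : 0 <= m -> u - e / 2 < uj -> c <= m * u ->
 c + m * (u - 2 * uj) <= e * m.
move=> m0 h hc;have : m * (u - e / 2) <= m * uj by apply:ler_wpM2l => //;exact:ltW.
lra.
Qed.

Lemma gap_real3 (R : realFieldType) (m : R) :
 `|m - m * true%:R| <= m + m * (true%:R - 2 * true%:R).
by have -> : true%:R = 1 by [];rewrite mulr1 subrr normr0;lra. Qed.

Lemma inv_bound_real (R : rcfType) (lam s q y : R) : 0 < lam -> lam * s ^+ 2 <= q -> q <= y ->
 y <= s -> 0 <= s -> s <= lam^-1.
move=> l0 h1 h2 h3 s0;rewrite -[lam^-1]mul1r ler_pdivlMr// mulrC.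
have [->|sn] := eqVneq s 0;first by rewrite mulr0.
have sp : 0 < s by rewrite lt0r sn.
by rewrite -(ler_pM2r sp) mul1r -mulrA -expr2;exact:le_trans (le_trans h1 h2) h3.
Qed.

Lemma cw_ge0 (R : realFieldType) (t a : R) m : 0 <= a ->
 0 <= 4 * t ^+ 2 * 2 ^+ m + 4 ^+ m + 4 * a * 4 ^+ m.
by move=> a0;pos.
Qed.

Lemma defect_real (R : comRingType) (s f0 t K : R) :
 (s - f0) * K = t * K - (f0 + (t - s)) * K.
ring. Qed.

Lemma sum_lt3 (R : realFieldType) (p q r : R) : 0 < r -> p < r -> q <= r -> p + q < 3 * r.
lra. Qed.

Lemma sum2_const (R : realFieldType) n (c : R) :
 \sum_(j < n) \sum_(i < n) (c + c) = 2 * c * n%:R ^+ 2.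
under eq_bigr do rewrite sumr_const card_ord.
by rewrite sumr_const card_ord -[LHS]mulr_natr -[_ *+ n]mulr_natr expr2;ring.
Qed.

Lemma cancel_real (R : realFieldType) (L a r h : R) : h != 0 ->
 L^-1 * (a * r) = a * (L * h)^-1 * (h * r).
by move=> h0;rewrite invfM -!mulrA (mulrA h^-1) mulVf// mul1r mulrCA. Qed.

Lemma div_real (R : realFieldType) (c t S K X r : R) : 0 < c -> 0 < t -> S <= K * X * r ->
 c / t * S <= c * K * X / t * r.
move=> c0 t0 h;have : c / t * S <= c / t * (K * X * r).
 by apply:ler_wpM2l => //;rewrite divr_ge0// ltW.
by move=> /le_trans;apply;apply:le_of_eq;ring.
Qed.

Lemma five_real (R : realFieldType) (p q sk sj : R) : p < 5 * sk -> q < sj -> 2 * sk <= sj -> 0 < sj ->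
 p + q < 5 * sj.
lra. Qed.

Lemma powR_sum_le (R : realType) (a b p : R) : 0 <= a -> 0 <= b -> 0 <= p ->
 (a + b) `^ p <= 2 `^ p * (a `^ p + b `^ p).
move=> a0 b0 p0;wlog ab : a b a0 b0 / a <= b => [h|].
 by have [ab|/ltW ba] := leP a b;[exact:h|rewrite addrC [X in _ * X]addrC;exact:h].
apply:(le_via (2 `^ p * b `^ p));last first.
 by rewrite ler_wpM2l ?powR_ge0// lerDr powR_ge0.
rewrite -powRM//;apply:ler_powRl => //;first exact:addr_ge0.
by rewrite mulr_natl mulr2n lerD2r.
Qed.

Lemma jensen_real (R : realType) (d J W p : R) : 1 <= d -> 0 <= J -> 0 < W -> 1 < p ->
 J `^ p^-1 * (d * W) `^ (1 - p^-1) <= d * (J / W) `^ p^-1 * W.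
move=> d1 J0 W0 p1;have d0 : 0 < d by exact:lt_le_trans d1.
have p0 : 0 < p by exact:lt_trans p1.
have c1 : 0 <= 1 - p^-1 <= 1.
 by rewrite subr_ge0 lerBlDr lerDl invr_ge0 (ltW p0) invf_le1// ltW.
rewrite powR_div ?(ltW W0)// powRM ?(ltW d0) ?(ltW W0)// mulrCA -!mulrA.
apply:ler_pM;rewrite ?mulr_ge0 ?powR_ge0//.
 by case/andP: c1 => _ c1;rewrite -[leRHS](powRr1 (ltW d0));apply:ler_powR.
apply:ler_wpM2l;first exact:powR_ge0.
have -> : W `^ (1 - p^-1) = W / W `^ p^-1.
 rewrite powRB;last by rewrite (gt_eqF W0) implybT.
 by rewrite powRr1// ltW.
by rewrite mulrC.
Qed.

Lemma lb_real1 (R : comRingType) (a b k d W : R) : a * b * (k * (d * W)) = a * (k * d) * (b * W).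
ring. Qed.

Lemma lb_real2 (R : comRingType) (a b e J D c k W h : R) :
 a * (b * W + e * (D * J)) + (c * k * (D * J) + h * J) = a * b * W + (a * e * D + c * k * D + h) * J.
ring. Qed.

(** Source of the smallness thresholds in the choice of constants; the cap [2^-1] keeps density
    ratios below 1. *)
Lemma powR_small (R : realType) (K p e : R) : 0 <= K -> 0 < p -> 0 < e ->
 exists2 x0, 0 < x0 <= 2^-1 & forall x, 0 <= x <= x0 -> K * x `^ p <= e.
move=> K0 p0 e0;have K1 : 0 < K + 1 by pos.
pose y := (e / (K + 1)) `^ p^-1.
have y0 : 0 < y by pos.
exists (Num.min y 2^-1);first by rewrite lt_min y0 invr_gt0 ltr0n ge_min lexx orbT.
move=> x /andP[x0];rewrite le_min => /andP[xy _].
have h : x `^ p <= e / (K + 1).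
 rewrite -(@powRVK _ (e / (K + 1)) p) ?gt_eqF ?divr_ge0 ?(ltW e0) ?(ltW K1)//.
 exact:ler_powRl (ltW p0) x0 xy.
apply:(le_via ((K + 1) * (e / (K + 1)))).
 by apply:ler_pM => //;[exact:powR_ge0|rewrite lerDl].
by rewrite mulrC divfK// gt_eqF.
Qed.

Lemma ratio_real (R : realFieldType) (C2 th x t r : R) : x != 0 -> t != 0 ->
 C2 * (th * x + th * x) / (t * x) * r = 2 * C2 * th / t * r.
move=> x0 t0;rewrite -mulrDl mulrA invfM !mulrA;congr (_ * _);rewrite mulrAC.
by rewrite -[LHS]mulrA -[LHS]mulrA;field;rewrite x0 t0.
Qed.

Lemma three_real (R : realFieldType) (a b c d e f g h i j eps : R) :
 a * c * b <= eps / 3 -> d * (e * f) * c * g <= eps / 3 -> e * f * f * h * i * j <= eps / 3 ->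
 a * b * c + d * (e * g * f) * c + e * j * f * f * h * i <= eps.
move=> h1 h2 h3;rewrite (_ : a * b * c = a * c * b);last by ring.
rewrite (_ : d * (e * g * f) * c = d * (e * f) * c * g);last by ring.
rewrite (_ : e * j * f * f * h * i = e * f * f * h * i * j);last by ring.
by move: h1 h2 h3;move: (a * c * b) (d * (e * f) * c * g) (e * f * f * h * i * j) => *;lra.
Qed.

Lemma final_real (R : realFieldType) (a b r ep Jv t JG xi : R) : 0 <= r -> 0 <= ep * t -> 0 <= a * b ->
 0 <= JG -> a * (b * r) + (ep * (Jv + t * JG) + xi) <= ep * Jv + (ep * t + a * b + 1) * (JG + r) + xi.
move=> r0 et ab J0;have h1 := mulr_ge0 et r0;have h2 := mulr_ge0 ab J0.
rewrite (_ : a * (b * r) = a * b * r);last by ring.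
rewrite (_ : ep * (Jv + t * JG) = ep * Jv + ep * t * JG);last by ring.
by move: h1 h2;rewrite !mulrDl !mulrDr !mul1r;move: (ep * t) (a * b) (ep * Jv) => *;lra.
Qed.

(** Iterating [k] times leaves [th^k phi(k)], which is harmless in the limit because the [phi(i)]
    are bounded by [F]. The errors grow like [be^i] but carry the weight [th^i], and
    [th * be <= 1/2] turns them into a geometric series with partial sums [K (2 - 2 / 2^k)]. *)
Lemma absorb (R : realType) (phi : nat -> R) (F th be K : R) :
 (forall i, phi i <= F) -> 0 <= th -> 1 <= be -> th * be <= 2^-1 -> 0 <= K ->
 (forall i, phi i <= th * phi i.+1 + K * be ^+ i) -> phi 0%N <= 2 * K.
move=> pF th0 be1 tb K0 H;have tb0 : 0 <= th * be by rewrite mulr_ge0// (le_trans ler01).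
have th2 : th <= 2^-1 by apply:le_trans tb;rewrite ler_peMr.
have key k : phi 0%N <= th ^+ k * phi k + K * (2 - 2 * 2^-1 ^+ k).
 elim: k => [|k ih];first by rewrite !expr0 mul1r mulr1 subrr mulr0 addr0.
 apply:(le_trans ih).
 have h1 : th ^+ k * phi k <= th ^+ k * (th * phi k.+1 + K * be ^+ k).
  by apply:ler_wpM2l;[exact:exprn_ge0|exact:H].
 have h2 : K * (th ^+ k * be ^+ k) <= K * 2^-1 ^+ k.
  apply:ler_wpM2l => //;rewrite -exprMn;apply:lerXn2r;rewrite ?nnegrE//.
 rewrite [th ^+ k.+1]exprSr [2^-1 ^+ k.+1]exprS.
 apply:(le_trans (lerD h1 (lexx _)));rewrite mulrDr [th ^+ k * (K * _)]mulrCA.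
 rewrite (_ : 2 * (2^-1 * 2^-1 ^+ k) = 2^-1 ^+ k);last by rewrite mulVKf.
 apply:(le_trans (lerD (lerD (lexx _) h2) (lexx _))).
 by apply:le_of_eq;ring.
apply/ler_addgt0Pr => e e0.
have [N hN] : exists N : nat, F / e < N%:R by exists (Num.truncn (F / e)).+1;exact:truncnS_gt.
apply:(le_trans (key N)).
have h3 : K * (2 - 2 * 2^-1 ^+ N) <= 2 * K.
 by rewrite mulrBr [K * 2]mulrC lerBlDr lerDl mulr_ge0// mulr_ge0.
rewrite addrC;apply:lerD => //.
have [pN|pN] := leP 0 (phi N);last first.
 by apply:(le_via 0);[rewrite mulr_ge0_le0 ?exprn_ge0// ltW|exact:ltW].
apply:(le_via (2^-1 ^+ N * F)).
 apply:ler_pM => //;first exact:exprn_ge0.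
 by apply:lerXn2r;rewrite ?nnegrE ?invr_ge0.
rewrite exprVn mulrC ler_pdivrMr ?exprn_gt0//.
move: hN;rewrite ltr_pdivrMr// => hN;apply:(le_trans (ltW hN));rewrite mulrC.
by apply:ler_wpM2l;[exact:ltW|rewrite -natrX ler_nat ltnW// ltn_expl].
Qed.

Lemma step_real (R : realFieldType) (p10 T c e pt Ce G ru S : R) : 0 < T ->
 T * S <= e * (p10 * T * pt) + (Ce * (p10 * T * G) + Ce * ru * (p10 * T * c)) ->
 S <= e * p10 * pt + Ce * p10 * (G + ru * c).
move=> T0 h;rewrite -(ler_pM2l T0);apply:(le_trans h).
by apply:le_of_eq;ring.
Qed.

Lemma radius_real (R : realFieldType) (nn t t' r : R) : 0 < nn -> 0 < r -> t' - t = 18 * nn * r ->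
 t + nn * r + 10 * (nn * r) <= t' /\ t + nn * r + 9 * (nn * r) + 8 * (nn * r) <= t'.
by move=> n0 r0 h;have := mulr_gt0 n0 r0;split;lra. Qed.

Lemma indic_step_real (R : realFieldType) (b : bool) (e Ce ru v m1 m2 m3 : R) :
 (b -> v <= e * m1 + Ce * (m2 + ru * m3)) ->
 b%:R * v <= e * (b%:R * m1) + (Ce * (b%:R * m2) + Ce * ru * (b%:R * m3)).
case: b => [/(_ isT)|_];last by rewrite !mul0r !mulr0 !addr0.
by rewrite !mul1r mulrDr mulrA.
Qed.

Lemma theta_real (R : realFieldType) (be p : R) : 0 < be -> 0 < p ->
 (2 * be * p)^-1 * p * be <= 2^-1.
move=> b0 p0;apply:le_of_eq.
by field;rewrite !gt_eqF.
Qed.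

Lemma psi_real (R : realFieldType) (k b G c P : R) : 1 <= k * b -> 0 <= G ->
 G + k * b * c * P <= k * ((G + c * P) * b).
move=> kb G0;have h := ler_wpM2r G0 kb;rewrite mul1r in h.
rewrite [leRHS](_ : _ = k * b * G + k * b * c * P);last by ring.
exact:lerD.
Qed.

Lemma sum_ord2_const (R : realFieldType) n (c : R) : \sum_(j < n) \sum_(i < n) c = n%:R ^+ 2 * c.
by rewrite !sumr_const card_ord -mulrnA -[LHS]mulr_natl natrM expr2. Qed.

Lemma delta_real (R : realFieldType) (al n r delta : R) m : 0 < n -> 0 < r -> 0 < al ->
 delta <= al / (n ^+ 2 * (6 * n) ^+ m) ->
 n ^+ 2 * (delta * (2 * (3 * n * r)) ^+ m) <= al * r ^+ m.
move=> n0 r0 al0;rewrite ler_pdivlMr;last pos.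
move=> h;have -> : 2 * (3 * n * r) = 6 * n * r by ring.
rewrite exprMn;have := ler_wpM2r (exprn_ge0 m (ltW r0)) h.
by apply:le_trans;apply:le_of_eq;ring.
Qed.

Lemma double_radius_lt (R : realFieldType) (n d : R) : 1 <= n -> 0 < d -> 2 * d < (2 * n + 1) * d.
by move=> n1 d0;rewrite ltr_pM2r//;lra. Qed.

Lemma radius_lt (R : realFieldType) (n d r : R) : 0 < n -> 0 < d -> 3 * r <= 2 * d ->
 3 * n * r < (2 * n + 1) * d.
move=> n0 d0 h;have h2 := ler_wpM2l (ltW n0) h.
have -> : 3 * n * r = n * (3 * r) by ring.
have -> : (2 * n + 1) * d = n * (2 * d) + d by ring.
by apply:(le_lt_trans h2);rewrite ltrDl.
Qed.

Section euclidean_space.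
Context (R : realType) (n : nat).
Local Notation V := 'rV[R]_n.
Local Notation E := (euclid R n).
Local Notation mu := (@lebesgue R n).
Local Notation Lint := (@Lint _ E R mu).
Local Notation ig := (@ig _ E R mu).
Local Notation "\I_ ( x 'in' D ) F" := (\int[mu]_(x in D) F%R%:E)%E
 (at level 36, F at level 36, x binder, D at level 200, only parsing).

(** * Dyadic cells, stopping rules and differentiation *)

Section dyadic.
Context (o : V) (r : R).
Implicit Types (x y : V) (k : nat) (z : 'rV[int]_n).

Definition side k : R := r / 2 ^+ k.

Definition idx k x : 'rV[int]_n := \row_i Num.floor ((x 0 i - o 0 i) / side k).

Definition cell k z : set V := [set x | idx k x = z].

Hypothesis r0 : 0 < r.

Lemma side_gt0 k : 0 < side k.
by rewrite divr_gt0// exprn_gt0. Qed.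

Lemma side_le j k : (j <= k)%N -> side k <= side j.
move=> jk;rewrite ler_pM2l// lef_pV2 ?posrE ?exprn_gt0//.
by rewrite ler_eXn2l// ltr1n.
Qed.

Lemma cell_box k z : cell k z =
 box (fun i => `[o 0 i + (z 0 i)%:~R * side k, o 0 i + (z 0 i + 1)%:~R * side k[).
have s0 := side_gt0 k.
apply/seteqP;split=> x.
 move=> <- i;rewrite in_itv/= mxE -lerBrDl -ltrBlDl.
 by rewrite -ler_pdivlMr// -ltr_pdivrMr// floor_itv.
move=> h;apply/rowP => i;rewrite mxE;apply/eqP;rewrite floor_eq.
by have := h i;rewrite in_itv/= -lerBrDl -ltrBlDl -ler_pdivlMr// -ltr_pdivrMr.
Qed.

Lemma measurable_cell k z : measurable (cell k z : set E).
by rewrite cell_box;exact:measurable_box. Qed.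
Hint Resolve measurable_cell : core.

Lemma lebesgue_cell k z : mu (cell k z) = (side k ^+ n)%:E.
have s0 := side_gt0 k.
rewrite cell_box lebesgue_box.
under eq_bigr => i _.
 rewrite lebesgue_measure_itv /= lte_fin ltrD2l ltr_pM2r// intrD ltrDl ltr01.
 rewrite -EFinB (_ : _ - _ = side k);last by ring.
over.
by rewrite prodEFin prodr_const card_ord.
Qed.

(** Integer lower bounds scale exactly: [m <= floor (c / side j)] amounts to
    [m 2^(k-j) <= floor (c / side k)], so the finer index determines the coarser one. *)
Lemma idx_nested j k x y : (j <= k)%N -> idx k x = idx k y -> idx j x = idx j y.
move=> jk xy;apply/rowP => i;rewrite !mxE.
have {xy} := congr1 (fun z : 'rV[int]_n => z 0 i) xy;rewrite !mxE.
have skE : side j = side k * (2 ^ (k - j))%:R.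
 rewrite /side natrX -[in RHS](subnK jk) exprD addnK invfM.
 by field;rewrite !expf_neq0 ?pnatr_eq0.
set a := x 0 i - _;set b := y 0 i - _ => h.
have ge (m : int) c : (m <= Num.floor (c / side j)) =
  (m * (2 ^ (k - j))%:Z <= Num.floor (c / side k)).
 rewrite !floor_ge_int skE intrM invfM mulrA [RHS]ler_pdivlMr ?side_gt0//.
 rewrite ler_pdivlMr ?ltr0n ?expn_gt0// ler_pdivlMr ?side_gt0//.
by apply/eqP;rewrite eq_le ge -h -ge lexx ge h -ge lexx.
Qed.

Lemma cell_sub_ball k x y : cell k (idx k x) y -> ball x (side k) y.
move=> h;rewrite ball_box ?side_gt0// => i.
have {h} := congr1 (fun z : 'rV[int]_n => z 0 i) h;rewrite !mxE.
have := floor_itv ((x 0 i - o 0 i) / side k) => /andP[h1 h2].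
have := floor_itv ((y 0 i - o 0 i) / side k) => /andP[h3 h4] h.
rewrite h in h3 h4;rewrite in_itv/=.
rewrite ler_pdivlMr ?side_gt0// in h1;rewrite ltr_pdivrMr ?side_gt0// in h2.
rewrite ler_pdivlMr ?side_gt0// in h3;rewrite ltr_pdivrMr ?side_gt0// in h4.
rewrite intrD mulrDl mul1r in h2 h4;lra.
Qed.

Lemma cell_sub_open x (U : set V) : open U -> U x ->
 exists k, cell k (idx k x) `<=` U.
move=> oU Ux;have /nbhs_ballP[e /= e0 eU] := open_nbhs_nbhs (conj oU Ux).
pose k := Num.truncn (r / e);exists k => y /cell_sub_ball xy;apply:eU.
apply:le_ball xy;rewrite /side ler_pdivrMr ?exprn_gt0// mulrC -ler_pdivrMr//.
rewrite (le_trans (ltW (truncnS_gt _)))// -natrX ler_nat.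
exact:ltn_expl.
Qed.

Section stopping.
Variable P : nat -> 'rV[int]_n -> Prop.

Definition stopped : set V := [set x | exists k, P k (idx k x)].

(** The second clause ranges over all points of the cell; since cells are nested it is a property of
    the cell alone, and stopping cells can be treated one at a time. *)
Definition first_stop k z :=
 P k z /\ forall x, idx k x = z -> forall j, (j < k)%N -> ~ P j (idx j x).

Lemma first_stopP x k : P k (idx k x) ->
 exists j, [/\ (j <= k)%N, first_stop j (idx j x) & P j (idx j x)].
move=> Pk;have ex : exists j, `[< P j (idx j x) >] by exists k;exact/asboolP.
case: (ex_minnP ex) => j /asboolP Pj jmin;exists j;split => //.
 by apply:jmin;exact/asboolP.
split=> // y yx i ij;rewrite (idx_nested (ltnW ij) yx) => Pi.
by have := jmin i;rewrite leqNgt ij => /(_ (asboolT Pi)).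
Qed.

Lemma first_stop_inj x j k : first_stop j (idx j x) -> first_stop k (idx k x) -> j = k.
move=> [Pj hj] [Pk hk];case: (ltngtP j k) => // jk.
 by case: (hk x erefl j jk).
by case: (hj x erefl k jk).
Qed.

(** Enumeration through [pickle_inv], a partial injection: no stopping cell is listed twice, and the
    family is disjoint. *)
Let cells (m : nat) : set E := if pickle_inv m is Some (k, z) then
 if `[< first_stop k z >] then cell k z else set0 else set0.

Let mcells m : measurable (cells m).
by rewrite /cells;case: pickle_inv => // -[k z];case: ifP. Qed.

Let cellsE : \bigcup_m cells m = stopped.
apply/seteqP;split=> x.
 move=> [m _];rewrite /cells;case: pickle_inv => // -[k z].
 by case: ifP => // /asboolP[Pk _] xz;exists k;rewrite (xz : idx k x = z).
move=> [k /first_stopP[j [_ fj _]]].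
exists (pickle (j, idx j x)) => //;rewrite /cells pickleK_inv.
by rewrite (asboolT fj).
Qed.

Let cells_triv : trivIset setT cells.
move=> m1 m2 _ _ [x []];rewrite /cells.
case E1 : (pickle_inv m1) => [[k1 z1]|]//;case E2 : (pickle_inv m2) => [[k2 z2]|]//.
case: ifP => // /asboolP f1 xz1;case: ifP => // /asboolP f2 xz2.
have {}xz1 : idx k1 x = z1 := xz1;have {}xz2 : idx k2 x = z2 := xz2.
subst z1 z2;have k12 := first_stop_inj f1 f2;subst k2.
have := @pickle_invK (nat * 'rV[int]_n)%type m1;rewrite E1 /= => <-.
by have := @pickle_invK (nat * 'rV[int]_n)%type m2;rewrite E2 /= => <-.
Qed.

Lemma measurable_stopped : measurable (stopped : set E).
by rewrite -cellsE;exact:bigcup_measurable. Qed.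

(** A covering argument without selection: the set attached to a cell lies in the set attached to
    each of its ancestors, so the first stopping cells already account for the whole union, and as
    they are disjoint their right-hand sides add up to the integral over [stopped]. *)
Lemma stopped_enlarge (S : nat -> 'rV[int]_n -> set E) (f g : E -> \bar R) :
 mfun f -> (forall x, (0 <= f x)%E) ->
 mfun g -> (forall x, (0 <= g x)%E) ->
 (forall k z, measurable (S k z)) ->
 (forall j k x, (j <= k)%N -> S k (idx k x) `<=` S j (idx j x)) ->
 (forall k z, first_stop k z ->
  (\int[mu]_(x in S k z) f x <= \int[mu]_(x in cell k z) g x)%E) ->
 (\int[mu]_(x in \bigcup_k \bigcup_(z in [set z | P k z /\ cell k z !=set0]) S k z) f x
  <= \int[mu]_(x in stopped) g x)%E.
move=> mf f0 mg g0 mS S_le fg.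
pose G (m : nat) : set E := if pickle_inv m is Some (k, z) then
 if `[< first_stop k z >] then S k z else set0 else set0.
have mG m : measurable (G m).
 by rewrite /G;case: pickle_inv => // -[k z];case: ifP.
have mg' D : measurable_fun D g by exact:measurable_funS mg.
have mf' D : measurable_fun D f by exact:measurable_funS mf.
apply:(le_via (\int[mu]_(x in \bigcup_m G m) f x)%E).
 apply:ge0_subset_integral => //.
 - apply:bigcup_measurable => k _;rewrite bigcup_mkcond.
  by apply:countable_bigcup_measurable => z;case: ifP.
 - exact:bigcup_measurable.
 - move=> y [k _ [z [Pk [x xz]] Sy]];rewrite -xz in Pk Sy.
  have [j [jk fj _]] := first_stopP Pk.
  exists (pickle (j, idx j x)) => //;rewrite /G pickleK_inv (asboolT fj).
  exact:S_le jk _ Sy.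
apply:(le_via (\sum_(m <oo) \int[mu]_(x in G m) f x)%E).
 exact:ge0_integral_bigcup_le.
rewrite -cellsE ge0_integral_bigcup//.
apply:lee_nneseries => [m _ _|m _];first exact:integral_ge0.
rewrite /G /cells;case: pickle_inv => [[k z]|];last by rewrite !integral_set0.
by case: ifP => [/asboolP/fg//|_];rewrite !integral_set0.
Qed.

Lemma stopped_le (f g : E -> \bar R) :
 mfun f -> (forall x, (0 <= f x)%E) ->
 mfun g -> (forall x, (0 <= g x)%E) ->
 (forall k z, first_stop k z ->
  (\int[mu]_(x in cell k z) f x <= \int[mu]_(x in cell k z) g x)%E) ->
 (\int[mu]_(x in stopped) f x <= \int[mu]_(x in stopped) g x)%E.
move=> mf f0 mg g0 fg.
apply:le_trans (@stopped_enlarge cell f g mf f0 mg g0 _ _ fg) => //.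
 apply:le_of_eq;congr (integral mu _ f).
 apply/seteqP;split=> x.
  by move=> [k Pk];exists k => //;exists (idx k x) => //;split => //;exists x.
 by move=> [k _ [z [Pk _] /= xz]];exists k;rewrite xz.
by move=> j k x jk y yx;exact:idx_nested jk yx.
Qed.

End stopping.

Lemma measurable_idx_pred k (Q : 'rV[int]_n -> Prop) :
 measurable ([set x | Q (idx k x)] : set E).
rewrite (_ : [set x | _] = stopped (fun j z => j = k /\ Q z)).
 exact:measurable_stopped.
by apply/seteqP;split=> x => [Qx|[j [-> ]]] //;exists k.
Qed.

(** One-sided Lebesgue differentiation. On the exceptional set [A m N] the function exceeds
    [l + 1/(m+1)], while that set is covered, within an open set of almost the same measure, by
    disjoint cells whose averages are at most [l]. *)
Lemma dyadic_differentiation (F : E -> \bar R) (l : R) : 0 <= l ->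
 mfun F -> (forall x, (0 <= F x)%E) ->
 {ae mu, forall x : V,
  (forall k, (\int[mu]_(y in cell k (idx k x)) F y <= l%:E * mu (cell k (idx k x)))%E) ->
  (F x <= l%:E)%E}.
move=> l0 mF F0.
pose Q k z := (\int[mu]_(y in cell k z) F y <= l%:E * mu (cell k z))%E.
pose A (m N : nat) : set E := [set x : V | ((l + m.+1%:R^-1)%:E < F x)%E] `&`
 \bigcap_k [set x : V | Q k (idx k x)] `&` ball (0 : V) N.+1%:R.
have mA m N : measurable (A m N).
 apply:measurableI;last by apply/open_meas/ball_open.
 apply:measurableI;last by apply:bigcap_measurable => // k _;exact:(@measurable_idx_pred k (fun z => Q k z)).
 rewrite -[X in measurable X]setTI.
 exact:emeasurable_fun_o_infty.
have A0 m N : mu (A m N) = 0%E.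
 set a := mu (A m N);have a0 : (0 <= a)%E by exact:measure_ge0.
 have aoo : (a < +oo)%E.
  apply:(@le_lt_trans _ _ (mu (ball 0 N.+1%:R))).
   apply:le_measure;rewrite ?inE//;last by move=> x [_].
   by apply:open_meas;exact:ball_open.
  by rewrite mu_ball// ltry.
 have afin : a \is a fin_num by rewrite ge0_fin_numE.
 have key e : 0 < e -> ((l + m.+1%:R^-1)%:E * a <= l%:E * (a + e%:E))%E.
  move=> e0;have [U [oU AU Ue]] := lebesgue_outer_open e0 aoo.
  (* Such a cell has average at most [l] because it contains a point of [A m N], all of whose cells
     obey this bound. *)
  pose P k z := cell k z `<=` U /\ exists2 x, cell k z x & A m N x.
  have AP : A m N `<=` stopped P.
   move=> x Ax;have [k kU] := cell_sub_open oU (AU _ Ax).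
   by exists k;split=> //;exists x.
  have PU : stopped P `<=` U by move=> x [k [kU _]];apply:kU.
  have mP := measurable_stopped P.
  apply:(le_via (\int[mu]_(x in A m N) F x)%E).
   rewrite -integral_cst//;apply:ge0_le_integral => //.
   - by move=> x _;rewrite lee_fin addr_ge0// invr_ge0.
   - exact:measurable_funS mF.
   - by move=> x [[/ltW]].
  apply:(le_via (\int[mu]_(x in stopped P) F x)%E).
   by apply:ge0_subset_integral => //;exact:measurable_funS mF.
  apply:(le_via (\int[mu]_(x in stopped P) (cst l%:E) x)%E).
   apply:stopped_le => //.
   move=> k z [[_ [x xz [[_ Qx] _]]] _];rewrite integral_cst//.
   by have := Qx k I;rewrite /Q /= xz.
  rewrite integral_cst//;apply:lee_wpmul2l;first pos.
  apply:le_trans Ue;apply:le_measure => //;rewrite inE//.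
  exact:open_meas.
 rewrite -(fineK afin) in key *.
 have ra0 : 0 <= fine a by exact:fine_ge0.
 apply/eqP;rewrite eqe;apply/negPn/negP => an0.
 have {}a0 : 0 < fine a by rewrite lt_neqAle eq_sym an0.
 (* Small enough that the loss [l e] stays below the gain [fine a / (m+1)] in [key]. *)
 pose e := m.+1%:R^-1 * fine a / (2 * (l + 1)).
 have e0 : 0 < e by pos.
 have := key e e0;rewrite -EFinD -!EFinM lee_fin leNgt => /negP;apply.
 rewrite mulrDr mulrDl ltrD2l /e.
 rewrite mulrA ltr_pdivrMr ?mulr_gt0 ?ltr_wpDl//.
 set c := m.+1%:R^-1 * fine a;have c0 : 0 < c by pos.
 nra.
exists (\bigcup_m \bigcup_N A m N);split.
- by apply:bigcup_measurable => m _;exact:bigcup_measurable.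
- apply/eqP;rewrite eq_le measure_ge0 andbT.
 rewrite (le_trans (measure_sigma_subadditive _ _ _ sub_id))//.
 + by move=> m;exact:bigcup_measurable.
 + by apply:bigcup_measurable => m _;exact:bigcup_measurable.
 rewrite eseries0// => m _ _;apply/eqP;rewrite eq_le measure_ge0 andbT.
 rewrite (le_trans (measure_sigma_subadditive _ _ _ sub_id))//.
  exact:bigcup_measurable.
 by rewrite eseries0// => N _ _;exact:A0.
- move=> x /= /not_implyP[Qx /negP];rewrite -ltNge => lF.
 have [m lm] : exists m : nat, ((l + m.+1%:R^-1)%:E < F x)%E.
  case: (F x) lF => [s| |]// => [|_];last by exists 0%N;rewrite ltry.
  rewrite lte_fin => ls;exists (Num.truncn (s - l)^-1);rewrite lte_fin -ltrBrDl.
  by rewrite invf_plt ?posrE ?subr_gt0// truncnS_gt.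
 have [N _ xN] : (\bigcup_k ball 0 k.+1%:R) x by rewrite bigcup_ball0.
 exists m => //;exists N => //;split;last exact:xN.
 by split;[exact:lm|move=> k _;exact:Qx].
Qed.

End dyadic.

(** * The reverse Hoelder inequality *)

Section reverse_hoelder.

Definition cube (o : V) (r : R) : set V := box (fun i => `[o 0 i, o 0 i + r[).

Lemma mcube o r : measurable (cube o r : set E).
exact:measurable_box. Qed.

Lemma cell_cube o r k (z : 'rV[int]_n) : 0 < r ->
 cell o r k z = cube (o + side r k *: map_mx intr z) (side r k).
move=> r0;rewrite cell_box//;congr box;apply/funext => i.
by rewrite !mxE intrD mulrDl mul1r addrA mulrC.
Qed.

Lemma cube_cell o r : 0 < r -> cube o r = cell o r 0 0.
move=> r0;rewrite cell_cube// map_mx0 scaler0 addr0.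
by rewrite /side expr0 divr1.
Qed.

Lemma mu_cube o r : 0 < r -> mu (cube o r) = (r ^+ n)%:E.
by move=> r0;rewrite cube_cell// lebesgue_cell// /side expr0 divr1. Qed.

(** Calderon-Zygmund iteration over the heights [L j = a^j l]. In a cell stopped at height [L j] the
    next stopped set fills at most half, so the mass of [v] on the stopped sets decays like
    [beta^j], while outside the [j]-th one [v] is almost everywhere at most [L j]. *)
Lemma reverse_hoelder (beta : R) : 0 < beta < 1 ->
 exists t C : R, [/\ 0 < t, 0 < C & forall v : V -> R,
  mfun (v : E -> R) -> ge0 v ->
  (forall o r (A : set E), 0 < r -> measurable A -> A `<=` cube o r ->
    (mu A <= 2^-1%:E * mu (cube o r))%E ->
    (\I_(x in A) v x <= beta%:E * \I_(x in cube o r) v x)%E) ->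
  forall o r l, 0 < r -> 0 < l ->
   (\I_(x in cube o r) v x <= l%:E * mu (cube o r))%E ->
   (\I_(x in cube o r) (v x `^ (1 + t)) <=
    (C * l `^ t)%:E * \I_(x in cube o r) v x)%E].
move=> /andP[b0 b1].
(* Passing to the parent of a stopped cell costs [2^n]; the additional factor 2 makes the next
   stopped set fill at most half of the cell. *)
pose a : R := 2 ^+ n.+1.
have a1 : 1 < a by rewrite exprn_egt1// ltr1n.
have a0 : 0 < a by exact:lt_trans a1.
pose th := (1 + beta) / 2.
have th1 : th < 1 by rewrite /th;lra.
have bth : beta < th by rewrite /th;lra.
have th0 : 0 < th by exact:lt_trans bth.
(* Chosen so that [a^t * beta = th < 1], the ratio of the geometric series formed by the heights
   [L j ^ t] and the masses [beta^j]. *)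
pose t := ln (th / beta) / ln a.
have lna : 0 < ln a by rewrite ln_gt0.
have t0 : 0 < t by rewrite divr_gt0// ln_gt0// ltr_pdivlMr// mul1r.
have atE : a `^ t = th / beta.
 rewrite /powR gt_eqF// /t divfK ?gt_eqF// lnK// posrE divr_gt0//.
exists t, (1 + a `^ t / (1 - th));split=> //.
 by rewrite addr_gt0// divr_gt0 ?powR_gt0// subr_gt0.
move=> v mv v0 hv o r l r0 l0 vl.
have mvE : mfun (EFin \o v : E -> \bar R) by exact/measurable_EFinP.
have mvE' D : measurable_fun D (EFin \o v : E -> \bar R) by exact:measurable_funS mvE.
have vE0 (x : E) : (0 <= (v x)%:E)%E by pos.
set Q := cube o r in vl *.
have QE : Q = cell o r 0 0 by exact:cube_cell.
have mQ : measurable (Q : set E) by exact:mcube.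
pose L j : R := a ^+ j * l.
have L0 j : 0 < L j by pos.
pose P j k (z : 'rV[int]_n) := ((L j)%:E * mu (cell o r k z) < \I_(x in cell o r k z) v x)%E
 /\ cell o r k z `<=` Q.
pose Om j : set E := stopped o r (P j).
have mOm j : measurable (Om j) by exact:measurable_stopped.
have OmQ j : Om j `<=` Q by move=> x [k [_ kQ]];exact:kQ.
have subQ k x : Q x -> cell o r k (idx o r k x) `<=` Q.
 by move=> Qx y yx;rewrite QE in Qx *;rewrite -Qx;exact:idx_nested yx.
have step j : (\I_(x in Om j.+1) v x <= beta%:E * \I_(x in Om j) v x)%E.
 have LL : L j <= L j.+1.
  by rewrite /L exprS -mulrA ler_peMl//;apply:ltW => //;exact:L0.
 have OmS : Om j.+1 `<=` Om j.
  move=> x [k [Lk kQ]];exists k;split=> //;apply:le_lt_trans Lk.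
  exact:lee_wpmul2r;rewrite ?measure_ge0// lee_fin.
 pose f (x : E) := ((v x)%:E * (\1_(Om j.+1) x)%:E)%E.
 have mf : mfun f.
  exact:emeasurable_mul_indic.
 have f0 x : (0 <= f x)%E by rewrite mule_ge0// lee_fin.
 have fE (D : set E) : measurable D -> (\int[mu]_(x in D) f x =
   \I_(x in D `&` Om j.+1) v x)%E.
  by move=> mD;exact:integral_mul_indic.
 rewrite -ge0_integralZl//;last pos.
 have -> : (\I_(x in Om j.+1) v x = \int[mu]_(x in Om j) f x)%E.
  by rewrite fE// setIidr.
 apply:(@stopped_le o r r0 (P j) f (fun x => beta%:E * (v x)%:E)%E mf f0).
 - exact:measurable_funeM.
 - by move=> x;rewrite mule_ge0// lee_fin ltW.
 move=> k z [[Lk kQ] hk].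
 have mc := @measurable_cell o r r0 k z.
 have [x xz] : cell o r k z !=set0.
  apply/set0P/eqP => c0.
  by have := lebesgue_cell o r0 k z;rewrite c0 measure0 => -[] /esym/eqP;
    rewrite gt_eqF// exprn_gt0// side_gt0.
 rewrite fE// ge0_integralZl//;last pos.
 have Qx : Q x by exact:kQ.
 (* The root cube cannot stop, its average being at most [l <= L j]; so every stopped cell has a
    parent inside [Q]. *)
 have k0 : (0 < k)%N.
  rewrite lt0n;apply/eqP => k0;move: Lk;rewrite -xz k0.
  have -> : cell o r 0 (idx o r 0 x) = Q by rewrite QE;congr cell;rewrite QE in Qx.
  rewrite ltNge => /negP;apply;apply:le_trans vl _.
  apply:lee_wpmul2r;rewrite ?measure_ge0// lee_fin.
  by rewrite /L ler_peMl ?(ltW l0)// exprn_ege1// ltW.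
 have par : (\I_(x in cell o r k z) v x <= (L j * 2 ^+ n)%:E * mu (cell o r k z))%E.
  have := hk x xz k.-1;rewrite ltn_predL => /(_ k0).
  move=> /not_andP[|];last by move=> h;exfalso;apply:h;exact:subQ.
  move=> /negP;rewrite -leNgt => h.
  apply:(le_via (\I_(x in cell o r k.-1 (idx o r k.-1 x)) v x)%E).
   apply:ge0_subset_integral => //;first exact:measurable_cell.
   by move=> y yz;apply:idx_nested (leq_pred _) _ => //;rewrite xz.
  apply:le_trans h _;rewrite !lebesgue_cell// -!EFinM lee_fin -[leRHS]mulrA.
  rewrite ler_wpM2l ?(ltW (L0 j))// -exprMn le_eqVlt;apply/orP;left;apply/eqP.
  congr (_ ^+ n);rewrite /side -[in RHS](prednK k0) exprS.
  by field;rewrite !expf_neq0 ?pnatr_eq0.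
 have hvc := @hv (o + side r k *: map_mx intr z) (side r k)
  (cell o r k z `&` Om j.+1) (side_gt0 r0 k).
 rewrite -cell_cube// in hvc;apply:hvc => //.
 - exact:measurableI.
 (* Cells stopped at the next height inside the given cell. A strictly larger cell stopped at
    [L j.+1] would already have stopped at [L j], against the minimality of the given one. *)
 - pose P' k' z' := P j.+1 k' z' /\ cell o r k' z' `<=` cell o r k z.
  have sP' : cell o r k z `&` Om j.+1 = stopped o r P'.
   apply/seteqP;split=> y;last by move=> [k' [Pk' kk']];split;[exact:kk'|exists k'].
   move=> [yz [k' Pk']];exists k';split=> //.
   have [kk'|k'k] := leqP k k'.
    by move=> u uy;rewrite -yz;exact:idx_nested kk' uy.
   exfalso;apply:(hk y yz k' k'k);case: Pk' => Pk' ?;split=> //.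
   apply:le_lt_trans Pk'.
   exact:lee_wpmul2r;rewrite ?measure_ge0// lee_fin.
  rewrite sP';have mP' := @measurable_stopped o r r0 P'.
  have h1 : ((L j.+1)%:E * mu (stopped o r P') <= \I_(x in stopped o r P') v x)%E.
   rewrite -integral_cst//.
   apply:(@stopped_le o r r0 P' (cst (L j.+1)%:E) (EFin \o v)) => //.
   + by move=> y;rewrite lee_fin ltW.
   + move=> k' z' [[[/ltW + _] _] _].
    by rewrite integral_cst//;exact:measurable_cell.
  have h2 : (\I_(x in stopped o r P') v x <= (L j * 2 ^+ n)%:E * mu (cell o r k z))%E.
   apply:le_trans par;apply:ge0_subset_integral => //.
   by move=> y [k' [_ h]];exact:h.
  have := le_trans h1 h2.
  have mfin : mu (stopped o r P') \is a fin_num.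
   rewrite ge0_fin_numE ?measure_ge0//.
   apply:(@le_lt_trans _ _ (mu (cell o r k z))).
    apply:le_measure;rewrite ?inE//.
    by move=> y [k' [_ h]];exact:h.
   by rewrite lebesgue_cell// ltry.
  rewrite lebesgue_cell// -(fineK mfin) -!EFinM !lee_fin.
  have -> : L j.+1 = (L j * 2 ^+ n) * 2.
   have aE : a = 2 * 2 ^+ n by rewrite /a exprS.
   by rewrite /L exprS {1}aE;ring.
  have c0 : 0 < L j * 2 ^+ n by pos.
  by rewrite -(mulrA _ 2) (ler_pM2l c0) => h;lra.
have pw s : 0 <= s -> s `^ (1 + t) = s `^ t * s.
 move=> s0;rewrite powRD;last by rewrite gt_eqF// addr_gt0.
 by rewrite powRr1// mulrC.
have decay j : (\I_(x in Om j) v x <= (beta ^+ j)%:E * \I_(x in Q) v x)%E.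
 elim: j => [|j IH].
  by rewrite expr0 mul1e;apply:ge0_subset_integral.
 apply:le_trans (step j) _;rewrite exprS EFinM -muleA.
 by apply:lee_wpmul2l => //;rewrite lee_fin ltW.
(* Majorant of [v^(1+t)] almost everywhere: the first term serves where [v <= l], the [j]-th summand
   where [L j < v <= L j.+1]. *)
pose g (x : E) : \bar R := ((l `^ t)%:E * (v x)%:E +
 \sum_(j <oo) (L j.+1 `^ t)%:E * ((v x)%:E * (\1_(Om j) x)%:E))%E.
have mg1 j : mfun (fun x : E => ((L j.+1 `^ t)%:E * ((v x)%:E * (\1_(Om j) x)%:E))%E).
 by apply:measurable_funeM;exact:emeasurable_mul_indic.
have g10 j x : (0 <= (L j.+1 `^ t)%:E * ((v x)%:E * (\1_(Om j) x)%:E))%E.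
 by rewrite !mule_ge0// lee_fin// powR_ge0.
have mg2 : mfun (fun x : E => (\sum_(j <oo) (L j.+1 `^ t)%:E * ((v x)%:E * (\1_(Om j) x)%:E))%E).
 exact:ge0_emeasurable_sum.
have vfin : (\I_(x in Q) v x < +oo)%E.
 by apply:le_lt_trans vl _;rewrite mu_cube// -EFinM ltry.
have vfin' : (\I_(x in Q) v x)%E \is a fin_num.
 by rewrite ge0_fin_numE//;apply:integral_ge0 => x _.
apply:(le_via (\int[mu]_(x in Q) g x)%E).
 apply:(ae_ge0_le_integral mQ).
 - by move=> x _;pos.
 - apply/measurable_EFinP;apply:(@mT_comp _ _ _ _ _ _ (@powR R ^~ (1 + t))) => //.
  exact:measurable_funS mv.
 - by move=> x _;rewrite adde_ge0 ?nneseries_ge0 ?mule_ge0// lee_fin powR_ge0.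
 - apply:emeasurable_funD;last exact:measurable_funS mg2.
  exact:measurable_funeM.
 have ae j : {ae mu, forall x : V, (forall k, (\I_(y in cell o r k (idx o r k x)) v y <=
   (L j)%:E * mu (cell o r k (idx o r k x)))%E) -> ((v x)%:E <= (L j)%:E)%E}.
  by apply:dyadic_differentiation => //;exact:ltW.
 have := ae_foralln ae;apply:filterS => x hx Qx.
 have out j : ~ Om j x -> v x <= L j.
  move=> nOm;rewrite -lee_fin;apply:hx => k;rewrite leNgt;apply/negP => h.
  by apply:nOm;exists k;split=> //;exact:subQ.
 have [vxl|vxl] := leP (v x) l.
  rewrite /g (le_via ((l `^ t)%:E * (v x)%:E)%E)//;last first.
   by rewrite leeDl// nneseries_ge0.
  rewrite -EFinM lee_fin pw//.
  by rewrite ler_wpM2r// ge0_ler_powR ?nnegrE ?(ltW t0) ?(ltW l0).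
 have [j /andP[Lj vLj]] : exists j, L j < v x <= L j.+1.
  have ex : exists j, v x <= L j.
   exists (Num.truncn (v x / l)).+1;rewrite /L -ler_pdivrMr//.
   rewrite (le_trans (ltW (truncnS_gt _)))//.
   rewrite (le_via (2 ^+ (Num.truncn (v x / l)).+1))//.
    by rewrite -natrX ler_nat ltnW// ltn_expl.
   by rewrite lerXn2r ?nnegrE ?(ltW a0)// /a exprS ler_peMr// exprn_ege1// ler1n.
  case: (ex_minnP ex) => -[|j] hj jmin.
   by move: hj;rewrite /L expr0 mul1r leNgt vxl.
  exists j;rewrite hj andbT ltNge;apply/negP => /jmin.
  by rewrite ltnn.
 have Omx : Om j x by apply:contrapT => /out;rewrite leNgt Lj.
 rewrite /g (le_via (\sum_(j <oo) (L j.+1 `^ t)%:E * ((v x)%:E * (\1_(Om j) x)%:E))%E)//;last first.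
  by rewrite leeDr// mule_ge0// lee_fin powR_ge0.
 apply:le_trans (nneseries_ge_term j _) => //.
 rewrite indicE mem_set//= mule1 -EFinM lee_fin pw//.
 by rewrite ler_wpM2r// ge0_ler_powR ?nnegrE// ltW.
rewrite /g (ge0_integralD mu mQ);last 4 first.
- by move=> x _;rewrite mule_ge0// lee_fin powR_ge0.
- exact:measurable_funeM;exact:mvE'.
- by move=> x _;rewrite nneseries_ge0.
- exact:measurable_funS mg2.
have lt0 : (0 <= (l `^ t)%:E)%E by pos.
rewrite (ge0_integralZl mu mQ (mvE' Q) (fun x _ => vE0 x) lt0).
rewrite (integral_nneseries mu mQ);last 2 first.
- by move=> j;exact:measurable_funS (mg1 j).
- by move=> j x _;exact:g10.
rewrite -(fineK vfin').
set I := fine _;have I0 : 0 <= I by apply:fine_ge0;apply:integral_ge0.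
rewrite -!EFinM.
have -> : (1 + a `^ t / (1 - th)) * l `^ t * I =
 l `^ t * I + (a `^ t * l `^ t * I) / (1 - th) by ring.
rewrite EFinD;apply:leeD => //.
apply:nneseries_geometric_le.
- by pos.
- by rewrite th1 ltW.
- by move=> j;apply:integral_ge0 => x _.
move=> j;have Ljt0 : (0 <= (L j.+1 `^ t)%:E)%E by pos.
rewrite (ge0_integralZl mu mQ _ _ Ljt0);last 2 first.
- exact:emeasurable_mul_indic.
- by move=> x _;rewrite mule_ge0// lee_fin.
rewrite integral_mul_indic setIidr//.
apply:(le_via ((L j.+1 `^ t)%:E * ((beta ^+ j)%:E * I%:E))%E).
 apply:lee_wpmul2l;first pos.
 by rewrite /I fineK.
rewrite -!EFinM lee_fin /L powRM ?exprn_ge0 ?(ltW a0) ?(ltW l0)//.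
have -> : (a ^+ j.+1) `^ t = (a `^ t) ^+ j.+1.
 by rewrite -(powR_mulrn _ (ltW a0)) -powRrM mulrC powRrM powR_mulrn// powR_ge0.
rewrite [X in X <= _](_ : _ = a `^ t * l `^ t * I * (a `^ t * beta) ^+ j);last first.
 by rewrite exprMn exprS;ring.
by rewrite atE divfK ?gt_eqF.
Qed.

End reverse_hoelder.

(** * Muckenhoupt weights on cubes *)

Section cube_weights.

Definition wint (w : V -> R) (D : set V) : R := fine (\I_(x in D) w x).

(** Strict positivity at every point makes negative powers honest real functions; a weight that is
    positive almost everywhere is first modified on a null set. *)
Definition weight (w : V -> R) := [/\ mfun (w : E -> R),
 forall x, 0 < w x &
 forall o r, 0 < r -> (\I_(x in cube o r) w x < +oo)%E].

Lemma wint_fin w o r (D : set E) : weight w -> 0 < r -> measurable D -> D `<=` cube o r ->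
 (\I_(x in D) w x)%E = (wint w D)%:E.
move=> [mw w0 wf] r0 mD DQ;rewrite /wint fineK//.
rewrite ge0_fin_numE;last by apply:integral_ge0 => x _;rewrite lee_fin ltW.
apply:le_lt_trans (wf o r r0).
apply:int_subset;[exact:mD|exact:mcube|exact:mEFin| |exact:DQ].
by move=> x;pos.
Qed.

Lemma wint_ge0 w D : weight w -> 0 <= wint w D.
by move=> [_ w0 _];rewrite fine_ge0//;apply:integral_ge0 => x _;rewrite lee_fin ltW.
Qed.

Lemma wint_setD w o r (A : set E) : weight w -> 0 < r -> measurable A -> A `<=` cube o r ->
 wint w (cube o r `\` A) = wint w (cube o r) - wint w A.
move=> hw r0 mA AQ;have [mw w0 wf] := hw.
have mQ : measurable (cube o r : set E) by exact:mcube.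
have mD : measurable (cube o r `\` A : set E) by exact:measurableD.
apply:(@addIr _ (wint w A));rewrite subrK.
apply:EFin_inj;rewrite EFinD -(wint_fin hw r0 mD (@subDsetl _ _ _)).
rewrite -(wint_fin hw r0 mA AQ) -(wint_fin hw r0 mQ sub_id).
rewrite addeC -(integral_setU_real _ mA mD mw);last 2 first.
- by move=> x;exact:ltW.
- by rewrite setDE setIC -setIA setICl setI0.
by rewrite setDE setUIr setUCr setIT setUidr.
Qed.

Lemma weight_mu o r (D : set E) : 0 < r -> measurable D -> D `<=` cube o r ->
 (mu D = (fine (mu D))%:E) /\ 0 <= fine (mu D) <= r ^+ n.
move=> r0 mD DQ.
have Dle : (mu D <= (r ^+ n)%:E)%E.
 by rewrite -(mu_cube o r0);apply:le_measure;rewrite ?inE//;exact:mcube.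
have Dfin : mu D \is a fin_num.
 by rewrite ge0_fin_numE ?measure_ge0// (le_lt_trans Dle)// ltry.
by rewrite fineK// fine_ge0 ?measure_ge0//=;split=> //;rewrite -lee_fin fineK.
Qed.

Lemma wint_subset w o r (A B : set E) : weight w -> 0 < r -> measurable A -> measurable B ->
 A `<=` B -> B `<=` cube o r -> wint w A <= wint w B.
move=> hw r0 mA mB AB BQ;have [mw w0 wf] := hw.
rewrite -lee_fin -(wint_fin hw r0 mA (subset_trans AB BQ)) -(wint_fin hw r0 mB BQ).
apply:(int_subset mu mA mB _ _ AB);first exact:mEFin.
by move=> x;pos.
Qed.

Lemma lebesgue_cube_gt0 o r : 0 < r -> (0 < mu (cube o r))%E.
by move=> r0;rewrite mu_cube// lte_fin exprn_gt0. Qed.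

Lemma wint_gt0 w o r : weight w -> 0 < r -> 0 < wint w (cube o r).
move=> hw r0;have [mw w0 wf] := hw.
have mQ : measurable (cube o r : set E) by exact:mcube.
rewrite -lte_fin -(wint_fin hw r0 mQ sub_id).
exact:(integral_gt0 mQ mw w0 (lebesgue_cube_gt0 o r0)).
Qed.

(** Applied to the complement of a set of at most half measure, the hypothesis leaves that set at
    most the fraction [b = 1 - 2^-p / M] of the mass, which is what [reverse_hoelder] asks for. *)
Lemma weight_reverse_hoelder (p M : R) : 0 < p -> 1 <= M ->
 exists t C : R, [/\ 0 < t, 0 < C & forall w, weight w ->
  (forall o r (A : set E), 0 < r -> measurable A -> A `<=` cube o r ->
   (fine (mu A) / r ^+ n) `^ p * wint w (cube o r) <= M * wint w A) ->
  forall o r, 0 < r ->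
   (\I_(x in cube o r) (w x `^ (1 + t)) <=
    (C * (wint w (cube o r) / r ^+ n) `^ (1 + t) * r ^+ n)%:E)%E].
move=> p0 M1;have M0 : 0 < M by exact:lt_le_trans M1.
pose b : R := 1 - (2^-1 `^ p) / M.
have h1 : 2^-1 `^ p < 1.
 have h : 1 `^ p = 1 by rewrite powR1.
 by rewrite -[ltRHS]h;apply:gt0_ltr_powR;rewrite ?nnegrE//;lra.
have hM : 0 < 2^-1 `^ p / M < 1.
 by rewrite divr_gt0//= ltr_pdivrMr// mul1r (lt_le_trans h1).
have b01 : 0 < b < 1 by rewrite /b;move/andP: hM => [? ?];apply/andP;split;lra.
have [t [C [t0 C0 H]]] := reverse_hoelder b01.
exists t, C;split=> // w hw low o r r0;have [mw w0 wf] := hw.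
have mQ (o' : V) r' : measurable (cube o' r' : set E) by exact:mcube.
have rn0 : 0 < r ^+ n by pos.
have Ww := wint_fin hw r0 (mQ o r) sub_id.
have Wpos : 0 < wint w (cube o r).
 by rewrite -lte_fin -Ww;exact:(integral_gt0 (mQ o r) mw w0 (lebesgue_cube_gt0 o r0)).
pose l := wint w (cube o r) / r ^+ n.
have l0 : 0 < l by pos.
have wl : (\I_(x in cube o r) w x <= l%:E * mu (cube o r))%E.
 by rewrite mu_cube// Ww -EFinM lee_fin /l divfK// gt_eqF.
have hyp : forall o' r' (A : set E), 0 < r' -> measurable A -> A `<=` cube o' r' ->
  (mu A <= 2^-1%:E * mu (cube o' r'))%E ->
  (\I_(x in A) w x <= b%:E * \I_(x in cube o' r') w x)%E.
 move=> o' r' A r'0 mA AQ hA.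
 have rn'0 : 0 < r' ^+ n by pos.
 have [muA muA1] := weight_mu r'0 mA AQ.
 rewrite mu_cube// muA -EFinM lee_fin in hA.
 rewrite (wint_fin hw r'0 mA AQ) (wint_fin hw r'0 (mQ o' r') sub_id).
 have mD : measurable (cube o' r' `\` A : set E) by exact:measurableD.
 have := low o' r' (cube o' r' `\` A) r'0 mD (@subDsetl _ _ _).
 rewrite wint_setD//.
 have muD : fine (mu (cube o' r' `\` A)) = r' ^+ n - fine (mu A).
  apply:EFin_inj;rewrite EFinB -muA -(mu_cube o' r'0).
  have [<- _] := weight_mu r'0 mD (@subDsetl _ _ _).
  have fin : (mu (cube o' r') < +oo)%E by rewrite mu_cube// ltry.
  by rewrite (measureD (mQ _ _) mA fin) setIidr.
 rewrite muD => hlow.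
 have : 2^-1 `^ p <= ((r' ^+ n - fine (mu A)) / r' ^+ n) `^ p.
  apply:ler_powRl;[exact:ltW|by pos|].
  rewrite ler_pdivlMr//;lra.
 move=> h2;have W0 := wint_ge0 (cube o' r') hw.
 have := le_trans (ler_wpM2r W0 h2) hlow => {}hlow.
 rewrite -EFinM lee_fin /b mulrBl mul1r lerBrDl -lerBrDr mulrAC ler_pdivrMr//.
 by rewrite [leRHS]mulrC.
have := H w mw (fun x => ltW (w0 x)) hyp o r l r0 l0 wl.
move=> /le_trans;apply;rewrite Ww -EFinM lee_fin.
have -> : wint w (cube o r) = l * r ^+ n by rewrite /l divfK// gt_eqF.
rewrite mulfK ?gt_eqF// powRD;last by rewrite gt_eqF// addr_gt0.
by rewrite powRr1 ?(ltW l0)// le_eqVlt;apply/orP;left;apply/eqP;ring.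
Qed.

Definition dualw (q : R) (w : V -> R) (x : V) : R := w x `^ (- (q - 1)^-1).

(** The [A_q] condition multiplied by [|Q|^q], with integrals in place of averages. *)
Definition cube_Aq (q M : R) (w : V -> R) := [/\ weight w, weight (dualw q w) &
 forall o r, 0 < r -> wint w (cube o r) * wint (dualw q w) (cube o r) `^ (q - 1)
  <= M * (r ^+ n) `^ q].

(** Hoelder's inequality for [1 = w^(1/q) w^(-1/q)]. *)
Lemma cube_Aq_hoelder q M w o r (A : set E) : 1 < q -> cube_Aq q M w -> 0 < r ->
 measurable A -> A `<=` cube o r ->
 fine (mu A) `^ q <= wint w A * wint (dualw q w) A `^ (q - 1).
move=> q1 [hw hs _] r0 mA AQ;have [mw w0 wf] := hw;have [ms s0 sf] := hs.
have q0 : 0 < q by exact:lt_trans q1.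
have q10 : 0 < q - 1 by rewrite subr_gt0.
have [muA /andP[muA0 _]] := weight_mu r0 mA AQ.
pose p' := q / (q - 1);have p'0 : 0 < p' by rewrite divr_gt0.
have pp' : q^-1 + p'^-1 = 1 by rewrite /p' invf_div;field;rewrite gt_eqF.
have wA0 := wint_ge0 A hw;have sA0 := wint_ge0 A hs.
have mpow a : mfun (fun x : E => w x `^ a).
 exact:(@mT_comp _ _ _ _ _ _ (@powR R ^~ a)).
have h := @hoelder_bound _ _ _ mu A (fun x => w x `^ q^-1) (fun x => w x `^ (- q^-1)) q p'
 (wint w A) (wint (dualw q w) A) mA (mpow _) (mpow _) (fun x => powR_ge0 _ _)
 (fun x => powR_ge0 _ _) q0 p'0 pp' wA0 sA0.
have {h} := h _ _;rewrite -!(wint_fin hw r0 mA AQ) -!(wint_fin hs r0 mA AQ).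
have -> : (\I_(x in A) ((w x `^ q^-1) `^ q) = \I_(x in A) w x)%E.
 by apply:eq_integral => x _;rewrite powRVK ?gt_eqF// ltW.
have -> : (\I_(x in A) ((w x `^ (- q^-1)) `^ p') =
      \I_(x in A) dualw q w x)%E.
 apply:eq_integral => x _;rewrite -powRrM /dualw;congr (_ `^ _)%:E.
 by rewrite /p' mulrA mulNr mulVf ?gt_eqF// mulN1r.
move=> /(_ (lexx _) (lexx _)).
have -> : (\I_(x in A) (w x `^ q^-1 * w x `^ (- q^-1)) = mu A)%E.
 rewrite -(mul1e (mu A)) -integral_cst//;apply:eq_integral => x _ /=.
 by rewrite powRN mulfV// gt_eqF// powR_gt0.
rewrite muA lee_fin => h.
have := ler_powRl (ltW q0) muA0 h;move=> /le_trans;apply.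
rewrite powRM ?powR_ge0// powRVK ?gt_eqF// -(powRrM (wint _ _)).
by rewrite /p' invf_div divfK ?gt_eqF.
Qed.

Lemma cube_Aq_lower q M w o r (A : set E) : 1 < q -> cube_Aq q M w -> 0 < r ->
 measurable A -> A `<=` cube o r ->
 (fine (mu A) / r ^+ n) `^ q * wint w (cube o r) <= M * wint w A.
move=> q1 hA r0 mA AQ;have [hw hs Aq] := hA.
have rn0 : 0 < r ^+ n by pos.
have [muA /andP[muA0 _]] := weight_mu r0 mA AQ.
have mQ : measurable (cube o r : set E) by exact:mcube.
have h := cube_Aq_hoelder q1 hA r0 mA AQ.
have W0 := wint_ge0 (cube o r) hw;have WA0 := wint_ge0 A hw;have S0 := wint_ge0 A hs.
have SQ := wint_subset hs r0 mA mQ AQ sub_id.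
exact:Aq_lower_real q1 muA0 rn0 W0 WA0 S0 SQ h (Aq o r r0).
Qed.

Lemma cube_Aq_dual_lower q M w o r (A : set E) : 1 < q -> cube_Aq q M w -> 0 < r ->
 measurable A -> A `<=` cube o r ->
 (fine (mu A) / r ^+ n) `^ (q / (q - 1)) * wint (dualw q w) (cube o r) <=
  M `^ (q - 1)^-1 * wint (dualw q w) A.
move=> q1 hA r0 mA AQ;have [hw hs Aq] := hA.
have rn0 : 0 < r ^+ n by pos.
have [muA /andP[muA0 _]] := weight_mu r0 mA AQ.
have mQ : measurable (cube o r : set E) by exact:mcube.
have h := cube_Aq_hoelder q1 hA r0 mA AQ.
have W0 := wint_gt0 o hw r0;have S0 := wint_gt0 o hs r0.
have SA0 := wint_ge0 A hs;have q10 : 0 < q - 1 by rewrite subr_gt0.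
have wA := wint_subset hw r0 mA mQ AQ sub_id.
apply:Aq_dual_lower_real q1 muA0 rn0 W0 S0 SA0 wA h _ (Aq o r r0).
have : 0 <= M * (r ^+ n) `^ q.
 by apply:le_trans (Aq o r r0);apply:mulr_ge0;[exact/ltW/wint_gt0|exact:powR_ge0].
by rewrite pmulr_lge0// powR_gt0// exprn_gt0.
Qed.

(** The [A_infinity] property: Hoelder's inequality with the exponent [1 + t] of the reverse Hoelder
    inequality leaves a positive power of the density of [A]. *)
Lemma small_set_weight (p M : R) : 0 < p -> 1 <= M ->
 exists g C : R, [/\ 0 < g, 0 < C & forall w, weight w ->
  (forall o r (A : set E), 0 < r -> measurable A -> A `<=` cube o r ->
   (fine (mu A) / r ^+ n) `^ p * wint w (cube o r) <= M * wint w A) ->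
  forall o r (A : set E), 0 < r -> measurable A -> A `<=` cube o r ->
   wint w A <= C * (fine (mu A) / r ^+ n) `^ g * wint w (cube o r)].
move=> p0 M1;have [t [C [t0 C0 H]]] := weight_reverse_hoelder p0 M1.
have t10 : 0 < 1 + t by pos.
pose t' := (1 + t) / t;have t'0 : 0 < t' by pos.
exists t'^-1, (C `^ (1 + t)^-1);split;rewrite ?invr_gt0 ?powR_gt0//.
move=> w hw low o r A r0 mA AQ;have [mw w0 _] := hw.
have rn0 : 0 < r ^+ n by pos.
have [muA /andP[muA0 _]] := weight_mu r0 mA AQ.
have mQ : measurable (cube o r : set E) by exact:mcube.
have W0 := wint_gt0 o hw r0.
set l := wint w (cube o r) / r ^+ n.
have l0 : 0 < l by pos.
have tt' : (1 + t)^-1 + t'^-1 = 1 by rewrite /t' invf_div;field;rewrite !gt_eqF.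
have B0 : 0 <= C * l `^ (1 + t) * r ^+ n.
 by pos.
have mwp : mfun (fun x : E => w x `^ (1 + t)).
 exact:(@mT_comp _ _ _ _ _ _ (@powR R ^~ (1 + t))).
have h1 : (\I_(x in A) (w x `^ (1 + t)) <= (C * l `^ (1 + t) * r ^+ n)%:E)%E.
 apply:le_trans (H w hw low o r r0).
 apply:(int_subset mu mA mQ _ _ AQ);first exact:mEFin.
 by move=> x;pos.
have h2 : (\I_(x in A) ((cst 1 : E -> R) x `^ t') <= (fine (mu A))%:E)%E.
 rewrite -muA -[leRHS]mul1e -integral_cst//.
 by apply:eq_le_integral || (apply:le_of_eq;
  apply:eq_integral => x _;rewrite /= powR1).
have := @hoelder_bound _ _ _ mu A w (cst 1) (1 + t) t' _ _ mA mw (measurable_cst _)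
 (fun x => ltW (w0 x)) (fun=> ler01) t10 t'0 tt' B0 muA0 h1 h2.
have -> : (\I_(x in A) (w x * cst 1 x) = (wint w A)%:E)%E.
 rewrite -(wint_fin hw r0 mA AQ);apply:eq_integral => x _ /=.
 by rewrite mulr1.
rewrite lee_fin => /le_trans;apply.
have -> : wint w (cube o r) = l * r ^+ n by rewrite /l divfK// gt_eqF.
by rewrite (powR_hoelder_real t10 t'0 tt' (ltW C0) (ltW l0) rn0 muA0).
Qed.

(** Open-endedness of the [A_q] condition: the reverse Hoelder inequality of the dual weight lets
    the exponent drop from [q] to [s], with some integrability to spare. The spare part is converted
    into the factor [al^g], the gain from [a] being small on average. *)
Lemma sub_weight_bound (q M : R) : 1 < q -> 1 <= M ->
 exists s g C : R, [/\ 1 < s < q, 0 < g, 0 < C & forall w, cube_Aq q M w ->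
  forall o r (F a : E -> R) (Ph al : R), 0 < r ->
  mfun F -> mfun a -> ge0 F ->
  (forall x, 0 <= a x <= 1) -> 0 <= Ph -> 0 <= al ->
  (\I_(x in cube o r) (F x `^ s * w x) <= (Ph * wint w (cube o r))%:E)%E ->
  (\I_(x in cube o r) a x <= (al * r ^+ n)%:E)%E ->
  (\I_(x in cube o r) (a x * F x) <= (C * al `^ g * Ph `^ s^-1 * r ^+ n)%:E)%E].
move=> q1 M1;have q10 : 0 < q - 1 by rewrite subr_gt0.
have q0 : 0 < q by exact:lt_trans q1.
have M0 : 0 < M by exact:lt_le_trans M1.
have p0 : 0 < q / (q - 1) by rewrite divr_gt0.
have M1' : 1 <= M `^ (q - 1)^-1.
 have h : 1 `^ (q - 1)^-1 = 1 by rewrite powR1.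
 by rewrite -[leLHS]h;apply:ler_powRl => //;rewrite invr_ge0 ltW.
have [t [Cs [t0 Cs0 H]]] := weight_reverse_hoelder p0 M1'.
(* The gain [1 + t] is spent in two equal parts: one factor [k] lowers [q] to [s], the other pays
   for Hoelder's inequality against [a]. *)
pose k := Num.sqrt (1 + t).
have kk : k * k = 1 + t by rewrite -expr2 sqr_sqrtr// addr_ge0// ltW.
have k1 : 1 < k by rewrite -[ltLHS]sqrtr1 ltr_sqrt ?ltrDl// addr_gt0.
have k0 : 0 < k by exact:lt_trans k1.
pose k' := k / (k - 1);have k'0 : 0 < k' by rewrite divr_gt0// subr_gt0.
have kk' : k^-1 + k'^-1 = 1 by rewrite /k' invf_div;field;rewrite gt_eqF.
pose s := 1 + (q - 1) / k.
have s1 : 1 < s by rewrite ltrDl divr_gt0.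
have s0 : 0 < s by exact:lt_trans s1.
have sq : s < q by rewrite /s -ltrBrDl ltr_pdivrMr// ltr_pMr.
pose s' := s / (s - 1);have s'0 : 0 < s' by rewrite divr_gt0// subr_gt0.
have ss' : s^-1 + s'^-1 = 1 by rewrite /s' invf_div;field;rewrite gt_eqF.
have sE : s - 1 = (q - 1) / k by rewrite /s;ring.
have kq : k / s' = (q - 1) / s by rewrite /s' invf_div sE;field;rewrite !gt_eqF.
have s'1 : 1 <= s' by rewrite ler_pdivlMr ?subr_gt0// mul1r gerBl.
have k'1 : 1 <= k' by rewrite ler_pdivlMr ?subr_gt0// mul1r gerBl.
exists s, (k'^-1 * s'^-1), (M `^ s^-1 * (Cs `^ k^-1) `^ s'^-1);split.
- by rewrite s1.
- by pos.
- by pos.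
move=> w hA o r F a Ph al r0 mF ma F0 a01 Ph0 al0 hF ha.
have [hw hs Aq] := hA;have [mw w0 _] := hw;have [ms sg0 _] := hs.
have rn0 : 0 < r ^+ n by pos.
have mQ : measurable (cube o r : set E) by exact:mcube.
have W0 := wint_gt0 o hw r0;have S0 := wint_gt0 o hs r0.
pose sg := dualw q w.
have mpow (h : E -> R) p : mfun h -> mfun (fun x => h x `^ p).
 by move=> mh;exact:(@mT_comp _ _ _ _ _ _ (@powR R ^~ p)).
set l := wint sg (cube o r) / r ^+ n.
have l0 : 0 < l by pos.
have B0 : 0 <= Cs * l `^ (k * k) * r ^+ n.
 by pos.
have rh : (\I_(x in cube o r) ((sg x `^ k) `^ k) <= (Cs * l `^ (k * k) * r ^+ n)%:E)%E.
 have -> : (\I_(x in cube o r) ((sg x `^ k) `^ k) =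
   \I_(x in cube o r) (sg x `^ (1 + t)))%E.
  by apply:eq_integral => x _;rewrite -(powRrM (sg x)) kk.
 rewrite kk.
 exact:(H sg hs (fun o r A => @cube_Aq_dual_lower q M w o r A q1 hA) o r r0).
have a0 x : 0 <= a x by case/andP: (a01 x).
have ha' : (\I_(x in cube o r) ((a x `^ s') `^ k') <= (al * r ^+ n)%:E)%E.
 apply:le_trans ha;apply:int_le mQ _ _ _ _.
 - exact:(mEFin (mpow _ _ (mpow _ _ ma))).
 - exact:mEFin.
 - by move=> x;pos.
 - move=> x _;rewrite lee_fin -(powRrM (a x));apply:ler_powR_le1 => //.
  by rewrite -[leLHS]mulr1;apply:ler_pM.
have al_rn : 0 <= al * r ^+ n by pos.
have h2 := @hoelder_bound _ _ _ mu (cube o r) (fun x => sg x `^ k) (fun x => a x `^ s') k k' _ _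
 mQ (mpow _ _ ms) (mpow _ _ ma) (fun x => powR_ge0 _ _) (fun x => powR_ge0 _ _) k0 k'0 kk'
 B0 al_rn rh ha'.
have h3 : (\I_(x in cube o r) ((a x * w x `^ (- s^-1)) `^ s') <=
  ((Cs * l `^ (k * k) * r ^+ n) `^ k^-1 * (al * r ^+ n) `^ k'^-1)%:E)%E.
 rewrite (le_trans _ h2)// le_eqVlt;apply/orP;left;apply/eqP.
 apply:eq_integral => x _;rewrite /sg /dualw.
 rewrite (@powR_split_real R (a x) (w x) s^-1 s' (q - 1)^-1 k) ?a0//.
 by rewrite /s' sE;field;rewrite !gt_eqF// sE divr_gt0.
have h1 : (\I_(x in cube o r) ((F x * w x `^ (s^-1)) `^ s) <=
  (Ph * wint w (cube o r))%:E)%E.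
 rewrite (le_trans _ hF)// le_eqVlt;apply/orP;left;apply/eqP.
 apply:eq_integral => x _;congr (_%:E);rewrite powRM ?powR_ge0//.
 by rewrite powRVK ?gt_eqF// ltW.
have Z0 : 0 <= (Cs * l `^ (k * k) * r ^+ n) `^ k^-1 * (al * r ^+ n) `^ k'^-1.
 by pos.
have PW0 : 0 <= Ph * wint w (cube o r) by pos.
have FG0 (h : E -> R) p x : 0 <= h x -> 0 <= h x * w x `^ p.
 by move=> h0;pos.
have := @hoelder_bound _ _ _ mu (cube o r) (fun x => F x * w x `^ s^-1)
 (fun x => a x * w x `^ (- s^-1)) s s' _ _ mQ
 (mfunM mF (mpow _ _ mw)) (mfunM ma (mpow _ _ mw))
 (fun x => FG0 F _ x (F0 x)) (fun x => FG0 a _ x (a0 x)) s0 s'0 ss' PW0 Z0 h1 h3.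
have -> : (\I_(x in cube o r) (F x * w x `^ s^-1 * (a x * w x `^ (- s^-1))) =
 \I_(x in cube o r) (a x * F x))%E.
 apply:eq_integral => x _;congr (_%:E);rewrite powRN.
 by field;rewrite gt_eqF// powR_gt0.
move=> /le_trans;apply;rewrite lee_fin.
have hl := Aq_avg_real rn0 (ltW S0) (Aq o r r0).
exact:(powR_sub_weight_real s0 s'0 k0 k'0 ss' kk' kq (ltW Cs0) l0 rn0 al0 Ph0 (ltW W0) (ltW M0) hl).
Qed.

End cube_weights.

(** * Euclidean norm and sup norm *)

Section euclidean_norm.
Implicit Types (v x y : 'rV[R]_n) (r : R).

Lemma dotv_ge0 v : 0 <= dotv v v.
by apply:sumr_ge0 => i _;rewrite -expr2 sqr_ge0. Qed.

Lemma sqr_normv v : normv v ^+ 2 = dotv v v.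
by rewrite sqr_sqrtr// dotv_ge0. Qed.

Lemma normv_ge0 v : 0 <= normv v.
exact:sqrtr_ge0. Qed.

Lemma coord_le_normv v i : `|v 0 i| <= normv v.
rewrite -sqrtr_sqr ler_sqrt ?sqr_ge0 ?dotv_ge0//.
rewrite /dotv (bigD1 i)//= -expr2 lerDl.
by apply:sumr_ge0 => j _;rewrite -expr2 sqr_ge0.
Qed.

Lemma coord_le_norm v i : `|v 0 i| <= `|v|.
by rewrite [`|v|]mx_normrE;apply:(le_bigmax _ _ (0, i)). Qed.

Lemma norm_leP v r : 0 <= r -> (forall i, `|v 0 i| <= r) -> `|v| <= r.
move=> r0 h;rewrite [`|v|]mx_normrE;apply:bigmax_le => // -[i j] _ /=.
by rewrite ord1.
Qed.

Lemma norm_le_normv v : `|v| <= normv v.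
by apply:norm_leP => [|i];[exact:normv_ge0|exact:coord_le_normv]. Qed.

Lemma normv_le_norm v : normv v <= n%:R * `|v|.
have n0 : 0 <= n%:R * `|v| by pos.
rewrite -(ger0_norm n0) -sqrtr_sqr ler_sqrt ?sqr_ge0//.
apply:(le_via (\sum_(i < n) `|v| ^+ 2)).
 apply:ler_sum => i _;rewrite -expr2 -real_normK ?num_real//.
 by rewrite lerXn2r ?nnegrE// coord_le_norm.
rewrite sumr_const card_ord -[leLHS]mulr_natl exprMn ler_wpM2r ?sqr_ge0//.
by rewrite -natrX ler_nat;case: (n) => // m;rewrite leq_pmulr.
Qed.

Lemma dotv_comm x y : dotv x y = dotv y x.
by apply:eq_bigr => i _;rewrite mulrC. Qed.

Lemma dotvDl x y v : dotv (x + y) v = dotv x v + dotv y v.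
by rewrite -big_split;apply:eq_bigr => i _;rewrite mxE mulrDl. Qed.

Lemma dotvZl r x v : dotv (r *: x) v = r * dotv x v.
by rewrite /dotv mulr_sumr;apply:eq_bigr => i _;rewrite mxE mulrA. Qed.

Lemma dotvDr x y v : dotv v (x + y) = dotv v x + dotv v y.
by rewrite dotv_comm dotvDl !(dotv_comm v). Qed.

Lemma dotvZr r x v : dotv v (r *: x) = r * dotv v x.
by rewrite dotv_comm dotvZl dotv_comm. Qed.

Lemma dotv_cauchy_schwarz x y : `|dotv x y| <= normv x * normv y.
rewrite -[leRHS]ger0_norm ?mulr_ge0 ?normv_ge0//.
rewrite -ler_sqr ?nnegrE// !real_normK ?num_real// exprMn !sqr_normv.
set a := dotv x x;set b := dotv y y;set c := dotv x y.
have a0 : 0 <= a := dotv_ge0 x;have b0 : 0 <= b := dotv_ge0 y.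
have h t s : 0 <= t ^+ 2 * a + 2 * t * s * c + s ^+ 2 * b.
 have := dotv_ge0 (t *: x + s *: y).
 rewrite !(dotvDl, dotvDr, dotvZl, dotvZr) -/a -/b (dotv_comm y x) -/c.
 by congr (0 <= _);ring.
have [a0'|a0'] := eqVneq a 0.
 rewrite a0' mul0r;have [->|c0] := eqVneq c 0;first by rewrite expr0n.
 have := h (- (b + 1) / (2 * c)) 1;rewrite a0' mulr0 add0r expr1n mul1r mulr1.
 have -> : 2 * (- (b + 1) / (2 * c)) * c = - (b + 1) by field;rewrite c0.
 lra.
have {}a0 : 0 < a by rewrite lt_neqAle eq_sym a0'.
have := h (- c) a.
have -> : (- c) ^+ 2 * a + 2 * - c * a * c + a ^+ 2 * b = a * (a * b - c ^+ 2) by ring.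
by rewrite pmulr_rge0// subr_ge0.
Qed.

Lemma normvD x y : normv (x + y) <= normv x + normv y.
have h : 0 <= normv x + normv y by rewrite addr_ge0 ?normv_ge0.
rewrite -(@ler_pXn2r _ 2) ?nnegrE ?normv_ge0//.
rewrite sqr_normv sqrrD !sqr_normv !(dotvDl, dotvDr) (dotv_comm y x).
have := le_trans (ler_norm _) (dotv_cauchy_schwarz x y).
by lra.
Qed.

Lemma normvN x : normv (- x) = normv x.
by rewrite /normv -scaleN1r dotvZl dotvZr !mulN1r opprK. Qed.

Lemma normv_dist x y : `|normv x - normv y| <= normv (x - y).
rewrite ler_norml;apply/andP;split.
 have := normvD (y - x) x;rewrite subrK -opprB normvN;lra.
by have := normvD (x - y) y;rewrite subrK;lra.
Qed.

Lemma ballP x r y : ball x r y <-> `|y - x| < r.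
by rewrite -ball_normE /ball_/= distrC. Qed.

Lemma lipschitz_continuous (f : 'rV[R]_n -> R) (L : R) :
 (forall x y, `|f x - f y| <= L * `|x - y|) -> continuous f.
move=> fL x A /nbhs_ballP[e /= e0 eA];apply/nbhs_ballP.
exists (e / (`|L| + 1)) => /=;first pos.
move=> y /ballP xy;apply:eA;rewrite /ball/=.
apply:le_lt_trans (fL x y) _;rewrite distrC.
apply:(@le_lt_trans _ _ ((`|L| + 1) * `|y - x|)).
 by rewrite ler_wpM2r// ler_wpDr// ler_norm.
by rewrite -ltr_pdivlMl// mulrC.
Qed.

Lemma normv_continuous x : continuous (fun y => normv (y - x)).
apply:(@lipschitz_continuous _ n%:R) => y z.
apply:le_trans (normv_dist _ _) _;rewrite opprB addrA subrK.
exact:normv_le_norm.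
Qed.

Lemma eball_open x r : open (eball x r).
rewrite (_ : eball x r = (fun y => normv (y - x)) @^-1` [set s | s < r])//.
apply:open_comp;last exact:open_lt.
by move=> y _;exact:normv_continuous.
Qed.

Lemma eball_sub_ball x r : eball x r `<=` ball x r.
by move=> y xy;apply/ballP;apply:le_lt_trans xy;exact:norm_le_normv. Qed.

Lemma ball_sub_eball x r : (0 < n)%N -> ball x r `<=` eball x (n%:R * r).
move=> n0 y /ballP xy;apply:le_lt_trans (normv_le_norm _) _.
by rewrite ltr_pM2l// ltr0n.
Qed.

Lemma eball_le x r s : r <= s -> eball x r `<=` eball x s.
by move=> rs y xy;exact:lt_le_trans rs. Qed.

Definition shiftc (x : 'rV[R]_n) (a : R) : 'rV[R]_n := x + const_mx a.

Lemma cube_sub_ball x r s : 0 < r -> r < s -> cube (shiftc x (- r)) (2 * r) `<=` ball x s.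
move=> r0 rs y h;apply/ballP;apply:le_lt_trans rs.
apply:norm_leP => [|i];first exact:ltW.
have := h i;rewrite !mxE in_itv/= => /andP[h1 h2].
by rewrite ler_norml;apply/andP;split;lra.
Qed.

Lemma ball_cube x r : 0 < r -> ball x r `<=` cube (shiftc x (- r)) (2 * r).
move=> r0 y /ballP h i;have := le_lt_trans (coord_le_norm _ i) h;rewrite !mxE in_itv/=.
rewrite ltr_norml => /andP[h1 h2].
by apply/andP;split;lra.
Qed.

Lemma cube_ball x r : 0 < r ->
 cube x r `<=` ball (shiftc x (r / 2)) r.
move=> r0;have := @cube_sub_ball (shiftc x (r / 2)) (r / 2) r.
rewrite divr_gt0// (_ : 2 * (r / 2) = r);last by field.
rewrite (_ : shiftc (shiftc x (r / 2)) (- (r / 2)) = x);last first.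
 by apply/rowP => i;rewrite !mxE addrK.
by apply => //;lra.
Qed.

Lemma compactly_in_ball x r : compactly_in (ball x r) setT.
split=> //;first exact:ball_open.
apply:bounded_closed_compact;last exact:closed_closure.
exists (`|x| + `|r| + 1);split;first exact:num_real.
move=> M MM y /(_ (ball y 1));case;first exact:nbhsx_ballx.
move=> z [/ballP xz /ballP yz];apply:ltW;apply:le_lt_trans MM.
have -> : y = x + (z - x) - (z - y) by pos|| (apply/rowP => i;rewrite !mxE;ring).
apply:le_trans (ler_normB _ _) _;apply:lerD;last exact:ltW.
apply:le_trans (ler_normD _ _) _;rewrite lerD2l.
by apply:ltW;apply:lt_le_trans xz _;exact:ler_norm.
Qed.

End euclidean_norm.

(** * From the condition on Euclidean balls to cubes *)

Section muckenhoupt.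
Hypothesis n0 : (0 < n)%N.

Lemma meball x r : measurable (eball x r : set E).
exact/open_meas/eball_open. Qed.

Lemma lebesgue_eball x r : 0 < r -> exists b : R, [/\ mu (eball x r) = b%:E, 0 < b &
 b <= (2 * r) ^+ n].
move=> r0;have n0R : 0 < n%:R :> R by pos.
have h1 : (mu (eball x r) <= ((2 * r) ^+ n)%:E)%E.
 rewrite -(mu_ball x r0);apply:le_measure;rewrite ?inE.
 - exact:meball.
 - exact/open_meas/ball_open.
 - exact:eball_sub_ball.
have h2 : (0 < mu (eball x r))%E.
 have r'0 : 0 < r / n%:R by pos.
 have rE : n%:R * (r / n%:R) = r by rewrite mulrC divfK ?gt_eqF.
 apply:(@lt_le_trans _ _ (mu (ball x (r / n%:R)))).
  by rewrite mu_ball// lte_fin exprn_gt0// mulr_gt0.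
 apply:le_measure;rewrite ?inE.
 - exact/open_meas/ball_open.
 - exact:meball.
 - by rewrite -{2}rE;exact:ball_sub_eball.
have fin : mu (eball x r) \is a fin_num.
 by rewrite ge0_fin_numE ?measure_ge0// (le_lt_trans h1)// ltry.
exists (fine (mu (eball x r)));rewrite fineK//;split=> //.
 by rewrite fine_gt0// h2 (le_lt_trans h1)// ltry.
by rewrite -lee_fin fineK.
Qed.

(** Extended-valued as in [Aq_const]: the value [+oo] at zeros of the weight is what shows that
    these zeros form a null set. *)
Definition dual_density (q : R) (w : V -> R) (x : V) : \bar R := ((w x `^ (q - 1)^-1)%:E)^-1.

(** If the dual integral were infinite, the product in [Aq_const] would be infinite too, since the
    weight has positive mass [a] on the ball. *)
Lemma Aq_eball q w (M0 : R) x r a : 1 < q -> (Aq_const q w <= M0%:E)%E -> 0 < r ->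
 (\I_(y in eball x r) w y = a%:E)%E -> 0 < a ->
 exists b : R, [/\ (\int[mu]_(y in eball x r) dual_density q w y = b%:E)%E, 0 <= b &
  a * b `^ (q - 1) <= M0 * ((2 * r) ^+ n) `^ q].
move=> q1 wM r0 wa a0;have [m [muB m0 mr]] := lebesgue_eball x r0.
have q10 : 0 < q - 1 by rewrite subr_gt0.
set G := (\int[mu]_(y in _) _)%E.
have G0 : (0 <= G)%E.
 apply:integral_ge0 => y _;rewrite /dual_density inver;case: ifP => // _.
 by pos.
have h : ((a / m)%:E * (G * (m^-1)%:E) `^ (q - 1) <= M0%:E)%E.
 apply:le_trans wM;apply:ereal_sup_ubound;exists (x, r) => //=.
 rewrite /average muB wa inver gt_eqF// -EFinM.
have Gfin : (G < +oo)%E.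
 rewrite ltey;apply/eqP => Goo;move: h;rewrite Goo gt0_mulye ?lte_fin ?invr_gt0//.
 by rewrite poweRyr ?gt_eqF// gt0_muley ?lte_fin ?divr_gt0// leye_eq.
have {}Gfin : G \is a fin_num by rewrite ge0_fin_numE.
exists (fine G);rewrite fineK//;split=> //;first exact:fine_ge0.
move: h;have -> : (G * (m^-1)%:E = (fine G / m)%:E)%E by rewrite EFinM fineK.
rewrite poweR_EFin -EFinM lee_fin.
have b0 : 0 <= fine G by exact:fine_ge0.
rewrite (powR_div _ b0 (ltW m0)) mulrACA -invfM ler_pdivrMr ?mulr_gt0 ?powR_gt0//.
move=> /le_trans;apply.
have -> : m * m `^ (q - 1) = m `^ q.
 rewrite -{1}(powRr1 (ltW m0)) -powRD;last by rewrite (gt_eqF m0) implybT.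
 by congr (_ `^ _);ring.
have M00 : 0 <= M0.
 rewrite -lee_fin;apply:le_trans wM;apply:le_trans (ereal_sup_ubound _);last first.
  by exists (x, r) => //=.
 apply:mule_ge0;last exact:poweR_ge0.
 by rewrite /average muB wa inver gt_eqF// -EFinM lee_fin divr_ge0 ?ltW.
by apply:ler_wpM2l => //;apply:ler_powRl;rewrite ?(ltW m0)// ltW// (lt_trans _ q1).
Qed.

Lemma ae_imp (P Q : V -> Prop) : (forall x, P x -> Q x) ->
 {ae mu, forall x : V, P x} -> {ae mu, forall x : V, Q x}.
exact:(@filterS E (almost_everywhere mu) _ P Q). Qed.

Lemma ae_integral_eq (D : set E) (f g : V -> \bar R) : measurable D ->
 mfun (f : E -> \bar R) -> mfun (g : E -> \bar R) ->
 {ae mu, forall x : V, f x = g x} -> (\int[mu]_(x in D) f x = \int[mu]_(x in D) g x)%E.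
move=> mD mf mg fg;apply:ae_eq_integral;[exact:mD|exact:measurable_funS mf|exact:measurable_funS mg|].
exact:ae_imp fg => x h _.
Qed.

Lemma ae_restrict_balls (P : V -> Prop) :
 (forall N : nat, {ae mu, forall x : V, ball (0 : V) N.+1%:R x -> P x}) ->
 {ae mu, forall x : V, P x}.
move=> h;have := ae_foralln h;apply:filterS => x hx.
have [N _ xN] : (\bigcup_k ball 0 k.+1%:R) x by rewrite bigcup_ball0.
exact:hx xN.
Qed.

(** A weight with positive mass on one ball has positive mass on all larger balls, so its dual
    density is integrable there and finite almost everywhere: the weight vanishes on a null set
    only, where it is reset to 1. The constant comes from enclosing a cube of side [r] in a
    Euclidean ball of radius [n r]. *)
Lemma Aq_cube_Aq q w (M0 : R) : 1 < q -> 0 <= M0 -> Aq q w -> (Aq_const q w <= M0%:E)%E ->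
 {ae mu, forall x : V, w x = 0} \/
 exists w' : V -> R, {ae mu, forall x : V, w x = w' x} /\
  cube_Aq q (Num.max 1 (M0 * ((2 * n%:R) ^+ n) `^ q)) w'.
move=> q1 M00 [w0 [mw' wloc] _] wM.
have q10 : 0 < q - 1 by rewrite subr_gt0.
have mw : mfun (w : E -> R) := mw'.
have mB (N : R) : measurable (ball (0%R : V) N : set E) by exact/open_meas/ball_open.
have mEB x r : measurable (eball x r : set E) := meball x r.
have wE0 x : (0 <= (w x)%:E)%E by pos.
have mwE : mfun (fun x : E => (w x)%:E) := mEFin mw.
have finB (x : V) r : (\I_(x in ball x r) w x < +oo)%E.
 have := wloc _ (compactly_in_ball x r);congr (_ < _)%E.
 by apply:eq_integral => y _;rewrite ger0_norm.
have finE x r : 0 < r -> exists2 a, (\I_(y in eball x r) w y = a%:E)%E & 0 <= a.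
 move=> r0;exists (fine (\I_(y in eball x r) w y)).
  rewrite fineK// ge0_fin_numE ?int_ge0T//;apply:le_lt_trans (finB x r).
  apply:(int_subset mu (mEB x r) _ mwE wE0 (@eball_sub_ball x r)).
  exact/open_meas/ball_open.
 by rewrite fine_ge0// int_ge0T.
have [[N WN]|allz] := pselect (exists N : nat, (0 < \I_(x in ball (0%R : V) N.+1%:R) w x)%E);last first.
 left;apply:ae_restrict_balls => N.
 have I0 : (\int[mu]_(x in ball (0%R : V) N.+1%:R) `|(w x)%:E| = 0)%E.
  apply/eqP;rewrite eq_le int_ge0T ?andbT//.
  rewrite leNgt;apply/negP => h;apply:allz;exists N.
  rewrite (lt_le_trans h)// le_eqVlt;apply/orP;left;apply/eqP.
  by apply:eq_integral => y _;rewrite abse_EFin ger0_norm.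
 have [+ _] := ae_eq_integral_abs mu (mB N.+1%:R) (measurable_funS (measurableT) (@subsetT _ _) (mEFin mw)).
 move=> /(_ I0);apply:filterS => x h /h.
 by move=> [].
right;pose w' x := if w x == 0 then 1 else w x.
have posE (x : V) r : `|x| + n%:R * N.+1%:R + N.+1%:R < r -> exists a, [/\ 0 < r,
  (\I_(y in eball x (n%:R * r)) w y = a%:E)%E & 0 < a].
 move=> hr.
 have r0 : 0 < r by apply:le_lt_trans hr;rewrite !addr_ge0// mulr_ge0.
 have nr0 : 0 < n%:R * r by pos.
 have [a wa a0] := finE x _ nr0;exists a;split=> //.
 rewrite -lte_fin -wa;apply:lt_le_trans WN _.
 apply:(int_subset mu (mB _) (mEB _ _) mwE wE0).
 move=> y /ballP;rewrite subr0 => yN;apply:ball_sub_eball => //;apply/ballP.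
 apply:le_lt_trans (ler_normB _ _) _;apply:le_lt_trans hr.
 rewrite addrC -addrA lerD2l;apply:le_trans (ltW yN) _.
 by rewrite lerDr mulr_ge0.
have ddE x : dual_density q w x = if w x == 0 then +oo%E else (w x `^ (- (q - 1)^-1))%:E.
 rewrite /dual_density inver;have [->|wx] := eqVneq (w x) 0.
  by rewrite powR0 ?eqxx// gt_eqF// invr_gt0.
 have wx0 : 0 < w x by rewrite lt_neqAle eq_sym wx w0.
 by rewrite gt_eqF ?powR_gt0// powRN.
have mpow p (h : E -> R) : mfun h -> mfun (fun x : E => h x `^ p).
 by move=> mh;exact:(@mT_comp _ _ _ _ _ _ (@powR R ^~ p)).
have meq0 : mfun (fun x : E => w x == 0).
 exact:measurable_fun_eqr => //;exact:measurable_cst.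
have mdd : mfun (dual_density q w : E -> \bar R).
 rewrite (_ : dual_density q w = fun x : E => if w x == 0 then +oo%E
   else ((w x `^ (- (q - 1)^-1))%:E));last by apply/funext => x;exact:ddE.
 apply:(measurable_fun_ifT meq0);first exact:measurable_cst.
 exact:(mEFin (mpow _ _ mw)).
have dd0 x : (0 <= dual_density q w x)%E by rewrite ddE;case: ifP;rewrite // lee_fin powR_ge0.
have wpos : {ae mu, forall x : V, w x != 0}.
 apply:ae_restrict_balls => k.
 pose r := n%:R * N.+1%:R + N.+1%:R + k.+1%:R : R.
 have [a [r0 wa a0]] : exists a, [/\ 0 < r, (\I_(y in eball (0%R : V) (n%:R * r)) w y = a%:E)%E & 0 < a].
  by apply:posE;rewrite normr0 add0r ltrDl.
 have nr0 : 0 < n%:R * r by pos.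
 have [b [Gb b0 _]] := Aq_eball q1 wM nr0 wa a0.
 have : mu.-integrable (eball (0%R : V) (n%:R * r)) (dual_density q w).
  apply/integrableP;split;first exact:measurable_funS mdd.
  rewrite (_ : (\int[mu]_(x in _) _)%E = b%:E) ?ltry// -Gb.
  by apply:eq_integral => x _;rewrite gee0_abs.
 move=> /(integrable_ae (mEB _ _));apply:filterS => x h xk.
 apply/negP => wx.
 suff xr : eball (0%R : V) (n%:R * r) x by have := h xr;rewrite ddE wx.
 apply:ball_sub_eball => //;apply:le_ball xk.
 by rewrite lerDr addr_ge0// mulr_ge0.
have w'w : {ae mu, forall x : V, w x = w' x}.
 by apply:ae_imp wpos => x;rewrite /w' => /negPf ->.
exists w';split;first exact:w'w.
have mww : mfun (w' : E -> R).
 exact:(measurable_fun_ifT meq0) => //;exact:measurable_cst.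
have w'0 x : 0 < w' x.
 by rewrite /w';case: ifPn => // wx;rewrite lt_neqAle eq_sym wx w0.
pose sg := dualw q w'.
have msg : mfun (sg : E -> R) by exact:mpow.
have sg0 x : 0 < sg x by exact:powR_gt0.
have cubeB (o : V) r : 0 < r -> cube o r `<=` eball (shiftc o (r / 2)) (n%:R * r).
 by move=> r0 y /(cube_ball r0) /(ball_sub_eball n0).
have eqw (D : set E) : measurable D -> (\I_(x in D) w' x = \I_(x in D) w x)%E.
 move=> mD;apply:(ae_integral_eq mD (mEFin mww) (mEFin mw)).
 by apply:ae_imp w'w => x ->.
have eqs (D : set E) : measurable D -> (\I_(x in D) sg x = \int[mu]_(x in D) dual_density q w x)%E.
 move=> mD;apply:(ae_integral_eq mD (mEFin msg) mdd).
 by apply:ae_imp wpos => x /negPf wx;rewrite ddE wx /sg /dualw /w' wx.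
have key o r : 0 < r -> exists a b, [/\ (\I_(x in cube o r) w' x <= a%:E)%E,
  (\I_(x in cube o r) sg x <= b%:E)%E, 0 <= a, 0 <= b &
  a * b `^ (q - 1) <= M0 * ((2 * (n%:R * r)) ^+ n) `^ q].
 move=> r0;set B := eball (shiftc o (r / 2)) (n%:R * r).
 have nr0 : 0 < n%:R * r by pos.
 have [a wa a0] := finE (shiftc o (r / 2)) _ nr0.
 have mC : measurable (cube o r : set E) by exact:mcube.
 have mB' : measurable (B : set E) by exact:mEB.
 have {}a0 : 0 < a.
  have [m [muB m0 _]] := lebesgue_eball (shiftc o (r / 2)) nr0.
  rewrite -lte_fin -wa -(eqw _ mB');apply:(integral_gt0 mB' mww w'0).
  by rewrite -[X in (_ < X)%E]/(mu B) muB lte_fin.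
 have [b [Gb b0 ab]] := Aq_eball q1 wM nr0 wa a0.
 exists a, b;split=> //;last exact:ltW.
  rewrite -wa -(eqw _ mB').
  apply:(int_subset mu mC mB' (mEFin mww) _ (cubeB o r r0)).
  by move=> x;pos.
 rewrite -Gb -(eqs _ mB').
 apply:(int_subset mu mC mB' (mEFin msg) _ (cubeB o r r0)).
 by move=> x;pos.
have hw' : weight w'.
 split=> // o r r0;have [a [b [h _ _ _ _]]] := key o r r0.
 by apply:le_lt_trans h _;rewrite ltry.
have hs' : weight sg.
 split=> // o r r0;have [a [b [_ h _ _ _]]] := key o r r0.
 by apply:le_lt_trans h _;rewrite ltry.
split=> // o r r0;have [a [b [ha hb a0 b0 ab]]] := key o r r0.
have mC : measurable (cube o r : set E) by exact:mcube.
rewrite (wint_fin hw' r0 mC sub_id) lee_fin in ha.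
rewrite (wint_fin hs' r0 mC sub_id) lee_fin in hb.
have W0 := wint_ge0 (cube o r) hw';have S0 := wint_ge0 (cube o r) hs'.
apply:(le_via (a * b `^ (q - 1))).
 by apply:ler_pM => //;[exact:powR_ge0|apply:ler_powRl => //;exact:ltW].
apply:(le_trans ab).
rewrite mulrA exprMn powRM ?exprn_ge0 ?mulr_ge0 ?(ltW r0)// mulrA.
by apply:ler_wpM2r;[exact:powR_ge0|rewrite le_max lexx orbT].
Qed.

End muckenhoupt.

(** * Smooth functions of several variables *)

Section smooth.
Implicit Types (f g : V -> R).

(** As in one variable, a syntactic class closed under partial derivatives; composition with
    [smooth1] brings in the profile of the kernels. *)
Inductive smooth : (V -> R) -> Prop :=
| smooth_cst c : smooth (fun=> c)
| smooth_coord i : smooth (fun x => x 0 i)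
| smooth_add f g of smooth f & smooth g : smooth (fun x => f x + g x)
| smooth_mul f g of smooth f & smooth g : smooth (fun x => f x * g x)
| smooth_comp F f of smooth1 F & smooth f : smooth (fun x => F (f x)).

Lemma smooth_sum m (F : 'I_m -> V -> R) : (forall i, smooth (F i)) ->
 smooth (fun x => \sum_i F i x).
elim: m F => [|m IH] F sF.
 rewrite (_ : (fun _ => _) = fun=> 0);first exact:smooth_cst.
 by apply/funext => x;rewrite big_ord0.
rewrite (_ : (fun _ => _) = fun x => \sum_(i < m) F (widen_ord (leqnSn m) i) x + F ord_max x).
 by apply:smooth_add => //;exact:IH.
by apply/funext => x;rewrite big_ord_recr.
Qed.

Lemma smooth_differentiable f : smooth f -> forall x, differentiable f x.
elim=> {f}.
- by move=> c x;exact:differentiable_cst.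
- by move=> i x;exact:differentiable_coord.
- by move=> f g _ df _ dg x;exact:differentiableD.
- by move=> f g _ df _ dg x;exact:differentiableM.
- move=> F f sF _ df x;apply:(@differentiable_comp _ _ _ _ f F) => //.
 by apply/derivable1_diffP;have [dF _ /(_ (f x))[]] := smooth1_derive sF.
Qed.

Lemma smooth_cont f : smooth f -> continuous f.
by move=> sf x;apply:differentiable_continuous;exact:smooth_differentiable. Qed.

Lemma partial_cst c i : partial i (fun _ : V => c) = fun=> 0.
by apply/funext => x;exact:derive_cst. Qed.

Lemma partial_coord k i : partial i (fun x : V => x 0 k) = fun=> (k == i)%:R.
apply/funext => x;rewrite /partial /derive.
apply:cvg_lim => //;apply:cvg_near_cst;near=> h.
have h0 : h != 0 by near: h;exact:nbhs_dnbhs_neq.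
by rewrite /= !mxE eqxx/= addrK /GRing.scale/= mulKf// eq_sym.
Unshelve. all: by end_near. Qed.

Lemma partialD f g i : smooth f -> smooth g ->
 partial i (fun x => f x + g x) = fun x => partial i f x + partial i g x.
move=> sf sg;apply/funext => x;rewrite /partial.
by apply:deriveD;apply:diff_derivable;exact:smooth_differentiable.
Qed.

Lemma partialM f g i : smooth f -> smooth g ->
 partial i (fun x => f x * g x) = fun x => f x * partial i g x + g x * partial i f x.
move=> sf sg;apply/funext => x;rewrite /partial.
by apply:deriveM;apply:diff_derivable;exact:smooth_differentiable.
Qed.

Lemma partial_comp (F dF : R -> R) f (i : 'I_n) : smooth f -> (forall x : R, is_derive x 1 F (dF x)) ->
 partial i (fun x => F (f x)) = fun x => dF (f x) * partial i f x.
move=> sf hF;apply/funext => x;rewrite /partial.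
have df := smooth_differentiable sf x.
have dFf : differentiable F (f x) by apply/derivable1_diffP;have [] := hF (f x).
rewrite !deriveE//;last exact:(@differentiable_comp _ _ _ _ f F).
rewrite (@diff_comp _ _ _ _ f F)//= diff1E//= derive1E.
by rewrite (@derive_val _ _ _ _ _ _ _ (hF (f x))) /GRing.scale/= mulrC.
Qed.

Lemma smooth_partial f i : smooth f -> smooth (partial i f).
elim=> {f}.
- by move=> c;rewrite partial_cst;exact:smooth_cst.
- by move=> k;rewrite partial_coord;exact:smooth_cst.
- by move=> f g sf df sg dg;rewrite partialD//;exact:smooth_add.
- move=> f g sf df sg dg;rewrite partialM//.
 by apply:smooth_add;exact:smooth_mul.
- move=> F f sF sf df;have [dF sdF hF] := smooth1_derive sF.
 rewrite (partial_comp _ sf hF);apply:smooth_mul => //.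
 exact:smooth_comp.
Qed.

Lemma smooth_Ck f k : smooth f -> Ck k f.
elim: k f => [|k IH] f sf /=;first exact:smooth_cont.
split;first exact:smooth_cont.
move=> i;split;last by apply:IH;exact:smooth_partial.
by move=> x;apply:diff_derivable;exact:smooth_differentiable.
Qed.

End smooth.

Section smooth_more.
Implicit Types (f g : V -> R).

Lemma smooth_scale c f : smooth f -> smooth (fun x => c * f x).
by move=> sf;apply:smooth_mul => //;exact:smooth_cst. Qed.

Lemma smooth_sub f g : smooth f -> smooth g -> smooth (fun x => f x - g x).
move=> sf sg;rewrite (_ : (fun _ => _) = fun x => f x + -1 * g x).
 by apply:smooth_add => //;exact:smooth_scale.
by apply/funext => x;rewrite mulN1r.
Qed.

Lemma partial_scale c f (i : 'I_n) : smooth f ->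
 partial i (fun x => c * f x) = fun x => c * partial i f x.
move=> sf;rewrite partialM ?partial_cst//;last exact:smooth_cst.
by apply/funext => x;rewrite mulr0 addr0.
Qed.

Lemma partialB f g (i : 'I_n) : smooth f -> smooth g ->
 partial i (fun x => f x - g x) = fun x => partial i f x - partial i g x.
move=> sf sg;apply/funext => x;rewrite /partial.
by apply:deriveB;apply:diff_derivable;exact:smooth_differentiable.
Qed.

Lemma partial_sum m (F : 'I_m -> V -> R) (i : 'I_n) : (forall k, smooth (F k)) ->
 partial i (fun x => \sum_k F k x) = fun x => \sum_k partial i (F k) x.
move=> sF;apply/funext => x;rewrite /partial -derive_sum.
 by congr ('D_ _ _ x);apply/funext => y;rewrite fct_sumE.
by move=> k;apply:diff_derivable;exact:smooth_differentiable.
Qed.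

Lemma smooth_reflect f x : smooth f -> smooth (fun y => f (x - y)).
elim=> {f}.
- by move=> c;exact:smooth_cst.
- move=> i;rewrite (_ : (fun _ => _) = fun y : V => x 0 i - y 0 i).
  by apply:smooth_sub;[exact:smooth_cst|exact:smooth_coord].
 by apply/funext => y;rewrite !mxE.
- by move=> f g _ sf _ sg;exact:smooth_add.
- by move=> f g _ sf _ sg;exact:smooth_mul.
- by move=> F f sF _ sf;exact:smooth_comp.
Qed.

Lemma diff_partial f x w : smooth f -> 'd f x w = \sum_i w 0 i * partial i f x.
move=> sf;have df := smooth_differentiable sf x.
rewrite {1}[w]row_sum_delta linear_sum;apply:eq_bigr => i _.
by rewrite linearZ/= /partial deriveE.
Qed.

Lemma partial_reflect f x (i : 'I_n) : smooth f ->
 partial i (fun y => f (x - y)) = fun y => - partial i f (x - y).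
move=> sf;apply/funext => y;rewrite /partial.
rewrite [LHS]/derive (_ : (fun _ => _) = fun h : R =>
  h^-1 *: ((f \o shift (x - y)) (h *: - delta_mx 0 i) - f (x - y)));last first.
 by apply/funext => h;rewrite /= scalerN opprD addrCA.
rewrite -[LHS]/('D_(- delta_mx 0 i) f (x - y)).
by rewrite !deriveE ?linearN//;exact:smooth_differentiable.
Qed.

Lemma is_derive_line f (v w : V) (t : R) : smooth f ->
 is_derive t 1 (fun t : R => f (v + t *: w)) ('d f (v + t *: w) w).
move=> sf;have df := smooth_differentiable sf (v + t *: w).
have E : (fun h : R => h^-1 *: (((fun t : R => f (v + t *: w)) \o shift t) (h *: 1) - f (v + t *: w))) =
  (fun h : R => h^-1 *: ((f \o shift (v + t *: w)) (h *: w) - f (v + t *: w))).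
 by apply/funext => h;rewrite /= [h%:A]mulr1 scalerDl addrCA.
have dw := @diff_derivable _ _ _ f (v + t *: w) w df.
split;first by rewrite /derivable E.
by rewrite /derive E -deriveE.
Qed.

Lemma mean_value f (M : R) (u v : V) : smooth f ->
 (forall (t : R) i, 0 < t < 1 -> `|partial i f (v + t *: (u - v))| <= M) ->
 `|f u - f v| <= n%:R * M * `|u - v|.
move=> sf hM.
pose g (t : R) := f (v + t *: (u - v)).
have dg (t : R) : is_derive t 1 g (\sum_i (u - v) 0 i * partial i f (v + t *: (u - v))).
 by rewrite -diff_partial//;exact:is_derive_line.
have cg : {within `[0, 1 : R], continuous g}.
 apply:continuous_subspaceT => t;apply:differentiable_continuous.
 by apply/derivable1_diffP;have [] := dg t.
have [t tI] := @MVT R g _ 0 1 ltr01 (fun x _ => dg x) cg.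
have -> : g 1 = f u by rewrite /g scale1r addrC subrK.
have -> : g 0 = f v by rewrite /g scale0r addr0.
rewrite subr0 mulr1 => ->.
apply:le_trans (ler_norm_sum _ _ _) _.
rewrite (_ : n%:R * M * _ = \sum_(i < n) (M * `|u - v|));last first.
 by rewrite sumr_const card_ord -[RHS]mulr_natl mulrA.
apply:ler_sum => i _;rewrite normrM mulrC;apply:ler_pM => //.
 exact:hM;move: tI;rewrite in_itv.
exact:coord_le_norm.
Qed.

Lemma smooth_test_function f (z : V) (r : R) (D : set V) : smooth f ->
 (forall x : V, r < `|x - z| -> f x = 0) -> (forall x : V, `|x - z| <= r -> D x) ->
 test_function D f.
move=> sf f0 rD.
have cl : closed [set x : V | `|x - z| <= r].
 have c : continuous (fun x : V => `|x - z|).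
  apply:(@lipschitz_continuous _ 1) => x y;rewrite mul1r.
  by apply:le_trans (ler_dist_dist _ _) _;rewrite opprB addrA subrK.
 by apply:(@closed_comp _ _ (fun x : V => `|x - z|) [set y | y <= r]) => [x _|];[exact:c|exact:closed_le].
have sub : closure [set x | f x != 0] `<=` [set x | `|x - z| <= r].
 rewrite closureE => x;apply;split => // y /=;rewrite leNgt;apply:contraNN => /f0 ->.
 by [].
split;first by move=> k;exact:smooth_Ck.
- apply:(subclosed_compact _ _ sub);first exact:closed_closure.
 apply:bounded_closed_compact => //.
 exists (r + `|z|);split;first exact:num_real.
 move=> M hM x /= xr;apply/ltW;apply:le_lt_trans hM.
 by rewrite -[x](subrK z);apply:le_trans (ler_normD _ _) _;rewrite lerD2r.
- by move=> x /sub;exact:rD.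
Qed.

End smooth_more.

(** * The regularised kernels *)

Section kernel.
Variables (B : 'M[R]_n) (b b1 b2 h h1 : R -> R) (C c : R).
Hypothesis pr : profile n b b1 b2 h h1 C c.
Hypothesis Bsym : forall i j, B i j = B j i.
Implicit Types (x : V) (e : R) (i j k l : 'I_n).

Definition lin i x : R := \sum_j B i j * x 0 j.
Definition qform x : R := \sum_i x 0 i * lin i x.
Definition kW e j x : R := e ^- n * (b (e ^- 2 * qform x) * lin j x).
Definition kK e j k x : R := e ^- n *
 (b1 (e ^- 2 * qform x) * (e ^- 2 * (2 * lin k x)) * lin j x + b (e ^- 2 * qform x) * B j k).
Definition kP e x : R := e ^- n * h (e ^- 2 * qform x).
Definition kP1 e k x : R := e ^- n * (h1 (e ^- 2 * qform x) * (e ^- 2 * (2 * lin k x))).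
Definition kK1 e j k l x : R := e ^- n *
 (b2 (e ^- 2 * qform x) * (e ^- 2 * (2 * lin l x)) * (e ^- 2 * (2 * lin k x)) * lin j x
  + b1 (e ^- 2 * qform x) * (e ^- 2 * (2 * B k l)) * lin j x
  + b1 (e ^- 2 * qform x) * (e ^- 2 * (2 * lin k x)) * B j l
  + b1 (e ^- 2 * qform x) * (e ^- 2 * (2 * lin l x)) * B j k).

Lemma smooth_lin i : smooth (lin i).
by apply:smooth_sum => j;apply:smooth_scale;exact:smooth_coord. Qed.

Lemma smooth_qform : smooth qform.
by apply:smooth_sum => j;apply:smooth_mul;[exact:smooth_coord|exact:smooth_lin]. Qed.

Lemma partial_lin i k : partial k (lin i) = fun=> B i k.
rewrite /lin partial_sum => [|j];last by apply:smooth_scale;exact:smooth_coord.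
apply/funext => x;rewrite (bigD1 k)//= big1 ?addr0.
 rewrite partial_scale ?partial_coord ?eqxx ?mulr1//;exact:smooth_coord.
move=> j jk;rewrite partial_scale ?partial_coord ?(negbTE jk) ?mulr0//;exact:smooth_coord.
Qed.

Lemma partial_qform k : partial k qform = fun x => 2 * lin k x.
rewrite /qform partial_sum => [|j];last first.
 by apply:smooth_mul;[exact:smooth_coord|exact:smooth_lin].
apply/funext => x.
rewrite (eq_bigr (fun i => x 0 i * B i k + lin i x * (i == k)%:R));last first.
 move=> i _;rewrite partialM ?partial_lin ?partial_coord//;[exact:smooth_coord|exact:smooth_lin].
rewrite big_split/= [X in _ + X](bigD1 k)//= [X in _ + (_ + X)]big1 ?addr0;last first.
 by move=> i /negbTE ->;rewrite mulr0.
rewrite eqxx mulr1 mulr2n mulrDl mul1r;congr (_ + _).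
by apply:eq_bigr => i _;rewrite mulrC Bsym.
Qed.

Lemma smooth_prof F e : smooth1 F -> smooth (fun x => F (e ^- 2 * qform x)).
by move=> sF;apply:smooth_comp => //;apply:smooth_scale;exact:smooth_qform. Qed.

Lemma partial_prof (F dF : R -> R) e k : (forall x : R, is_derive x 1 F (dF x)) ->
 partial k (fun x => F (e ^- 2 * qform x)) =
 fun x => dF (e ^- 2 * qform x) * (e ^- 2 * (2 * lin k x)).
move=> hF;rewrite (partial_comp _ _ hF);last by apply:smooth_scale;exact:smooth_qform.
by rewrite partial_scale ?partial_qform//;exact:smooth_qform.
Qed.

Let sb : smooth1 b. Proof. by have [[]] := pr. Qed.
Let sb1 : smooth1 b1. Proof. by have [[]] := pr. Qed.
Let sb2 : smooth1 b2. Proof. by have [[]] := pr. Qed.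
Let sh : smooth1 h. Proof. by have [[]] := pr. Qed.
Let sh1 : smooth1 h1. Proof. by have [[]] := pr. Qed.
Let db (x : R) : is_derive x 1 b (b1 x). Proof. by have [_ []] := pr. Qed.
Let db1 (x : R) : is_derive x 1 b1 (b2 x). Proof. by have [_ []] := pr. Qed.
Let dh (x : R) : is_derive x 1 h (h1 x). Proof. by have [_ []] := pr. Qed.

Lemma smooth_kW e j : smooth (kW e j).
by apply:smooth_scale;apply:smooth_mul;[exact:smooth_prof|exact:smooth_lin].
Qed.

Lemma smooth_kP e : smooth (kP e).
by apply:smooth_scale;exact:smooth_prof. Qed.

Let slin2 e k : smooth (fun x => e ^- 2 * (2 * lin k x)).
by do 2!apply:smooth_scale;exact:smooth_lin. Qed.

Lemma smooth_kK e j k : smooth (kK e j k).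
apply:smooth_scale;apply:smooth_add.
 apply:smooth_mul;last exact:smooth_lin.
 by apply:smooth_mul => //;exact:smooth_prof.
by apply:smooth_mul;[exact:smooth_prof|exact:smooth_cst].
Qed.

Lemma partial_kP e k : partial k (kP e) = kP1 e k.
by rewrite /kP partial_scale ?(partial_prof _ _ dh)//;exact:smooth_prof.
Qed.

Lemma partial_kW e j k : partial k (kW e j) = kK e j k.
rewrite /kW partial_scale;last by apply:smooth_mul;[exact:smooth_prof|exact:smooth_lin].
rewrite partialM;[|exact:smooth_prof|exact:smooth_lin].
rewrite partial_lin (partial_prof _ _ db);apply/funext => x;rewrite /kK;ring.
Qed.

Lemma partial_kK e j k l : partial l (kK e j k) = kK1 e j k l.
have s1 : smooth (fun x => b1 (e ^- 2 * qform x) * (e ^- 2 * (2 * lin k x))).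
 by apply:smooth_mul => //;exact:smooth_prof.
have sB := smooth_cst.
rewrite /kK partial_scale;last first.
 apply:smooth_add;first by apply:smooth_mul => //;exact:smooth_lin.
 by apply:smooth_mul => //;exact:smooth_prof.
rewrite partialD;last 2 first.
- by apply:smooth_mul => //;exact:smooth_lin.
- by apply:smooth_mul => //;exact:smooth_prof.
rewrite partialM//;last exact:smooth_lin.
rewrite partialM//;last exact:smooth_prof.
rewrite [partial l (fun x => b (e ^- 2 * qform x) * _)]partialM//;last exact:smooth_prof.
rewrite partial_lin partial_cst (partial_prof _ _ db) (partial_prof _ _ db1).
do 2!(rewrite partial_scale;last by do ?apply:smooth_scale;exact:smooth_lin).
rewrite partial_lin;apply/funext => x;rewrite /kK1;ring.
Qed.

Lemma kK_sym e j k x : kK e j k x = kK e k j x.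
by rewrite /kK (Bsym j k);ring. Qed.

(** Since [A B = 1], contracting [lin k x] with [A] gives back [x], and the trace term gives [n];
    what remains is the relation [h = n b + 2 s b1] of the profile. *)
Lemma kK_trace (A : 'M[R]_n) e x : A *m B = 1%:M ->
 \sum_j \sum_k A j k * kK e j k x = kP e x.
move=> AB;have hE : forall s, h s = n%:R * b s + 2 * s * b1 s by have [_ []] := pr.
have ABE p l : \sum_i A p i * B i l = (p == l)%:R.
 by have := congr1 (fun M : 'M[R]_n => M p l) AB;rewrite !mxE.
have Alin j : \sum_k A j k * lin k x = x 0 j.
 rewrite /lin;under eq_bigr => k _ do rewrite mulr_sumr.
 rewrite exchange_big/= (bigD1 j)//= [X in _ + X]big1 ?addr0.
  rewrite (_ : \sum_(i < n) _ = (\sum_i A j i * B i j) * x 0 j).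
   by rewrite ABE eqxx mul1r.
  by rewrite mulr_suml;apply:eq_bigr => i _;rewrite mulrA.
 move=> l lj;rewrite (_ : \sum_(i < n) _ = (\sum_i A j i * B i l) * x 0 l).
  by rewrite ABE eq_sym (negbTE lj) mul0r.
 by rewrite mulr_suml;apply:eq_bigr => i _;rewrite mulrA.
have trAB : \sum_j \sum_k A j k * B j k = n%:R.
 rewrite (eq_bigr (fun=> 1)) ?sumr_const ?card_ord// => j _.
 under eq_bigr => k _ do rewrite Bsym.
 by rewrite ABE eqxx.
rewrite /kP hE -trAB /qform.
set s := e ^- 2 * _.
rewrite (eq_bigr (fun j => e ^- n * (b1 s * e ^- 2 * 2 * (x 0 j * lin j x) + b s * \sum_k A j k * B j k))).
 rewrite -mulr_sumr big_split/= -!mulr_sumr;congr (_ * _).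
 by rewrite /s /qform;set Q := \sum_i _;set t := \sum_j _;ring.
move=> j _;rewrite -{1}(Alin j) mulrDr mulr_suml.
rewrite [X in X + _]mulrA [X in _ + X]mulrA !mulr_sumr -big_split/=.
apply:eq_bigr => k _;rewrite /kK -/s;ring.
Qed.

End kernel.

(** * Kernel bounds uniform in the scale *)

Section kernel_bounds.
Variables (B : 'M[R]_n) (b b1 b2 h h1 : R -> R) (C c be bl : R).
Hypothesis pr : profile n b b1 b2 h h1 C c.
Hypothesis Bsym : forall i j, B i j = B j i.
Hypothesis Bbound : forall i j, `|B i j| <= be.
Hypothesis be0 : 0 <= be.
Hypothesis bl0 : 0 < bl.
Hypothesis Bl : forall x : V, bl * `|x| ^+ 2 <= qform B x.
Implicit Types (x u v : V) (e : R) (i j k l : 'I_n).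

Local Notation a := (- (n%:R / 2) : R).
Local Notation qform := (qform B).
Local Notation lin := (lin B).
Local Notation kK := (kK B b b1).
Local Notation kK1 := (kK1 B b1 b2).
Local Notation kP := (kP B h).
Local Notation kP1 := (kP1 B h1).
Local Notation kW := (kW B b).

Let C0 : 0 < C. Proof. by have [_ _ _ _ []] := pr. Qed.

Lemma lin_le i x : `|lin i x| <= n%:R * be * `|x|.
apply:le_trans (ler_norm_sum _ _ _) _.
rewrite (_ : n%:R * be * _ = \sum_(i < n) (be * `|x|));last first.
 by rewrite sumr_const card_ord -[RHS]mulr_natl mulrA.
by apply:ler_sum => j _;rewrite normrM;apply:ler_pM => //;exact:coord_le_norm.
Qed.

Lemma qform_gt0 x : x != 0 -> 0 < qform x.
by move=> x0;apply:lt_le_trans (Bl x);rewrite mulr_gt0// exprn_gt0// normr_gt0. Qed.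

Lemma qformB x y : qform x - qform y = \sum_i (x - y) 0 i * lin i (x + y).
have linD i u v : lin i (u + v) = lin i u + lin i v.
 by rewrite /lin -big_split/=;apply:eq_bigr => j _;rewrite mxE mulrDr.
have sy : \sum_i x 0 i * lin i y = \sum_i y 0 i * lin i x.
 rewrite /lin;under eq_bigr => i _ do rewrite mulr_sumr.
 under [RHS]eq_bigr => i _ do rewrite mulr_sumr.
 rewrite exchange_big/=;apply:eq_bigr => i _;apply:eq_bigr => j _.
 by rewrite Bsym;ring.
rewrite (eq_bigr (fun i => (x 0 i * lin i x - y 0 i * lin i y) + (x 0 i * lin i y - y 0 i * lin i x))).
 by rewrite big_split/= !big_split/= !sumrN sy subrr addr0.
by move=> i _;rewrite linD !mxE;ring.
Qed.

(** The exponent [-n/2] is the one for which the prefactor [e^-n] cancels, so that away from the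
    origin the kernel does not see the scale. *)
Lemma scale_powR e s : 0 < e -> 0 < s -> e ^- n * (e ^- 2 * s) `^ a = s `^ a.
move=> e0 s0;have e10 : 0 < e^-1 by pos.
rewrite powRM ?(ltW s0)//;last pos.
rewrite mulrA (_ : e ^- n * (e ^- 2) `^ a = 1) ?mul1r//.
have -> : e ^- 2 = e^-1 `^ 2 by rewrite powR_mulrn ?(ltW e10)// exprVn.
rewrite -powRrM (_ : 2 * a = - n%:R);last by field.
by rewrite powRN powR_mulrn ?(ltW e10)// exprVn mulfV// invr_eq0 expf_neq0// gt_eqF.
Qed.

Lemma profile_scale (F : R -> R) m e x : (forall s, 0 < s -> `|F s| <= C * s `^ (a - m%:R)) ->
 0 < e -> x != 0 ->
 e ^- n * (e ^- 2) ^+ m * `|F (e ^- 2 * qform x)| <=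
 C * bl `^ (a - m%:R) * `|x| ^- (n + 2 * m).
move=> hF e0 x0;have Q0 := qform_gt0 x0.
have e20 : 0 < e ^- 2 by pos.
have en0 : 0 < e ^- n by pos.
have s0 : 0 < e ^- 2 * qform x by pos.
have nx0 : 0 < `|x| by pos.
have pB (s : R) : 0 < s -> s `^ (a - m%:R) = s `^ a * s ^- m.
 move=> s1;rewrite powRD;last by rewrite (gt_eqF s1) implybT.
 by rewrite (powRN s m%:R) powR_mulrn ?(ltW s1).
apply:(le_via (C * qform x `^ (a - m%:R))).
 have := hF _ s0;rewrite !pB// => hF'.
 apply:(le_via (e ^- n * (e ^- 2) ^+ m * (C * ((e ^- 2 * qform x) `^ a * (e ^- 2 * qform x) ^- m)))).
  by apply:ler_wpM2l => //;rewrite mulr_ge0 ?exprn_ge0// ltW.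
 rewrite -(scale_powR e0 Q0).
 have := lt0r_neq0 e20;move: (e ^- 2) => t t0.
 rewrite exprMn invfM;have := expf_neq0 m t0.
 move: (_ `^ _) (e ^- n) (t ^+ m) (qform x ^- m) => p q r s r0.
 by apply:le_of_eq;field.
rewrite -mulrA;apply:ler_wpM2l;first exact:ltW.
apply:(le_via ((bl * `|x| ^+ 2) `^ (a - m%:R))).
 rewrite (_ : a - m%:R = - (n%:R / 2 + m%:R));last by ring.
 rewrite (powRN (qform x)) (powRN (bl * _)).
 rewrite lef_pV2 ?posrE ?powR_gt0 ?mulr_gt0 ?exprn_gt0//.
 apply:ge0_ler_powR;rewrite ?nnegrE ?mulr_ge0 ?exprn_ge0 ?(ltW bl0) ?(ltW Q0)//.
rewrite powRM ?exprn_ge0 ?(ltW bl0)//.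
apply:le_of_eq;congr (_ * _).
rewrite -powR_mulrn// -powRrM (_ : 2 * _ = - (n + 2 * m)%:R).
 by rewrite powRN powR_mulrn.
by rewrite natrD natrM;field.
Qed.

Definition kD : R := C * (bl `^ (a - 0%:R) + bl `^ (a - 1%:R) + bl `^ (a - 2%:R)).

Lemma kD_ge0 : 0 <= kD.
by rewrite mulr_ge0 ?(ltW C0)// !addr_ge0// powR_ge0. Qed.

Lemma profile_bounds e x : 0 < e -> x != 0 ->
 let s := e ^- 2 * qform x in
 [/\ e ^- n * `|b s| <= kD * `|x| ^- n,
   e ^- n * e ^- 2 * `|b1 s| <= kD * `|x| ^- n * `|x| ^- 2 &
   e ^- n * (e ^- 2) ^+ 2 * `|b2 s| <= kD * `|x| ^- n * (`|x| ^- 2) ^+ 2].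
move=> e0 x0;have [_ _ [_ _ hb hb1 hb2] _ _] := pr.
have k m : C * bl `^ (a - m%:R) * `|x| ^- (n + 2 * m) = C * bl `^ (a - m%:R) * (`|x| ^- n * (`|x| ^- 2) ^+ m).
 by rewrite exprD invfM exprM exprVn.
have w m : (m <= 2)%N -> C * bl `^ (a - m%:R) <= kD.
 move=> m2;rewrite /kD ler_wpM2l ?(ltW C0)//.
 have := powR_ge0 bl (a - 0%:R);have := powR_ge0 bl (a - 1%:R);have := powR_ge0 bl (a - 2%:R).
 by case: m m2 => [|[|[|]]]// _;lra.
have X m : 0 <= `|x| ^- n * (`|x| ^- 2) ^+ m by pos.
split.
- have := @profile_scale b 0 e x;rewrite k expr0 !mulr1 subr0 => /(_ hb e0 x0) => h'.
 apply:(le_trans h');rewrite ler_wpM2r ?invr_ge0 ?exprn_ge0//.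
 by have := w 0%N;rewrite subr0;exact.
- have := @profile_scale b1 1 e x;rewrite k !expr1 => /(_ hb1 e0 x0) h'.
 by apply:(le_trans h');rewrite -[leRHS]mulrA;apply:ler_wpM2r;[have := X 1%N;rewrite expr1|exact:(w 1%N)].
- have := @profile_scale b2 2 e x;rewrite k => /(_ hb2 e0 x0) h'.
 by apply:(le_trans h');rewrite -[leRHS]mulrA;apply:ler_wpM2r;[exact:X|exact:(w 2%N)].
Qed.

Definition kA1 : R := kD * (4 * (n%:R * be) ^+ 3 + 6 * (be * (n%:R * be))).

Lemma kA1_ge0 : 0 <= kA1.
by rewrite mulr_ge0 ?kD_ge0// addr_ge0// !mulr_ge0// exprn_ge0.
Qed.

Lemma kK1_bound e j k l x : 0 < e -> x != 0 -> `|kK1 e j k l x| <= kA1 * `|x| ^- n.+1.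
move=> e0 x0;have [h0 h1' h2'] := profile_bounds e0 x0.
set s := e ^- 2 * qform x in h0 h1' h2'.
have nx0 : 0 < `|x| by pos.
have e20 : 0 <= e ^- 2 by pos.
have en0 : 0 <= e ^- n by pos.
have one (P Q S : 'I_n) : `|e ^- n * (b1 s * (e ^- 2 * (2 * lin P x)) * B Q S)| <=
  kD * `|x| ^- n.+1 * (2 * (be * (n%:R * be))).
 rewrite !normrM !(ger0_norm en0) !(ger0_norm e20) (@ger0_norm _ 2)//.
 rewrite (_ : _ * _ = e ^- n * e ^- 2 * `|b1 s| * (2 * (`|B Q S| * `|lin P x|)));last by ring.
 apply:(le_via (kD * `|x| ^- n * `|x| ^- 2 * (2 * (be * (n%:R * be * `|x|))))).
  apply:ler_pM => //;rewrite ?mulr_ge0//.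
  by apply:ler_wpM2l => //;apply:ler_pM => //;exact:lin_le.
 apply:le_of_eq;rewrite (exprVnS _ n).
 move: (`|x| ^- n) nx0 => p nx0;have nx0' : `|x| != 0 by pos.
 by field.
have two : `|e ^- n * (b2 s * (e ^- 2 * (2 * lin l x)) * (e ^- 2 * (2 * lin k x)) * lin j x)| <=
  kD * `|x| ^- n.+1 * (4 * (n%:R * be) ^+ 3).
 rewrite !normrM !(ger0_norm en0) !(ger0_norm e20) (@ger0_norm _ 2)//.
 rewrite (_ : _ * _ = e ^- n * (e ^- 2) ^+ 2 * `|b2 s| * (4 * (`|lin l x| * `|lin k x| * `|lin j x|)));last by ring.
 apply:(le_via (kD * `|x| ^- n * (`|x| ^- 2) ^+ 2 * (4 * ((n%:R * be * `|x|) * (n%:R * be * `|x|) * (n%:R * be * `|x|))))).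
  apply:ler_pM => //;rewrite ?mulr_ge0 ?exprn_ge0//.
  apply:ler_wpM2l => //;apply:ler_pM => //;rewrite ?mulr_ge0 ?lin_le//.
  by apply:ler_pM => //;exact:lin_le.
 apply:le_of_eq;rewrite (exprVnS _ n).
 move: (`|x| ^- n) nx0 => p nx0;have nx0' : `|x| != 0 by pos.
 by field.
rewrite /kK1 -/s !mulrDr.
rewrite (_ : e ^- n * (b1 s * (e ^- 2 * (2 * B k l)) * lin j x) = e ^- n * (b1 s * (e ^- 2 * (2 * lin j x)) * B k l));last by ring.
rewrite (_ : kA1 * _ = kD * `|x| ^- n.+1 * (4 * (n%:R * be) ^+ 3) + kD * `|x| ^- n.+1 * (2 * (be * (n%:R * be)))
 + kD * `|x| ^- n.+1 * (2 * (be * (n%:R * be))) + kD * `|x| ^- n.+1 * (2 * (be * (n%:R * be))));last by rewrite /kA1;ring.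
do 3!(apply:le_trans (ler_normD _ _) _;apply:lerD => //).
Qed.

Definition kL : R := n%:R * kA1 * 2 ^+ n.+1.

Lemma kL_ge0 : 0 <= kL.
by rewrite mulr_ge0 ?exprn_ge0// mulr_ge0// kA1_ge0. Qed.

(** Mean value theorem along the segment from [v] to [u], which stays at distance at least [|v| / 2]
    from the origin; this is the factor [2^(n+1)] in [kL]. *)
Lemma kK_lipschitz e j k u v : 0 < e -> v != 0 -> `|u - v| <= `|v| / 2 ->
 `|kK e j k u - kK e j k v| <= kL * `|u - v| * `|v| ^- n.+1.
move=> e0 v0 uv;have nv0 : 0 < `|v| by pos.
have hM : forall (t : R) i, 0 < t < 1 ->
  `|partial i (kK e j k) (v + t *: (u - v))| <= kA1 * (`|v| / 2) ^- n.+1;last first.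
 apply:le_trans (mean_value (smooth_kK B pr e j k) hM) _.
 apply:le_of_eq.
 by rewrite /kL expr_div_n invf_div;ring.
 move=> t i /andP[t0 t1];rewrite (partial_kK pr Bsym).
 have vt : `|v| / 2 <= `|v + t *: (u - v)|.
  have := ler_normB (v + t *: (u - v)) (t *: (u - v)).
  rewrite addrK normrZ (gtr0_norm t0) => h'.
  have : t * `|u - v| <= `|v| / 2 by rewrite (le_trans _ uv)// ler_piMl// ltW.
  by lra.
 have w0 : 0 < `|v + t *: (u - v)| by apply:lt_le_trans vt;rewrite divr_gt0.
 apply:le_trans (kK1_bound _ _ _ _ _) _;rewrite -?normr_gt0//.
 apply:ler_wpM2l;first exact:kA1_ge0.
 by rewrite lef_pV2 ?posrE ?exprn_gt0 ?divr_gt0// lerXn2r ?nnegrE ?divr_ge0.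
Qed.

(** Beyond [kS e] the rescaled form exceeds 2, the end of the transition zone of the profile. *)
Definition kS : R := Num.sqrt (2 / bl).

Lemma kS_gt0 : 0 < kS.
by rewrite sqrtr_gt0 divr_gt0. Qed.

Lemma qform_large e x : 0 < e -> kS * e < `|x| -> 2 < e ^- 2 * qform x.
move=> e0 xe;have e20 : 0 < e ^+ 2 by pos.
rewrite -(@ltr_pM2l _ (e ^+ 2))// mulrA divff ?gt_eqF// mul1r.
apply:lt_le_trans (Bl x).
have S2 : bl * kS ^+ 2 = 2 by rewrite sqr_sqrtr ?divr_ge0 ?(ltW bl0)// mulrC divfK// gt_eqF.
have : (kS * e) ^+ 2 < `|x| ^+ 2.
 by rewrite ltrXn2r// ?nnegrE// mulr_ge0 ?(ltW e0) ?(ltW kS_gt0).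
rewrite -(ltr_pM2l bl0);apply:le_lt_trans.
by rewrite exprMn mulrA S2 mulrC.
Qed.

Lemma kP_ge0 e x : 0 < e -> 0 <= kP e x.
move=> e0;have [_ _ _ [/(_ (e ^- 2 * qform x))/andP[h0 _] _ _ _ _] _] := pr.
by rewrite mulr_ge0// invr_ge0 exprn_ge0// ltW.
Qed.

Lemma kP_le e x : 0 < e -> kP e x <= C * e ^- n.
move=> e0;have [_ _ _ [/(_ (e ^- 2 * qform x))/andP[_ h0] _ _ _ _] _] := pr.
by rewrite /kP [leLHS]mulrC;apply:ler_wpM2r => //;rewrite invr_ge0 exprn_ge0// ltW.
Qed.

Lemma kP_out e x : 0 < e -> kS * e < `|x| -> kP e x = 0.
move=> e0 xe;have [_ _ _ [_ _ _ h2 _] _] := pr.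
by rewrite /kP h2 ?mulr0// ltW// qform_large.
Qed.

Lemma kP1_le e k x : 0 < e -> `|kP1 e k x| <= (2 * C * (n%:R * be) * kS) * e ^- n.+1.
move=> e0;have [_ _ _ [_ hh1 _ h2 _] _] := pr.
have Y := mulr_ge0 (ler0n R n) be0.
have S0 := ltW kS_gt0.
have en0 : 0 <= e ^- n by pos.
have e20 : 0 <= e ^- 2 by pos.
have [xe|xe] := ltP (kS * e) `|x|.
 have <- : partial k (kP e) x = kP1 e k x by rewrite (partial_kP pr Bsym).
 suff -> : partial k (kP e) x = 0.
  by rewrite normr0 !mulr_ge0 ?(ltW C0)// invr_ge0 exprn_ge0// ltW.
 have <- := congr1 (fun f => f x) (partial_cst (0 : R) k).
 apply:near_eq_derive;apply:(@filterS _ _ _ [set y : V | kS * e < `|y|]).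
  by move=> y /= ye;rewrite kP_out.
 apply:open_nbhs_nbhs;split => //.
 have c' := norm_continuous.
 by apply:(@open_comp _ _ (fun x => `|x|) [set y | kS * e < y]) => [y _|];[exact:c'|exact:open_gt].
rewrite /kP1 !normrM (ger0_norm en0) (ger0_norm e20) (@ger0_norm _ 2)//.
apply:(le_via (e ^- n * (C * (e ^- 2 * (2 * (n%:R * be * (kS * e))))))).
 apply:ler_wpM2l => //;apply:ler_pM => //;first pos.
 do 2!apply:ler_wpM2l => //;apply:le_trans (lin_le _ _) _.
 exact:ler_wpM2l.
apply:le_of_eq;rewrite (exprVnS _ n).
have : e != 0 by pos.
by move: (e ^- n) => p e1;field.
Qed.

Lemma kW_out e j x : 0 < e -> kS * e < `|x| -> kW e j x = qform x `^ a * lin j x.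
move=> e0 xe;have [_ _ [_ hb _ _ _] _ _] := pr.
have hq := qform_large e0 xe.
have x0 : x != 0.
 by rewrite -normr_gt0 (le_lt_trans _ xe)// mulr_ge0 ?(ltW e0)// ltW// kS_gt0.
by rewrite /kW hb ?(ltW hq)// mulrA scale_powR// qform_gt0.
Qed.

(** Beyond the larger scale both fields are the exact homogeneous one, so the difference of two
    scales has compact support. *)
Lemma kW_eq e1 e2 j x : 0 < e1 -> e1 <= e2 -> kS * e2 < `|x| -> kW e1 j x = kW e2 j x.
move=> e10 e12 xe;rewrite !kW_out// ?(lt_le_trans e10 e12)//.
by apply:le_lt_trans xe;rewrite ler_wpM2l// ltW// kS_gt0.
Qed.

Lemma kK_diff_lipschitz e1 e2 j k u v : 0 < e1 -> 0 < e2 -> v != 0 -> `|u - v| <= `|v| / 2 ->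
 `|(kK e1 j k u - kK e2 j k u) - (kK e1 j k v - kK e2 j k v)| <= 2 * kL * `|u - v| * `|v| ^- n.+1.
move=> e10 e20 v0 uv.
rewrite (_ : _ - _ = (kK e1 j k u - kK e1 j k v) - (kK e2 j k u - kK e2 j k v));last by ring.
apply:le_trans (ler_normB _ _) _.
rewrite (_ : 2 * kL * _ * _ = kL * `|u - v| * `|v| ^- n.+1 + kL * `|u - v| * `|v| ^- n.+1);last by ring.
by apply:lerD;exact:kK_lipschitz.
Qed.

(** Radius, relative to [e], on which the form deviates by at most [e^2 / 6] from the value
    [3/2 e^2], so that the profile stays in the zone [[4/3, 5/3]]. *)
Definition kR : R := (6 * (1 + (n%:R * (n%:R * be)) * (2 * Num.sqrt (3 / 2 / bl) + 1)))^-1.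

Lemma kR_gt0 : 0 < kR.
by rewrite invr_gt0 mulr_gt0// ltr_wpDr// !mulr_ge0// addr_ge0// mulr_ge0// sqrtr_ge0.
Qed.

(* On the ray through the first coordinate vector, qform takes the value
  3/2 e^2, the middle of the region where the profile is bounded below. *)
Lemma kP_bulk e : (0 < n)%N -> 0 < e ->
 exists z : V, forall x, `|x - z| <= kR * e -> c * e ^- n <= kP e x.
move=> n0 e0;pose i0 := Ordinal n0.
pose E0 : V := delta_mx 0 i0.
have nE0 : `|E0| = 1.
 apply/eqP;rewrite eq_le;apply/andP;split.
  by apply/norm_leP => // j;rewrite mxE eqxx/=;case: (_ == _);rewrite ?normr1 ?normr0.
 by have := coord_le_norm E0 i0;rewrite !mxE !eqxx normr1.
have Q0 : 0 < qform E0 by apply:qform_gt0;rewrite -normr_gt0 nE0.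
have bQ : bl <= qform E0 by have := Bl E0;rewrite nE0 expr1n mulr1.
pose tau := Num.sqrt (3 / 2 / qform E0).
have tau0 : 0 <= tau by rewrite sqrtr_ge0.
have tau2 : tau ^+ 2 * qform E0 = 3 / 2 by rewrite sqr_sqrtr ?divfK// ?gt_eqF// divr_ge0// ltW.
have taub : tau <= Num.sqrt (3 / 2 / bl) by rewrite ler_sqrt ?ler_pM2l ?lef_pV2 ?posrE ?divr_gt0// ?divr_ge0// ltW.
pose z := (tau * e) *: E0;exists z => x xz.
have nz : `|z| = tau * e by rewrite normrZ nE0 mulr1 ger0_norm// mulr_ge0// ltW.
have Qz : qform z = e ^+ 2 * (3 / 2).
 have linZ i (t : R) y : lin i (t *: y) = t * lin i y.
  by rewrite /lin mulr_sumr;apply:eq_bigr => j _;rewrite mxE mulrCA.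
 rewrite -tau2 /z /qform !mulr_sumr;apply:eq_bigr => i _.
 by rewrite linZ mxE;ring.
have kR0 := kR_gt0.
have nn0 : (0 : R) <= n%:R * (n%:R * be) by rewrite !mulr_ge0.
have Qx : `|qform x - qform z| <= e ^+ 2 * (1 / 6).
 rewrite qformB;apply:le_trans (ler_norm_sum _ _ _) _.
 have nxz : `|x + z| <= (2 * tau + 1) * e.
  rewrite (_ : x + z = (x - z) + (z + z));last by rewrite addrA subrK.
  apply:le_trans (ler_normD _ _) _;have := ler_normD z z;rewrite nz.
  have : kR <= 1.
   rewrite invf_le1//;last by rewrite -invr_gt0.
   have h0 : 0 <= 2 * Num.sqrt (3 / 2 / bl) + 1 by rewrite addr_ge0 ?mulr_ge0 ?sqrtr_ge0.
   by have := mulr_ge0 nn0 h0;lra.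
  by nra.
 apply:(le_via (\sum_(i < n) (kR * e * (n%:R * be * ((2 * tau + 1) * e))))).
  apply:ler_sum => i _;rewrite normrM;apply:ler_pM => //.
   by apply:le_trans (coord_le_norm _ _) _.
  by apply:le_trans (lin_le _ _) _;apply:ler_wpM2l => //;rewrite mulr_ge0.
 rewrite sumr_const card_ord -[leLHS]mulr_natl.
 rewrite (_ : _ * _ = e ^+ 2 * (kR * (n%:R * (n%:R * be) * (2 * tau + 1))));last by ring.
 apply:ler_wpM2l;first by rewrite exprn_ge0// ltW.
 rewrite mulrC -ler_pdivlMr// /kR invrK.
 have : n%:R * (n%:R * be) * (2 * tau + 1) <= n%:R * (n%:R * be) * (2 * Num.sqrt (3 / 2 / bl) + 1).
  by apply:ler_wpM2l => //;lra.
 by lra.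
have [_ _ _ [_ _ _ _ hc] _] := pr.
rewrite /kP mulrC;apply:ler_wpM2l;first by rewrite invr_ge0 exprn_ge0// ltW.
have e20 : 0 < e ^+ 2 by rewrite exprn_gt0.
apply:hc;rewrite [e ^- 2 * _]mulrC ler_pdivlMr// ler_pdivrMr//.
move: Qx;rewrite Qz ler_norml => /andP[q1 q2].
by apply/andP;split;lra.
Qed.

End kernel_bounds.

(** * Convolutions and their measurability *)

Section convolution.
Implicit Types (f g k : V -> R).

Lemma measurable_sub_coord (i : 'I_n) :
 mfun (fun z : E * E => (z.1 : V) 0 i - (z.2 : V) 0 i).
apply:measurable_funB.
- exact:(mT_comp (@measurable_coordE R n setT i) measurable_fst).
- exact:(mT_comp (@measurable_coordE R n setT i) measurable_snd).
Qed.

(** Measurability is wanted for a product of completed sigma-algebras, which is not generated by a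
    topology; open sets are therefore resolved into countably many rational boxes, coordinate by
    coordinate. *)
Lemma measurable_coords_open d (T : measurableType d) (m : T -> V) (U : set V) :
 (forall i, mfun (fun t => m t 0 i)) -> open U ->
 measurable [set t : T | U (m t)].
move=> mm /open_rational_cover UE.
pose D := [set z : 'rV[rat]_n * nat | ball (map_mx ratr z.1 : V) z.2.+1%:R^-1 `<=` U].
pose G (p : 'rV[rat]_n * nat) := [set t : T | D p /\
 ball (map_mx ratr p.1 : V) p.2.+1%:R^-1 (m t)].
rewrite (_ : [set t : T | _] = \bigcup_p G p);last first.
 rewrite UE;apply/seteqP;split=> z /=.
  by move=> [p Dp zp];exists p.
 by move=> [p _ [Dp zp]];exists p.
apply:countable_bigcup_measurable => p;have [Dp|nDp] := pselect (D p);last first.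
 rewrite (_ : G p = set0);first exact:measurable0.
 by apply/seteqP;split=> // z [].
pose C (i : 'I_n) := [set t : T | m t 0 i \in
  `](map_mx ratr p.1 : V) 0 i - p.2.+1%:R^-1, (map_mx ratr p.1 : V) 0 i + p.2.+1%:R^-1[].
rewrite (_ : G p = \bigcap_(i in [set: 'I_n]) C i);last first.
 apply/seteqP;split=> z /=.
  by move=> [_];rewrite ball_box// => h i _;have := h i;rewrite /C/= !mxE.
 by move=> h;split=> //;rewrite ball_box// => i;have := h i I;rewrite /C/= !mxE.
apply:fin_bigcap_measurable => [|i _];first exact:finite_finset.
have h := mm i measurableT _ (measurable_itv
 `](map_mx ratr p.1 : V) 0 i - p.2.+1%:R^-1, (map_mx ratr p.1 : V) 0 i + p.2.+1%:R^-1[).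
by rewrite setTI in h;exact:h.
Qed.

Lemma measurable_coords_comp d (T : measurableType d) (m : T -> V) k :
 (forall i, mfun (fun t => m t 0 i)) -> continuous k ->
 mfun (fun t => k (m t)).
move=> mm ck mT;apply:(measurability (@RGenOInfty.G R)).
 exact:RGenOInfty.measurableE.
move=> _ [_ [a ->] <-];rewrite setTI.
apply:(measurable_coords_open (U := k @^-1` `]a, +oo[%classic) mm).
by apply:open_comp;[move=> x _;exact:ck|exact:interval_open].
exact:mT.
Qed.

Lemma measurable_sub_comp k : continuous k ->
 mfun (fun z : E * E => k ((z.1 : V) - (z.2 : V))).
move=> ck;apply:(measurable_coords_comp (m := fun z : E * E => (z.1 : V) - (z.2 : V))) => // i.
rewrite (_ : (fun _ => _) = fun z : E * E => (z.1 : V) 0 i - (z.2 : V) 0 i).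
 exact:measurable_sub_coord.
by apply/funext => z;rewrite !mxE.
Qed.

Lemma leb_swap (F : E -> E -> R) (a b : E -> R) :
 mfun (fun z : E * E => F z.1 z.2) ->
 (forall x y, `|F x y| <= a x * b y) -> Lint a -> Lint b ->
 (Lint (fun x => ig (F x)) /\ Lint (fun y => ig (F^~ y))) /\
 ig (fun x => ig (F x)) = ig (fun y => ig (F^~ y)).
move=> mF Fab ai bi.
have mF' : mfun (fun z : E * E => F z.2 z.1).
 have ms : mfun (fun z : E * E => (z.2, z.1)).
  by apply:measurable_fun_pair;[exact:measurable_snd|exact:measurable_fst].
 exact:(mT_comp mF ms).
have Fab' y x : `|F x y| <= b y * a x by rewrite mulrC.
split;last exact:(ig_swap mF Fab ai bi).
split;first exact:(swap_Lint mF Fab ai bi).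
exact:(swap_Lint (F := fun y x => F x y) mF' Fab' bi ai).
Qed.

Lemma leb_Lint (F : E -> E -> R) (a b : E -> R) :
 mfun (fun z : E * E => F z.1 z.2) ->
 (forall x y, `|F x y| <= a x * b y) -> Lint a -> Lint b ->
 (forall x, Lint (F x)) /\ (forall y, Lint (F^~ y)).
move=> mF Fab ai bi;split=> [x|y];first exact:(swap_Lint1 mF Fab bi).
exact:(swap_Lint2 mF Fab ai).
Qed.

Definition conv k g (x : V) : R := ig (fun y : E => g y * k (x - y)).

Section conv_facts.
Variables (k : V -> R) (M : R).
Hypothesis ck : continuous k.
Hypothesis kM : forall x, `|k x| <= M.

Lemma measurable_reflect x : mfun (fun y : E => k (x - (y : V))).
exact:(mT_comp (measurable_sub_comp ck) (measurable_pair1 (x : E))). Qed.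

Lemma measurable_translate y : mfun (fun x : E => k ((x : V) - y)).
exact:(mT_comp (measurable_sub_comp ck) (measurable_pair2 (y : E))). Qed.

Lemma Lint_conv g x : Lint g -> Lint (fun y : E => g y * k (x - (y : V))).
by move=> gi;apply:(Lint_mulb gi (measurable_reflect x) (fun=> kM _)). Qed.

Lemma conv_swap f g : Lint f -> Lint g ->
 [/\ Lint (fun x : E => f x * conv k g x),
   Lint (fun y : E => g y * ig (fun x : E => f x * k ((x : V) - (y : V)))) &
 ig (fun x : E => f x * conv k g x) = ig (fun y : E => g y * ig (fun x : E => f x * k ((x : V) - (y : V))))].
move=> fi gi.
pose F (x y : E) : R := f x * (g y * k ((x : V) - (y : V))).
have mF : mfun (fun z : E * E => F z.1 z.2).
 apply:mfunM;first exact:(mT_comp (Lint_meas fi) measurable_fst).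
 apply:mfunM;first exact:(mT_comp (Lint_meas gi) measurable_snd).
 exact:measurable_sub_comp.
have FM x y : `|F x y| <= `|f x| * (M * `|g y|).
 by rewrite /F !normrM ler_wpM2l// mulrC ler_wpM2r.
have ai := Lint_abs fi.
have bi : Lint (fun y => M * `|g y|) by apply:LintZ;exact:Lint_abs.
have E1 x : ig (F x) = f x * conv k g x by rewrite /F igZ//;exact:Lint_conv.
have fk y : Lint (fun x => f x * k (x - (y : V))).
 exact:(Lint_mulb fi (measurable_translate y) (fun=> kM _)).
have E2 y : ig (F^~ y) = g y * ig (fun x => f x * k (x - y)).
 by rewrite -igZ//;congr ig;apply/funext => x;rewrite /F mulrCA.
have [s1 s2] := leb_swap mF FM ai bi.
rewrite (_ : (fun x => ig (F x)) = (fun x => f x * conv k g x)) in s1 s2;last exact/funext.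
rewrite (_ : (fun y => ig (F^~ y)) = (fun y => g y * ig (fun x => f x * k (x - y)))) in s1 s2;last exact/funext.
by case: s1 => s1 s1';split;[exact:s1|exact:s1'|exact:s2].
Qed.

End conv_facts.

End convolution.

(** * Compact support and integrals of derivatives *)

Section compact_support.
Implicit Types (f g a b : V -> R) (x y : V).

Definition csupp f := exists2 N : R, 0 < N & forall x, N < `|x| -> f x = 0.

Definition cbf f := [/\ mfun (f : E -> R),
 exists M, forall x, `|f x| <= M & csupp f].

Lemma csuppMl f g : csupp f -> csupp (fun x => f x * g x).
by move=> [N N0 fN];exists N => // x /fN ->;rewrite mul0r. Qed.

Lemma csuppD f g : csupp f -> csupp g -> csupp (fun x => f x + g x).
move=> [N N0 fN] [N' N0' gN];exists (Num.max N N');first by rewrite lt_max N0.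
by move=> x;rewrite gt_max => /andP[/fN -> /gN ->];rewrite addr0.
Qed.

Lemma csuppZ c f : csupp f -> csupp (fun x => c * f x).
by move=> [N N0 fN];exists N => // x /fN ->;rewrite mulr0. Qed.

Lemma csupp_translate f y : csupp f -> csupp (fun x => f (x - y)).
move=> [N N0 fN];exists (N + `|y|);first pos.
move=> x xN;apply:fN;apply:lt_le_trans (lerB_dist _ _).
by rewrite ltrBrDr.
Qed.

Lemma csupp_sum m (F : 'I_m -> V -> R) : (forall i, csupp (F i)) -> csupp (fun x => \sum_i F i x).
elim: m F => [|m IH] F sF.
 by exists 1 => // x _;rewrite big_ord0.
rewrite (_ : (fun _ => _) = fun x => \sum_(i < m) F (widen_ord (leqnSn m) i) x + F ord_max x).
 by apply:csuppD => //;exact:IH.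
by apply/funext => x;rewrite big_ord_recr.
Qed.

Lemma csupp_partial f (i : 'I_n) : csupp f -> csupp (partial i f).
move=> [N N0 fN];exists N => // x xN.
have <- := congr1 (fun f => f x) (partial_cst (0 : R) i).
apply:near_eq_derive;apply:(@filterS _ _ _ [set y : V | N < `|y|]).
 by move=> y /= ye;rewrite fN.
apply:open_nbhs_nbhs;split => //.
have c' := norm_continuous.
by apply:(@open_comp _ _ (fun x => `|x|) [set y | N < y]) => [y _|];[exact:c'|exact:open_gt].
Qed.

Lemma cbfP f : cbf f -> Lint f.
move=> [mf [M fM] [N N0 fN]].
have N10 : 0 < N + 1 by pos.
pose B : set E := ball (0 : V) (N + 1).
have mB : measurable B by exact/open_meas/ball_open.
have Boo : (mu B < +oo)%E by rewrite mu_ball// ltry.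
have [Bi _] := Lint_indic_lty mB Boo.
apply:(Lint_dom mf _ (LintZ M Bi)) => x;rewrite indicE.
have [xB|xB] := boolP (x \in B);first by rewrite mulr1.
rewrite mulr0 fN ?normr0// ltNge;apply:contra xB => xN;rewrite inE.
by apply/ballP;rewrite subr0 (le_lt_trans xN)// ltrDl.
Qed.

Lemma csupp_bounded f : continuous f -> csupp f -> exists M, forall x, `|f x| <= M.
move=> cf [N N0 fN].
have cB : compact [set x : V | `|x| <= N].
 apply:bounded_closed_compact.
  exists N;split;first exact:num_real.
  by move=> M NM x /= xN;rewrite (le_trans xN)// ltW.
 by apply:(@closed_comp _ _ (fun x => `|x|) [set y | y <= N]) => [x _|];[exact:norm_continuous|exact:closed_le].
have cn : {within [set x : V | `|x| <= N], continuous (fun x => `|f x|)}.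
 by apply:continuous_subspaceT => x;apply:(continuous_comp (cf x));exact:norm_continuous.
have [|c _ hc] := EVT_max_rV _ cB cn;first by exists 0;rewrite /= normr0 ltW.
exists (`|f c|) => x;have [xN|xN] := ltP N `|x|;first by rewrite fN// normr0.
by apply:hc;rewrite inE.
Qed.

Lemma cbf_continuous f : continuous f -> csupp f -> cbf f.
move=> cf sf;split=> //;last exact:csupp_bounded.
exact:cont_meas.
Qed.

Lemma cbf_smooth f : smooth f -> csupp f -> cbf f.
by move=> sf cf;apply:cbf_continuous => //;exact:smooth_cont. Qed.

Lemma cbfM f g : cbf f -> cbf g -> cbf (fun x => f x * g x).
move=> [mf [M fM] sf] [mg [M' gM] sg];split;first exact:mfunM.
 by exists (M * M') => x;rewrite normrM;apply:ler_pM.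
exact:csuppMl.
Qed.

Lemma cbf_abs f : cbf f -> cbf (fun x => `|f x|).
move=> [mf [M fM] [N N0 fN]];split;first exact:mT_comp.
 by exists M => x;rewrite normr_id.
by exists N => // x /fN ->;rewrite normr0.
Qed.

Lemma smooth_lipschitz f : smooth f -> csupp f -> exists2 L, 0 <= L & forall x y, `|f x - f y| <= L * `|x - y|.
move=> sf cf.
have h i : exists M, forall x, `|partial i f x| <= M.
 by apply:csupp_bounded;[apply:smooth_cont;exact:smooth_partial|exact:csupp_partial].
pose M i := sval (cid (h i)).
have M0 i : 0 <= M i by apply:le_trans (svalP (cid (h i)) 0).
exists (n%:R * \sum_i M i);first by rewrite mulr_ge0// sumr_ge0.
move=> x y;apply:mean_value => // t i _.
apply:le_trans (svalP (cid (h i)) _) _.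
by rewrite (bigD1 i)//= lerDl sumr_ge0.
Qed.

Lemma smooth_translate f y : smooth f -> smooth (fun x => f (x - y)).
elim=> {f}.
- by move=> c;exact:smooth_cst.
- move=> i;rewrite (_ : (fun _ => _) = fun x => x 0 i - y 0 i).
  by apply:smooth_sub;[exact:smooth_coord|exact:smooth_cst].
 by apply/funext => x;rewrite !mxE.
- by move=> f g _ sf _ sg;exact:smooth_add.
- by move=> f g _ sf _ sg;exact:smooth_mul.
- by move=> F f sF _ sf;exact:smooth_comp.
Qed.

Lemma partial_translate f y (i : 'I_n) : partial i (fun x => f (x - y)) = fun x => partial i f (x - y).
apply/funext => x;rewrite /partial /derive.
rewrite (_ : (fun h => h^-1 *: (((fun x => f (x - y)) \o shift x) (h *: delta_mx 0 i) - f (x - y))) =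
 (fun h : R => h^-1 *: ((f \o shift (x - y)) (h *: delta_mx 0 i) - f (x - y))))//.
by apply/funext => h;rewrite /= addrA.
Qed.

Let comm4 (p a d b g c e h : R) :
 p * a + d * b + (g * c + e * h) = p * a + h * e + (g * c + b * d).
ring. Qed.

Let comm3 (a b c d e : R) : a * b + c * (d * e) = a * b + e * (d * c).
ring. Qed.

(** Mixed derivatives are compared through their explicit formulas, by induction on the construction
    of [f]. *)
Lemma partial_comm f (i j : 'I_n) : smooth f -> partial i (partial j f) = partial j (partial i f).
elim=> {f}.
- by move=> c;pos.
- by move=> k;rewrite !partial_coord !partial_cst.
- move=> f g sf hf sg hg.
 rewrite (partialD j sf sg) (partialD i sf sg).
 rewrite (partialD i (smooth_partial j sf) (smooth_partial j sg)).
 by rewrite (partialD j (smooth_partial i sf) (smooth_partial i sg)) hf hg.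
- move=> f g sf hf sg hg.
 have [fi fj] := (smooth_partial i sf, smooth_partial j sf).
 have [gi gj] := (smooth_partial i sg, smooth_partial j sg).
 rewrite (partialM j sf sg) (partialM i sf sg).
 rewrite (partialD i (smooth_mul sf gj) (smooth_mul sg fj)).
 rewrite (partialD j (smooth_mul sf gi) (smooth_mul sg fi)).
 rewrite (partialM i sf gj) (partialM i sg fj) (partialM j sf gi) (partialM j sg fi).
 by rewrite hf hg;apply/funext => x;exact:comm4.
- move=> F f sF sf hf;have [dF sdF hF] := smooth1_derive sF.
 have [d2F sd2F h2F] := smooth1_derive sdF.
 have [fi fj] := (smooth_partial i sf, smooth_partial j sf).
 rewrite (partial_comp j sf hF) (partial_comp i sf hF).
 have s1 : smooth (fun x => dF (f x)) by exact:smooth_comp.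
 rewrite (partialM i s1 fj) (partialM j s1 fi).
 by rewrite (partial_comp i sf h2F) (partial_comp j sf h2F) hf;apply/funext => x;exact:comm3.
Qed.

Lemma ig_shift f (v : V) : Lint f -> ig (fun x : E => f ((x : V) + v)) = ig f.
move=> fi;have mf := Lint_meas fi.
have mfe : mfun (fun x : E => (f x)%:E) by exact/measurable_EFinP.
have mp : mfun ((fun x : E => (f x)%:E)^\+)%E by exact:measurable_funepos.
have mn : mfun ((fun x : E => (f x)%:E)^\-)%E by exact:measurable_funeneg.
rewrite /ig /Rintegral;congr fine;rewrite integralE [RHS]integralE.
have := @ge0_integral_shiftE R n v _ mp (funepos_ge0 _).
have := @ge0_integral_shiftE R n v _ mn (funeneg_ge0 _).
rewrite -[fun x0 => (f (x0 + v))%:E]/((fun x0 : E => (f x0)%:E) \o (fun x : E => (x : V) + v)).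
pose sh (x : E) : E := (x : V) + v.
by rewrite (funepos_comp (fun x0 => (f x0)%:E) sh) (funeneg_comp (fun x0 => (f x0)%:E) sh) => -> ->.
Qed.

(** Difference quotients have integral 0 by translation invariance; they are bounded by the
    Lipschitz constant on a fixed ball, and dominated convergence passes to the derivative. *)
Lemma ig_partial0 f (i : 'I_n) : smooth f -> csupp f -> ig (partial i f : E -> R) = 0.
move=> sf cf;have [N N0 fN] := cf;have [L L0 fL] := smooth_lipschitz sf cf.
pose e : V := delta_mx 0 i.
have ne : `|e| <= 1.
 by apply/norm_leP => // j;rewrite mxE eqxx/=;case: (_ == _);rewrite ?normr1 ?normr0.
pose B : set E := ball (0 : V) (N + 2).
pose h (k : nat) : R := k.+1%:R^-1.
have h0 k : 0 < h k by pos.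
have h1 k : h k <= 1 by rewrite invf_le1// ler1n.
pose q (k : nat) x : R := (h k)^-1 * (f (x + h k *: e) - f x).
have fi := cbfP (cbf_smooth sf cf).
have cfs (k : nat) : cbf (fun x => f (x + h k *: e)).
 have := @cbf_smooth _ (smooth_translate (- (h k *: e)) sf) (csupp_translate _ cf).
 by rewrite (_ : (fun x => f (x - - (h k *: e))) = (fun x => f (x + h k *: e)))//;apply/funext => x;rewrite opprK.
have shift (k : nat) := ig_shift _ fi.
have q0 (k : nat) : ig (q k) = 0.
 rewrite /q igZ;last by apply:LintB => //;exact:cbfP.
 by rewrite igB ?shift ?subrr ?mulr0//;exact:cbfP.
have mq (k : nat) : mfun (q k : E -> R).
 exact:(Lint_meas (LintZ _ (LintB (cbfP (cfs k)) fi))).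
have N20 : 0 < N + 2 by pos.
have mB : measurable B by exact/open_meas/ball_open.
have Boo : (mu B < +oo)%E by rewrite mu_ball// ltry.
have [Bi _] := Lint_indic_lty mB Boo.
have qM (k : nat) (x : E) : `|q k x| <= L * \1_B x.
 rewrite indicE;have [xB|xB] := boolP (x \in B).
  rewrite mulr1 /q normrM ger0_norm ?invr_ge0 ?(ltW (h0 _))// ler_pdivrMl//.
  apply:le_trans (fL _ _) _;rewrite addrAC subrr add0r normrZ gtr0_norm// mulrC.
  by rewrite ler_wpM2r// ler_piMr// ltW.
 have xN : N + 2 <= `|x|.
  by rewrite leNgt;apply:contra xB => xN;rewrite inE;apply/ballP;rewrite subr0.
 rewrite mulr0 /q !fN ?subrr ?mulr0 ?normr0//;first by rewrite (lt_le_trans _ xN)// ltrDl.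
 apply:lt_le_trans (lerB_normD _ _);rewrite normrZ gtr0_norm//.
 have : h k * `|e| <= 1 by rewrite mulr_ile1// ltW.
 by lra.
have pf : Lint (partial i f).
 by apply:cbfP;apply:cbf_smooth;[exact:smooth_partial|exact:csupp_partial].
have qcvg x : q ^~ x @ \oo --> partial i f x.
 have dv := @diff_derivable _ _ _ f x e (smooth_differentiable sf x).
 have h_cvg : h @ \oo --> 0^'.
  move=> A [r /= r0 rA];rewrite nbhs_filterE /=;near=> k.
  apply:rA => /=;last pos.
  rewrite sub0r normrN gtr0_norm//;near: k.
  exact:near_infty_natSinv_lt (PosNum r0).
 have := cvg_comp _ _ h_cvg dv.
 apply:cvg_trans;apply:near_eq_cvg;near=> k.
 by rewrite /q/= [x + _]addrC.
have lim : (\int[mu]_x (q k x)%:E)%E @[k --> \oo] --> (\int[mu]_x (partial i f x)%:E)%E.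
 have [] := @dominated_convergence _ E R mu setT measurableT (fun k x => (q k x)%:E)
   (fun x => (partial i f x)%:E) (fun x => (L * \1_B x)%:E).
 - by move=> k;apply/measurable_EFinP;exact:mq.
 - by apply/measurable_EFinP;exact:Lint_meas pf.
 - by apply:aeW => x _;apply:cvg_EFin;[near=> k|exact:qcvg].
 - exact:(LintZ L Bi).
 - by apply:aeW => x k _;rewrite lee_fin;exact:qM.
 by move=> _ _;exact.
have E0 : (fun k => \int[mu]_x (q k x)%:E)%E = fun=> 0%:E.
 apply/funext => k;rewrite ig_EFin ?q0//;exact:(LintZ _ (LintB (cbfP (cfs k)) fi)).
rewrite E0 (ig_EFin pf) in lim.
by apply:EFin_inj;apply:(cvg_unique _ lim (cvg_cst _)).
Unshelve. all: by end_near. Qed.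

End compact_support.

End euclidean_space.

#[global] Opaque ig Lint.

Section euclidean_integrals.
Context (R : realType) (n : nat).
Local Notation V := 'rV[R]_n.
Local Notation E := (euclid R n).
Local Notation mu := (@lebesgue R n).
Local Notation Lint := (@Lint _ E R mu).
Local Notation ig := (@ig _ E R mu).
Local Notation "\I_ ( x 'in' D ) F" := (\int[mu]_(x in D) F%R%:E)%E
 (at level 36, F at level 36, x binder, D at level 200, only parsing).

(** * The L^2 bound by integration by parts *)

Section energy.
Implicit Types (f g a b : V -> R) (x y z : V).

Lemma cbf_translate f y : smooth f -> csupp f -> cbf (fun x => f (x - y)).
by move=> sf cf;apply:cbf_smooth;[exact:smooth_translate|exact:csupp_translate]. Qed.

Lemma continuous_abs f : continuous f -> continuous (fun x => `|f x|).
move=> cf x;have h : {for x, continuous (fun x => `|f x|)}.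
 by apply:(continuous_comp (cf x));exact:norm_continuous.
exact:h.
Qed.

Lemma notin_ball0 (N : R) x : (x : E) \notin (ball (0 : V) (N + 1) : set E) -> N < `|x|.
move=> xB;rewrite ltNge;apply/negP => xN;move/negP: xB;apply.
apply/mem_set;apply/ballP;rewrite subr0;apply:(le_lt_trans xN).
by rewrite ltrDl.
Qed.

Lemma ibp a b (i : 'I_n) : smooth a -> smooth b -> csupp a -> csupp b ->
 ig (fun x : E => partial i a x * b x) = - ig (fun x : E => a x * partial i b x).
move=> sa sb ca cb;have [si sj] := (smooth_partial i sa, smooth_partial i sb).
have [ci cj] := (csupp_partial i ca, csupp_partial i cb).
have := ig_partial0 i (smooth_mul sa sb) (csuppMl _ ca).
have l1 := cbfP (cbfM (cbf_smooth sa ca) (cbf_smooth sj cj)).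
have l2 := cbfP (cbfM (cbf_smooth sb cb) (cbf_smooth si ci)).
rewrite (partialM i sa sb) igD// => /eqP;rewrite addr_eq0 => /eqP h.
rewrite h opprK;congr ig;apply/funext => x;exact:mulrC.
Qed.

Lemma ibp2 a b (i j : 'I_n) : smooth a -> smooth b -> csupp a -> csupp b ->
 ig (fun x : E => partial i a x * partial j b x) = ig (fun x : E => partial j a x * partial i b x).
move=> sa sb ca cb.
rewrite (ibp i sa (smooth_partial j sb) ca (csupp_partial j cb)).
rewrite (ibp j sa (smooth_partial i sb) ca (csupp_partial i cb)).
by rewrite (partial_comm i j sb).
Qed.

Lemma conv_csupp k g : csupp k -> csupp g -> csupp (conv k g).
move=> [N N0 kN] [N' N0' gN];exists (N + N');first pos.
move=> x xN;rewrite /conv -[RHS](@ig0 _ E R mu);congr ig;apply/funext => y.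
have [yN|yN] := ltP N' `|y : V|;first by rewrite gN// mul0r.
rewrite kN ?mulr0//;apply:lt_le_trans (lerB_dist _ _).
by rewrite ltrBrDr (le_lt_trans _ xN)// lerD2l.
Qed.

Lemma conv_bound k g M x : continuous k -> (forall x, `|k x| <= M) -> Lint g ->
 `|conv k g x| <= M * ig (fun y : E => `|g y|).
move=> ck kM gi;have gk := Lint_conv ck kM x gi.
apply:le_trans (ig_abs gk) _;rewrite -igZ;last exact:Lint_abs.
apply:ig_le;[exact:Lint_abs|exact/LintZ/Lint_abs|] => y.
by rewrite normrM mulrC;apply:ler_wpM2r.
Qed.

Lemma conv_cbf k g : smooth k -> csupp k -> cbf g -> cbf (conv k g).
move=> sk ck cg;have gi := cbfP cg;have [mg _ sg] := cg.
have [M kM] := csupp_bounded (smooth_cont sk) ck.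
have [L L0 kL] := smooth_lipschitz sk ck.
apply:cbf_continuous;last exact:conv_csupp.
apply:(@lipschitz_continuous _ _ _ (L * ig (fun y : E => `|g y|))) => x x'.
have [g1 g2] := (Lint_conv (smooth_cont sk) kM x gi, Lint_conv (smooth_cont sk) kM x' gi).
rewrite /conv -igB//;apply:le_trans (ig_abs (LintB g1 g2)) _.
rewrite mulrAC -igZ;last exact:Lint_abs.
apply:ig_le;[exact/Lint_abs/LintB|exact/LintZ/Lint_abs|] => y.
rewrite -mulrBr normrM mulrC;apply:ler_wpM2r => //.
by apply:le_trans (kL _ _) _;rewrite opprB addrA subrK.
Qed.

Lemma conv_swap_cbf k f g : smooth k -> csupp k -> cbf f -> cbf g ->
 Lint (fun y : E => g y * ig (fun x : E => f x * k ((x : V) - (y : V)))) /\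
 ig (fun x : E => f x * conv k g x) = ig (fun y : E => g y * ig (fun x : E => f x * k ((x : V) - (y : V)))).
move=> sk ck cf cg;have [M kM] := csupp_bounded (smooth_cont sk) ck.
by have [_ h1 h2] := conv_swap (smooth_cont sk) kM (cbfP cf) (cbfP cg);split.
Qed.

Lemma Lint_sum2 (F : 'I_n -> 'I_n -> V -> R) : (forall k l, Lint (F k l)) ->
 Lint (fun x : E => \sum_k \sum_l F k l x).
by move=> h;apply:Lint_sum => k;apply:Lint_sum => l. Qed.

Lemma ig_sum2 (F : 'I_n -> 'I_n -> V -> R) : (forall k l, Lint (F k l)) ->
 ig (fun x : E => \sum_k \sum_l F k l x) = \sum_k \sum_l ig (F k l).
move=> h;rewrite ig_sum => [|k];last exact:Lint_sum.
by apply:eq_bigr => k _;rewrite ig_sum.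
Qed.

Variables (W : 'I_n -> V -> R) (A : 'M[R]_n) (j : 'I_n).
Hypothesis sW : forall k, smooth (W k).
Hypothesis cW : forall k, csupp (W k).
Hypothesis curl : forall k l, partial k (W l) = partial l (W k).

(** The [A]-divergence of the field [W]. *)
Definition theta x : R := \sum_k \sum_l A k l * partial l (W k) x.

Let K k : V -> R := partial k (W j).

Let sK k : smooth (K k). Proof. exact:smooth_partial. Qed.
Let cK k : csupp (K k). Proof. exact:csupp_partial. Qed.

Lemma smooth_theta : smooth theta.
apply:smooth_sum => k;apply:smooth_sum => l;apply:smooth_scale.
exact:smooth_partial.
Qed.

Lemma csupp_theta : csupp theta.
apply:csupp_sum => k;apply:csupp_sum => l;apply:csuppZ.
exact:csupp_partial.
Qed.

(** Both sides are unfolded into double integrals over the shifts [y] and [z], where two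
    integrations by parts exchange the derivatives [l] and [j] between the two kernels. As [W] is
    curl-free, one factor becomes [K j] and the other [partial l (W k)], and the sum against [A]
    collapses to [theta]. *)
Lemma energy_identity g : cbf g ->
 \sum_k \sum_l A k l * ig (fun x : E => conv (K k) g x * conv (K l) g x) =
 ig (fun x : E => conv theta g x * conv (K j) g x).
move=> cg.
have cp k : cbf (conv (K k) g) by exact:conv_cbf.
have ct : cbf (conv theta g) by apply:conv_cbf => //;[exact:smooth_theta|exact:csupp_theta].
have ck l z : cbf (fun x => K l (x - z)) by exact:cbf_translate.
pose H k l z := ig (fun x : E => conv (K k) g x * K l ((x : V) - z)).
have inner z : \sum_k \sum_l A k l * H k l z = ig (fun x : E => conv theta g x * K j (x - z)).
 have E1 k l : H k l z = ig (fun y : E => g y * ig (fun x : E => K l (x - z) * K k (x - y))).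
  rewrite -(conv_swap_cbf (sK k) (cK k) (ck l z) cg).2.
  by congr ig;apply/funext => x;exact:mulrC.
 have L1 k l := (conv_swap_cbf (sK k) (cK k) (ck l z) cg).1.
 transitivity (ig (fun y : E => \sum_k \sum_l A k l * (g y * ig (fun x : E => K l (x - z) * K k (x - y))))).
  rewrite ig_sum2 => [|k l];last exact:LintZ.
  by apply:eq_bigr => k _;apply:eq_bigr => l _;rewrite E1 igZ.
 transitivity (ig (fun y : E => g y * ig (fun x : E => K j (x - z) * theta (x - y))));last first.
  rewrite -(conv_swap_cbf smooth_theta csupp_theta (ck j z) cg).2.
  by congr ig;apply/funext => x;exact:mulrC.
 congr ig;apply/funext => y.
 transitivity (g y * \sum_k \sum_l A k l * ig (fun x : E => K l (x - z) * K k (x - y))).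
  rewrite mulr_sumr;apply:eq_bigr => k _;rewrite mulr_sumr;apply:eq_bigr => l _.
  by rewrite mulrCA.
 congr (_ * _).
 have E2 k l : ig (fun x : E => K l (x - z) * K k (x - y)) =
   ig (fun x : E => K j (x - z) * partial l (W k) (x - y)).
  have := ibp2 l j (smooth_translate z (sW j)) (smooth_translate y (sW k))
   (csupp_translate z (cW j)) (csupp_translate y (cW k)).
  by rewrite !partial_translate /K (curl k j).
 have L2 k l : Lint (fun x : E => K j (x - z) * partial l (W k) (x - y)).
  apply/cbfP/cbfM;first exact:ck.
  by apply:cbf_translate;[exact:smooth_partial|exact:csupp_partial].
 transitivity (ig (fun x : E => \sum_k \sum_l A k l * (K j (x - z) * partial l (W k) (x - y)))).
  rewrite ig_sum2 => [|k l];last exact:LintZ.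
  by apply:eq_bigr => k _;apply:eq_bigr => l _;rewrite E2 igZ.
 congr ig;apply/funext => x;rewrite /theta mulr_sumr;apply:eq_bigr => k _.
 by rewrite mulr_sumr;apply:eq_bigr => l _;rewrite mulrCA.
have E3 k l : ig (fun x : E => conv (K k) g x * conv (K l) g x) = ig (fun z : E => g z * H k l z).
 exact:(conv_swap_cbf (sK l) (cK l) (cp k) cg).2.
have L3 k l : Lint (fun z : E => g z * H k l z) := (conv_swap_cbf (sK l) (cK l) (cp k) cg).1.
transitivity (ig (fun z : E => \sum_k \sum_l A k l * (g z * H k l z))).
 rewrite ig_sum2 => [|k l];last exact:LintZ.
 by apply:eq_bigr => k _;apply:eq_bigr => l _;rewrite E3 igZ.
rewrite (conv_swap_cbf (sK j) (cK j) ct cg).2.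
congr ig;apply/funext => z;rewrite -inner mulr_sumr;apply:eq_bigr => k _.
by rewrite mulr_sumr;apply:eq_bigr => l _;rewrite mulrCA.
Qed.

(** Cauchy-Schwarz at each point with the weight [|t(x - y)|], read off from the sign of a quadratic
    polynomial in [m] at its minimum [m = S / Th]; Fubini then integrates the kernel out. *)
Lemma young_sqr (t g : V -> R) (Th : R) : 0 < Th -> smooth t -> csupp t -> cbf g ->
 (forall x, ig (fun y : E => `|t (x - (y : V))|) <= Th) ->
 (forall y, ig (fun x : E => `|t ((x : V) - y)|) <= Th) ->
 ig (fun x : E => conv t g x ^+ 2) <= Th ^+ 2 * ig (fun x : E => g x ^+ 2).
move=> Th0 st ct cg h1 h2.
have ctg : cbf (conv t g) by exact:conv_cbf.
have [M tM] := csupp_bounded (smooth_cont st) ct.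
pose at_ x := `|t x|.
have cat : continuous at_ by apply:continuous_abs;exact:smooth_cont.
have atM x : `|at_ x| <= M by rewrite normr_id.
have g2 : cbf (fun x => g x * g x) by exact:cbfM.
have ga := cbf_abs cg.
have Lt x : Lint (fun y : E => at_ (x - y)).
 have [N N0 tN] := ct;apply:cbfP;split.
 - exact:measurable_reflect.
 - by exists M.
 exists (N + `|x|);first pos.
 move=> y yN;rewrite /at_ tN ?normr0// distrC.
 by apply:lt_le_trans (lerB_dist _ _);rewrite ltrBrDr.
have pt x : conv t g x ^+ 2 <= Th * conv at_ (fun y => g y * g y) x.
 have L1 := Lint_conv cat atM x (cbfP ga).
 have L2 := Lint_conv cat atM x (cbfP g2).
 set P := conv at_ (fun y => g y * g y) x.
 pose S := ig (fun y : E => `|g y| * at_ (x - (y : V))).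
 have tS : `|conv t g x| <= S.
  apply:le_trans (ig_abs (Lint_conv (smooth_cont st) tM x (cbfP cg))) _.
  apply:ig_le => //;first exact/Lint_abs/(Lint_conv (smooth_cont st) tM x (cbfP cg)).
  by move=> y;rewrite normrM.
 have S0 : 0 <= S by apply:le_trans tS.
 have m2 (m : R) : 0 <= P - 2 * m * S + m ^+ 2 * Th.
  have e : ig (fun y : E => (`|g y| - m) ^+ 2 * at_ (x - y)) =
    P - 2 * m * S + m ^+ 2 * ig (fun y : E => at_ (x - y)).
   have L3 := LintZ (2 * m) L1;have L4 := LintZ (m ^+ 2) (Lt x).
   rewrite /P /S /conv -(igZ _ L1) -(igZ _ (Lt x)) -(igB L2 L3) -(igD (LintB L2 L3) L4).
   congr ig;apply/funext => y;rewrite -[g y * g y]expr2 -(real_normK (num_real (g y)));ring.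
  have : 0 <= ig (fun y : E => (`|g y| - m) ^+ 2 * at_ (x - y)).
   by apply:ig_ge0 => y;rewrite mulr_ge0 ?sqr_ge0//;exact:normr_ge0.
  rewrite e => h;apply:le_trans h _;rewrite lerD2l.
  by apply:ler_wpM2l;[exact:sqr_ge0|exact:h1].
 have := m2 (S / Th);rewrite (_ : _ + _ = P - S ^+ 2 / Th);last by field;rewrite gt_eqF.
 rewrite subr_ge0 ler_pdivrMr// mulrC => h;apply:le_trans h.
 by rewrite -(real_normK (num_real (conv t g x))) lerXn2r// ?nnegrE.
have [_ [Mc cM] [N N0 cN]] := ctg.
pose B : set E := ball (0 : V) (N + 1).
have N10 : 0 < N + 1 by pos.
have mB : measurable B by exact/open_meas/ball_open.
have Boo : (mu B < +oo)%E by rewrite mu_ball// ltry.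
have [Bi _] := Lint_indic_lty mB Boo.
have [s1 s2 s3] := conv_swap cat atM Bi (cbfP g2).
apply:(le_via (ig (fun x : E => Th * (\1_B x * conv at_ (fun y => g y * g y) x)))).
 apply:ig_le.
 - by have := cbfP (cbfM ctg ctg).
 - exact:(LintZ _ s1).
 move=> x;rewrite indicE;have [xB|xB] := boolP (x \in B);first by rewrite mul1r;exact:pt.
 have c0 : conv t g x = 0.
  by apply:cN;exact:notin_ball0 xB.
 by rewrite c0 expr0n/= mul0r mulr0.
rewrite (igZ _ s1) s3 expr2 -mulrA;apply:ler_wpM2l;first exact:ltW.
rewrite -(igZ _ (cbfP g2)).
apply:ig_le;[exact:s2|exact:(LintZ _ (cbfP g2))|] => y.
rewrite -expr2 mulrC;apply:ler_wpM2r;first exact:sqr_ge0.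
apply:le_trans (h2 y);apply:ig_le.
- exact:(Lint_mulb Bi (measurable_translate cat _) (fun=> atM _)).
- exact:(cbfP (cbf_abs (cbf_translate _ st ct))).
- by move=> z;apply:indic_mul_le;exact:normr_ge0.
Qed.

(** Ellipticity bounds the energy from below, [young_sqr] bounds the convolution with [theta], and
    the cross term in the identity is absorbed. *)
Lemma energy_bound g (lam Th : R) (k : 'I_n) : 0 < lam -> 0 < Th ->
 (forall xi : 'I_n -> R, lam * \sum_k xi k ^+ 2 <= \sum_k \sum_l A k l * (xi k * xi l)) ->
 (forall x, ig (fun y : E => `|theta (x - (y : V))|) <= Th) ->
 (forall y, ig (fun x : E => `|theta ((x : V) - y)|) <= Th) ->
 cbf g -> ig (fun x : E => conv (K k) g x ^+ 2) <= (Th / lam) ^+ 2 * ig (fun x : E => g x ^+ 2).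
move=> lam0 Th0 ell h1 h2 cg.
have cp l : cbf (conv (K l) g) by exact:conv_cbf.
have ct : cbf (conv theta g) by apply:conv_cbf => //;[exact:smooth_theta|exact:csupp_theta].
have Lpp l m : Lint (fun x : E => conv (K l) g x * conv (K m) g x) by exact/cbfP/cbfM.
have Lp2 l : Lint (fun x : E => conv (K l) g x ^+ 2) by exact:Lpp.
have Lt2 : Lint (fun x : E => conv theta g x ^+ 2) by have := cbfP (cbfM ct ct).
have T := young_sqr Th0 smooth_theta csupp_theta cg h1 h2.
have e1 : lam * \sum_l ig (fun x : E => conv (K l) g x ^+ 2) <=
  ig (fun x : E => conv theta g x * conv (K j) g x).
 have -> : lam * \sum_l ig (fun x : E => conv (K l) g x ^+ 2) =
   ig (fun x : E => lam * \sum_l conv (K l) g x ^+ 2).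
  by apply/esym/(etrans (igZ lam (Lint_sum Lp2)));congr (_ * _);exact:(ig_sum Lp2).
 rewrite -(energy_identity cg).
 have -> : \sum_k \sum_l A k l * ig (fun x : E => conv (K k) g x * conv (K l) g x) =
   ig (fun x : E => \sum_k \sum_l A k l * (conv (K k) g x * conv (K l) g x)).
  rewrite (ig_sum2 (fun l m => LintZ (A l m) (Lpp l m))).
  by apply:eq_bigr => l _;apply:eq_bigr => m _;rewrite (igZ _ (Lpp l m)).
 apply:ig_le;[exact:(LintZ _ (Lint_sum Lp2))|exact:(Lint_sum2 (fun l m => LintZ (A l m) (Lpp l m)))|].
 by move=> x;exact:ell.
have e2 : ig (fun x : E => conv theta g x * conv (K j) g x) <=
  (2 * lam)^-1 * ig (fun x : E => conv theta g x ^+ 2) + lam / 2 * ig (fun x : E => conv (K j) g x ^+ 2).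
 have [l1 l2] := (LintZ (2 * lam)^-1 Lt2, LintZ (lam / 2) (Lp2 j)).
 rewrite -(igZ _ Lt2) -(igZ _ (Lp2 j)) -(igD l1 l2).
 apply:ig_le;[exact:(cbfP (cbfM ct (cp j)))|exact:(LintD l1 l2)|] => x.
 rewrite -subr_ge0 (_ : _ - _ = (2 * lam)^-1 * (conv theta g x - lam * conv (K j) g x) ^+ 2);last first.
  by field;rewrite gt_eqF.
 by pos.
have I0 l : 0 <= ig (fun x : E => conv (K l) g x ^+ 2) by apply:ig_ge0 => x;exact:sqr_ge0.
exact:(energy_real lam0 e1 e2 (ler_term_sum j I0) (ler_term_sum k I0) T).
Qed.

End energy.

(** * An integral over dyadic annuli *)

Section annuli.

Lemma measurable_norm_sub (c : V) : mfun (fun x : E => `|(x : V) - c|).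
exact:(measurable_translate (@norm_continuous _ _) c). Qed.

Lemma mpowR p (h : E -> R) : mfun h -> mfun (fun x : E => h x `^ p).
by move=> mh;exact:(@mT_comp _ _ _ _ _ _ (@powR R ^~ p)). Qed.

Lemma measurable_norm_itv (c : V) (I : interval R) : measurable [set x : E | `|(x : V) - c| \in I].
by have := measurable_norm_sub c measurableT (measurable_itv I);rewrite setTI. Qed.

(** On the annulus of inner radius [2^k rho] the integrand is at most [(2^k rho)^-(n+1)] and the
    volume at most [(4 2^k rho)^n]; the contributions decrease like [2^-k]. *)
Lemma tail_integral (c : V) (rho : R) : 0 < rho ->
 (\I_(x in [set x : E | (rho <= `|(x : V) - c|)%R]) (`|((x : V) - c)%R| ^- n.+1)
  <= (2 * 4 ^+ n / rho)%:E)%E.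
move=> r0;pose f (x : E) : R := `|(x : V) - c| ^- n.+1.
have mn := measurable_norm_sub c.
have f0 x : (0 <= (f x)%:E)%E by pos.
have mf : mfun (fun x => (f x)%:E).
 apply/measurable_EFinP.
 rewrite (_ : f = fun x => `|x - c| `^ (- n.+1%:R));last first.
  by apply/funext => x;rewrite powRN powR_mulrn.
 exact:(mpowR (- n.+1%:R) mn).
pose F k : set E := [set x : E | 2 ^+ k * rho <= `|(x : V) - c| < 2 ^+ k.+1 * rho].
have mF k : measurable (F k).
 rewrite (_ : F k = [set x : E | `|x - c| \in `[2 ^+ k * rho, 2 ^+ k.+1 * rho[]).
  exact:measurable_norm_itv.
 by apply/seteqP;split=> x /=;rewrite in_itv.
have sub : [set x : E | rho <= `|x - c|] `<=` \bigcup_k F k.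
 move=> x /= rx;have ex : exists k, `|x - c| < 2 ^+ k * rho.
  exists (Num.truncn (`|x - c| / rho)).+1;rewrite -ltr_pdivrMr//.
  apply:lt_le_trans (truncnS_gt _) _;rewrite -natrX ler_nat ltnW//.
  exact:ltn_expl.
 case: (ex_minnP ex) => -[|k] hk kmin;first by move: hk;rewrite expr0 mul1r ltNge rx.
 exists k => //;rewrite /F/= hk andbT leNgt;apply/negP => h.
 by have := kmin _ h;rewrite ltnn.
have mS : measurable [set x : E | rho <= `|x - c|].
 rewrite (_ : [set x : E | rho <= _] = [set x : E | `|x - c| \in `[rho, +oo[]).
  exact:measurable_norm_itv.
 by apply/seteqP;split=> x /=;rewrite in_itv/= andbT.
have mU : measurable (\bigcup_k F k) by exact:bigcup_measurable.
apply:le_trans (int_subset mu mS mU mf f0 sub) _.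
apply:le_trans (ge0_integral_bigcup_le mu mF mf f0) _.
have -> : 2 * 4 ^+ n / rho = (4 ^+ n / rho) / (1 - 2^-1) by field;rewrite gt_eqF.
apply:nneseries_geometric_le.
- by pos.
- by lra.
- by move=> k;apply:integral_ge0.
move=> k;have rk : 0 < 2 ^+ k * rho by pos.
have r2k : 0 < 2 ^+ k.+1 * rho by pos.
apply:(le_via (\I_(x in F k) ((2 ^+ k * rho) ^- n.+1))%E).
 apply:(int_le mu (mF k) mf _ f0);first exact:measurable_cst.
 move=> x /andP[h _];rewrite lee_fin /f lef_pV2 ?posrE ?exprn_gt0//;last exact:lt_le_trans h.
 by apply:lerXn2r;rewrite ?nnegrE// ltW.
rewrite integral_cst//.
have FB : (mu (F k) <= ((2 * (2 ^+ k.+1 * rho)) ^+ n)%:E)%E.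
 rewrite -(mu_ball c r2k);apply:le_measure;rewrite ?inE//.
  exact/open_meas/ball_open.
 by move=> x /andP[_ h];apply/ballP.
apply:(le_via (((2 ^+ k * rho) ^- n.+1)%:E * ((2 * (2 ^+ k.+1 * rho)) ^+ n)%:E)%E).
 by apply:lee_wpmul2l => //;rewrite lee_fin invr_ge0 exprn_ge0// ltW.
rewrite -EFinM lee_fin le_eqVlt;apply/orP;left;apply/eqP.
have -> : 2 * (2 ^+ k.+1 * rho) = 4 * (2 ^+ k * rho) by rewrite exprS;ring.
rewrite (exprVnS _ n) (exprMn _ 4) exprVn invfM.
have : (2 ^+ k * rho) ^+ n != 0 by pos.
have : (2 ^+ k : R) != 0 by pos.
have : rho != 0 by pos.
by move: ((2 ^+ k * rho) ^+ n) (2 ^+ k) (4 ^+ n : R) => X p q rh0 p0 X0;field;rewrite p0 X0 rh0.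
Qed.

End annuli.

(** * Functions constant on stopping cells *)

Section stop_functions.
Context (o : V) (r : R).
Hypothesis r0 : 0 < r.
Variable P : nat -> 'rV[int]_n -> Prop.
Local Notation idx := (idx o r).
Local Notation cell := (cell o r).
Local Notation side := (side r).
Local Notation fs := (first_stop o r P).
Local Notation Om := (stopped o r P).
Implicit Types (phi : nat -> 'rV[int]_n -> R).

Definition stop_time (x : V) : nat := xget 0%N [set k | fs k (idx k x)].

Definition stop_fun phi (x : V) : R :=
 if `[< Om x >] then phi (stop_time x) (idx (stop_time x) x) else 0.

Lemma stop_timeP x : Om x -> fs (stop_time x) (idx (stop_time x) x).
move=> [k /(first_stopP r0)[j [_ fj _]]].
exact:(@xgetPex _ 0%N [set k | fs k (idx k x)] (ex_intro _ j fj)).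
Qed.

Lemma first_stop_cell k z x : fs k z -> cell k z x -> Om x /\ stop_time x = k.
move=> fk;rewrite /cell/= => xz.
have Ox : Om x by exists k;rewrite xz;case: fk.
by split=> //;apply:(first_stop_inj (stop_timeP Ox));rewrite xz.
Qed.

Lemma stop_fun_cell phi k z x : fs k z -> cell k z x -> stop_fun phi x = phi k z.
move=> fk xz;have [Ox kx] := first_stop_cell fk xz.
by rewrite /stop_fun (asboolT Ox) kx (xz : idx k x = z).
Qed.

Lemma stop_fun_out phi x : ~ Om x -> stop_fun phi x = 0.
by move=> Ox;rewrite /stop_fun asboolF. Qed.

Lemma measurable_stop_fun phi : mfun (stop_fun phi : E -> R).
move=> _ Y mY;rewrite setTI.
rewrite (_ : _ @^-1` Y = (\bigcup_k [set x : E | fs k (idx k x) /\ Y (phi k (idx k x))]) `|`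
  (~` (Om) `&` [set x | Y 0]));last first.
 apply/seteqP;split=> x /=.
  have [Ox|nOx] := pselect (Om x).
   rewrite /stop_fun (asboolT Ox) => Yx;left;exists (stop_time x) => //.
   by split=> //;exact:stop_timeP.
  by rewrite (stop_fun_out _ nOx) => Y0;right.
 move=> [[k _ [fk Yk]]|[nOx Y0]];last by rewrite (stop_fun_out _ nOx).
 by rewrite (stop_fun_cell _ fk).
apply:measurableU.
 apply:bigcup_measurable => k _.
 exact:(@measurable_idx_pred R n o r r0 k (fun z => fs k z /\ Y (phi k z))).
apply:measurableI;first by apply:measurableC;exact:measurable_stopped.
have [Y0|nY0] := pselect (Y 0).
 by rewrite (_ : [set x : E | Y 0] = setT)//;apply/seteqP;split.
by rewrite (_ : [set x : E | Y 0] = set0)//;apply/seteqP;split.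
Qed.

Lemma stop_funB phi psi x : stop_fun (fun k z => phi k z - psi k z) x = stop_fun phi x - stop_fun psi x.
by rewrite /stop_fun;case: ifP => _;rewrite ?subrr. Qed.

Lemma stop_funM phi psi x : stop_fun (fun k z => phi k z * psi k z) x = stop_fun phi x * stop_fun psi x.
by rewrite /stop_fun;case: ifP => _;rewrite ?mulr0. Qed.

Lemma stop_fun1 x : stop_fun (fun _ _ => 1) x = \1_Om x.
rewrite indicE /stop_fun;have [Ox|nOx] := pselect (Om x).
 by rewrite (asboolT Ox) mem_set.
by rewrite (asboolF nOx) memNset.
Qed.

Implicit Types (g : V -> R).

Definition cavg g k z : R := ig (fun y : E => g y * \1_(cell k z) y) / side k ^+ n.

Lemma Lint_cell g k z : Lint g -> Lint (fun y : E => g y * \1_(cell k z) y).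
move=> gi;apply:(Lint_mulb (M := 1) gi).
 by apply:measurable_indic;exact:measurable_cell.
by move=> x;rewrite indicE;case: (_ \in _);rewrite ?normr1 ?normr0.
Qed.

Lemma cavgB g1 g2 k z : Lint g1 -> Lint g2 ->
 cavg (fun y => g1 y - g2 y) k z = cavg g1 k z - cavg g2 k z.
move=> i1 i2;rewrite /cavg -mulrBl -(igB (Lint_cell k z i1) (Lint_cell k z i2)).
by congr (ig _ / _);apply/funext => y;rewrite mulrBl.
Qed.

Lemma cavg_cell g k z : Lint g ->
 (\I_(x in cell k z) g x = (cavg g k z * side k ^+ n)%:E)%E.
move=> gi;rewrite /cavg divfK ?expf_neq0 ?(gt_eqF (side_gt0 r0 k))//.
transitivity (\int[mu]_x (g x * \1_(cell k z) x)%:E)%E;last exact:(ig_EFin (Lint_cell k z gi)).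
rewrite integral_mkcond;apply:eq_integral => x _.
by rewrite patchE indicE;case: ifP => _;rewrite ?mulr1 ?mulr0.
Qed.

Lemma cavg_abs g k z : Lint g -> `|cavg g k z| <= cavg (fun y => `|g y|) k z.
move=> gi;have sn0 : 0 < side k ^+ n by rewrite exprn_gt0// side_gt0.
rewrite /cavg normrM [X in _ * X]gtr0_norm ?invr_gt0// ler_wpM2r ?invr_ge0 ?(ltW sn0)//.
apply:le_trans (ig_abs (Lint_cell k z gi)) _.
apply:ig_le;[exact:(Lint_abs (Lint_cell k z gi))|exact:(Lint_cell k z (Lint_abs gi))|] => y.
rewrite normrM;apply:ler_wpM2l;first exact:normr_ge0.
by rewrite indicE;case: (_ \in _);rewrite ?normr1 ?normr0.
Qed.

Lemma cavg_ge0 g k z : ge0 g -> 0 <= cavg g k z.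
move=> g0;rewrite divr_ge0 ?exprn_ge0 ?(ltW (side_gt0 r0 k))//.
apply:ig_ge0 => y;apply:mulr_ge0;first exact:g0.
by pos.
Qed.

Lemma stop_fun_ge0 phi x : (forall k z, 0 <= phi k z) -> 0 <= stop_fun phi x.
by move=> p0;rewrite /stop_fun;case: ifP. Qed.

Lemma stop_fun_bound phi M x : (forall k z, `|phi k z| <= M) -> `|stop_fun phi x| <= M.
move=> h;rewrite /stop_fun;case: ifP => _;first exact:h.
by rewrite normr0;apply:le_trans (h 0%N 0).
Qed.

Lemma integral_stopped (f : V -> R) : (forall x, ~ Om x -> f x = 0) ->
 (\I_(x in Om) f x = \int[mu]_x (f x)%:E)%E.
move=> f0;rewrite integral_mkcond;apply:eq_integral => x _;rewrite patchE.
by case: ifPn => // xO;rewrite f0// => Ox;move/negP: xO;apply;exact/mem_set.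
Qed.

Lemma stop_avg0 g phi M : Lint g -> ge0 g -> (forall k z, 0 <= phi k z <= M) ->
 Lint (stop_fun (fun k z => cavg g k z * phi k z)) /\
 ig (fun y : E => g y * stop_fun phi y) = ig (stop_fun (fun k z => cavg g k z * phi k z)).
move=> gi g0 pM.
have p0 k z : 0 <= phi k z by have /andP[] := pM k z.
pose f1 y := g y * stop_fun phi y.
pose f2 y := stop_fun (fun k z => cavg g k z * phi k z) y.
have i1 : Lint f1.
 apply:(Lint_mulb (M := M) gi (measurable_stop_fun _)) => x.
 rewrite ger0_norm ?stop_fun_ge0// /stop_fun;case: ifP => _;first by have /andP[] := pM (stop_time x) (idx (stop_time x) x).
 by have /andP[h1 h2] := pM 0%N 0;apply:le_trans h2.
have m2 : mfun (f2 : E -> R) := measurable_stop_fun _.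
have f10 x : 0 <= f1 x by rewrite mulr_ge0// stop_fun_ge0.
have f20 x : 0 <= f2 x by apply:stop_fun_ge0 => k z;rewrite mulr_ge0// cavg_ge0.
have E1 : (\I_(x in Om) f1 x = (ig f1)%:E)%E.
 by rewrite integral_stopped ?ig_EFin// => x nOx;rewrite /f1 stop_fun_out ?mulr0.
have E2 : (\I_(x in Om) f2 x = \int[mu]_x (f2 x)%:E)%E.
 by rewrite integral_stopped// => x nOx;rewrite /f2 stop_fun_out.
have cellE k z : fs k z -> (\I_(x in cell k z) f1 x = \I_(x in cell k z) f2 x)%E.
 move=> fk;transitivity ((cavg g k z * phi k z * side k ^+ n)%:E).
  rewrite mulrAC EFinM -(cavg_cell k z gi) muleC -ge0_integralZl_EFin;last exact:p0.
  - by apply:eq_integral => x;rewrite inE => xz;rewrite /f1 (stop_fun_cell _ fk xz) mulrC.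
  - exact:measurable_cell.
  - by move=> x _;pos.
  - exact:(mEFin (Lint_meas gi)).
 rewrite EFinM -(lebesgue_cell o r0 k z) -integral_cst;last exact:measurable_cell.
 apply:eq_integral => x;rewrite inE => xz.
 by rewrite /f2 (stop_fun_cell _ fk xz).
have [mf1 mf2] := (mEFin (D := setT) (Lint_meas i1), mEFin (D := setT) m2).
have le12 : (\I_(x in Om) f1 x <= \I_(x in Om) f2 x)%E.
 apply:(@stopped_le R n o r r0 P _ _ mf1 _ mf2).
 - by move=> x;pos.
 - by move=> x;pos.
 - by move=> k z /cellE ->.
have le21 : (\I_(x in Om) f2 x <= \I_(x in Om) f1 x)%E.
 apply:(@stopped_le R n o r r0 P _ _ mf2 _ mf1).
 - by move=> x;pos.
 - by move=> x;pos.
 - by move=> k z /cellE ->.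
have e12 : (\int[mu]_x (f2 x)%:E = (ig f1)%:E)%E by rewrite -E2 -E1;apply/eqP;rewrite eq_le le12 le21.
have i2 : Lint f2 by apply:(Lint_lty m2 f20);rewrite e12 ltry.
split=> //;apply:EFin_inj;rewrite -[RHS](ig_EFin i2);exact/esym.
Qed.

(** On a stopping cell [phi] is constant, so replacing [g] by its mean changes nothing. Nonnegative
    [g] and [phi] come first, where [stopped_le] applies in both directions; then [phi] is raised by
    [M] and [g] written as [|g| - (|g| - g)]. *)
Lemma stop_avg g phi M : Lint g -> (forall k z, `|phi k z| <= M) ->
 Lint (stop_fun (fun k z => cavg g k z * phi k z)) /\
 ig (fun y : E => g y * stop_fun phi y) = ig (stop_fun (fun k z => cavg g k z * phi k z)).
move=> gi pM.
have M0 : 0 <= M by apply:le_trans (pM 0%N 0).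
have sM psi y : (forall k z, `|psi k z| <= M) -> `|stop_fun psi y| <= M.
 by move=> h;rewrite /stop_fun;case: ifP => // _;rewrite normr0.
have step g' : Lint g' -> (forall x, 0 <= g' x) ->
  Lint (stop_fun (fun k z => cavg g' k z * phi k z)) /\
  ig (fun y => g' y * stop_fun phi y) = ig (stop_fun (fun k z => cavg g' k z * phi k z)).
 move=> gi' g0'.
 have [|a1 a2] := stop_avg0 (phi := fun k z => phi k z + M) (M := M + M) gi' g0'.
  by move=> k z;have := pM k z;rewrite ler_norml => /andP[];lra.
 have [|c1 c2] := stop_avg0 (phi := fun k z => M) (M := M) gi' g0';first by move=> k z;rewrite M0 lexx.
 have E1 : stop_fun (fun k z => cavg g' k z * phi k z) = fun y =>
   stop_fun (fun k z => cavg g' k z * (phi k z + M)) y - stop_fun (fun k z => cavg g' k z * M) y.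
  apply/funext => y;rewrite -stop_funB;congr (stop_fun _ y).
  by apply/funext => k;apply/funext => z;rewrite mulrDr addrK.
 have E2 : (fun y => g' y * stop_fun phi y) = fun y =>
   g' y * stop_fun (fun k z => phi k z + M) y - g' y * stop_fun (fun k z => M) y.
  apply/funext => y;rewrite -mulrBr -stop_funB;congr (_ * stop_fun _ y).
  by apply/funext => k;apply/funext => z;rewrite addrK.
 have b1 : Lint (fun y => g' y * stop_fun (fun k z => phi k z + M) y).
  apply:(Lint_mulb (M := M + M) gi' (measurable_stop_fun _)) => y.
  rewrite /stop_fun;case: ifP => _;last by rewrite normr0 addr_ge0.
  by apply:le_trans (ler_normD _ _) _;rewrite (ger0_norm M0) lerD2r.
 have b2 : Lint (fun y => g' y * stop_fun (fun k z => M) y).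
  apply:(Lint_mulb (M := M) gi' (measurable_stop_fun _)) => y.
  by apply:sM => k z;rewrite ger0_norm.
 rewrite E1 E2;split;first exact:(LintB a1 c1).
 by rewrite (igB b1 b2) (igB a1 c1) a2 c2.
have [a1 a2] := step _ (Lint_abs gi) (fun x => normr_ge0 _).
have gi2 := LintB (Lint_abs gi) gi.
have [|c1 c2] := step _ gi2;first by move=> x;rewrite subr_ge0 ler_norm.
have E1 : stop_fun (fun k z => cavg g k z * phi k z) = fun y =>
  stop_fun (fun k z => cavg (fun y => `|g y|) k z * phi k z) y -
  stop_fun (fun k z => cavg (fun y => `|g y| - g y) k z * phi k z) y.
 apply/funext => y;rewrite -stop_funB;congr (stop_fun _ y).
 apply/funext => k;apply/funext => z.
 by rewrite (cavgB k z (Lint_abs gi) gi) -mulrBl opprB addrC subrK.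
have b1 : Lint (fun y => `|g y| * stop_fun phi y).
 exact:(Lint_mulb (Lint_abs gi) (measurable_stop_fun _) (fun y => sM phi y pM)).
have b2 : Lint (fun y => (`|g y| - g y) * stop_fun phi y).
 exact:(Lint_mulb gi2 (measurable_stop_fun _) (fun y => sM phi y pM)).
rewrite E1;split;first exact:(LintB a1 c1).
rewrite (igB a1 c1) -a2 -c2 -(igB b1 b2);congr ig;apply/funext => y.
by rewrite -mulrBl opprB addrC subrK.
Qed.

End stop_functions.

Section more_ig.
Implicit Types (f g : V -> R).

Lemma markov_ig f (S : set E) s : Lint f -> ge0 f -> measurable S -> 0 < s ->
 (forall x, S x -> s <= f x) -> (mu S <= (ig f / s)%:E)%E.
move=> fi f0 mS s0 Sf.
have : (s%:E * mu S <= (ig f)%:E)%E.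
 rewrite -(integral_cst _ mS) -(ig_EFin fi).
 have mfE := mEFin (D := setT) (Lint_meas fi).
 have f0E x : (0 <= (f x)%:E)%E by pos.
 apply:(le_via (\I_(x in S) f x)%E).
  apply:(int_le mu mS _ mfE);first exact:measurable_cst.
  - by move=> x;pos.
  - by move=> x /Sf;pos.
 exact:(int_subset mu mS measurableT mfE f0E (@subsetT _ _)).
by rewrite muleC -lee_pdivlMr//.
Qed.

Lemma ig_ae_eq f g : Lint f -> Lint g -> {ae mu, forall x : V, f x = g x} -> ig f = ig g.
move=> fi gi fg;apply:EFin_inj;rewrite -[LHS](ig_EFin fi) -[RHS](ig_EFin gi).
have mf := mEFin (D := setT) (Lint_meas fi).
have mg := mEFin (D := setT) (Lint_meas gi).
by apply:(ae_integral_eq measurableT mf mg);apply:ae_imp fg => x ->.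
Qed.

Lemma conv_continuous k g : smooth k -> csupp k -> Lint g -> continuous (conv k g).
move=> sk ck gi.
have [M kM] := csupp_bounded (smooth_cont sk) ck.
have [L L0 kL] := smooth_lipschitz sk ck.
apply:(@lipschitz_continuous _ _ _ (L * ig (fun y => `|g y|))) => x x'.
have [g1 g2] := (Lint_conv (smooth_cont sk) kM x gi, Lint_conv (smooth_cont sk) kM x' gi).
rewrite -(igB g1 g2);apply:le_trans (ig_abs (LintB g1 g2)) _.
rewrite mulrAC -(igZ _ (Lint_abs gi)).
apply:ig_le;[exact/Lint_abs/LintB|exact/LintZ/Lint_abs|] => y.
rewrite -mulrBr normrM mulrC;apply:ler_wpM2r;first exact:normr_ge0.
by apply:le_trans (kL _ _) _;rewrite opprB addrA subrK.
Qed.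

Lemma convD k f g x : smooth k -> csupp k -> Lint f -> Lint g ->
 conv k (fun y => f y + g y) x = conv k f x + conv k g x.
move=> sk ck fi gi;have [M kM] := csupp_bounded (smooth_cont sk) ck.
have [g1 g2] := (Lint_conv (smooth_cont sk) kM x fi, Lint_conv (smooth_cont sk) kM x gi).
by rewrite -(igD g1 g2);congr ig;apply/funext => y;rewrite mulrDl.
Qed.

Lemma Lint_indic f (D : set E) : Lint f -> measurable D -> Lint (fun x : E => f x * \1_D x).
move=> fi mD;apply:(Lint_mulb (M := 1) fi);first exact:measurable_indic.
by move=> x;rewrite indicE;case: (_ \in _);rewrite ?normr1 ?normr0.
Qed.

Lemma int_indic f (D : set E) :
 (\int[mu]_x (f x * \1_D x)%:E = \I_(x in D) f x)%E.
rewrite [RHS]integral_mkcond;apply:eq_integral => x _.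
by rewrite patchE indicE;case: ifP => _;rewrite ?mulr1 ?mulr0.
Qed.

End more_ig.

(** * Weak type bound by the Calderon-Zygmund decomposition *)

Section weak_type.
Hypothesis n0 : (0 < n)%N.
Variables (K : V -> R) (A2 AH : R).
Hypothesis sK : smooth K.
Hypothesis cK : csupp K.
Hypothesis A20 : 0 <= A2.
Hypothesis AH0 : 0 <= AH.
Hypothesis L2 : forall g, cbf g -> ig (fun x : E => conv K g x ^+ 2) <= A2 * ig (fun x : E => g x ^+ 2).
Hypothesis HK : forall u v : V, v != 0 -> `|u - v| <= `|v| / 2 ->
 `|K u - K v| <= AH * `|u - v| * `|v| ^- n.+1.

Section decomposition.
Variables (g : V -> R) (t N : R).
Hypothesis gi : Lint g.
Hypothesis gN : forall x, N < `|x| -> g x = 0.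
Hypothesis N0 : 0 < N.
Hypothesis t0 : 0 < t.

Let I := ig (fun y : E => `|g y|).
Let I0 : 0 <= I. Proof. exact:ig_ge0 => y;exact:normr_ge0. Qed.
(** Side of the root cells: as [r >= 1] and [n > 0], one has [r^n >= I / t], so that no root cell
    has average above [t]. *)
Let r : R := 1 + I / t.
Let r0 : 0 < r. Proof. by pos. Qed.
Let ag := fun y : V => `|g y|.
Let agi : Lint ag. Proof. exact:Lint_abs. Qed.

Local Notation side := (side r).
Local Notation idx := (idx (0 : V) r).
Local Notation cell := (cell (0 : V) r).
Local Notation cavg := (cavg (0 : V) r).

Let P (k : nat) (z : 'rV[int]_n) : Prop := t < cavg ag k z.
Local Notation fs := (first_stop (0 : V) r P).
Local Notation Om := (stopped (0 : V) r P).
Local Notation sf := (stop_fun (0 : V) r P).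

Let sn0 k : 0 < side k ^+ n. Proof. by rewrite exprn_gt0// side_gt0. Qed.

Let cen k (z : 'rV[int]_n) : V := \row_i ((z 0 i)%:~R * side k).

Let cen_cell k z : cell k z (cen k z).
apply/rowP => i;rewrite !mxE subr0 mulfK ?(gt_eqF (side_gt0 r0 k))//.
by rewrite intrKfloor.
Qed.

Let cen_near k z x : cell k z x -> `|x - cen k z| < side k.
move=> xz;have idc : idx k (cen k z) = z := cen_cell k z.
have : cell k (idx k (cen k z)) x by rewrite idc.
by move/(cell_sub_ball r0)/ballP.
Qed.

Let cell_ig k z (D : set E) : cell k z `<=` D -> measurable D ->
 ig (fun y : E => ag y * \1_(cell k z) y) <= ig (fun y : E => ag y * \1_D y).
move=> sub mD;apply:ig_le;[exact:Lint_cell|exact:Lint_indic|] => y.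
apply:ler_wpM2l;first exact:normr_ge0.
rewrite !indicE;case: (boolP (y \in cell k z)) => // /set_mem/sub/mem_set -> //.
Qed.

Let notP0 z : ~ P 0 z.
rewrite /cavg;apply/negP;rewrite -leNgt ler_pdivrMr//.
apply:(le_via I).
 apply:ig_le;[exact:Lint_cell|exact:agi|] => y.
 by rewrite mulrC;apply:indic_mul_le;exact:normr_ge0.
rewrite -ler_pdivrMl// mulrC.
have r1 : 1 <= r by rewrite lerDl divr_ge0// ltW.
have -> : side 0 = r by rewrite /side divr1.
apply:(le_via r);first by rewrite lerDr.
by rewrite -[leLHS]expr1;apply:ler_weXn2l.
Qed.

Let fs_avg k z : fs k z -> cavg ag k z <= 2 ^+ n * t.
move=> [Pk hk];case: k Pk hk => [/notP0//|k] Pk hk.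
have idc := cen_cell k.+1 z.
have := hk _ idc k (ltnSn k);rewrite /P => /negP;rewrite -leNgt.
rewrite !ler_pdivrMr// => h.
have sE : side k = 2 * side k.+1 by rewrite /side exprS;field;rewrite expf_neq0.
apply:le_trans (le_trans h _);last by rewrite sE exprMn mulrA [2 ^+ n * t]mulrC.
apply:cell_ig;last exact:measurable_cell.
by move=> y yz;rewrite /cell/=;apply:(idx_nested r0 (leqnSn k));rewrite idc.
Qed.

(** Corner of the stopping cell of [y], written coordinatewise through [stop_fun] to make it
    measurable in [y]. *)
Let cc (y : V) : V := \row_i sf (fun k z => cen k z 0 i) y.

Let cc_cell k z y : fs k z -> cell k z y -> cc y = cen k z.
by move=> fk yz;apply/rowP => i;rewrite mxE (stop_fun_cell r0 _ fk yz). Qed.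

Let A : V -> R := sf (cavg g).
(** Points outside the stopped set with [|g| > t] form a null set but are left out of the good part:
    [gd] is then bounded at every point, while [g = gd + gb] holds almost everywhere. *)
Let S0 : set E := (~` Om) `&` [set y | ag y <= t].
Let mOm : measurable (Om : set E). Proof. exact:measurable_stopped. Qed.
Let mS0 : measurable S0.
apply:measurableI;first exact:measurableC.
have := Lint_meas agi measurableT (measurable_itv `]-oo, t]).
by rewrite setTI;congr measurable;apply/seteqP;split=> y /=;rewrite in_itv.
Qed.

Let one_bd : forall (k : nat) (z : 'rV[int]_n), `|(1 : R)| <= 1.
by move=> k z;rewrite normr1. Qed.

Let A_Lint : Lint A.
have [h _] := stop_avg 0 r0 P (phi := fun _ _ => 1) gi one_bd.
rewrite (_ : A = sf (fun k z => cavg g k z * 1))//.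
by apply/funext => y;congr (sf _ y);apply/funext => k;apply/funext => z;rewrite mulr1.
Qed.

Let aA_Lint : Lint (sf (cavg ag)) /\ ig (sf (cavg ag)) = ig (fun y : E => ag y * \1_Om y).
have [h1 h2] := stop_avg 0 r0 P (phi := fun _ _ => 1) agi one_bd.
have e : sf (fun k z => cavg ag k z * 1) = sf (cavg ag).
 by apply/funext => y;congr (sf _ y);apply/funext => k;apply/funext => z;rewrite mulr1.
rewrite e in h1 h2;split=> //;rewrite -h2;congr ig;apply/funext => y.
by rewrite stop_fun1.
Qed.

Let gd (y : V) : R := A y + g y * \1_S0 y.
Let gb (y : V) : R := g y * \1_Om y - A y.

Let gb_out y : ~ Om y -> gb y = 0.
by move=> nOy;rewrite /gb /A (stop_fun_out _ nOy) subr0 indicE (memNset nOy) mulr0. Qed.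

Let gd_Lint : Lint gd. Proof. by apply:LintD => //;exact:Lint_indic. Qed.
Let gb_Lint : Lint gb. Proof. by apply:LintB => //;exact:Lint_indic. Qed.

Let A_abs y : `|A y| <= sf (cavg ag) y.
rewrite /A /stop_fun;case: ifP => _;last by rewrite normr0.
exact:cavg_abs.
Qed.

Let gd_abs_ig : ig (fun y : E => `|gd y|) <= I.
have [a1 a2] := aA_Lint;have l1 := Lint_indic agi mS0;have l2 := Lint_indic agi mOm.
apply:(le_via (ig (fun y => sf (cavg ag) y + ag y * \1_S0 y))).
 apply:ig_le;[exact:(Lint_abs gd_Lint)|exact:(LintD a1 l1)|] => y.
 apply:le_trans (ler_normD _ _) _;apply:lerD;first exact:A_abs.
 by rewrite normrM [X in _ * X]ger0_norm.
rewrite (igD a1 l1) a2 -(igD l2 l1);apply:ig_le;[exact:(LintD l2 l1)|exact:agi|] => y.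
rewrite -mulrDr -[leRHS]mulr1;apply:ler_wpM2l;first exact:normr_ge0.
rewrite !indicE;have [yO|yO] := boolP (y \in (Om)).
 rewrite memNset ?addr0// => -[nO _];exact:(nO (set_mem yO)).
by rewrite add0r;case: (_ \in _).
Qed.

Let gb_abs_ig : ig (fun y : E => `|gb y|) <= 2 * I.
have [a1 a2] := aA_Lint;have l2 := Lint_indic agi mOm.
apply:(le_via (ig (fun y => ag y * \1_Om y + sf (cavg ag) y))).
 apply:ig_le;[exact:(Lint_abs gb_Lint)|exact:(LintD l2 a1)|] => y.
 apply:le_trans (ler_normB _ _) _;apply:lerD;last exact:A_abs.
 by rewrite normrM [X in _ * X]ger0_norm.
rewrite (igD l2 a1) a2 mulrDl mul1r.
have h : ig (fun y => ag y * \1_Om y) <= I.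
 apply:ig_le;[exact:l2|exact:agi|] => y.
 by rewrite mulrC;apply:indic_mul_le;exact:normr_ge0.
exact:lerD.
Qed.

Let gd_bound y : `|gd y| <= 2 ^+ n * t.
have n1 : 1 <= 2 ^+ n :> R by rewrite exprn_ege1// ler1n.
have [Oy|nOy] := pselect (Om y).
 rewrite /gd indicE memNset;last by move=> [].
 rewrite mulr0 addr0;apply:le_trans (A_abs y) _.
 by rewrite /stop_fun (asboolT Oy);apply:fs_avg;exact:stop_timeP.
rewrite /gd /A (stop_fun_out _ nOy) add0r.
have t2 : t <= 2 ^+ n * t by rewrite ler_peMl// ltW.
rewrite indicE;have [yS|yS] := boolP (y \in S0).
 by rewrite mulr1;have [_ h] := set_mem yS;apply:le_trans t2.
by rewrite mulr0 normr0;apply:le_trans t2;exact:ltW.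
Qed.

Let A_out y : N + r < `|y| -> A y = 0.
move=> yN;apply:stop_fun_out => -[k];rewrite /P.
suff -> : cavg ag k (idx k y) = 0 by move=> h;have := lt_trans t0 h;rewrite ltxx.
rewrite /cavg (_ : (fun y0 => _) = fun=> 0) ?ig0 ?mul0r//.
apply/funext => y';rewrite indicE;case: (boolP (_ \in _)) => [/set_mem yz|];last by rewrite mulr0.
have /ballP h := cell_sub_ball r0 yz.
rewrite /ag gN ?normr0 ?mul0r//.
have sr : side k <= r by have := side_le r0 (leq0n k);rewrite {2}/side divr1.
have := ler_normB (y' : V) (y' - y);rewrite opprB addrC subrK => h2.
by have h3 : `|y' - y| < side k := h;lra.
Qed.

Let gd_cbf : cbf gd.
split;first exact:Lint_meas gd_Lint.
 by exists (2 ^+ n * t) => y;exact:gd_bound.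
exists (N + r);first pos.
move=> y yN;rewrite /gd A_out// add0r gN ?mul0r//.
by apply:lt_trans yN;rewrite ltrDl.
Qed.

Let gd_sqr : ig (fun x : E => gd x ^+ 2) <= 2 ^+ n * t * I.
have l1 := LintZ (2 ^+ n * t) (Lint_abs gd_Lint).
apply:(le_via (ig (fun y => 2 ^+ n * t * `|gd y|))).
 apply:ig_le;[by have := cbfP (cbfM gd_cbf gd_cbf)|exact:l1|] => y.
 rewrite -(real_normK (num_real (gd y)));apply:ler_wpM2r;first exact:normr_ge0.
 exact:gd_bound.
rewrite (igZ _ (Lint_abs gd_Lint));apply:ler_wpM2l;last exact:gd_abs_ig.
by pos.
Qed.

Let g_split : {ae mu, forall y : V, g y = gd y + gb y}.
have aF y : (0 <= (ag y)%:E)%E by pos;exact:normr_ge0.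
have := @dyadic_differentiation R n 0 r r0 _ t (ltW t0) (mEFin (D := setT) (Lint_meas agi)) aF.
apply:ae_imp => y h.
rewrite addrC addrA subrK -mulrDr !indicE.
have [yO|yO] := boolP (y \in (Om)).
 rewrite memNset ?addr0 ?mulr1// => -[nO _];exact:(nO (set_mem yO)).
rewrite mem_set ?add0r ?mulr1;split;first by move=> Oy;move/negP: yO;apply;exact/mem_set.
have := h _;rewrite lee_fin;apply => k.
rewrite (cavg_cell 0 r0 _ _ agi) (lebesgue_cell 0 r0) lee_fin ler_wpM2r ?(ltW (sn0 k))//.
rewrite leNgt;apply/negP => Pk;move/negP: yO;apply;apply/mem_set.
by exists k.
Qed.

(** The balls of descendants lie in the balls of ancestors, as [stopped_enlarge] requires; outside
    them every point is two side lengths away from the corner of each stopping cell. *)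
Let OmS : set E := \bigcup_k \bigcup_(z in [set z | P k z /\ cell k z !=set0]) ball (cen k z) (2 * side k).

Let OmS_out k z (x : V) : fs k z -> ~ OmS x -> 2 * side k <= `|x - cen k z|.
move=> fk nOx;rewrite leNgt;apply/negP => xc;apply:nOx;exists k;first exact:Logic.I.
exists z;first by split;[case: fk|exists (cen k z);exact:cen_cell].
exact/ballP.
Qed.

Let mOmS : measurable OmS.
apply/open_meas/bigcup_open => k _;apply:bigcup_open => z _.
exact:ball_open.
Qed.

Let OmS_small : (mu OmS <= (4 ^+ n / t * I)%:E)%E.
have l1 := LintZ (4 ^+ n / t) agi.
have h := @stopped_enlarge R n 0 r r0 P (fun k z => ball (cen k z) (2 * side k)) (cst 1%E)
 (fun y => (4 ^+ n / t * ag y)%:E) (measurable_cst _) (fun=> lee01).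
have mg := mEFin (D := setT) (Lint_meas l1).
have g0 x : (0 <= (4 ^+ n / t * ag x)%:E)%E by pos;exact:normr_ge0.
have := h mg g0;rewrite integral_cst// mul1e => {}h.
apply:(le_via (\I_(x in Om) (4 ^+ n / t * ag x))%E).
 apply:h.
 - by move=> k z;exact/open_meas/ball_open.
 - move=> j k x jk;have [->//|jk'] := eqVneq j k.
  have {}jk : (j < k)%N by rewrite ltn_neqAle jk'.
  move=> y /ballP yk;apply/ballP.
  have c1 : cell j (idx j x) (cen k (idx k x)).
   by rewrite /cell/=;apply:(idx_nested r0 (ltnW jk));exact:cen_cell.
  have c2 := cen_near c1.
  have s2 : 2 * side k <= side j.
   have -> : side j = 2 * side j.+1 by rewrite /side exprS;field;rewrite expf_neq0.
   by rewrite ler_pM2l// side_le.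
  rewrite -[y](subrK (cen k (idx k x))) -addrA;apply:le_lt_trans (ler_normD _ _) _.
  by have := ltr_leD yk (ltW c2);rewrite mulrDl => h';lra.
 - move=> k z [Pk _].
  have s20 : 0 < 2 * side k by rewrite mulr_gt0// side_gt0.
  rewrite integral_cst ?mul1e;last exact/open_meas/ball_open.
  rewrite -[X in (X <= _)%E]/(mu (ball (cen k z) (2 * side k))) mu_ball//.
  rewrite (cavg_cell 0 r0 _ _ l1) lee_fin.
  have -> : cavg (fun y => 4 ^+ n / t * ag y) k z = 4 ^+ n / t * cavg ag k z.
   rewrite /cavg mulrA -(igZ _ (Lint_cell 0 r0 k z agi)).
   by congr (ig _ / _);apply/funext => y;rewrite mulrA.
  rewrite (_ : 2 * (2 * side k) = 4 * side k);last by ring.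
  rewrite exprMn ler_wpM2r ?(ltW (sn0 k))// -mulrA ler_peMr ?exprn_ge0//.
  by rewrite -ler_pdivrMl ?invr_gt0// invrK mulr1 ltW.
apply:le_trans (int_subset mu mOm measurableT mg g0 (@subsetT _ _)) _.
by rewrite (ig_EFin l1) (igZ _ agi).
Qed.

(** The three terms of the constant are the [L^2] bound on the good part, the measure of the
    enlarged cells, and the smoothness of the kernel against the bad part off these cells. The ball
    of radius [N'] makes the exchange of integrals legitimate; the bound does not depend on it. *)
Lemma weak_type_aux (N' : R) : 0 < N' ->
 (mu ([set x : E | (t < `|conv K g x|)%R] `&` ball (0%R : V) N') <=
  ((4 * A2 * 2 ^+ n + 4 ^+ n + 4 * AH * 4 ^+ n) / t * I)%:E)%E.
move=> N'0.
have [M kM] := csupp_bounded (smooth_cont sK) cK.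
have ck := smooth_cont sK.
pose B : set E := ball (0 : V) N'.
have mB : measurable B by exact/open_meas/ball_open.
have Boo : (mu B < +oo)%E by rewrite mu_ball// ltry.
have [Bi _] := Lint_indic_lty mB Boo.
have cE x : conv K g x = conv K gd x + conv K gb x.
 rewrite -(convD x sK cK gd_Lint gb_Lint).
 apply:ig_ae_eq;[exact:(Lint_conv ck kM)|exact:(Lint_conv ck kM x (LintD gd_Lint gb_Lint))|].
 by apply:ae_imp g_split => y ->.
have t20 : 0 < t / 2 by pos.
have mabs h s : Lint h -> measurable [set x : E | s < `|conv K h x|].
 move=> hi;have m1 : mfun (fun x : E => `|conv K h x|).
  by apply:cont_meas;apply:continuous_abs;exact:conv_continuous.
 have := m1 measurableT _ (measurable_itv `]s, +oo[).
 by rewrite setTI;congr measurable;apply/seteqP;split=> y /=;rewrite in_itv/= andbT.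
pose S1 : set E := [set x : E | t / 2 < `|conv K gd x|].
pose D' : set E := B `\` OmS.
have mD' : measurable D' by exact:measurableD.
pose S3 : set E := [set x : E | t / 2 < `|conv K gb x|] `&` D'.
have mS1 : measurable S1 by exact:mabs.
have mS3 : measurable S3 by apply:measurableI => //;exact:mabs.
have b1 : (mu S1 <= (4 * A2 * 2 ^+ n / t * I)%:E)%E.
 have cg := conv_cbf sK cK gd_cbf.
 have t2 : 0 < (t / 2) ^+ 2 by pos.
 have := @markov_ig (fun x => conv K gd x ^+ 2) S1 ((t / 2) ^+ 2) (cbfP (cbfM cg cg)) (fun x => sqr_ge0 _) mS1 t2.
 move=> h;apply:(le_trans (h _)).
  move=> x /ltW;rewrite -(real_normK (num_real (conv K gd x))) => h'.
  by rewrite lerXn2r ?nnegrE ?(ltW t20).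
 rewrite lee_fin (ler_pdivrMr _ _ t2);apply:le_trans (L2 gd_cbf) _.
 apply:le_trans (ler_wpM2l A20 gd_sqr) _.
 apply:le_of_eq;field.
 by pos.
have b3 : (mu S3 <= (4 * AH * 4 ^+ n / t * I)%:E)%E.
 have ngb := Lint_abs gb_Lint.
 (* On each stopping cell [gb] has integral 0, so [K(x - y)] may be diminished by its value at the
    corner [cc y]; [F] is the modulus of the resulting integrand, cut off to [D']. *)
 pose F (x y : E) : R := \1_D' x * (`|gb y| * `|K ((x : V) - (y : V)) - K ((x : V) - cc y)|).
 have mK1 := measurable_sub_comp ck.
 have mK2 : mfun (fun z : E * E => K ((z.1 : V) - cc z.2)).
  apply:(measurable_coords_comp (m := fun z : E * E => (z.1 : V) - cc z.2)) ck => i.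
  rewrite (_ : (fun _ => _) = fun z : E * E => (z.1 : V) 0 i - sf (fun k z => cen k z 0 i) z.2).
   apply:measurable_funB.
    exact:(mT_comp (@measurable_coordE R n setT i) measurable_fst).
   exact:(mT_comp (measurable_stop_fun 0 r0 P (fun k z => cen k z 0 i)) measurable_snd).
  by apply/funext => z;rewrite !mxE.
 have mF : mfun (fun z : E * E => F z.1 z.2).
  apply:mfunM.
   have mI : mfun (\1_D' : E -> R) by exact:measurable_indic.
   exact:(mT_comp mI measurable_fst).
  apply:mfunM.
   exact:(mT_comp (Lint_meas ngb) measurable_snd).
  by apply:mT_comp => //;exact:measurable_funB.
 have D'B x : \1_D' x <= \1_B x :> R.
  rewrite !indicE;case: (boolP (x \in D')) => [/set_mem[Bx _]|_];first by rewrite mem_set.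
  by pos.
 have F0 x y : 0 <= F x y by rewrite mulr_ge0 ?indicE//;exact:normr_ge0.
 have FM x y : `|F x y| <= \1_B x * (2 * M * `|gb y|).
  rewrite ger0_norm//;apply:ler_pM.
  - by pos.
  - by pos;exact:normr_ge0.
  - exact:D'B.
  rewrite mulrC;apply:ler_wpM2r;first exact:normr_ge0.
  by apply:le_trans (ler_normB _ _) _;rewrite mulrDl mul1r;apply:lerD.
 have [[s1 s2] s3] := leb_swap mF FM Bi (LintZ (2 * M) ngb).
 have [sx sy] := leb_Lint mF FM Bi (LintZ (2 * M) ngb).
 have inner y : ig (F^~ y) <= AH * 4 ^+ n * `|gb y|.
  have [Oy|nOy] := pselect (Om y);last first.
   have gb0 := gb_out nOy.
   have Fy : F^~ y = fun=> 0 by apply/funext => x;rewrite /F gb0 normr0 mul0r mulr0.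
   by rewrite Fy ig0 gb0 normr0 mulr0.
  pose k := stop_time 0 r P y;pose z := idx k y.
  have fk : fs k z by exact:stop_timeP.
  have ccE : cc y = cen k z by apply:cc_cell.
  have s0 := side_gt0 r0 k.
  have yc : `|y - cc y| <= side k by rewrite ccE;apply/ltW/cen_near.
  have s20 : 0 < 2 * side k by pos.
  have T := tail_integral (cc y) s20.
  set Tl := [set x : E | _] in T.
  have mT : measurable Tl.
   rewrite (_ : Tl = [set x : E | `|x - cc y| \in `[2 * side k, +oo[]).
    exact:measurable_norm_itv.
   by apply/seteqP;split=> x /=;rewrite in_itv/= andbT.
  pose G (x : E) : R := AH * side k * (`|(x : V) - cc y| ^- n.+1 * \1_Tl x).
  have mp : mfun (fun x : E => `|x - cc y| ^- n.+1).
   rewrite (_ : (fun _ => _) = fun x : E => `|x - cc y| `^ (- n.+1%:R)).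
    exact:(mpowR _ (measurable_norm_sub (cc y))).
   by apply/funext => x;rewrite powRN powR_mulrn.
  have [|||Gi Gc] := @ig_lty _ E R mu (fun x => `|x - cc y| ^- n.+1 * \1_Tl x) _ _ (2 * 4 ^+ n / (2 * side k)).
  - exact:mfunM;exact:measurable_indic.
  - by move=> x;pos.
  - by move: T;rewrite -int_indic.
  have G0 x : 0 <= G x.
   apply:mulr_ge0;first by apply:mulr_ge0;[exact:AH0|exact:ltW].
   apply:mulr_ge0;first by pos;apply:exprn_ge0;exact:normr_ge0.
   by pos;exact:ler0n.
  have le1 : forall x, F x y <= `|gb y| * G x.
   move=> x;rewrite /F mulrCA;apply:ler_wpM2l;first exact:normr_ge0.
   rewrite indicE;have [/set_mem[Bx nOx]|_] := boolP (x \in D');last first.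
    by rewrite mul0r;exact:G0.
   have xT : 2 * side k <= `|x - cc y|.
    by rewrite ccE;apply:OmS_out.
   have xTl : x \in Tl by apply/mem_set.
   rewrite mul1r /G indicE xTl mulr1.
   have v0 : x - cc y != 0 by rewrite -normr_gt0;apply:lt_le_trans xT.
   have uv : (x - y) - (x - cc y) = cc y - y by rewrite opprB addrC addrA subrK.
   have := HK (u := x - y) v0;rewrite uv distrC => /(_ _) h.
   have half : `|y - cc y| <= `|x - cc y| / 2.
    exact:half_real yc xT.
   apply:(le_trans (h half)).
   apply:ler_wpM2r;first pos.
   exact:ler_wpM2l.
  apply:(le_via (ig (fun x => `|gb y| * G x))).
   apply:ig_le;[|exact:(LintZ _ (LintZ _ Gi))|exact:le1].
   exact:(sy y).
  rewrite (igZ _ (LintZ _ Gi)) (igZ _ Gi) mulrC;apply:ler_wpM2r;first exact:normr_ge0.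
  apply:(le_via (AH * side k * (2 * 4 ^+ n / (2 * side k)))).
   by apply:ler_wpM2l;[apply:mulr_ge0;[exact:AH0|exact:ltW]|exact:Gc].
  by apply:le_of_eq;field;rewrite gt_eqF.
 have tot : ig (fun x => ig (F x)) <= AH * 4 ^+ n * (2 * I).
  rewrite s3;apply:(le_via (ig (fun y => AH * 4 ^+ n * `|gb y|))).
   by apply:ig_le;[exact:s2|exact:(LintZ _ ngb)|exact:inner].
  rewrite (igZ _ ngb);apply:ler_wpM2l;last exact:gb_abs_ig.
  by pos.
 have pt x : S3 x -> t / 2 <= ig (F x).
  move=> [/ltW h Dx];apply:(le_trans h).
  have l1 := Lint_conv ck kM x gb_Lint.
  have pM k z : `|K (x - cen k z)| <= M by [].
  have [a1 a2] := stop_avg 0 r0 P (phi := fun k z => K (x - cen k z)) gi pM.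
  have e0 y : gb y * sf (fun k z => K (x - cen k z)) y =
    g y * sf (fun k z => K (x - cen k z)) y - sf (fun k z => cavg g k z * K (x - cen k z)) y.
   rewrite (stop_funM 0 r P (cavg g) (fun k z => K (x - cen k z)) y) mulrBl;congr (_ - _).
   by rewrite -mulrA -stop_fun1 -stop_funM;congr (_ * sf _ y);apply/funext => k;apply/funext => z;rewrite mul1r.
  have l2 : Lint (fun y => g y * sf (fun k z => K (x - cen k z)) y).
   apply:(Lint_mulb (M := M) gi (measurable_stop_fun 0 r0 P _)) => y.
   exact:(stop_fun_bound _ _ _ _ pM).
  have z0 : ig (fun y => gb y * sf (fun k z => K (x - cen k z)) y) = 0.
   rewrite (_ : (fun y => _) = fun y : E => g y * sf (fun k z => K (x - cen k z)) y - sf (fun k z => cavg g k z * K (x - cen k z)) y).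
    by rewrite (igB l2 a1) a2 subrr.
   exact/funext.
  have l3 : Lint (fun y => gb y * sf (fun k z => K (x - cen k z)) y).
   rewrite (_ : (fun y => _) = fun y : E => g y * sf (fun k z => K (x - cen k z)) y - sf (fun k z => cavg g k z * K (x - cen k z)) y).
    exact:LintB.
   exact/funext.
  have -> : conv K gb x = ig (fun y => gb y * K (x - y) - gb y * sf (fun k z => K (x - cen k z)) y).
   by rewrite (igB l1 l3) z0 subr0.
  apply:le_trans (ig_abs (LintB l1 l3)) _.
  apply:ig_le;[exact:(Lint_abs (LintB l1 l3))|exact:(sx x)|] => y.
  rewrite /F indicE (mem_set Dx) mul1r -mulrBr normrM.
  have [Oy|nOy] := pselect (Om y);last first.
   by rewrite (gb_out nOy) normr0 !mul0r.
  have fk := stop_timeP r0 Oy.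
  by rewrite (stop_fun_cell r0 _ fk erefl) (cc_cell fk erefl).
 have F0' x : 0 <= ig (F x) by apply:ig_ge0 => y.
 apply:le_trans (markov_ig s1 F0' mS3 t20 pt) _.
 rewrite lee_fin (ler_pdivrMr _ _ t20);apply:(le_trans tot).
 by apply:le_of_eq;field;rewrite gt_eqF.
have sub : [set x : E | t < `|conv K g x|] `&` B `<=` S1 `|` OmS `|` S3.
 move=> x [/= tx Bx];have [Ox|nOx] := pselect (OmS x);first by left;right.
 have [h1|h1] := ltP (t / 2) `|conv K gd x|;first by left;left.
 right;split;last by split.
 rewrite /= ltNge;apply/negP => h2;move: tx;rewrite cE ltNge => /negP;apply.
 apply:le_trans (ler_normD _ _) _;rewrite [leRHS](splitr t);exact:lerD.
have mS : measurable ([set x : E | t < `|conv K g x|] `&` B) by apply:measurableI => //;exact:mabs.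
apply:le_trans (le_measure mu _ _ sub) _;rewrite ?inE//.
 by apply:measurableU => //;exact:measurableU.
apply:le_trans (measureU2 _ _ _) _ => //;first exact:measurableU.
rewrite (_ : _ * I = (4 * A2 * 2 ^+ n / t * I) + 4 ^+ n / t * I + 4 * AH * 4 ^+ n / t * I);last by ring.
rewrite 2!EFinD;apply:leeD => //;apply:le_trans (measureU2 _ _ _) _ => //.
exact:leeD.
Qed.

End decomposition.
End weak_type.

(** * Approximate identities in L^1 *)

Section approximate_identity.
Implicit Types (f g k F G : V -> R).

Lemma Lint_ball (z : V) (r : R) : 0 < r -> measurable (ball z r : set E) /\
 Lint (\1_(ball z r : set E) : V -> R).
move=> r0;have mB : measurable (ball z r : set E) by exact/open_meas/ball_open.
split;first exact:mB.
have Bf : (mu (ball z r) < +oo)%E by rewrite mu_ball//;exact:ltry.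
by have [] := Lint_indic_lty mB Bf.
Qed.

Definition bump (rho : R) k := [/\ smooth k, csupp k, ge0 k,
 forall x, k (- x) = k x & forall x, rho < `|x| -> k x = 0].

Lemma convZ k (c : R) F x : smooth k -> csupp k -> Lint F ->
 conv k (fun y => c * F y) x = c * conv k F x.
move=> sk ck Fi;have [M kM] := csupp_bounded (smooth_cont sk) ck.
rewrite /conv -(igZ c (Lint_conv (smooth_cont sk) kM x Fi)).
by congr ig;apply/funext => y;rewrite mulrA.
Qed.

Lemma Lint_conv_csupp k F : smooth k -> csupp k -> Lint F -> csupp F -> Lint (conv k F).
move=> sk ck Fi cF;apply:cbfP;apply:cbf_continuous;first exact:conv_continuous.
exact:conv_csupp.
Qed.

Lemma ig_reflect_even rho k (x : V) : bump rho k -> ig (fun y : E => k (x - (y : V))) = ig k.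
move=> [sk ck _ ek _];rewrite -(ig_shift (- x) (cbfP (cbf_smooth sk ck))).
by congr ig;apply/funext => y;rewrite -ek opprB.
Qed.

Lemma ig_conv_le rho k F : bump rho k -> Lint F -> csupp F -> ge0 F ->
 ig (conv k F) <= ig k * ig F.
move=> bk Fi cF F0;have [sk ck k0 _ _] := bk.
have kc := smooth_cont sk;have [M kM] := csupp_bounded kc ck.
have [N N0 NF] := conv_csupp ck cF.
pose B : set E := ball (0 : V) (N + 1).
have N10 : 0 < N + 1 by pos.
have [mB Bi] := Lint_ball 0 N10.
have -> : ig (conv k F) = ig (fun x => \1_B x * conv k F x).
 congr ig;apply/funext => x;rewrite indicE.
 have [xB|xB] := boolP (x \in B);first by rewrite mul1r.
 by rewrite mul0r (NF x (notin_ball0 xB)).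
have [_ i2 ->] := conv_swap kc kM Bi Fi.
rewrite -(igZ (ig k) Fi);apply:ig_le => //;first exact:LintZ.
move=> y;rewrite mulrC;apply:ler_wpM2r;first exact:F0.
have ki := cbfP (cbf_smooth sk ck).
have -> : ig k = ig (fun x => k (x - y)) by rewrite (ig_shift (- y) ki).
have kyi := cbfP (cbf_translate y sk ck).
apply:ig_le => [||x];last by apply:indic_mul_le;exact:k0.
 apply:(Lint_mulb (M := M) Bi);first exact:Lint_meas kyi.
 by move=> x;exact:kM.
exact:kyi.
Qed.

Lemma conv_gap_le rho k F : bump rho k -> Lint F -> csupp F ->
 Lint (fun x => conv k F x - ig k * F x) /\
 ig (fun x : E => `|conv k F x - ig k * F x|) <= 2 * ig k * ig (fun x : E => `|F x|).
move=> bk Fi cF;have [sk ck k0 _ _] := bk.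
have aFi := Lint_abs Fi.
have caF : csupp (fun x => `|F x|).
 by have [N N0 NF] := cF;exists N => // x xN;rewrite NF// normr0.
have ci := Lint_conv_csupp sk ck Fi cF.
have cai := Lint_conv_csupp sk ck aFi caF.
have m0 : 0 <= ig k by exact:ig_ge0.
have di : Lint (fun x => conv k F x - ig k * F x) := LintB ci (LintZ _ Fi).
split;first exact:di.
rewrite -mulrA mulr_natl mulr2n.
apply:(le_via (ig (fun x => conv k (fun y => `|F y|) x + ig k * `|F x|))).
 apply:ig_le;[exact:Lint_abs di | exact:LintD cai (LintZ _ aFi) | move=> x].
 apply:(le_trans (ler_normB _ _));rewrite normrM (ger0_norm m0) lerD2r.
 have kc := smooth_cont sk;have [M kM] := csupp_bounded kc ck.
 have l1 := Lint_conv kc kM x Fi;have l2 := Lint_conv kc kM x aFi.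
 apply:(le_trans (ig_abs l1));apply:ig_le;[exact:Lint_abs l1 | exact:l2 | move=> y].
 by rewrite normrM (ger0_norm (k0 _)).
rewrite (igD cai (LintZ _ aFi)) (igZ _ aFi) lerD2r.
exact:(ig_conv_le bk) => // x;exact:normr_ge0.
Qed.

(** Bumps are not normalised, hence the factors [ig k]. The threshold [rho] depends on [F] and [eta]
    but not on the shape of the bump. *)
Definition good F := [/\ Lint F, csupp F & forall eta, 0 < eta -> exists2 rho, 0 < rho &
 forall k, bump rho k -> ig (fun x : E => `|conv k F x - ig k * F x|) <= eta * ig k].

Lemma goodD F G : good F -> good G -> good (fun x => F x + G x).
move=> [Fi cF hF] [Gi cG hG];split;[exact:LintD|exact:csuppD|move=> eta eta0].
have e20 : 0 < eta / 2 by pos.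
have [r1 r10 h1] := hF _ e20;have [r2 r20 h2] := hG _ e20.
exists (Num.min r1 r2);first by rewrite lt_min r10.
move=> k [sk ck k0 ek kr].
have b1 : bump r1 k by split => // x xr;apply:kr;rewrite gt_min xr.
have b2 : bump r2 k by split => // x xr;apply:kr;rewrite gt_min xr orbT.
have [d1 _] := conv_gap_le b1 Fi cF;have [d2 _] := conv_gap_le b2 Gi cG.
have FGi := LintD Fi Gi;have [d3 _] := conv_gap_le b1 FGi (csuppD cF cG).
rewrite (_ : eta * ig k = eta / 2 * ig k + eta / 2 * ig k);last by rewrite -mulrDl -splitr.
apply:(le_trans _ (lerD (h1 k b1) (h2 k b2))).
rewrite -(igD (Lint_abs d1) (Lint_abs d2)).
apply:ig_le;[exact:Lint_abs d3 | exact:LintD (Lint_abs d1) (Lint_abs d2) | move=> x].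
by rewrite (convD x sk ck Fi Gi) mulrDr opprD addrACA ler_normD.
Qed.

Lemma goodZ (c : R) F : good F -> good (fun x => c * F x).
move=> [Fi cF hF];split;[exact:LintZ|exact:csuppZ|move=> eta eta0].
have c10 : 0 < `|c| + 1 by pos.
have [r r0 h] := hF _ (divr_gt0 eta0 c10);exists r => // k bk.
have [sk ck k0 _ _] := bk;have [d1 _] := conv_gap_le bk Fi cF.
have m0 : 0 <= ig k by exact:ig_ge0.
rewrite (_ : (fun x : E => `|conv k (fun x => c * F x) x - ig k * (c * F x)|) =
       (fun x => `|c| * `|conv k F x - ig k * F x|));last first.
 by apply/funext => x;rewrite (convZ c x sk ck Fi) mulrCA -mulrBr normrM.
rewrite (igZ _ (Lint_abs d1)).
apply:(le_trans (ler_wpM2l (normr_ge0 c) (h k bk))).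
rewrite mulrA;apply:ler_wpM2r => //.
rewrite mulrCA ler_piMr ?(ltW eta0)// ler_pdivrMr// mul1r lerDl//.
Qed.

Lemma good0 : good (fun=> 0).
split;[exact:Lint0|by exists 1|move=> eta eta0;exists 1 => // k [sk ck k0 _ _]].
rewrite (_ : (fun x => _) = fun=> 0);last first.
 apply/funext => x;rewrite mulr0 subr0 /conv (_ : (fun y => _) = fun=> 0) ?ig0 ?normr0//.
 by apply/funext => y;rewrite mul0r.
by rewrite ig0 mulr_ge0 ?(ltW eta0)//;exact:ig_ge0.
Qed.

(** The [L^1] norm of [conv k F - ig k F] is at most [2 ig k] times that of [F], uniformly over
    bumps, so the class is closed under [L^1] limits. *)
Lemma good_approx F : Lint F -> csupp F ->
 (forall eta, 0 < eta -> exists2 G, good G & ig (fun x : E => `|F x - G x|) <= eta) -> good F.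
move=> Fi cF H;split => // eta eta0.
have e20 : 0 < eta / 4 by pos.
have [G [Gi cG hG] FG] := H _ e20.
have [r r0 h] := hG _ (divr_gt0 eta0 (ltr0Sn R 1)).
exists r => // k bk;have [sk ck k0 _ _] := bk.
have di := LintB Fi Gi.
have cd : csupp (fun x => F x - G x).
 have := csuppD cF (csuppZ (-1) cG).
 by rewrite (_ : (fun x => F x + -1 * G x) = fun x => F x - G x)//;apply/funext => x;rewrite mulN1r.
have [i1 l1] := conv_gap_le bk di cd.
have [i2 _] := conv_gap_le bk Gi cG;have [i3 _] := conv_gap_le bk Fi cF.
have m0 : 0 <= ig k by exact:ig_ge0.
apply:(le_via (2 * ig k * (eta / 4) + eta / 2 * ig k));last by rewrite gap_real.
have l1' := le_trans l1 (ler_wpM2l (mulr_ge0 (ler0n _ 2) m0) FG).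
apply:(le_trans _ (lerD l1' (h k bk))).
rewrite -(igD (Lint_abs i1) (Lint_abs i2)).
apply:ig_le;[exact:Lint_abs i3 | exact:LintD (Lint_abs i1) (Lint_abs i2) | move=> x].
have -> : conv k F x = conv k (fun y => F y - G y) x + conv k G x.
 rewrite -(convD x sk ck di Gi);congr (conv k _ x).
 by apply/funext => y;rewrite subrK.
apply:le_trans (ler_normD _ _);apply:le_of_eq.
by congr (`|_|);ring.
Qed.

(** At points deeper than [1/(j+1)] inside [U] the convolution equals [ig k] exactly. Elsewhere it
    is controlled by its total mass, at most [ig k] times the measure of [U], so no regularity of
    the boundary enters. *)
Lemma good_open (U : set V) (N : R) : open U -> U `<=` ball (0 : V) N -> 0 < N ->
 good (\1_(U : set E) : V -> R).
move=> oU UN N0.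
have mU : measurable (U : set E) by exact:open_meas.
have UB : (mu U <= ((2 * N) ^+ n)%:E)%E.
 rewrite -(mu_ball 0 N0);apply:le_measure => //;rewrite ?inE//.
 exact/open_meas/ball_open.
have [Ui UE] := Lint_indic_lty mU (le_lt_trans UB (ltry _)).
have cU : csupp (\1_(U) : V -> R).
 exists N => // x xN;rewrite indicE memNset// => /UN /ballP.
 by rewrite subr0 => /(lt_trans xN);rewrite ltxx.
split;[exact:Ui|exact:cU|move=> eta eta0].
pose Us j : set E := [set x | ball (x : V) j.+1%:R^-1 `<=` U].
have j0 j : 0 < j.+1%:R^-1 :> R by pos.
have UsU j : Us j `<=` U by move=> x;apply;exact:ballxx (j0 j).
have mUs j : measurable (Us j).
 rewrite -[Us j]setCK;apply:measurableC;apply:open_meas.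
 rewrite openE => x /existsNP[y /not_implyP[xy Uy]].
 apply:(@filterS _ _ _ (ball y j.+1%:R^-1)).
  by move=> t ty /(_ y);rewrite -/(ball _ _ _) => /(_ (ball_sym ty)).
 by apply:open_nbhs_nbhs;split;[exact:ball_open|exact:ball_sym].
have ndU : nondecreasing_seq Us.
 move=> i j ij;apply/subsetPset => x Ux y xy;apply:Ux.
 by apply:le_ball xy;rewrite lef_pV2 ?posrE// ler_nat.
have UsE : \bigcup_j Us j = U.
 apply/seteqP;split => [x [j _ /UsU]//|x Ux].
 have /nbhs_ballP[e /= e0 eU] := open_nbhs_nbhs (conj oU Ux).
 have [j je] := ltr_add_invr (ltac:(exact:e0) : 0 < e);rewrite add0r in je.
 by exists j => // y xy;apply:eU;exact:le_ball (ltW je) _ xy.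
have := @nondecreasing_cvg_mu _ E R mu Us mUs;rewrite UsE => /(_ mU ndU) cvU.
have Usi j : (mu (Us j) < +oo)%E.
 apply:(le_lt_trans _ (le_lt_trans UB (ltry _)));apply:le_measure;rewrite ?inE//.
have Uf : mu U \is a fin_num by rewrite ge0_fin_numE// (le_lt_trans UB (ltry _)).
have [j jU] : exists j, fine (mu U) - eta / 2 < fine (mu (Us j)).
 have : (fine \o (mu \o Us)) j @[j --> \oo] --> fine (mu U).
  by apply:fine_cvg;rewrite fineK.
 move=> /cvgr_gt /(_ (fine (mu U) - eta / 2)).
 rewrite ltrBlDr ltrDl divr_gt0// => /(_ isT) [j _ hj].
 by exists j;exact:hj j (leqnn j).
have [Ji JE] := Lint_indic_lty (mUs j) (Usi j).
(* Strictly smaller than [1/(j+1)]: the balls defining [Us j] are open, while a bump may be nonzero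
   at distance exactly [rho]. *)
exists (j.+2%:R^-1);first exact:j0.
move=> k bk;have [sk ck k0 ek kr] := bk.
have m0 : 0 <= ig k by exact:ig_ge0.
have ci := Lint_conv_csupp sk ck Ui cU.
have [di _] := conv_gap_le bk Ui cU.
have kc := smooth_cont sk;have [M kM] := csupp_bounded kc ck.
have c0 x : 0 <= conv k (\1_(U)) x.
 by apply:ig_ge0 => y;rewrite mulr_ge0// indicE.
have cm x : Us j x -> conv k (\1_(U)) x = ig k.
 move=> Ux;rewrite -(ig_reflect_even x bk);congr ig;apply/funext => y.
 have [xy|xy] := ltP j.+2%:R^-1 `|x - y|;first by rewrite (kr _ xy) mulr0.
 rewrite indicE mem_set ?mul1r//;apply:Ux;rewrite -ball_normE /=.
 by apply:(le_lt_trans xy);rewrite ltf_pV2 ?posrE// ltr_nat.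
apply:(le_via (ig (fun x => conv k (\1_(U)) x + ig k * (\1_(U) x - 2 * \1_(Us j) x)))).
 have Li : Lint (fun x => \1_(U) x - 2 * \1_(Us j) x) := LintB Ui (LintZ _ Ji).
 apply:ig_le;[exact:Lint_abs di | exact:LintD ci (LintZ _ Li) | move=> x].
 rewrite [\1_(Us j) x]indicE;have [/set_mem xj|xj] := boolP (x \in Us j).
  rewrite (cm x xj) indicE mem_set;last exact:UsU xj.
  exact:gap_real3.
 rewrite mulr0 subr0;apply:(le_trans (ler_normB _ _)).
 by rewrite !ger0_norm// ?mulr_ge0// indicE.
have Li : Lint (fun x => \1_(U) x - 2 * \1_(Us j) x) := LintB Ui (LintZ _ Ji).
rewrite (igD ci (LintZ _ Li)) (igZ _ Li) (igB Ui (LintZ _ Ji)) (igZ _ Ji).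
have u0 x : 0 <= (\1_(U) : V -> R) x by pos.
have := ig_conv_le bk Ui cU u0.
rewrite UE JE;exact:gap_real2.
Qed.

Lemma good_indic (A : set E) (N : R) : measurable A -> A `<=` ball (0 : V) N -> 0 < N ->
 good (\1_A : V -> R).
move=> mA AN N0.
have [mB Bi] := Lint_ball 0 N0.
have AB : (mu A <= ((2 * N) ^+ n)%:E)%E.
 by rewrite -(mu_ball 0 N0);apply:le_measure => //;rewrite inE.
have Aoo := le_lt_trans AB (ltry _).
have [Ai AE] := Lint_indic_lty mA Aoo.
have cA : csupp (\1_A : V -> R).
 exists N => // x xN;rewrite indicE memNset// => /AN /ballP.
 by rewrite subr0 => /(lt_trans xN);rewrite ltxx.
apply:(good_approx Ai cA) => eta eta0.
have [W [oW AW We]] := lebesgue_outer_open eta0 Aoo.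
pose U := W `&` ball (0 : V) N.
have oU : open U by apply:openI => //;exact:ball_open.
have UN : U `<=` ball 0 N by move=> x [].
have AU : A `<=` U by move=> x Ax;split;[exact:AW|exact:AN].
have mU : measurable (U : set E) by exact:open_meas.
have mW : measurable (W : set E) by exact:open_meas.
have UW : (mu U <= mu W)%E by apply:le_measure;rewrite ?inE//;move=> x [].
have UA : (mu U <= mu A + eta%:E)%E := le_trans UW We.
have Af : mu A \is a fin_num by rewrite ge0_fin_numE.
have Uoo : (mu U < +oo)%E by apply:(le_lt_trans UA);rewrite -(fineK Af) -EFinD ltry.
have [Ui UE] := Lint_indic_lty mU Uoo.
exists (\1_(U));first exact:good_open oU UN N0.
have -> : (fun x => `|\1_A x - \1_(U) x|) = (fun x => \1_(U) x - \1_A x :> R).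
 apply/funext => x;rewrite distrC ger0_norm// subr_ge0 !indicE.
 by have [/set_mem /AU /mem_set ->|//] := boolP (x \in A).
rewrite (igB Ui Ai) UE AE lerBlDl -lee_fin EFinD.
by rewrite !fineK// ge0_fin_numE.
Qed.

Lemma good_sum (I : Type) (s : seq I) (F : I -> V -> R) : (forall i, good (F i)) ->
 good (fun x => \sum_(i <- s) F i x).
move=> h;elim: s => [|i s ih].
 by rewrite (_ : (fun x => _) = fun=> 0);[exact:good0|apply/funext => x;rewrite big_nil].
rewrite (_ : (fun x => _) = fun x => F i x + \sum_(i <- s) F i x);first exact:goodD.
by apply/funext => x;rewrite big_cons.
Qed.

Import HBSimple.

Lemma Lint_good F (N : R) : 0 < N -> Lint F -> (forall x, N <= `|x| -> F x = 0) -> good F.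
move=> N0 Fi FN;have cF : csupp F by exists N => // x xN;apply:FN;exact:ltW.
apply:(good_approx Fi cF) => eta eta0.
pose B : set E := ball (0 : V) N;have [mB Bi] := Lint_ball 0 N0.
have [g_ [g1 _ g3]] := approximation_sfun_integrable measurableT Fi.
have [j hj] := cvg0_ex_le g3 eta0.
have gi := g1 j.
exists (fun x : V => g_ j x * \1_B x).
 rewrite (_ : (fun x => _) = fun x : V =>
  \sum_(y <- finmap.enum_fset (fset_set (range (g_ j)))) y * \1_((g_ j @^-1` [set y]) `&` B) x).
  apply:good_sum => y;apply:goodZ;apply:(good_indic _ _ N0);last by move=> x [].
  exact:measurableI.
 apply/funext => x;rewrite fimfunE fsbig_finite//= mulr_suml.
 by apply:eq_bigr => y _;rewrite -mulrA indicI.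
have Gi : Lint (fun x : V => g_ j x * \1_B x) by exact:Lint_indic.
have d1 := LintB Fi Gi;have d2 := LintB Fi gi.
apply:(le_via (ig (fun x => `|F x - g_ j x|))).
 apply:ig_le;[exact:Lint_abs d1|exact:Lint_abs d2|move=> x].
 rewrite indicE;have [xB|xB] := boolP (x \in B);first by rewrite mulr1.
 rewrite mulr0 FN ?subr0 ?normr0//;move: xB;rewrite notin_setE /B => xB.
 by rewrite leNgt;apply/negP => xN;apply:xB;apply/ballP;rewrite subr0.
rewrite -lee_fin -(ig_EFin (Lint_abs d2));apply:le_trans hj.
by pos;apply/orP;left;apply/eqP;apply:eq_integral => x _.
Qed.

End approximate_identity.

(** * Elliptic matrices and their inverses *)

Section elliptic_matrix.
Implicit Types (A B : 'M[R]_n) (x y : V).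

Definition elliptic (lam Lam : R) A := (forall i j, A i j = A j i) /\
 forall x, lam * dotv x x <= qform A x <= Lam * dotv x x.

Lemma lin_mul A B i x : lin A i (\row_j lin B j x) = lin (A *m B) i x.
rewrite /lin;under eq_bigr do rewrite mxE mulr_sumr.
rewrite exchange_big /=;apply:eq_bigr => j _;rewrite mxE mulr_suml.
by apply:eq_bigr => k _;rewrite mulrA.
Qed.

Lemma lin1 i x : lin (1%:M : 'M[R]_n) i x = x 0 i.
rewrite /lin (bigD1 i)//= mxE eqxx mul1r big1 ?addr0// => j ji.
by rewrite mxE eq_sym (negbTE ji) mul0r.
Qed.

Lemma qform_dotv A x : qform A x = dotv x (\row_i lin A i x).
by apply:eq_bigr => i _;rewrite mxE. Qed.

Lemma qform_eq A x : qform A x = \sum_k \sum_l A k l * (x 0 k * x 0 l).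
by apply:eq_bigr => k _;rewrite mulr_sumr;apply:eq_bigr => l _;ring. Qed.

Lemma dotv_delta x i : dotv x (delta_mx 0 i) = x 0 i.
rewrite /dotv (bigD1 i)//= mxE !eqxx mulr1 big1 ?addr0// => j ji.
by rewrite mxE eqxx (negbTE ji) mulr0.
Qed.

Lemma lin_delta A i j : lin A i (delta_mx 0 j) = A i j.
rewrite /lin (bigD1 j)//= mxE !eqxx mulr1 big1 ?addr0// => k kj.
by rewrite mxE eqxx (negbTE kj) mulr0.
Qed.

Lemma linDZ A i x y (c : R) : lin A i (x + c *: y) = lin A i x + c * lin A i y.
rewrite /lin mulr_sumr -big_split;apply:eq_bigr => j _;rewrite !mxE.
by rewrite mulrDr mulrCA.
Qed.

Variables (lam Lam : R) (A : 'M[R]_n).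
Hypothesis lam0 : 0 < lam.
Hypothesis EA : elliptic lam Lam A.
Let As : forall i j, A i j = A j i := EA.1.
Let Ae : forall x, lam * dotv x x <= qform A x <= Lam * dotv x x := EA.2.

(** Diagonal entries come from unit vectors, the others by polarisation with [e_i + e_j] and
    [e_i - e_j]. *)
Lemma elliptic_entry i j : `|A i j| <= Lam.
have Ld k : 0 <= A k k <= Lam.
 have := Ae (delta_mx 0 k);rewrite dotv_delta mxE !eqxx mulr1 qform_dotv.
 rewrite dotv_comm dotv_delta mxE lin_delta mulr1 => /andP[h1 ->].
 by rewrite (le_trans (ltW lam0) h1).
have [->|ij] := eqVneq i j;first by have /andP[h1 h2] := Ld j;rewrite ger0_norm.
have L0 : 0 <= Lam by have /andP[h1 h2] := Ld i;exact:le_trans h2.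
have key (c : R) : 0 <= A i i + c * A i j + c * (A j i + c * A j j) <= Lam * (1 + c ^+ 2).
 pose v : V := delta_mx 0 i + c *: delta_mx 0 j.
 have dd : dotv v v = 1 + c ^+ 2.
  rewrite {2}/v dotvDr dotvZr !dotv_delta !mxE !eqxx (negbTE ij) eq_sym (negbTE ij) /=.
  by rewrite mulr0 addr0 mulr1 add0r expr2.
 have qq : qform A v = A i i + c * A i j + c * (A j i + c * A j j).
  rewrite qform_dotv dotv_comm {2}/v dotvDr dotvZr !dotv_delta !mxE.
  by rewrite !linDZ !lin_delta.
 have /andP[h1 h2] := Ae v;rewrite -qq -dd h2 (le_trans _ h1)//.
 by rewrite mulr_ge0 ?(ltW lam0)// dotv_ge0.
have /andP[p1 p2] := key 1;have /andP[q1 q2] := key (-1).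
have /andP[i1 i2] := Ld i;have /andP[j1 j2] := Ld j.
rewrite (As j i) in p1 p2 q1 q2.
rewrite ler_norml;move: p1 p2 q1 q2;rewrite sqrrN expr1n => *.
by apply/andP;split;lra.
Qed.

Lemma elliptic_unit : A \in unitmx.
rewrite -row_free_unit;apply:inj_row_free => v vA.
have lv i : lin A i v = 0.
 have <- : (v *m A) 0 i = 0 by rewrite vA mxE.
 by rewrite mxE;apply:eq_bigr => j _;rewrite mulrC As.
have /andP[h _] := Ae v.
have q0 : qform A v = 0 by rewrite /qform big1// => i _;rewrite lv mulr0.
move: h;rewrite q0 pmulr_rle0// => h.
have d0 : dotv v v = 0 by apply/eqP;rewrite eq_le h dotv_ge0.
apply/rowP => i;rewrite mxE;apply/eqP;rewrite -normr_le0.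
apply:(le_trans (coord_le_normv v i)).
by rewrite -(@ler_pXn2r _ 2) ?nnegrE ?normv_ge0// sqr_normv d0 expr0n.
Qed.

Let B := invmx A.
Let AB : A *m B = 1%:M. Proof. exact:mulmxV elliptic_unit. Qed.

Lemma elliptic_inv_sym i j : B i j = B j i.
have AT : A^T = A by apply/matrixP => k l;rewrite mxE As.
by rewrite -[B in RHS]trmxK mxE {2}/B trmx_inv AT.
Qed.

Let Bx x : V := \row_i lin B i x.
Let qB x : qform B x = qform A (Bx x).
rewrite qform_dotv (qform_dotv A) dotv_comm;congr dotv.
by apply/rowP => i;rewrite mxE lin_mul AB lin1.
Qed.

(** For [y = B e_j] the form gives [lam |y|^2 <= <A y, y> = y_j <= |y|]. *)
Lemma elliptic_inv_entry i j : `|B i j| <= lam^-1.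
pose y := Bx (delta_mx 0 j);have yi : B i j = y 0 i by rewrite mxE lin_delta.
rewrite yi;apply:(le_trans (coord_le_normv y i)).
have /andP[h _] := Ae y;rewrite -qB in h.
have qe : qform B (delta_mx 0 j) = y 0 j by rewrite qform_dotv dotv_comm dotv_delta.
rewrite qe -sqr_normv in h.
apply:(inv_bound_real lam0 h (lexx _) _ (normv_ge0 y)).
exact:le_trans (ler_norm _) (coord_le_normv y j).
Qed.

Hypothesis L0 : 0 <= Lam.

Lemma elliptic_inv_lower x : lam / (n%:R * Lam + 1) ^+ 2 * `|x| ^+ 2 <= qform B x.
pose y := Bx x;have [h _] := andP (Ae y);rewrite -qB in h;apply:le_trans h.
have xy : `|x| <= (n%:R * Lam + 1) * normv y.
 apply:norm_leP => [|i].
  by rewrite mulr_ge0 ?normv_ge0// addr_ge0// mulr_ge0.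
 have -> : x 0 i = lin A i y by rewrite lin_mul AB lin1.
 apply:(le_trans (ler_norm_sum _ _ _)).
 apply:(le_via (\sum_(j < n) Lam * normv y)).
  apply:ler_sum => j _;rewrite normrM;apply:ler_pM => //;first exact:elliptic_entry.
  exact:coord_le_normv.
 rewrite sumr_const card_ord -[leLHS]mulr_natl mulrA.
 by apply:ler_wpM2r;rewrite ?normv_ge0// lerDl.
rewrite -sqr_normv -mulrA;apply:ler_wpM2l;first exact:ltW.
have : `|x| ^+ 2 <= ((n%:R * Lam + 1) * normv y) ^+ 2.
 by rewrite ler_sqr// nnegrE// (le_trans _ xy).
have c2 : 0 < (n%:R * Lam + 1) ^+ 2 by pos.
by rewrite exprMn => h;rewrite mulrC ler_pdivrMr// [leRHS]mulrC.
Qed.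

End elliptic_matrix.

(** * Kernel families with uniform constants *)

Section kernels.

Lemma ig_ball (z : V) (r : R) : 0 < r -> ig (\1_(ball z r : set E) : V -> R) = (2 * r) ^+ n.
move=> r0;have [mB _] := Lint_ball z r0.
have Bf : (mu (ball z r) < +oo)%E by rewrite mu_ball//;exact:ltry.
by have [_ ->] := Lint_indic_lty mB Bf;rewrite [X in fine X](mu_ball z r0).
Qed.

Lemma ig_bump_le rho k M : 0 < rho -> bump rho k -> (forall x : V, k x <= M) ->
 ig k <= M * (4 * rho) ^+ n.
move=> r0 [sk ck k0 _ kr] kM;have r20 : 0 < 2 * rho by pos.
have [mB Bi] := Lint_ball (0 : V) r20.
rewrite (_ : 4 * rho = 2 * (2 * rho));last by rewrite mulrA -natrM.
rewrite -(ig_ball 0 r20) -(igZ M Bi);apply:ig_le;[exact:cbfP (cbf_smooth sk ck)|exact:LintZ|].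
move=> x;rewrite indicE;have [xB|xB] := boolP (x \in _);first by rewrite mulr1.
rewrite mulr0 kr// ltNge;apply/negP => xr;move: xB;rewrite notin_setE;apply;apply/ballP.
by rewrite subr0 (le_lt_trans xr)// mulr_natl mulr2n ltrDl.
Qed.

(* [P e] is an approximate identity at scale [e] and [W e] a vector field with
  div (A W e) = P e, equal to the gradient of the fundamental solution of
  div (A grad) outside the support of [P e]. *)
Definition kernel_family (S CW m0 CP : R) (A : 'M[R]_n) (W : R -> 'I_n -> V -> R)
  (P : R -> V -> R) : Prop :=
 forall e, 0 < e ->
 [/\ (forall j, smooth (W e j)) /\ (forall j k, partial k (W e j) = partial j (W e k)),
   forall l j x, e <= l -> S * l < `|x| -> W e j x = W l j x,
   bump (S * e) (P e) /\ m0 <= ig (P e),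
   forall x, \sum_j \sum_k A j k * partial k (W e j) x = P e x &
   ((forall x, P e x <= CP * e ^- n) /\
    (forall k x, `|partial k (P e) x| <= CP * e ^- n.+1)) /\
   forall l j k g N t N', e <= l -> Lint g -> (forall x : V, N < `|x| -> g x = 0) ->
    0 < N -> 0 < t -> 0 < N' ->
    (mu ([set x : E | (t < `|conv (fun x => partial k (W e j) x - partial k (W l j) x) g x|)%R]
     `&` ball (0%R : V) N') <= (CW / t * ig (fun y : E => `|g y|))%:E)%E].

(** The constants are computed from the profile and the ellipticity bounds before the matrix is
    given. The difference of the fields at scales [e] and [l] has divergence [P e - P l], of [L^1]
    norm at most [Th], which feeds the energy bound; its Jacobian inherits the Lipschitz bound,
    doubled. *)
Lemma kernels_exist (lam Lam : R) : (0 < n)%N -> 0 < lam -> lam <= Lam ->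
 exists S CW m0 CP : R, [/\ 0 < S, 0 <= CW, 0 < m0, 0 < CP & forall A, elliptic lam Lam A ->
 exists (W : R -> 'I_n -> V -> R) (P : R -> V -> R), kernel_family S CW m0 CP A W P].
move=> n0 lam0 lL;have Lam0 : 0 <= Lam by exact:le_trans (ltW lam0) lL.
have [b [b1 [b2 [h [h1 [C [c pr]]]]]]] := profile_exists R n.
have [_ _ _ _ [C0 c0]] := pr.
pose be := lam^-1;pose bl := lam / (n%:R * Lam + 1) ^+ 2.
have be0 : 0 <= be by pos.
have bl0 : 0 < bl by pos.
have S0 := kS_gt0 bl0;have kr0 := @kR_gt0 R n be bl be0.
pose Th := 2 * (C * (4 * kS bl) ^+ n).
have Th0 : 0 < Th by pos.
have AH0 : 0 <= 2 * kL n C be bl by rewrite mulr_ge0//;exact:(kL_ge0 bl pr be0).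
pose CP1 := 2 * C * (n%:R * be) * kS bl.
have CP10 : 0 <= CP1 by pos.
pose CW := 4 * (Th / lam) ^+ 2 * 2 ^+ n + 4 ^+ n + 4 * (2 * kL n C be bl) * 4 ^+ n.
exists (kS bl), CW, (c * (2 * kR n be bl) ^+ n), (C + CP1);split => //.
- exact:cw_ge0.
- by pos.
- by pos.
move=> A EA;pose B := invmx A.
have AB := mulmxV (elliptic_unit lam0 EA).
have Bs := elliptic_inv_sym EA.
have Bb := elliptic_inv_entry lam0 EA.
have Bl := elliptic_inv_lower lam0 EA Lam0.
have bP e : 0 < e -> bump (kS bl * e) (kP B h e).
 move=> e0;split.
 - exact:smooth_kP pr e.
 - exists (kS bl * e);first pos.
  by move=> x xr;exact:(kP_out pr bl0 Bl e0 xr).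
 - by move=> x;exact:(kP_ge0 B pr x e0).
 - move=> x;rewrite /kP (_ : qform B (- x) = qform B x)//.
  by rewrite !qform_eq;apply:eq_bigr => i _;apply:eq_bigr => j _;rewrite !mxE mulrNN.
 - by move=> x xr;exact:(kP_out pr bl0 Bl e0 xr).
have ePi e : 0 < e -> ig (kP B h e) <= C * (4 * kS bl) ^+ n.
 move=> e0;have Se : 0 < kS bl * e by pos.
 apply:(le_trans (ig_bump_le Se (bP e e0) (fun x => kP_le B pr x e0))).
 have en : e ^+ n != 0 by pos.
 by rewrite mulrA [in leLHS]exprMn (mulrC _ (e ^+ n)) mulrA divfK.
exists (kW B b), (kP B h) => e e0;split.
- split=> [j|j k];first exact:smooth_kW pr e j.
 rewrite !(partial_kW pr Bs);apply/funext => x;exact:kK_sym.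
- by move=> l j x el xl;exact:(kW_eq pr bl0 Bl j e0 el xl).
- split;first exact:bP.
 have [z zP] := kP_bulk pr Bs Bb be0 bl0 Bl n0 e0.
 have r0 : 0 < kR n be bl * e by pos.
 have [mB Bi] := Lint_ball z r0;have [sk ck k0 _ _] := bP e e0.
 have -> : c * (2 * kR n be bl) ^+ n = ig (fun x => c * e ^- n * \1_(ball z (kR n be bl * e)) x).
  rewrite (igZ _ Bi) (ig_ball z r0) (mulrA 2) [in RHS]exprMn (mulrC _ (e ^+ n)) mulrA divfK//.
  by pos.
 apply:ig_le;[exact:LintZ|exact:cbfP (cbf_smooth sk ck)|move=> x].
 rewrite indicE;have [/set_mem/ballP/ltW xB|_] := boolP (x \in _);last by rewrite mulr0.
 by rewrite mulr1;exact:zP.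
- move=> x;rewrite -(kK_trace pr Bs e x AB);apply:eq_bigr => j _;apply:eq_bigr => k _.
 by rewrite (partial_kW pr Bs).
split;first split.
- move=> x;apply:(le_trans (kP_le B pr x e0));apply:ler_wpM2r;last by rewrite lerDl.
 by pos.
- move=> k x;rewrite (partial_kP pr Bs);apply:(le_trans (kP1_le pr Bs Bb be0 bl0 Bl k x e0)).
 apply:ler_wpM2r;last by rewrite lerDr ltW.
 by pos.
move=> l j k g N t N' el gi gN N0 t0 N'0.
have l0 := lt_le_trans e0 el.
pose W j x := kW B b e j x - kW B b l j x.
have sW i : smooth (W i) by apply:smooth_sub;exact:smooth_kW pr _ _.
have cW i : csupp (W i).
 exists (kS bl * l);first pos.
 by move=> x xl;rewrite /W (kW_eq pr bl0 Bl i e0 el xl) subrr.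
have pW i m : partial m (W i) = fun x => kK B b b1 e i m x - kK B b b1 l i m x.
 by rewrite /W partialB ?(partial_kW pr Bs)//;exact:smooth_kW pr _ _.
have curl i m : partial i (W m) = partial m (W i).
 by rewrite !pW;apply/funext => x;rewrite (kK_sym b b1 Bs e) (kK_sym b b1 Bs l).
have thE x : theta W A x = kP B h e x - kP B h l x.
 rewrite -(kK_trace pr Bs e x AB) -(kK_trace pr Bs l x AB) -sumrB.
 apply:eq_bigr => i _;rewrite -sumrB;apply:eq_bigr => m _.
 by rewrite pW mulrBr.
have [se ce ke0 _ _] := bP e e0;have [sl cl kl0 _ _] := bP l l0.
have ei := cbfP (cbf_smooth se ce);have li := cbfP (cbf_smooth sl cl).
have thi : Lint (fun x => kP B h e x + kP B h l x) by exact:LintD.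
have thT : ig (fun x => kP B h e x + kP B h l x) <= Th.
 by rewrite (igD ei li) /Th mulr_natl mulr2n;apply:lerD;exact:ePi.
have sth : smooth (theta W A) by exact:smooth_theta.
have cth : csupp (theta W A) by exact:csupp_theta.
have th1 y : ig (fun x => `|theta W A (x - y)|) <= Th.
 apply:le_trans thT;rewrite -(ig_shift (- y) thi).
 apply:ig_le.
 - exact:Lint_abs (cbfP (cbf_translate y sth cth)).
 - exact:cbfP (cbf_translate y (smooth_add se sl) (csuppD ce cl)).
 move=> x;rewrite thE (le_trans (ler_normB _ _))//.
 by rewrite !ger0_norm ?ke0 ?kl0.
have th2 x : ig (fun y => `|theta W A (x - y)|) <= Th.
 apply:le_trans (th1 x);apply:le_of_eq;congr ig.
 have [_ _ _ ee _] := bP e e0;have [_ _ _ le_ _] := bP l l0.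
 by apply/funext => y;rewrite !thE -(opprB y x) ee le_.
have -> : (fun x => partial k (kW B b e j) x - partial k (kW B b l j) x) = partial k (W j).
 by rewrite pW !(partial_kW pr Bs).
apply:(weak_type_aux n0 (A2 := (Th / lam) ^+ 2) (AH := 2 * kL n C be bl) _ _ _ AH0 _ _ gi gN N0 t0 N'0).
- exact:smooth_partial.
- exact:csupp_partial.
- exact:sqr_ge0.
- move=> g' cg';apply:(energy_bound j sW cW curl k lam0 Th0 _ th2 th1 cg').
 move=> xi;pose x : V := \row_i xi i.
 have /andP[hx _] := EA.2 x.
 move: hx;rewrite qform_eq /dotv.
 under eq_bigr do rewrite mxE -expr2.
 by under [X in _ <= X -> _]eq_bigr do under eq_bigr do rewrite !mxE.
- move=> u v v0 uv;rewrite !pW;exact:(kK_diff_lipschitz pr Bs Bb be0 bl0 Bl j k e0 l0 v0 uv).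
Qed.

End kernels.

(** * Representation and weak estimate of the gradient *)

Section local_estimate.
Hypothesis n0 : (0 < n)%N.
Implicit Types (g F G u phi : V -> R) (O : set V).

Lemma partial_out phi (z : V) (r : R) (i : 'I_n) : (forall x : V, r < `|x - z| -> phi x = 0) ->
 forall x : V, r < `|x - z| -> partial i phi x = 0.
move=> h x xr;have <- := congr1 (fun f => f x) (partial_cst (0 : R) i).
apply:near_eq_derive;apply:(@filterS _ _ _ [set y : V | r < `|y - z|]).
 by move=> y /= yr;rewrite h.
have c : continuous (fun y : V => `|y - z|).
 move=> y;apply:(@continuous_comp _ _ _ (fun y : V => y - z) (fun y => `|y|));last exact:norm_continuous.
 by apply:(@continuousB _ _ _ id (fun=> z));[exact:cvg_id|exact:cst_continuous].
apply:open_nbhs_nbhs;split;last exact:xr.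
by apply:(@open_comp _ _ (fun y : V => `|y - z|) [set y | r < y]) => [y _|];[exact:c|exact:open_gt].
Qed.

Lemma conv_local rho k g (B : set E) (x : V) : (forall y : V, rho < `|y| -> k y = 0) ->
 (forall y : V, `|x - y| <= rho -> B y) ->
 conv k g x = conv k (fun y => g y * \1_B y) x.
move=> kr xB;congr ig;apply/funext => y.
have [xy|xy] := ltP rho `|x - y|;first by rewrite (kr _ xy) !mulr0.
by rewrite indicE mem_set ?mulr1//;exact:xB.
Qed.

Lemma igN F : Lint F -> ig (fun x : E => - F x) = - ig F.
move=> Fi;rewrite -mulN1r -(igZ (-1) Fi);congr ig;apply/funext => x.
by rewrite mulN1r.
Qed.

Lemma ig_linear (c : 'I_n -> R) (G : 'I_n -> V -> R) : (forall i, Lint (G i)) ->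
 Lint (fun y => \sum_i c i * G i y) /\
 \sum_i c i * ig (G i) = ig (fun y : E => \sum_i c i * G i y).
move=> Gi;have cG i : Lint (fun y => c i * G i y) by exact:LintZ.
split;first exact:(Lint_sum cG).
by rewrite (ig_sum cG);apply:eq_bigr => i _;rewrite (igZ _ (Gi i)).
Qed.

(** Test functions are supported in sup-norm balls inside [O], the shape of the support of a kernel
    centred at a point. Coefficients, data and gradient are families of real functions on the whole
    space, ready for convolution. *)
Definition local_eq O (a : 'I_n -> 'I_n -> V -> R) (f : 'I_n -> V -> R) (D : 'I_n -> V -> R) u :=
 forall phi (z : V) (r : R), smooth phi -> (forall x : V, r < `|x - z| -> phi x = 0) ->
  (forall x : V, `|x - z| <= r -> O x) ->
 \sum_j ig (fun x : E => (\sum_i a j i x * D i x - f j x) * partial j phi x) = 0 /\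
 forall i, ig (fun x : E => u x * partial i phi x) = - ig (fun x : E => D i x * phi x).

Definition local_data (Lam : R) (a : 'I_n -> 'I_n -> V -> R) (f : 'I_n -> V -> R)
  (D : 'I_n -> V -> R) u :=
 [/\ forall i j, mfun (a i j : E -> R), forall i j x, `|a i j x| <= Lam,
   forall i, Lint (f i), forall i, Lint (D i) & Lint u].

Section problem.
Variables (Lam : R) (O : set V) (a : 'I_n -> 'I_n -> V -> R) (f D : 'I_n -> V -> R) (u : V -> R).
Hypothesis dat : local_data Lam a f D u.
Hypothesis eqn : local_eq O a f D u.

Let ma i j : mfun (a i j : E -> R). Proof. by have [h _ _ _ _] := dat. Qed.
Let aL i j x : `|a i j x| <= Lam. Proof. by have [_ h _ _ _] := dat. Qed.
Let fi i : Lint (f i). Proof. by have [_ _ h _ _] := dat. Qed.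
Let Di i : Lint (D i). Proof. by have [_ _ _ h _] := dat. Qed.
Let ui : Lint u. Proof. by have [_ _ _ _ h] := dat. Qed.
Let aDi i j : Lint (fun x => a j i x * D i x).
rewrite (_ : (fun x => _) = fun x => D i x * a j i x);last by apply/funext => x;rewrite mulrC.
exact:Lint_mulb (Di i) (ma j i) (aL j i).
Qed.

(** The datum after freezing: the equation becomes [div (A D) = div (f + (A - a) D)]. *)
Definition defect (A : 'M[R]_n) j x : R := f j x + \sum_i (A j i - a j i x) * D i x.

Lemma Lint_defect A j : Lint (defect A j).
apply:LintD;first exact:fi.
rewrite (_ : (fun x => _) = fun x => \sum_i (A j i * D i x - a j i x * D i x));last first.
 by apply/funext => x;apply:eq_bigr => i _;rewrite mulrBl.
by apply:Lint_sum => i;apply:LintB (aDi i j);exact:LintZ.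
Qed.

(** A gradient is curl-free in the weak sense: both sides arise by testing [u] with the same mixed
    derivative of [phi]. *)
Lemma swap_gradient phi (z : V) (r : R) (i k : 'I_n) : smooth phi ->
 (forall x : V, r < `|x - z| -> phi x = 0) -> (forall x : V, `|x - z| <= r -> O x) ->
 ig (fun x : E => D i x * partial k phi x) = ig (fun x : E => D k x * partial i phi x).
move=> sp pr zO.
have [_ /(_ i) h1] := eqn (smooth_partial k sp) (partial_out k pr) zO.
have [_ /(_ k) h2] := eqn (smooth_partial i sp) (partial_out i pr) zO.
rewrite (partial_comm i k sp) in h1;apply:oppr_inj;exact:etrans (esym h1) h2.
Qed.

Section identity.
Variables (A : 'M[R]_n) (W : 'I_n -> V -> R) (P : V -> R) (r : R) (x : V) (k : 'I_n).
Hypothesis sW : forall j, smooth (W j).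
Hypothesis curl : forall j i, partial i (W j) = partial j (W i).
Hypothesis Wr : forall j (y : V), r < `|y| -> W j y = 0.
Hypothesis tr : forall y, \sum_j \sum_i A j i * partial i (W j) y = P y.
Hypothesis xO : forall y : V, `|y - x| <= r -> O y.
Let K j i := partial i (W j).
Let phi j (y : V) := W j (x - y).
Let sphi j : smooth (phi j). Proof. exact:smooth_reflect. Qed.
Let pphi i j : partial i (phi j) = fun y => - K j i (x - y). Proof. exact:partial_reflect. Qed.
Let phir j (y : V) : r < `|y - x| -> phi j y = 0.
by rewrite distrC => h;exact:Wr. Qed.
Let cK j i : exists M, forall y, `|K j i y| <= M.
have cW : csupp (W j).
 by exists (`|r| + 1);[rewrite ltr_wpDl|move=> y yr;apply:Wr;apply:lt_trans yr;
  rewrite (le_lt_trans (ler_norm r))// ltrDl].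
apply:csupp_bounded;first exact/smooth_cont/smooth_partial.
exact:csupp_partial.
Qed.
Let LK g j i : Lint g -> Lint (fun y : E => g y * K j i (x - (y : V))).
move=> gi;have [M KM] := cK j i.
exact:(Lint_conv (smooth_cont (smooth_partial i (sW j))) KM x gi).
Qed.

Lemma conv_defect : conv P (D k) x = \sum_j conv (K k j) (defect A j) x.
have [e1 _] := eqn (sphi k) (@phir k) xO.
pose q j y := \sum_i a j i y * D i y - f j y.
have Lq j : Lint (q j) by apply:LintB (fi j);exact:(Lint_sum (fun i => aDi i j)).
pose X j := ig (fun y => q j y * K k j (x - (y : V))).
have e2j j : ig (fun y => q j y * partial j (phi k) y) = - X j.
 rewrite -(igN (LK k j (Lq j)));congr ig;apply/funext => y.
 by rewrite pphi mulrN.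
have e2 : \sum_j X j = 0.
 apply:oppr_inj;rewrite oppr0 -sumrN;apply:etrans e1;apply:eq_bigr => j _.
 by rewrite -e2j.
pose T i j := ig (fun y => D i y * K k j (x - (y : V))).
have e3 j : X j = \sum_i A j i * T i j - conv (K k j) (defect A j) x.
 have [l1 ->] := ig_linear (A j) (fun i => LK k j (Di i)).
 have l2 := LK k j (Lint_defect A j).
 rewrite /conv -(igB l1 l2);congr ig;apply/funext => y;rewrite /defect /q.
 have -> : \sum_i (A j i - a j i y) * D i y = \sum_i A j i * D i y - \sum_i a j i y * D i y.
  by rewrite -sumrB;apply:eq_bigr => i _;rewrite mulrBl.
 have -> : \sum_i A j i * (D i y * K k j (x - y)) = (\sum_i A j i * D i y) * K k j (x - y).
  by rewrite mulr_suml;apply:eq_bigr => i _;rewrite mulrA.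
 exact:defect_real.
have e4 i j : T i j = ig (fun y => D k y * K j i (x - y)).
 have l1 := LK j k (Di i);have l2 := LK j i (Di k).
 have h := swap_gradient i k (sphi j) (@phir j) xO.
 have Kc : K k j = K j k := curl k j.
 have G1 : (fun y : E => D i y * partial k (phi j) y) = (fun y => - (D i y * K j k (x - y))).
  by apply/funext => y;rewrite pphi mulrN.
 have G2 : (fun y : E => D k y * partial i (phi j) y) = (fun y => - (D k y * K j i (x - y))).
  by apply/funext => y;rewrite pphi mulrN.
 rewrite G1 G2 in h;have h2 := etrans (esym (igN l1)) (etrans h (igN l2)).
 by rewrite /T Kc;apply:oppr_inj.
have e5 : \sum_j (\sum_i A j i * T i j) = \sum_j conv (K k j) (defect A j) x.
 apply/eqP;rewrite -subr_eq0 -sumrB;apply/eqP;apply:etrans e2.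
 exact:eq_bigr => j _;rewrite e3.
rewrite -e5;have l j := (ig_linear (A j) (fun i => LK j i (Di k))).
rewrite (_ : \sum_j _ = \sum_j ig (fun y => \sum_i A j i * (D k y * K j i (x - y))));last first.
 by apply:eq_bigr => j _;rewrite -(l j).2;apply:eq_bigr => i _;rewrite e4.
rewrite -(ig_sum (fun j => (l j).1));congr ig;apply/funext => y.
rewrite -tr mulr_sumr;apply:eq_bigr => j _.
by rewrite mulr_sumr;apply:eq_bigr => i _;rewrite mulrCA.
Qed.

End identity.

(** Moves the derivative from [u] to the bump, which is how [u] itself enters the estimate. *)
Lemma gradient_conv (P : V -> R) (r : R) (x : V) (k : 'I_n) : smooth P ->
 (forall y : V, r < `|y| -> P y = 0) -> (forall y : V, `|y - x| <= r -> O y) -> csupp P ->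
 conv P (D k) x = conv (partial k P) u x.
move=> sP Pr xO cP;pose phi (y : V) := P (x - y).
have sphi : smooth phi by exact:smooth_reflect.
have phir (y : V) : r < `|y - x| -> phi y = 0 by rewrite distrC => h;exact:Pr.
have [_ /(_ k) h] := eqn sphi phir xO.
have [M PM] := csupp_bounded (smooth_cont (smooth_partial k sP)) (csupp_partial k cP).
have l1 := Lint_conv (smooth_cont (smooth_partial k sP)) PM x ui.
have G1 : (fun y : E => u y * partial k phi y) = (fun y => - (u y * partial k P (x - y))).
 by apply/funext => y;rewrite (partial_reflect x k sP) mulrN.
rewrite G1 in h;exact:oppr_inj (esym (etrans (esym (igN l1)) h)).
Qed.

End problem.

Lemma convBl (k1 k2 : V -> R) F x : smooth k1 -> csupp k1 -> smooth k2 -> csupp k2 -> Lint F ->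
 conv (fun y => k1 y - k2 y) F x = conv k1 F x - conv k2 F x.
move=> s1 c1 s2 c2 Fi.
have [M1 b1] := csupp_bounded (smooth_cont s1) c1.
have [M2 b2] := csupp_bounded (smooth_cont s2) c2.
have l1 := Lint_conv (smooth_cont s1) b1 x Fi.
have l2 := Lint_conv (smooth_cont s2) b2 x Fi.
rewrite /conv -(igB l1 l2);congr ig;apply/funext => y;exact:mulrBr.
Qed.

Lemma mu_bigcup_ord m (S : 'I_m -> set E) (c : 'I_m -> R) : (forall i, measurable (S i)) ->
 (forall i, (mu (S i) <= (c i)%:E)%E) -> (mu (\bigcup_i S i) <= (\sum_i c i)%:E)%E.
elim: m S c => [|m ih] S c mS Sc.
 by rewrite (_ : \bigcup_i _ = set0) ?measure0 ?big_ord0//;apply/seteqP;split => // x [[]].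
rewrite big_ord_recl EFinD.
have mU : measurable (\bigcup_i S (lift ord0 i)).
 exact:countable_bigcup_measurable => i;exact:mS.
apply:(le_via (mu (S ord0 `|` \bigcup_i S (lift ord0 i)))).
 apply:le_measure;rewrite ?inE.
 - exact:countable_bigcup_measurable => i;exact:mS.
 - by apply:measurableU;[exact:mS|exact:mU].
 move=> x [i _ Sx];case: (unliftP ord0 i) Sx => [j ->|->] Sx;last by left.
 by right;exists j.
apply:(le_trans (measureU2 _ (mS _) mU));apply:leeD;first exact:Sc.
by apply:(ih (fun i => S (lift ord0 i)) (fun i => c (lift ord0 i))) => i;[exact:mS|exact:Sc].
Qed.

Lemma weak_real (m0 m d c F t s b : R) : m0 <= m -> `|c - m * F| < t -> `|c| <= s + b ->
 d = F -> m0 * `|d| <= b + s + t.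
move=> mm h1 h2 ->;have p : m0 * `|F| <= `|m * F|.
 by rewrite normrM;apply:ler_wpM2r => //;exact:le_trans mm (ler_norm m).
have := ler_normB c (c - m * F);rewrite opprB addrCA subrr addr0;lra.
Qed.

Section weak_component.
Variables (Lam S CW m0 CP : R) (O : set V) (a : 'I_n -> 'I_n -> V -> R)
 (f D : 'I_n -> V -> R) (u : V -> R) (A : 'M[R]_n)
 (W : R -> 'I_n -> V -> R) (P : R -> V -> R).
Hypotheses (S0 : 0 < S) (CP0 : 0 < CP).
Hypothesis dat : local_data Lam a f D u.
Hypothesis eqn : local_eq O a f D u.
Hypothesis HW : kernel_family S CW m0 CP A W P.
Variables (z : V) (r t b : R) (k : 'I_n).
Hypotheses (r0 : 0 < r) (t0 : 0 < t).
Let B : set E := ball z (3 * r).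
Hypothesis BO : forall y : V, B y -> O y.
Let l := r / S.
Let l0 : 0 < l. Proof. exact:divr_gt0. Qed.
Let Sl : S * l = r. Proof. by rewrite /l mulrC divfK// gt_eqF. Qed.
Let F x := D k x * \1_B x.
Let G j x := defect a f D A j x * \1_B x.
Hypothesis Pb : forall x : V, ball z r x -> `|conv (P l) F x| <= b.

Let mB : measurable B. Proof. by have [] := @Lint_ball z (3 * r) (ltac:(rewrite mulr_gt0)). Qed.
Let Di i : Lint (D i). Proof. by have [_ _ _ h _] := dat. Qed.
Let Gd j : Lint (defect a f D A j). Proof. exact:Lint_defect dat A j. Qed.
Let Fi : Lint F. Proof. exact:Lint_indic. Qed.
Let Gi j : Lint (G j). Proof. exact:Lint_indic. Qed.
Let N := `|z| + 3 * r.
Let N0 : 0 < N. Proof. by pos. Qed.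
Let BN (x : V) : N <= `|x| -> \1_B x = 0 :> R.
move=> xN;rewrite indicE memNset// => /ballP h;move: xN;rewrite leNgt => /negP;apply.
rewrite /N -(subrK z x) addrC;apply:(le_lt_trans (ler_normD _ _)).
by rewrite ltrD2l.
Qed.
Let nearB (x y : V) : ball z r x -> `|x - y| <= r -> B y.
move=> /ballP xz xy;apply/ballP;rewrite -(subrKA x) addrC.
apply:(le_lt_trans (ler_normD _ _));rewrite (distrC y).
exact:sum_lt3.
Qed.

(** The representation is used for the difference of the fields at scales [e] and [l], with [e] so
    small that [conv (P e) F] is close to a multiple of [F] in [L^1]. The threshold counts [b] for
    the mean at scale [l], [t] for each of the [n] singular integrals and [t] for the approximation
    error, whose level set costs an arbitrary [eps]. *)
Lemma weak_component : (mu (ball z r `&` [set x : E | (b + n%:R * t + t < m0 * `|D k x|)%R])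
 <= (\sum_j CW / t * ig (fun y : E => `|G j y|))%:E)%E.
apply/lee_addgt0Pr => eps eps0.
(* Bound for the mass of [P e], independent of [e]: the height [CP e^-n] times the volume of a ball
   containing the support. *)
pose mb := CP * (4 * S) ^+ n.
have mb0 : 0 < mb by pos.
have gF : good F by apply:(Lint_good N0 Fi) => x xN;rewrite /F BN ?mulr0.
have [_ cF hg] := gF.
have [rho rho0 hrho] := hg (eps * t / mb) (ltac:(by rewrite divr_gt0// mulr_gt0)).
pose e := Num.min l (rho / S).
have e0 : 0 < e by rewrite lt_min l0 divr_gt0.
have el : e <= l by rewrite ge_min lexx.
have Se : S * e <= rho by rewrite mulrC -ler_pdivlMr// ge_min lexx orbT.
have [[sW curl] We [bP mP] trP [[Ple _] weak]] := HW e0.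
have [[sWl curll] _ [bPl _] trPl _] := HW l0.
have [sP cP P0 eP Pr] := bP;have [sPl cPl _ _ Plr] := bPl.
have bP' : bump rho (P e) by split => // x xr;apply:Pr;exact:le_lt_trans Se xr.
have mPb : ig (P e) <= mb.
 have Se0 : 0 < S * e by pos.
 apply:(le_trans (ig_bump_le Se0 bP Ple)).
 rewrite /mb mulrA [in leLHS]exprMn (mulrC _ (e ^+ n)) mulrA divfK//.
 by pos.
have [gapi _] := conv_gap_le bP Fi cF.
have gap : ig (fun x => `|conv (P e) F x - ig (P e) * F x|) <= eps * t.
 apply:(le_trans (hrho _ bP')).
 rewrite -[leRHS](divfK (lt0r_neq0 mb0));apply:ler_wpM2l => //.
 exact:divr_ge0 (mulr_ge0 (ltW eps0) (ltW t0)) (ltW mb0).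
pose K j := fun x => partial j (W e k) x - partial j (W l k) x.
pose S1 j : set E := [set x : E | (t < `|conv (K j) (G j) x|)%R] `&` ball (0%R : V) N.
pose S2 : set E := [set x : E | (t <= `|conv (P e) F x - ig (P e) * F x|)%R].
have sK j : smooth (K j) by apply:smooth_sub;exact:smooth_partial.
pose Wd j x := W e j x - W l j x.
have sWd j : smooth (Wd j) by apply:smooth_sub.
have pWd i j : partial i (Wd j) = fun x => partial i (W e j) x - partial i (W l j) x by exact:partialB.
have Wdr j (y : V) : r < `|y| -> Wd j y = 0.
 by move=> yr;rewrite /Wd (We l j y el) ?subrr// Sl.
have cWd j : csupp (Wd j) by exists r;[exact:r0|exact:Wdr j].
have cK j : csupp (K j) by rewrite /K -pWd;exact:csupp_partial.
have Kr j (y : V) : r < `|y| -> K j y = 0.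
 move=> yr;rewrite /K -[LHS]/((fun x => partial j (W e k) x - partial j (W l k) x) y) -pWd.
 apply:(partial_out (z := 0));last by rewrite subr0;exact:yr.
 by move=> x;rewrite subr0;exact:Wdr.
have mS1 j : measurable (S1 j).
 apply:open_meas;apply:openI;last exact:ball_open.
 have c := conv_continuous (sK j) (cK j) (Gi j).
 have ca := continuous_abs c.
 by apply:(@open_comp _ _ (fun y => `|conv (K j) (G j) y|) [set y | t < y]) => [y _|];[exact:ca|exact:open_gt].
have mS2 : measurable S2.
 have mg := Lint_meas (Lint_abs gapi).
 rewrite /S2 (_ : [set x : E | _] = (fun x : E => `|conv (P e) F x - ig (P e) * F x|) @^-1` `[t, +oo[).
  by rewrite -[X in measurable X]setTI;exact:mg measurableT _ (measurable_itv _).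
 by apply/seteqP;split => x /=;rewrite in_itv /= andbT.
have sub : ball z r `&` [set x : E | (b + n%:R * t + t < m0 * `|D k x|)%R] `<=` (\bigcup_j S1 j) `|` S2.
 move=> x [xz hx];apply:contrapT => /not_orP[n1 n2].
 have xN : ball 0 N x.
  apply/ballP;rewrite subr0 -(subrK z x) addrC;apply:(le_lt_trans (ler_normD _ _)).
  by move/ballP : xz => xz;rewrite /N ltrD2l (lt_trans xz)// ltr_pMl// ltr1n.
 have h1 j : `|conv (K j) (G j) x| <= t.
  by rewrite leNgt;apply/negP => h;apply:n1;exists j.
 have h2 : `|conv (P e) F x - ig (P e) * F x| < t by rewrite ltNge;apply/negP.
 have xB : B x by apply:(nearB xz);rewrite subrr normr0 ltW.
 have xO (y : V) : `|y - x| <= r -> O y by rewrite distrC => xy;exact:BO (nearB xz xy).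
 have nB (y : V) : `|x - y| <= r -> B y by exact:nearB.
 have trd y : \sum_j \sum_i A j i * partial i (Wd j) y = P e y - P l y.
  rewrite -trP -trPl -sumrB;apply:eq_bigr => j _;rewrite -sumrB;apply:eq_bigr => i _.
  by rewrite pWd mulrBr.
 have curld j i : partial i (Wd j) = partial j (Wd i) by rewrite !pWd curl curll.
 have id := conv_defect dat eqn k sWd curld Wdr trd xO.
 rewrite (convBl x sP cP sPl cPl (Di k)) in id.
 have er : S * e <= r by rewrite -Sl ler_wpM2l// ltW.
 have Per (y : V) : r < `|y| -> P e y = 0 by move=> yr;apply:Pr;exact:le_lt_trans er yr.
 have Plr' (y : V) : r < `|y| -> P l y = 0 by move=> yr;apply:Plr;rewrite Sl.
 rewrite (conv_local (D k) Per nB) (conv_local (D k) Plr' nB) -/F in id.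
 have ks : `|conv (P e) F x| <= n%:R * t + b.
  have -> : conv (P e) F x = (\sum_j conv (K j) (G j) x) + conv (P l) F x.
   apply/eqP;rewrite -subr_eq;apply/eqP;rewrite id;apply:eq_bigr => j _.
   by rewrite pWd;exact:(conv_local _ (Kr j) nB).
  apply:(le_trans (ler_normD _ _));apply:lerD;last exact:Pb.
  apply:(le_trans (ler_norm_sum _ _ _)).
  apply:(le_via (\sum_(j < n) t));first by apply:ler_sum => j _;exact:h1.
  by rewrite sumr_const card_ord -[leLHS]mulr_natl.
 have dF : D k x = F x by rewrite /F indicE mem_set// mulr1.
 have := weak_real mP h2 ks dF;rewrite leNgt => /negP;apply;exact:hx.
have mU : measurable (\bigcup_j S1 j) by apply:countable_bigcup_measurable.
apply:(le_via (mu ((\bigcup_j S1 j) `|` S2))).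
 apply:le_measure;rewrite ?inE;[|exact:measurableU|exact:sub].
 apply:measurableI;first exact/open_meas/ball_open.
 have mD := Lint_meas (LintZ m0 (Lint_abs (Di k))).
 rewrite (_ : [set x : E | _] = (fun x : E => m0 * `|D k x|) @^-1` `]b + n%:R * t + t, +oo[).
  by rewrite -[X in measurable X]setTI;exact:mD measurableT _ (measurable_itv _).
 by apply/seteqP;split => x /=;rewrite in_itv /= andbT.
apply:(le_trans (measureU2 _ mU mS2));apply:leeD.
 apply:mu_bigcup_ord => j;first exact:mS1.
 apply:(weak l k j (G j) N t N el (Gi j) _ N0 t0 N0) => x /ltW xN.
 by rewrite /G BN ?mulr0.
have ga0 x : 0 <= `|conv (P e) F x - ig (P e) * F x| by exact:normr_ge0.
apply:(le_trans (markov_ig (Lint_abs gapi) ga0 mS2 t0 _));first by [].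
by rewrite lee_fin ler_pdivrMr.
Qed.

End weak_component.

Lemma conv_le (P : V -> R) F (M x0 : R) x : continuous P -> (forall y, `|P y| <= M) -> Lint F ->
 0 <= M -> ig (fun y : E => `|F y|) <= x0 -> `|conv P F x| <= M * x0.
move=> cP PM Fi M0 h;apply:(le_trans (conv_bound x cP PM Fi));exact:ler_wpM2l.
Qed.

Lemma scale_real (c S r b : R) m : 0 < S -> 0 < r ->
 c * (r / S) ^- m * (b * r ^+ m) = c * S ^+ m * b.
move=> S0 r0;rewrite expr_div_n invf_div.
have rm : r ^+ m != 0 by pos.
by rewrite -!mulrA;congr (c * (_ * _));rewrite mulrCA mulrA mulrVK// unitfE.
Qed.

(** Scale [l = r / S] gives [P l] a support of radius [r]. Its convolution with [D] is bounded
    either by an average of [D] itself or, with the derivative moved onto [P l], by an average of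
    [u]; the latter costs one more power of [r]. *)
Lemma local_weak (lam Lam : R) : 0 < lam -> lam <= Lam ->
 exists C1 C2 : R, [/\ 0 < C1, 0 < C2 & forall O a f D u, local_data Lam a f D u ->
  local_eq O a f D u -> forall (A : 'M[R]_n) (z : V) (r t b : R), elliptic lam Lam A ->
  0 < r -> (forall y, ball z (3 * r) y -> O y) -> 0 < t -> 0 <= b ->
  (forall k, ig (fun x : E => `|D k x| * \1_(ball z (3 * r) : set E) x) <= b * r ^+ n) \/
  ig (fun x : E => `|u x| * \1_(ball z (3 * r) : set E) x) <= b * r ^+ n.+1 ->
  (mu (ball z r `&` [set x : E | (C1 * (b + t) < normv (\row_k D k x))%R]) <=
  (C2 / t * \sum_j ig (fun y : E => `|defect a f D A j y| * \1_(ball z (3 * r) : set E) y))%:E)%E].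
move=> lam0 lL;have [S [CW [m0 [CP [S0 CW0 m00 CP0 ker]]]]] := kernels_exist n0 lam0 lL.
pose Cb := CP * S ^+ n + CP * S ^+ n.+1.
have CS m : 0 < CP * S ^+ m by pos.
have Cb0 : 0 < Cb by pos.
pose C1 := n%:R * ((Cb + n.+1%:R) / m0).
have nR : 0 < n%:R :> R by pos.
exists C1, (n%:R * CW + 1);split.
- by pos.
- by pos.
move=> O a f D u dat eqn A z r t b EA r0 BO t0 b0 hb.
have [W [P HW]] := ker A EA.
have l0 : 0 < r / S by pos.
pose B : set E := ball z (3 * r).
have r30 : 0 < 3 * r by pos.
have [mB Bi] := Lint_ball z r30.
have [_ _ _ Di ui] := dat.
have [_ _ [bP _] _ [[Ple P1le] _]] := HW _ l0.
have [sP cP P0 _ Pr] := bP.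
have Sl : S * (r / S) = r by rewrite mulrC divfK// gt_eqF.
have abs_ind F : Lint F -> (fun y : E => `|F y * \1_B y|) = (fun y => `|F y| * \1_B y).
 by move=> _;apply/funext => y;rewrite normrM;congr (_ * _);rewrite indicE ger0_norm.
have Pb k x : ball z r x -> `|conv (P (r / S)) (fun y => D k y * \1_B y) x| <= Cb * b.
 move=> xz.
 have nB (y : V) : `|x - y| <= r -> B y.
  move/ballP : xz => xz xy;apply/ballP;rewrite -(subrKA x) addrC.
  by apply:(le_lt_trans (ler_normD _ _));rewrite (distrC y);exact:sum_lt3.
 have xO (y : V) : `|y - x| <= r -> O y by rewrite distrC => xy;exact:BO (nB y xy).
 have Pr' (y : V) : r < `|y| -> P (r / S) y = 0 by move=> yr;apply:Pr;rewrite Sl.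
 have cn m : 0 <= CP * (r / S) ^- m by pos.
 case: hb => hb.
  apply:(le_via (CP * (r / S) ^- n * (b * r ^+ n))).
   apply:conv_le => //;first exact:smooth_cont.
   - by move=> y;rewrite ger0_norm.
   - exact:Lint_indic.
   - by rewrite (abs_ind _ (Di k));exact:hb.
  by rewrite scale_real// /Cb mulrDl lerDl mulr_ge0// ltW.
 rewrite -(conv_local (D k) Pr' nB) (gradient_conv dat eqn k sP Pr' xO cP).
 have pPr (y : V) : r < `|y| -> partial k (P (r / S)) y = 0.
  move=> yr;apply:(partial_out (z := 0) (r := r));last by rewrite subr0;exact:yr.
  by move=> v;rewrite subr0;exact:Pr'.
 rewrite (conv_local u pPr nB).
 apply:(le_via (CP * (r / S) ^- n.+1 * (b * r ^+ n.+1))).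
  apply:conv_le => //;first exact/smooth_cont/smooth_partial.
  - exact:Lint_indic.
  - by rewrite (abs_ind _ ui);exact:hb.
 by rewrite scale_real// /Cb mulrDl lerDr mulr_ge0// ltW.
pose cc := \sum_j CW / t * ig (fun y => `|defect a f D A j y * \1_B y|).
have wk k := weak_component S0 CP0 dat eqn HW r0 t0 BO (Pb k).
pose Sk k : set E := ball z r `&` [set x : E | (Cb * b + n%:R * t + t < m0 * `|D k x|)%R].
have mSk k : measurable (Sk k).
 apply:measurableI;first exact/open_meas/ball_open.
 have mD := Lint_meas (LintZ m0 (Lint_abs (Di k))).
 rewrite (_ : [set x : E | _] = (fun x : E => m0 * `|D k x|) @^-1` `]Cb * b + n%:R * t + t, +oo[).
  by rewrite -[X in measurable X]setTI;exact:mD measurableT _ (measurable_itv _).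
 by apply/seteqP;split => x /=;rewrite in_itv /= andbT.
have mn : mfun (fun x : E => normv (\row_k D k x) : R).
 apply:(measurable_coords_comp (m := fun x : E => \row_k D k x)).
  by move=> i;under eq_fun do rewrite mxE;exact:Lint_meas.
 by move=> y;have := @normv_continuous R n 0 y;under eq_fun do rewrite subr0.
apply:(le_via (mu (\bigcup_k Sk k))).
 apply:le_measure;rewrite ?inE.
 - apply:measurableI;first exact/open_meas/ball_open.
  exact:measurable_gt mn.
 - exact:countable_bigcup_measurable.
 move=> x [xz hx];apply:contrapT => nS.
 have h k : m0 * `|D k x| <= (Cb + n.+1%:R) * (b + t).
  apply:(le_via (Cb * b + n%:R * t + t)).
   by rewrite leNgt;apply/negP => h;apply:nS;exists k.
  rewrite -natr1;have := mulr_ge0 (ltW Cb0) (ltW t0);have := mulr_ge0 (ltW nR) b0.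
  by move: b0;clear;move=> *;lra.
 move: hx;rewrite /= ltNge => /negP;apply.
 apply:(le_trans (normv_le_norm _));rewrite /C1 -!mulrA ler_pM2l//.
 apply:norm_leP => [|k].
  by pos.
 by rewrite mxE mulrCA [leRHS]mulrC ler_pdivlMr// mulrC;exact:h.
apply:(le_trans (mu_bigcup_ord mSk wk)).
rewrite lee_fin sumr_const card_ord -[leLHS]mulr_natl.
under eq_bigr do rewrite (abs_ind _ (Lint_defect dat A _)).
rewrite -mulr_sumr mulrA;apply:ler_wpM2r.
 by apply:sumr_ge0 => j _;apply:ig_ge0 => x;rewrite mulr_ge0// indicE.
by rewrite mulrA ler_wpM2r ?invr_ge0 ?(ltW t0)// lerDl.
Qed.

End local_estimate.

(** * The weak estimate with weighted data *)

Section weighted_local.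
Hypothesis n0 : (0 < n)%N.
Implicit Types (g F G u phi w : V -> R) (O : set V).

Definition bigQ (z : V) (r : R) : set E := cube (shiftc z (- r)) (2 * r).

Definition vnorm (D : 'I_n -> V -> R) (x : V) : R := normv (\row_k D k x).

Lemma mvnorm D : (forall i, mfun (D i : E -> R)) ->
 mfun (vnorm D : E -> R).
move=> mD;apply:(measurable_coords_comp (m := fun x => \row_k D k x)).
 by move=> i;under eq_fun do rewrite mxE;exact:mD.
by move=> y;have := @normv_continuous R n 0 y;under eq_fun do rewrite subr0.
Qed.

Lemma vnorm_ge0 D x : 0 <= vnorm D x. Proof. exact:normv_ge0. Qed.

Lemma coord_le_vnorm D k x : `|D k x| <= vnorm D x.
by have := coord_le_normv (\row_k D k x) k;rewrite mxE. Qed.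

Lemma integral_mul_indicR (D B : set E) (h : V -> R) :
 (\I_(x in D) (h x * \1_B x) = \I_(x in D `&` B) h x)%E.
exact:(integral_mul_indic mu D B (fun x => (h x)%:E)). Qed.

Lemma ig_sub_cube (B Q : set E) (h : V -> R) c : measurable B -> measurable Q -> B `<=` Q ->
 mfun (h : E -> R) -> ge0 h ->
 (\I_(x in Q) (h x * \1_B x) <= c%:E)%E ->
 Lint (fun x => h x * \1_B x) /\ ig (fun x : E => h x * \1_B x) <= c.
move=> mB mQ BQ mh h0 hc.
have mhB : mfun (fun x : E => h x * \1_B x).
 exact:(mfunM mh (measurable_indic mB)).
apply:ig_lty => //;first by move=> x;pos.
have -> : (\int[mu]_x (h x * \1_B x)%:E = \I_(x in Q) (h x * \1_B x))%E;last exact:hc.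
by rewrite int_indic integral_mul_indicR setIC (setIidl BQ).
Qed.

Lemma defect_le a (f D : 'I_n -> V -> R) (A : 'M[R]_n) x :
 \sum_j `|defect a f D A j x| <=
 n%:R * vnorm f x + (\sum_j \sum_i `|A j i - a j i x|) * vnorm D x.
apply:(le_via (\sum_j (vnorm f x + (\sum_i `|A j i - a j i x|) * vnorm D x))).
 apply:ler_sum => j _;apply:(le_trans (ler_normD _ _));apply:lerD.
  exact:coord_le_vnorm.
 apply:(le_trans (ler_norm_sum _ _ _));rewrite mulr_suml;apply:ler_sum => i _.
 by rewrite normrM;apply:ler_wpM2l => //;exact:coord_le_vnorm.
by rewrite big_split /= sumr_const card_ord -[X in X + _]mulr_natl -mulr_suml.
Qed.

(** The unweighted averages in [local_weak] are bounded through [sub_weight_bound]. The oscillation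
    of the coefficients, divided by its bound [L] to lie in [[0, 1]], plays the role of the small
    function there, which produces [al^g]. The factors [6^n] are the volume ratio between
    [bigQ z (3 * r)] and a cube of side [r]. *)
Lemma weighted_local (lam Lam q M : R) : 0 < lam -> lam <= Lam -> 1 < q -> 1 <= M ->
 exists s g C1 C2 C3 : R, [/\ 1 < s < q, 0 < g, 0 < C1, 0 < C2 & 0 < C3 /\
 forall w, cube_Aq q M w -> forall O a f D u, local_data Lam a f D u -> local_eq O a f D u ->
 forall (A : 'M[R]_n) (z : V) (r t b al Ph Pf : R), elliptic lam Lam A ->
  0 < r -> (forall y, ball z (3 * r) y -> O y) -> 0 < t -> 0 <= b -> 0 <= al -> 0 <= Ph -> 0 <= Pf ->
  ig (fun x => (\sum_j \sum_i `|A j i - a j i x|) * \1_(ball z (3 * r) : set E) x)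
   <= al * r ^+ n ->
  (\I_(x in ball z (3 * r)) (vnorm D x `^ s * w x) <= (Ph * wint w (bigQ z (3 * r)))%:E)%E ->
  (\I_(x in ball z (3 * r)) (vnorm f x `^ s * w x) <= (Pf * wint w (bigQ z (3 * r)))%:E)%E ->
  C3 * Ph `^ s^-1 <= b \/ ig (fun x => `|u x| * \1_(ball z (3 * r)) x) <= b * r ^+ n.+1 ->
  (mu (ball z r `&` [set x : E | (C1 * (b + t) < vnorm D x)%R]) <=
  (C2 * ((al `^ g) * Ph `^ s^-1 + Pf `^ s^-1) / t * r ^+ n)%:E)%E].
move=> lam0 lL q1 M1;have Lam0 : 0 < Lam by exact:lt_le_trans lL.
have [C1 [C2 [C10 C20 LW]]] := local_weak n0 lam0 lL.
have [s [g [C [sq g0 C0 SW]]]] := @sub_weight_bound R n q M q1 M1.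
pose L := 2 * Lam * n%:R ^+ 2.
have nR : 0 < n%:R :> R by pos.
have L0 : 0 < L by pos.
pose c6 : R := (L * 6 ^+ n)^-1.
have c60 : 0 < c6 by pos.
pose K1 := L * (C * c6 `^ g * 6 ^+ n);pose K2 := n%:R * (C * 6 ^+ n).
have K10 : 0 < K1 by pos.
have K20 : 0 < K2 by pos.
exists s, g, C1, (C2 * (K1 + K2)), (C * 6 ^+ n);split => //.
 by pos.
split;first pos.
move=> w Hw O a f D u dat eqn A z r t b al Ph Pf EA r0 BO t0 b0 al0 Ph0 Pf0 hal hPh hPf hb.
have [ma aL fi Di ui] := dat.
have r30 : 0 < 3 * r by pos.
pose B : set E := ball z (3 * r);pose Q := bigQ z (3 * r).
have mB : measurable B by have [] := Lint_ball z r30.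
have mQ : measurable Q by exact:mcube.
have BQ : B `<=` Q by exact:ball_cube.
have r60 : 0 < 2 * (3 * r) by pos.
have r6E : (2 * (3 * r)) ^+ n = 6 ^+ n * r ^+ n by rewrite mulrA -natrM exprMn.
have s0 : 0 < s by move: sq => /andP[s1 _];exact:lt_trans s1.
have mD : mfun (vnorm D : E -> R) by apply:mvnorm => i;exact:Lint_meas.
have mf : mfun (vnorm f : E -> R) by apply:mvnorm => i;exact:Lint_meas.
have ind1 (x : V) : 0 <= (\1_B x : R) <= 1 by rewrite indicE;case: (_ \in _);rewrite /= ?lexx ?ler01.
have powB (F : V -> R) p : (\I_(x in B) (F x `^ s * w x) <= p)%E ->
  (\I_(x in Q) ((F x * \1_B x) `^ s * w x) <= p)%E.
 apply:le_trans;have -> : (fun x : E => ((F x * \1_B x) `^ s * w x)%:E) =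
   (fun x => ((F x `^ s * w x) * \1_B x)%:E).
  apply/funext => x;congr _%:E;rewrite indicE.
  by case: (_ \in _);rewrite ?mulr1// !mulr0 powR0 ?mul0r// gt_eqF.
 by rewrite (integral_mul_indicR Q B (fun x => F x `^ s * w x)) setIC (setIidl BQ).
have meas_FB (F : V -> R) : mfun (F : E -> R) -> mfun (fun x : E => F x * \1_B x).
 by move=> mF;exact:(mfunM mF (measurable_indic mB)).
pose al' := al * c6.
have al'0 : 0 <= al' by pos.
pose av x := (\sum_j \sum_i `|A j i - a j i x|) / L.
have av01 x : 0 <= av x <= 1.
 apply/andP;split;first by rewrite divr_ge0 ?(ltW L0)//;do 2 (apply:sumr_ge0 => ? _).
 rewrite ler_pdivrMr// mul1r;apply:(le_via (\sum_(j < n) \sum_(i < n) (Lam + Lam))).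
  apply:ler_sum => j _;apply:ler_sum => i _;apply:(le_trans (ler_normB _ _)).
  by apply:lerD;[exact:(elliptic_entry lam0 EA)|exact:aL].
 by rewrite sum2_const.
have mav : mfun (av : E -> R).
 apply:mfunM;last exact:measurable_cst.
 apply:measurable_sum => j;apply:measurable_sum => i.
 apply:mT_comp;first exact:normr_measurable.
 by apply:measurable_funB;[exact:measurable_cst|exact:ma].
have avQ : (\I_(x in Q) (av x * \1_B x) <= (al' * (2 * (3 * r)) ^+ n)%:E)%E.
 have avB : Lint (fun x => av x * \1_B x).
  rewrite (_ : (fun x => _) = fun x => \1_B x * av x);last by apply/funext => x;rewrite mulrC.
  have [_ Bi] := Lint_ball z r30.
  apply:(Lint_mulb (M := 1) Bi mav) => x;have /andP[p1 p2] := av01 x.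
  by rewrite ger0_norm.
 apply:(le_via (\int[mu]_x (av x * \1_B x)%:E)%E).
  apply:(int_subset mu mQ measurableT _ _ (@subsetT _ Q));first exact:mEFin (Lint_meas avB).
  move=> x;rewrite lee_fin;have /andP[p1 _] := av01 x;have /andP[p2 _] := ind1 x.
  exact:mulr_ge0.
 rewrite (ig_EFin avB) lee_fin r6E /al' /c6.
 have -> : ig (fun x => av x * \1_B x) = L^-1 *
   ig (fun x => (\sum_j \sum_i `|A j i - a j i x|) * \1_B x).
  rewrite -igZ;first by congr ig;apply/funext => x;rewrite /av mulrAC mulrC mulrA.
  rewrite (_ : (fun x => _) = fun x => L * (av x * \1_B x));first exact:LintZ.
  by apply/funext => x;rewrite /av mulrA mulrCA divff ?mulr1// gt_eqF.
 apply:(le_trans (ler_wpM2l _ hal));first pos.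
 have h6 : (6 ^+ n : R) != 0 by pos.
 by rewrite (cancel_real L al (r ^+ n) h6).
have oneQ : (\I_(x in Q) (1 : R) <= (1 * (2 * (3 * r)) ^+ n)%:E)%E.
 have muQ : mu Q = ((2 * (3 * r)) ^+ n)%:E by exact:mu_cube.
 by rewrite integral_cst// mul1e mul1r [leLHS]muQ.
have av1 : forall x : E, 0 <= (1 : R) <= 1 by move=> x;rewrite ler01 lexx.
have bnd (F : V -> R) (c : E -> R) p be : mfun (F : E -> R) -> ge0 F ->
  mfun c -> (forall x, 0 <= c x <= 1) -> 0 <= p -> 0 <= be ->
  (\I_(x in B) (F x `^ s * w x) <= (p * wint w Q)%:E)%E ->
  (\I_(x in Q) (c x * \1_B x) <= (be * (2 * (3 * r)) ^+ n)%:E)%E ->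
  Lint (fun x => (c x * F x) * \1_B x) /\
  ig (fun x => (c x * F x) * \1_B x) <= C * be `^ g * p `^ s^-1 * (6 ^+ n * r ^+ n).
 move=> mF F0 mc c01 p0 be0 hF hc.
 apply:(@ig_sub_cube B Q _ _ mB mQ BQ).
 - exact:mfunM.
 - by move=> x;rewrite mulr_ge0//;have /andP[] := c01 x.
 have := SW w Hw (shiftc z (- (3 * r))) (2 * (3 * r)) (fun x => F x * \1_B x) (fun x => c x * \1_B x) p be r60.
 have mc1 : forall x : E, 0 <= c x * \1_B x <= 1.
  move=> x;have /andP[c1 c2] := c01 x;have /andP[i1 i2] := ind1 x.
  by rewrite mulr_ge0//= mulr_ile1.
 have F10 : forall x : E, 0 <= F x * \1_B x by move=> x;pos;have /andP[] := ind1 x.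
 move=> /(_ (meas_FB _ mF) (meas_FB _ mc) F10 mc1 p0 be0 (powB _ _ hF) hc).
 rewrite r6E;apply:le_trans;apply:le_of_eq.
 apply:eq_integral => x _;congr _%:E;rewrite indicE.
 by case: (_ \in _);rewrite ?mulr1// !mulr0.
have D0 := vnorm_ge0 D;have f0 := vnorm_ge0 f.
have m1 : mfun (fun _ : E => 1 : R) by exact:measurable_cst.
have oneB : (\I_(x in Q) (1 * \1_B x) <= (1 * (2 * (3 * r)) ^+ n)%:E)%E.
 apply:le_trans oneQ;apply:(int_le mu mQ).
 - exact:(mEFin (D := setT) (meas_FB (fun=> 1) m1)).
 - exact:(mEFin (D := setT) m1).
 - by move=> x;pos;have /andP[] := ind1 x.
 - by move=> x _;pos;have /andP[] := ind1 x.
have [LD igD1] := bnd _ _ _ _ mD D0 m1 av1 Ph0 (@ler01 R) hPh oneB.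
have [Lf igf] := bnd _ _ _ _ mf f0 m1 av1 Pf0 (@ler01 R) hPf oneB.
have [La iga] := bnd _ _ _ _ mD D0 mav av01 Ph0 al'0 hPh avQ.
rewrite powR1 mulr1 in igD1 igf.
have hb' : (forall k, ig (fun x => `|D k x| * \1_B x) <= b * r ^+ n) \/
  ig (fun x => `|u x| * \1_B x) <= b * r ^+ n.+1.
 case: hb => hb;[left => k|by right].
 have ak := Lint_indic (Lint_abs (Di k)) mB.
 apply:(le_via (ig (fun x => 1 * vnorm D x * \1_B x))).
  apply:ig_le;[exact:ak|exact:LD|move=> x];rewrite mul1r.
  by apply:ler_wpM2r;[have /andP[] := ind1 x|exact:coord_le_vnorm].
 apply:(le_trans igD1);rewrite mulrA ler_wpM2r ?exprn_ge0 ?(ltW r0)//.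
 by rewrite mulrAC.
apply:(le_trans (LW O a f D u dat eqn A z r t b EA r0 BO t0 b0 hb')).
rewrite lee_fin;apply:div_real => //.
have Ld j := Lint_indic (Lint_abs (Lint_defect dat A j)) mB.
rewrite -(ig_sum Ld).
apply:(le_via (n%:R * ig (fun x => 1 * vnorm f x * \1_B x) +
  L * ig (fun x => av x * vnorm D x * \1_B x))).
 rewrite -(igZ _ Lf) -(igZ _ La) -(igD (LintZ _ Lf) (LintZ _ La)).
 apply:ig_le;[exact:Lint_sum|exact:LintD (LintZ _ Lf) (LintZ _ La)|move=> x].
 rewrite -mulr_suml mul1r !mulrA -mulrDl;apply:ler_wpM2r;first by have /andP[] := ind1 x.
 by rewrite [L * _]mulrC mulfK ?gt_eqF//;exact:defect_le.
apply:(le_trans (lerD (ler_wpM2l (ltW nR) igf) (ler_wpM2l (ltW L0) iga))).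
have rn : 0 <= r ^+ n by pos.
rewrite /al' powRM ?(ltW c60)//.
have X0 : 0 <= al `^ g * Ph `^ s^-1 by pos.
have Y0 : 0 <= Pf `^ s^-1 by exact:powR_ge0.
have := mulr_ge0 (mulr_ge0 (ltW K10) Y0) rn;have := mulr_ge0 (mulr_ge0 (ltW K20) X0) rn.
by rewrite /K1 /K2;move: (r ^+ n) (6 ^+ n : R) => ? ?;clear;lra.
Qed.

End weighted_local.

(** * The good lambda inequality *)

Section good_lambda.
Hypothesis n0 : (0 < n)%N.
Variables (q M : R) (w : V -> R).
Hypotheses (q1 : 1 < q) (M1 : 1 <= M) (Hw : cube_Aq q M w).
Let mw : mfun (w : E -> R). Proof. by have [[]] := Hw. Qed.
Let w0 x : 0 < w x. Proof. by have [[_ h _] _ _] := Hw. Qed.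
Let mwE : mfun (fun x : E => (w x)%:E). Proof. exact:mEFin. Qed.
Let wE0 (x : E) : (0 <= (w x)%:E)%E. Proof. by pos. Qed.

Definition dbl : R := M * (10 ^+ n) `^ q.

Lemma dbl_ge1 : 1 <= dbl.
rewrite -[1]mulr1;apply:ler_pM => //.
have e1 : (1 : R) `^ q = 1 by rewrite powR1.
rewrite -{1}e1;apply:(ler_powRl (ltW (lt_trans ltr01 q1)) ler01).
by rewrite exprn_ege1// ler1n.
Qed.

(** The smaller cube has at least the fraction [10^-n] of the volume of the larger one, to which
    [cube_Aq_lower] applies. *)
Lemma doubling (c1 c2 : V) (r1 r2 : R) (A : set E) : 0 < r1 -> r2 <= 10 * r1 -> measurable A ->
 A `<=` cube c2 r2 -> cube c1 r1 `<=` cube c2 r2 ->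
 (\I_(x in A) w x <= dbl%:E * \I_(x in cube c1 r1) w x)%E.
move=> r10 r21 mA A2 c12;have [Ww _ _] := Hw.
have m1 := @mcube R n c1 r1;have m2 := @mcube R n c2 r2.
have r20 : 0 < r2.
 have : cube c1 r1 c1 by move=> i;rewrite in_itv /= lexx ltrDl.
 move=> /c12 /(_ (Ordinal n0));rewrite in_itv /= => /andP[h1 h2].
 by have := le_lt_trans h1 h2;rewrite ltrDl.
rewrite (wint_fin Ww r20 mA A2) (wint_fin Ww r10 m1 sub_id) -EFinM lee_fin.
have h2 := wint_subset Ww r20 mA m2 A2 sub_id;apply:(le_trans h2).
have := cube_Aq_lower q1 Hw r20 m1 c12;rewrite mu_cube//= => h.
have W2 : 0 <= wint w (cube c2 r2) by exact:wint_ge0.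
have q0 : 0 <= q by rewrite (ltW (lt_trans ltr01 q1)).
have le10 : ((10 ^+ n)^-1 : R) `^ q <= (r1 ^+ n / r2 ^+ n) `^ q.
 apply:(ler_powRl q0);first pos.
 rewrite -expr_div_n -exprVn;apply:lerXn2r;rewrite ?nnegrE ?invr_ge0 ?divr_ge0 ?(ltW r10) ?(ltW r20)//.
 by rewrite ler_pdivlMr// mulrC ler_pdivrMr// mulrC.
have := le_trans (ler_wpM2r W2 le10) h.
have -> : ((10 ^+ n)^-1 : R) `^ q = ((10 ^+ n) `^ q)^-1.
 by have := powR_div q (@ler01 R) (ltW (exprn_gt0 n (ltr0Sn R 9)));rewrite div1r powR1 div1r.
by rewrite /dbl mulrC ler_pdivrMr// mulrAC.
Qed.

Variables (v G : V -> R) (s th kap C4 rho : R) (o : V).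
Hypotheses (mv : mfun (v : E -> R)) (mG : mfun (G : E -> R)).
Hypotheses (v0 : ge0 v) (G0 : ge0 G).
Hypotheses (s1 : 1 < s) (th0 : 0 < th) (kap01 : 0 < kap < 1) (rho0 : 0 < rho) (C40 : 0 <= C4).
Let BIG : set E := ball o (4 * rho).
Hypothesis HPW : forall (z : V) (r Ph : R), 0 < r -> ball z (3 * r) `<=` BIG -> 0 < Ph ->
  (\I_(x in ball z (3 * r)) (v x `^ s * w x) <= (Ph * wint w (bigQ z (3 * r)))%:E)%E ->
  (\I_(x in ball z (3 * r)) (G x `^ s * w x) <= (th `^ s * Ph * wint w (bigQ z (3 * r)))%:E)%E ->
  (mu (ball z r `&` [set x : E | (C4 * Ph `^ s^-1 < v x)%R]) <= (kap * r ^+ n)%:E)%E.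

Local Notation side := (side rho).
Local Notation idx := (idx o rho).
Local Notation cell := (cell o rho).
Definition cen (k : nat) (z : 'rV[int]_n) : V := o + side k *: map_mx intr z.

Let sd0 k : 0 < side k. Proof. exact:side_gt0. Qed.
Let mcell k z : measurable (cell k z : set E). Proof. exact:measurable_cell. Qed.
Let mball (c : V) r : measurable (ball c r : set E).
have [r0|r0] := ltP 0 r;first exact/open_meas/ball_open.
rewrite (_ : ball c r = set0)//;apply/seteqP;split => // y /ballP;rewrite ltNge.
by rewrite (le_trans r0).
Qed.

Let cellE k z : cell k z = cube (cen k z) (side k). Proof. exact:cell_cube. Qed.

Let cell_near k z (x : V) : cell k z x -> `|x - cen k z| < side k.
rewrite cellE => h;apply/ballP;rewrite (ball_box _ (sd0 k)) => i;have := h i.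
rewrite !in_itv /= => /andP[h1 ->];rewrite andbT (lt_le_trans _ h1)// ltrBlDr ltrDl//.
Qed.

Let cell_cen k z : cell k z (cen k z).
by rewrite cellE;move=> i;rewrite in_itv /= lexx ltrDl;exact:sd0. Qed.

Let side_half j k : (j < k)%N -> 2 * side k <= side j.
move=> jk;apply:(le_via (2 * side j.+1)).
 by apply:ler_wpM2l => //;exact:side_le.
by rewrite /side exprS invfM mulrCA mulVKf.
Qed.

Let sub_bigQ (c : V) (r : R) : 0 < r -> ball c r `<=` bigQ c r.
exact:ball_cube. Qed.

Let dbl_ball k z : (\I_(x in ball (cen k z) (5 * side k)) w x <=
 dbl%:E * \I_(x in cell k z) w x)%E.
have s5 : 0 < 5 * side k by pos.
rewrite cellE;apply:(@doubling _ (shiftc (cen k z) (- (5 * side k))) _ (2 * (5 * side k))) => //.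
- by rewrite mulrA -natrM.
- exact:sub_bigQ.
rewrite -cellE => x /cell_near xz;apply:(sub_bigQ s5);apply/ballP.
by rewrite (lt_le_trans xz)// ler_peMl// ?(ltW (sd0 k))// ler1n.
Qed.

(** Dividing [G] by [th] puts both functions on the scale demanded by [HPW], so that a single
    stopping rule controls them. *)
Definition Zs (x : V) : R := (v x `^ s + (G x / th) `^ s) * \1_BIG x.

Lemma measurable_Zs : mfun (Zs : E -> R).
apply:mfunM;last exact:(measurable_indic (mball _ _)).
apply:mfunD;first exact:(mpowR s mv).
exact:(mpowR s (mfunM mG (measurable_cst th^-1))).
Qed.

Lemma Zs_ge0 x : 0 <= Zs x.
by rewrite mulr_ge0 ?addr_ge0 ?powR_ge0// indicE. Qed.

Variable L : R.
Hypothesis L0 : 0 < L.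
Let trunc : set E := [set x | L < Zs x].
Let mtrunc : measurable trunc.
exact:measurable_gt measurable_Zs.
Qed.
Definition ZL (x : V) : R := Zs x * w x * \1_trunc x.
Let ZL0 x : 0 <= ZL x. Proof. by apply:mulr_ge0;[apply:mulr_ge0;[exact:Zs_ge0|exact:ltW]|rewrite indicE]. Qed.
Let mZw : mfun (fun x : E => Zs x * w x).
exact:(mfunM measurable_Zs mw). Qed.
Let mZL : mfun (ZL : E -> R).
exact:(mfunM mZw (measurable_indic mtrunc)). Qed.
Let mZLE : mfun (fun x : E => (ZL x)%:E). Proof. exact:mEFin. Qed.
Let ZLE0 (x : E) : (0 <= (ZL x)%:E)%E. Proof. rewrite lee_fin;exact:ZL0. Qed.

Let P' k z : Prop := (L%:E * \I_(x in cell k z) w x < \I_(x in cell k z) ZL x)%E.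
(** A cell stops as soon as some cell of its generation within four side lengths has a large
    average. A cell that does not stop then controls the ball of three times its side, as [HPW]
    needs. *)
Let P k z : Prop := exists2 z', P' k z' & `|cen k z - cen k z'| <= 4 * side k.

Let Lw_int (D : set E) (c : R) : 0 <= c -> measurable D ->
 (\int[mu]_(x in D) (c%:E * (w x)%:E) = c%:E * \I_(x in D) w x)%E.
move=> c0 mD;apply:(ge0_integralZl_EFin mu mD _ _ c0);first by move=> x _;exact:wE0.
exact:(measurable_funS measurableT (@subsetT _ D) mwE).
Qed.

(** The ball of radius three sides is covered by cells of the same generation whose corners are
    within four sides; none of them has [P'], and together they stay inside the ball of radius five
    sides. *)
Let notP_int k z : ~ P k z -> (\I_(x in ball (cen k z) (3 * side k)) ZL x <=
  L%:E * \I_(x in ball (cen k z) (5 * side k)) w x)%E.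
move=> nP;pose Pk j z' : Prop := j = k /\ `|cen k z - cen k z'| <= 4 * side k.
pose D : set E := stopped o rho Pk.
have mD : measurable D by exact:measurable_stopped.
have D5 : D `<=` ball (cen k z) (5 * side k).
 move=> x [j [-> h]];apply/ballP;have xc := @cell_near k (idx k x) x erefl.
 rewrite -(subrKA (cen k (idx k x))) (_ : 5 * side k = side k + 4 * side k);last by ring.
 by apply:(le_lt_trans (ler_normD _ _));rewrite ltr_leD// distrC.
have D3 : ball (cen k z) (3 * side k) `<=` D.
 move=> x /ballP h;exists k;split => //;have xc := @cell_near k (idx k x) x erefl.
 rewrite -(subrKA x) (_ : 4 * side k = 3 * side k + side k);last by ring.
 by apply:(le_trans (ler_normD _ _));apply:lerD;[rewrite distrC|];exact:ltW.
have mLw : mfun (fun x : E => (L%:E * (w x)%:E)%E) := mEFin (mfunM (measurable_cst L) mw).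
have Lw0 (x : E) : (0 <= L%:E * (w x)%:E)%E by rewrite mule_ge0// lee_fin ltW.
apply:(le_via (\I_(x in D) ZL x)%E).
 exact:(int_subset mu (mball _ _) mD mZLE ZLE0 D3).
apply:(le_via (\int[mu]_(x in D) (L%:E * (w x)%:E))%E).
 apply:(stopped_le rho0 mZLE ZLE0 mLw Lw0) => j z' [[-> h] _].
 rewrite (Lw_int (ltW L0));last exact:mcell.
 by rewrite leNgt;apply/negP => p;apply:nP;exists z'.
rewrite (Lw_int (ltW L0));last exact:mD.
apply:lee_wpmul2l;first pos.
exact:(int_subset mu mD (mball _ _) mwE wE0 D5).
Qed.

Let nest k z (y : V) : cell k z y -> cell 0 0 y -> `|cen k z - o| < rho.
move=> yz y0;have c0 : cell 0 0 (cen k z).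
 have h : idx k (cen k z) = idx k y by rewrite (cell_cen k z).
 by have := idx_nested rho0 (leq0n k) h;rewrite /cell /= => ->.
have := cell_near c0;rewrite /cen /side expr0 divr1.
by rewrite (_ : map_mx intr 0 = 0 :> V) ?scaler0 ?addr0//;apply/rowP => i;rewrite !mxE.
Qed.

Let side_le0 k : side k <= rho.
by have := side_le rho0 (leq0n k);rewrite /side expr0 divr1. Qed.

Let ball_BIG k z (y : V) : cell k z y -> cell 0 0 y -> ball (cen k z) (3 * side k) `<=` BIG.
move=> yz y0 x /ballP xc;have h := nest yz y0;apply/ballP;rewrite -(subrKA (cen k z)).
apply:(le_lt_trans (ler_normD _ _));rewrite (_ : 4 * rho = 3 * rho + rho);last by ring.
by apply:ltrD => //;apply:(lt_le_trans xc);rewrite ler_pM2l.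
Qed.

Definition thr : R := C4 * (2 * dbl * L) `^ s^-1.

Let dbl0 : 0 < dbl. Proof. exact:lt_le_trans ltr01 dbl_ge1. Qed.

Let B3sub (k : nat) (z : 'rV[int]_n) : ball (cen k z) (3 * side k) `<=` ball (cen k z) (5 * side k).
by apply:le_ball;apply:ler_wpM2r;[exact:ltW|rewrite ler_nat]. Qed.

Let s30 k : 0 < 3 * side k. Proof. by pos. Qed.

Let cell_bigQ3 k z : cell k z `<=` bigQ (cen k z) (3 * side k).
move=> x /cell_near xz;apply:(sub_bigQ (s30 k));apply/ballP.
by rewrite (lt_le_trans xz)// ler_peMl// ?(ltW (sd0 k))// ler1n.
Qed.

(** Above the level [L] the absence of stopping bounds the integral, below it [Zs w] is at most
    [L w]; hence the factor 2. *)
Let int_Zs k z : ~ P k z ->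
 (\I_(x in ball (cen k z) (3 * side k)) (Zs x * w x) <=
  (2 * dbl * L * wint w (bigQ (cen k z) (3 * side k)))%:E)%E.
move=> nP;have [Ww _ _] := Hw.
pose B3 : set E := ball (cen k z) (3 * side k).
pose B5 : set E := ball (cen k z) (5 * side k).
have mB3 : measurable B3 by exact:mball.
have mB5 : measurable B5 by exact:mball.
have mLw : mfun (fun x : E => (L * w x)%:E) := mEFin (mfunM (measurable_cst L) mw).
have Lw0r x : 0 <= L * w x by pos.
have Lw0 (x : E) : (0 <= (L * w x)%:E)%E by pos;exact:Lw0r.
have mQ3 : measurable (bigQ (cen k z) (3 * side k)) by exact:mcube.
have hcell := int_subset mu (mcell k z) mQ3 mwE wE0 (@cell_bigQ3 k z).
have h2 : (L%:E * \I_(x in B5) w x <= (dbl * L * wint w (bigQ (cen k z) (3 * side k)))%:E)%E.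
 rewrite EFinM /wint -(wint_fin Ww (mulr_gt0 (ltr0Sn R 1) (s30 k)) mQ3 sub_id).
 rewrite (mulrC dbl) EFinM -muleA;apply:lee_wpmul2l;first pos.
 apply:(le_trans (dbl_ball k z));apply:lee_wpmul2l;first pos.
 exact:hcell.
apply:(le_via (\I_(x in B3) ZL x + \I_(x in B3) (L * w x))%E).
 rewrite -(integralD_real mu mB3 mZL (mfunM (measurable_cst L) mw) ZL0 Lw0r).
 apply:(int_le mu mB3).
 - exact:mEFin mZw.
 - exact:mEFin (mfunD mZL (mfunM (measurable_cst L) mw)).
 - by move=> x;rewrite lee_fin mulr_ge0 ?Zs_ge0// ltW.
 move=> x _;rewrite lee_fin /ZL indicE.
 have [xt|xt] := boolP (x \in trunc);first by rewrite mulr1 lerDl Lw0r.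
 rewrite mulr0 add0r;apply:ler_wpM2r;first exact:ltW.
 by move: xt;rewrite notin_setE /trunc /= => /negP;rewrite -leNgt.
rewrite (_ : 2 * dbl * L * wint w _ = dbl * L * wint w (bigQ (cen k z) (3 * side k)) +
 dbl * L * wint w (bigQ (cen k z) (3 * side k)));last by ring.
rewrite EFinD;apply:leeD;first exact:le_trans (notP_int nP) h2.
apply:le_trans h2;rewrite -(Lw_int (ltW L0) mB5).
exact:(int_subset mu mB3 mB5 mLw Lw0 (@B3sub k z)).
Qed.

Let cell_bound k z : ~ P k z -> ball (cen k z) (3 * side k) `<=` BIG ->
 (mu (ball (cen k z) (side k) `&` [set x : E | (thr < v x)%R]) <= (kap * side k ^+ n)%:E)%E.
move=> nP BB;have h := int_Zs nP.
have mB : measurable (ball (cen k z) (3 * side k) : set E) by exact:mball.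
have wpos (x : E) : 0 <= w x by pos.
have Ph0 := mulr_gt0 (mulr_gt0 (ltr0Sn R 1) dbl0) L0.
apply:(HPW (sd0 k) BB Ph0).
 apply:le_trans h;apply:(int_le mu mB).
 - exact:mEFin (mfunM (mpowR s mv) mw).
 - exact:mEFin mZw.
 - by move=> x;pos.
 move=> x /BB xB;rewrite lee_fin;apply:ler_wpM2r => //.
 by rewrite /Zs indicE mem_set// mulr1 lerDl powR_ge0.
rewrite -mulrA EFinM;have tp : 0 <= th `^ s by exact:powR_ge0.
apply:le_trans (lee_wpmul2l _ h);last pos.
rewrite -(ge0_integralZl_EFin mu mB _ _ tp);last 2 first.
- by move=> x _;rewrite lee_fin mulr_ge0 ?Zs_ge0.
- exact:mEFin mZw.
apply:(int_le mu mB).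
- exact:mEFin (mfunM (mpowR s mG) mw).
- exact:(mEFin (mfunM (measurable_cst (th `^ s)) mZw)).
- by move=> x;pos.
move=> x /BB xB;rewrite -EFinM lee_fin mulrA;apply:ler_wpM2r => //.
rewrite /Zs indicE mem_set// mulr1 powR_div ?(ltW th0)//.
rewrite mulrDr mulrCA divff ?mulr1 ?gt_eqF ?powR_gt0//.
by rewrite lerDr mulr_ge0 ?powR_ge0.
Qed.

Variable kw : R.
Hypothesis kw0 : 0 <= kw.
Hypothesis Hsm : forall (c : V) (r : R) (A : set E), 0 < r -> measurable A -> A `<=` cube c r ->
 (mu A <= (kap * r ^+ n)%:E)%E ->
 (\I_(x in A) w x <= kw%:E * \I_(x in cube c r) w x)%E.
Hypothesis HL : (dbl%:E * \int[mu]_x (Zs x * w x)%:E <= L%:E * \I_(x in cell 0 0) w x)%E.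

(** By [HL] and doubling, no cell of generation 0 near the root has a large average. A stopped cell
    inside the root therefore has a parent. *)
Let root_notP : ~ P 0 0.
case=> z' p zz;move: p;rewrite /P' ltNge => /negP;apply.
have mZT : (\I_(x in cell 0 z') ZL x <= \int[mu]_x (Zs x * w x)%:E)%E.
 apply:(le_via (\int[mu]_x (ZL x)%:E)%E).
  exact:(int_subset mu (mcell 0 z') measurableT mZLE ZLE0 (@subsetT _ _)).
 apply:(int_le mu measurableT mZLE (mEFin mZw) ZLE0) => x _.
 rewrite lee_fin /ZL indicE;case: (_ \in _);rewrite ?mulr1// mulr0.
 by rewrite mulr_ge0 ?Zs_ge0// ltW.
apply:(le_trans mZT).
have h5 : (\I_(x in cell 0 0) w x <= dbl%:E * \I_(x in cell 0 z') w x)%E.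
 apply:le_trans (dbl_ball 0 z');apply:(int_subset mu (mcell 0 0) (mball _ _) mwE wE0).
 move=> x /cell_near xz;apply/ballP;rewrite -(subrKA (cen 0 0)).
 rewrite (_ : 5 * side 0 = side 0 + 4 * side 0);last by ring.
 by apply:(le_lt_trans (ler_normD _ _));rewrite ltr_leD.
have h6 := le_trans HL (lee_wpmul2l (ltac:(by rewrite lee_fin ltW) : (0 <= L%:E)%E) h5).
by move: h6;rewrite muleCA lee_pmul2l// ltry.
Qed.

Let EL : set E := cell 0 0 `&` [set x | thr < v x].
Let mthr : measurable [set x : E | (thr < v x)%R].
exact:measurable_gt mv.
Qed.
Let mEL : measurable EL. Proof. by apply:measurableI;[exact:mcell|exact:mthr]. Qed.
Let St : set E := stopped o rho P.
Let mSt : measurable St. Proof. exact:measurable_stopped. Qed.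

(** A point of the root with [v > thr] outside the stopped set lies only in cells where such points
    have density at most [kap < 1]; differentiation of the indicator shows that these points form a
    null set. *)
Let null_part : {ae mu, forall x : V, w x * \1_EL x = w x * \1_(EL `&` St) x}.
pose N : set E := EL `&` ~` St.
have mN : measurable N by apply:measurableI => //;exact:measurableC.
have mF : mfun (fun x : E => (\1_N x : R)%:E) := (mEFin (measurable_indic mN)).
have F0 x : (0 <= (\1_N x : R)%:E)%E by pos.
have k0 : 0 <= kap by case/andP: kap01 => /ltW.
have := dyadic_differentiation o rho0 k0 mF F0;apply:ae_imp => x hx.
have xN : x \notin N.
 apply/negP => xN;have : ((\1_N x : R)%:E <= kap%:E)%E.
  apply:hx => k;set Q := cell k (idx k x).
  have -> : (\I_(y in Q) (\1_N y : R) = mu (N `&` Q))%E by rewrite integral_indic// ?setIC//;exact:mcell.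
  have /set_mem[[x0 _] _] := xN.
  have muQ : mu Q = (side k ^+ n)%:E by exact:lebesgue_cell.
  rewrite muQ -EFinM.
  have nPk : ~ P k (idx k x) by move=> p;move/set_mem : xN => [_];apply;exists k.
  apply:le_trans (cell_bound nPk (@ball_BIG k _ x erefl x0)).
  apply:le_measure;rewrite ?inE.
  - by apply:measurableI => //;exact:mcell.
  - by apply:measurableI;[exact:mball|exact:mthr].
  by move=> y [[[_ yv] _] yQ];split => //;apply/ballP;exact:cell_near.
 rewrite lee_fin indicE xN leNgt => /negP;apply;by case/andP: kap01.
congr (_ * _);rewrite !indicE in_setI;have [xE|//] := boolP (x \in EL).
have [//|xS] := boolP (x \in St);exfalso;move/negP: xN;apply;apply/mem_set;split;first exact/set_mem.
by apply/set_mem;rewrite in_setC.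
Qed.

(** The parent of a first stopping cell is not stopped, so the set [v > thr] has density at most
    [kap] around it; [Hsm] turns this into weighted measure, and doubling returns to the child. *)
Let cell_weight k z : first_stop o rho P k z ->
 (\I_(x in cell k z) (w x * \1_EL x) <= (kw * dbl)%:E * \I_(x in cell k z) w x)%E.
move=> [Pk fst];rewrite integral_mul_indicR.
have kd0 : (0 <= (kw * dbl)%:E)%E by pos.
have [[y [yz [y0 yv]]]|/forallNP e] := pselect (exists y, (cell k z `&` EL) y);last first.
 rewrite (_ : _ `&` _ = set0);last by apply/seteqP;split => // y /e.
 by rewrite integral_set0 mule_ge0// int_ge0T.
case: k Pk fst yz => [|k] Pk fst yz.
 by have e : z = 0 := etrans (esym yz) y0;exfalso;apply:root_notP;rewrite -e.
pose z' := idx k y.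
have nP' := fst y yz k (ltnSn k).
have BB := @ball_BIG k z' y erefl y0.
pose S : set E := ball (cen k z') (side k) `&` [set x : E | (thr < v x)%R].
have hS := cell_bound nP' BB.
have sub1 : cell k.+1 z `<=` cell k z'.
 move=> x xz;have e : idx k.+1 x = idx k.+1 y by rewrite xz yz.
 by rewrite /cell /=;apply:(idx_nested rho0 (leqnSn k) e).
have mS : measurable S.
 by apply:measurableI;[exact:mball|exact:mthr].
have mC : measurable ((cell k.+1 z : set E) `&` EL) by apply:measurableI => //;exact:mcell.
have sub2 : (cell k.+1 z) `&` EL `<=` S.
 by move=> x [xz [_ xv]];split => //;apply/ballP;apply:cell_near;exact:sub1.
have SQ : S `<=` bigQ (cen k z') (side k) by move=> x [xb _];exact:(sub_bigQ (sd0 k)).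
have d2 : 0 < 2 * side k by pos.
apply:(le_trans (int_subset mu mC mS mwE wE0 sub2)).
have hS2 : (mu S <= (kap * (2 * side k) ^+ n)%:E)%E.
 apply:(le_trans hS);rewrite lee_fin;apply:ler_wpM2l;first by case/andP: kap01 => /ltW.
 apply:lerXn2r;rewrite ?nnegrE ?(ltW d2) ?(ltW (sd0 k))//.
 by rewrite ler_peMl ?(ltW (sd0 k))// ler1n.
apply:(le_trans (Hsm d2 mS SQ hS2)).
rewrite EFinM -muleA;apply:lee_wpmul2l;first pos.
rewrite (cellE k.+1 z);apply:(@doubling _ _ (side k.+1) (2 * side k)) => //.
- have -> : side k = 2 * side k.+1 by rewrite /side exprS invfM mulrCA mulVKf.
 by rewrite mulrA -natrM;apply:ler_wpM2r;[exact:ltW|rewrite ler_nat].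
- exact:mcube.
- exact:subset_refl.
by rewrite -cellE => x /sub1 /cell_near xz;apply:(sub_bigQ (sd0 k));apply/ballP.
Qed.

(** A cell is stopped on account of a neighbour with [P'], so enlarged balls around the cells with
    [P'] cover the stopped set; their weight is bounded by doubling and by [P'] itself. *)
Let stopped_weight : (\I_(x in St) w x <= (dbl / L)%:E * \int[mu]_x (ZL x)%:E)%E.
pose S (k : nat) (z : 'rV[int]_n) : set E := ball (cen k z) (5 * side k).
pose S' : set E := \bigcup_k \bigcup_(z in [set z | P' k z /\ cell k z !=set0]) S k z.
have c0 : 0 <= dbl / L by pos.
have mS' : measurable S'.
 apply:countable_bigcup_measurable => k;rewrite bigcup_mkcond.
 apply:countable_bigcup_measurable => z;case: ifP => _ //.
 exact:mball.
have sub : St `<=` S'.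
 move=> x [k [z' pz' zz]];exists k => //;exists z'.
  by split => //;exists (cen k z').
 apply/ballP;rewrite -(subrKA (cen k (idx k x))) (_ : 5 * side k = side k + 4 * side k);last by ring.
 by apply:(le_lt_trans (ler_normD _ _));rewrite ltr_leD// cell_near.
apply:(le_trans (int_subset mu mSt mS' mwE wE0 sub)).
have mg : mfun (fun x : E => (dbl / L * ZL x)%:E) := mEFin (mfunM (measurable_cst _) mZL).
have g0 (x : E) : (0 <= (dbl / L * ZL x)%:E)%E by pos.
have gint (D : set E) : measurable D -> (\I_(x in D) (dbl / L * ZL x) =
  (dbl / L)%:E * \I_(x in D) ZL x)%E.
 move=> mD;under eq_integral do rewrite EFinM.
 apply:(ge0_integralZl_EFin mu mD _ _ c0);first by move=> x _;exact:ZLE0.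
 exact:(measurable_funS measurableT (@subsetT _ D) mZLE).
rewrite -(gint _ measurableT).
apply:(le_via (\I_(x in stopped o rho P') (dbl / L * ZL x))%E);last first.
 apply:(int_subset mu _ measurableT mg g0 (@subsetT _ _)).
 exact:measurable_stopped.
apply:(stopped_enlarge rho0 mwE wE0 mg g0) => [k z|j k x|k z [pz _]].
- exact:mball.
- rewrite leq_eqVlt => /orP[/eqP ->//|jk] y /ballP yk;apply/ballP.
 have xj : cell j (idx j x) (cen k (idx k x)).
  have h : idx k (cen k (idx k x)) = idx k x by rewrite cell_cen.
  exact:(idx_nested rho0 (ltnW jk) h).
 rewrite -(subrKA (cen k (idx k x)));apply:(le_lt_trans (ler_normD _ _)).
 have h1 := cell_near xj;have h2 := side_half jk.
 exact:five_real yk h1 h2 (sd0 j).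
rewrite (gint _ (mcell k z));apply:(le_trans (dbl_ball k z)).
have d0 : (0 <= (dbl / L)%:E)%E by pos.
have := lee_wpmul2l d0 (ltW pz).
by rewrite muleA -EFinM divfK ?gt_eqF.
Qed.

(** Up to a null set the high part of [v] lies in the stopped set. It is summed cell by cell, which
    gives the small factor [kw], and then the whole stopped set is bounded by the part of [Zs] above
    [L]. *)
Lemma good_lambda_level :
 (\I_(x in cell 0 0 `&` [set x : E | (thr < v x)%R]) w x <=
  (kw * dbl * (dbl / L))%:E * \int[mu]_x (ZL x)%:E)%E.
have kd0 : 0 <= kw * dbl by pos.
have mwi (D : set E) : measurable D -> mfun (fun x : E => (w x * \1_D x)%:E).
 by move=> mD;exact:mEFin (mfunM mw (measurable_indic mD)).
have mES : measurable (EL `&` St) by exact:measurableI.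
have -> : (\I_(x in cell 0 0 `&` [set x : E | (thr < v x)%R]) w x =
  \I_(x in St) (w x * \1_EL x))%E.
 rewrite integral_mul_indicR (setIC St).
 have := ae_integral_eq (D := setT) measurableT (mwi _ mEL) (mwi _ mES).
 rewrite !integral_mul_indicR !setTI;apply.
 by apply:ae_imp null_part => x ->.
have wi0 (x : E) : (0 <= (w x * \1_EL x)%:E)%E by pos.
have mkw : mfun (fun x : E => ((kw * dbl)%:E * (w x)%:E)%E) := mEFin (mfunM (measurable_cst (kw * dbl)) mw).
have kw0' (x : E) : (0 <= (kw * dbl)%:E * (w x)%:E)%E by rewrite mule_ge0// lee_fin.
apply:(le_via (\int[mu]_(x in St) ((kw * dbl)%:E * (w x)%:E))%E).
 apply:(stopped_le rho0 (mwi _ mEL) wi0 mkw kw0') => k z fst.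
 by rewrite (Lw_int kd0 (mcell k z));exact:cell_weight.
rewrite (Lw_int kd0 mSt) (EFinM (kw * dbl)) -muleA;apply:lee_wpmul2l;first pos.
exact:stopped_weight.
Qed.

End good_lambda.

(** * The local L^q bound *)

Section local_bound.
Hypothesis n0 : (0 < n)%N.
Variables (q M : R) (w : V -> R).
Hypotheses (q1 : 1 < q) (M1 : 1 <= M) (Hw : cube_Aq q M w).
Variables (rho : R) (o : V).
Hypothesis rho0 : 0 < rho.
Let BIG : set E := ball o (4 * rho).
Let Q1 : set E := cube o rho.
Let mw : mfun (w : E -> R). Proof. by have [[]] := Hw. Qed.
Let w0 x : 0 < w x. Proof. by have [[_ h _] _ _] := Hw. Qed.
Let Ww : weight w. Proof. by have [] := Hw. Qed.
Let dd := dbl q M.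
Let d1 : 1 <= dd. Proof. exact:dbl_ge1. Qed.
Let d0 : 0 < dd. Proof. exact:lt_le_trans d1. Qed.
Definition W1 : R := wint w Q1.
Let W10 : 0 < W1. Proof. exact:wint_gt0. Qed.
Let mQ1 : measurable Q1. Proof. exact:mcube. Qed.
Let mBIG : measurable BIG. Proof. exact/open_meas/ball_open;rewrite mulr_gt0. Qed.
Let w0' x : 0 <= w x. Proof. exact:ltW. Qed.

Lemma Q1_bigQ m : 1 <= m -> Q1 `<=` bigQ o (m * rho).
move=> m1 x h i;have := h i;rewrite !in_itv /= /shiftc !mxE => /andP[h1 h2].
have r2 : rho <= m * rho by rewrite ler_peMl// ltW.
apply/andP;split;first by apply:le_trans h1;rewrite lerBlDr lerDl (le_trans (ltW rho0)).
apply:(lt_le_trans h2);rewrite -addrA lerD2l;lra.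
Qed.

Lemma weight_BIG : (\I_(x in BIG) w x <= (dd * W1)%:E)%E.
have r40 : 0 < 4 * rho by pos.
rewrite EFinM /W1 -(wint_fin Ww rho0 mQ1 sub_id).
apply:(@doubling n0 _ _ _ q1 Hw _ (shiftc o (- (4 * rho))) _ (2 * (4 * rho))) => //.
- by rewrite mulrA -natrM ler_pM2r// ler_nat.
- exact:ball_cube.
- by apply:Q1_bigQ;rewrite ler1n.
Qed.

Lemma jensen_BIG (X : V -> R) (p J : R) : mfun (X : E -> R) -> ge0 X ->
 1 < p -> 0 <= J -> (\I_(x in BIG) (X x `^ p * w x) <= J%:E)%E ->
 (\I_(x in BIG) (X x * w x) <= (dd * (J / W1) `^ p^-1 * W1)%:E)%E.
move=> mX X0 p1 J0 hJ;have dW : 0 <= dd * W1 by pos.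
have := jensen_weight mBIG mX mw X0 w0' p1 J0 dW hJ weight_BIG.
by move/le_trans;apply;rewrite lee_fin;exact:jensen_real.
Qed.

Variables (v G : V -> R) (s th kap kw C1 C4 b eta kap1 kw1 J : R).
Hypotheses (mv : mfun (v : E -> R)) (mG : mfun (G : E -> R)).
Hypotheses (v0 : ge0 v) (G0 : ge0 G).
Hypotheses (sq : 1 < s < q) (th0 : 0 < th) (kap01 : 0 < kap < 1) (C40 : 0 < C4) (J0 : 0 < J).
Hypotheses (kw0 : 0 <= kw) (kw10 : 0 <= kw1) (C10 : 0 < C1) (b0 : 0 <= b) (eta0 : 0 < eta).
Hypothesis HPW : forall (z : V) (r Ph : R), 0 < r -> ball z (3 * r) `<=` BIG -> 0 < Ph ->
  (\I_(x in ball z (3 * r)) (v x `^ s * w x) <= (Ph * wint w (bigQ z (3 * r)))%:E)%E ->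
  (\I_(x in ball z (3 * r)) (G x `^ s * w x) <= (th `^ s * Ph * wint w (bigQ z (3 * r)))%:E)%E ->
  (mu (ball z r `&` [set x : E | (C4 * Ph `^ s^-1 < v x)%R]) <= (kap * r ^+ n)%:E)%E.
Hypothesis Hsm : forall (c : V) (r : R) (A : set E), 0 < r -> measurable A -> A `<=` cube c r ->
 (mu A <= (kap * r ^+ n)%:E)%E ->
 (\I_(x in A) w x <= kw%:E * \I_(x in cube c r) w x)%E.
Hypothesis Hlow : forall l : R, 0 < l ->
  (\I_(x in ball o (3 * rho)) (v x `^ s * w x) <= (l `^ s * wint w (bigQ o (3 * rho)))%:E)%E ->
  (\I_(x in ball o (3 * rho)) (G x `^ s * w x) <= (th `^ s * l `^ s * wint w (bigQ o (3 * rho)))%:E)%E ->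
  (mu (ball o rho `&` [set x : E | (C1 * (b + eta * l) < v x)%R]) <= (kap1 * rho ^+ n)%:E)%E.
Hypothesis Hsm1 : forall (c : V) (r : R) (A : set E), 0 < r -> measurable A -> A `<=` cube c r ->
 (mu A <= (kap1 * (r / 2) ^+ n)%:E)%E ->
 (\I_(x in A) w x <= kw1%:E * \I_(x in cube c r) w x)%E.
Hypothesis HJ : (\I_(x in BIG) (2 `^ (q / s) * (v x `^ q + (G x / th) `^ q) * w x) <= J%:E)%E.

Let s0 : 0 < s. Proof. by case/andP: sq => h _;exact:lt_trans h. Qed.
Let q0 : 0 < q. Proof. exact:lt_trans q1. Qed.
Let s1 : 1 < s. Proof. by case/andP: sq. Qed.
Let Z := Zs v G s th rho o.
Let mZ : mfun (Z : E -> R). Proof. exact:measurable_Zs. Qed.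
Let Z0 x : 0 <= Z x. Proof. by rewrite /Z mulr_ge0 ?addr_ge0 ?powR_ge0// indicE. Qed.
Let C5 := C4 * (2 * dd) `^ s^-1.
Let C50 : 0 < C5. Proof. by pos. Qed.
(** A level from which on the root cube is never stopped: by Jensen's inequality, [dd] times the
    integral of [Z w] is at most [l1^s W1]. *)
Let l1 := dd `^ (2 / s) * (J / W1) `^ q^-1.
Let l10 : 0 < l1. Proof. by pos. Qed.
Let JW0 : 0 <= J / W1. Proof. by pos. Qed.
Let l1s : l1 `^ s = dd ^+ 2 * (J / W1) `^ (s / q).
rewrite /l1 powRM ?powR_ge0// -!powRrM divfK ?gt_eqF// [q^-1 * s]mulrC.
by congr (_ * _);rewrite powR_mulrn// ltW.
Qed.
Let l1q : l1 `^ q * W1 = dd `^ (2 * q / s) * J.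
rewrite /l1 powRM ?powR_ge0// -!powRrM mulVf ?gt_eqF// powRr1// -mulrA divfK ?gt_eqF//.
by congr (_ `^ _ * _);rewrite mulrAC.
Qed.

Let ZqE x : Z x `^ (q / s) <= (2 `^ (q / s) * (v x `^ q + (G x / th) `^ q)) * \1_BIG x.
have qs : q / s != 0 by pos.
rewrite /Z /Zs !indicE;case: (_ \in _);last by rewrite !mulr0 powR0.
rewrite !mulr1;apply:(le_trans (powR_sum_le _ _ _));rewrite ?powR_ge0//.
 by pos.
by rewrite -!powRrM !(mulrCA s) divff ?mulr1// gt_eqF.
Qed.

Let ZJ : (\int[mu]_x (Z x `^ (q / s) * w x)%:E <= J%:E)%E.
have mvG : mfun (fun x : E => 2 `^ (q / s) * (v x `^ q + (G x / th) `^ q) * w x).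
 apply:mfunM;last exact:mw.
 apply:mfunM;first exact:measurable_cst.
 apply:mfunD;first exact:(mpowR q mv).
 exact:(mpowR q (mfunM mG (measurable_cst th^-1))).
apply:le_trans HJ.
rewrite -(setTI BIG) -(integral_mul_indicR setT BIG (fun x => 2 `^ (q / s) * (v x `^ q + (G x / th) `^ q) * w x)).
apply:(int_le mu measurableT).
- exact:mEFin (mfunM (mpowR (q / s) mZ) mw).
- exact:mEFin (mfunM mvG (measurable_indic mBIG)).
- by move=> x;pos.
by move=> x _;rewrite lee_fin mulrAC;apply:ler_wpM2r => //;exact:ZqE.
Qed.

Let Zw_BIG : (\int[mu]_x (Z x * w x)%:E = \I_(x in BIG) (Z x * w x))%E.
rewrite -[in RHS](setTI BIG) -(integral_mul_indicR setT BIG (fun x => Z x * w x)).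
apply:eq_integral => x _;congr _%:E;rewrite /Z /Zs !indicE.
by case: (_ \in _);rewrite ?mulr1// !mulr0 !mul0r.
Qed.

Let ZI : (dd%:E * \int[mu]_x (Z x * w x)%:E <= (l1 `^ s * W1)%:E)%E.
have p1 : 1 < q / s by rewrite ltr_pdivlMr// mul1r;case/andP: sq.
have h : (\I_(x in BIG) (Z x `^ (q / s) * w x) <= J%:E)%E.
 apply:le_trans ZJ;apply:(int_subset mu mBIG measurableT _ _ (@subsetT _ BIG)).
  exact:mEFin (mfunM (mpowR (q / s) mZ) mw).
 by move=> x;pos.
have := jensen_BIG mZ Z0 p1 (ltW J0) h;rewrite -Zw_BIG invf_div => h2.
apply:(le_trans (lee_wpmul2l _ h2));first pos.
by rewrite -EFinM lee_fin l1s le_eqVlt;apply/orP;left;apply/eqP;ring.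
Qed.

Let high : (\I_(x in Q1 `&` [set x | (C5 * l1 < v x)%R]) (v x `^ q * w x) <=
  (kw * dd * dd * (2 * C5) `^ q * (2 `^ (q - s) / (2 `^ (q - s) - 1)) * J)%:E)%E.
have k0 := mulr_ge0 (mulr_ge0 kw0 (ltW d0)) (ltW d0).
have sq' : 0 < s < q by rewrite s0;case/andP: sq.
apply:(le_trans (sum_levels mQ1 mv mZ mw v0 Z0 w0' sq' k0 l10 C50 _));last first.
 rewrite [X in (_ <= X)%E]EFinM;apply:lee_wpmul2l;last exact:ZJ.
 rewrite lee_fin;apply:mulr_ge0;first exact:mulr_ge0 k0 (powR_ge0 _ _).
 apply:divr_ge0;first exact:powR_ge0.
 rewrite subr_ge0.
 by rewrite -[leLHS](powRr0 2);apply:ler_powR;rewrite ?ler1n// subr_ge0 ltW//;case/andP: sq.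
move=> j;set l := l1 * 2 ^+ j.
have l0 : 0 < l by pos.
have L0 : 0 < l `^ s by pos.
have ll : l1 `^ s <= l `^ s.
 apply:ler_powRl;rewrite ?(ltW s0) ?(ltW l10)//.
 by rewrite ler_peMr ?(ltW l10)// exprn_ege1// ler1n.
have HL : (dd%:E * \int[mu]_x (Z x * w x)%:E <= (l `^ s)%:E * \I_(x in cell o rho 0 0) w x)%E.
 apply:(le_trans ZI);rewrite -(cube_cell _ rho0) (wint_fin Ww rho0 mQ1 sub_id).
 by rewrite -EFinM lee_fin;apply:ler_wpM2r => //;exact:ltW.
have := good_lambda_level n0 q1 M1 Hw mv mG G0 th0 kap01 rho0 HPW L0 kw0 Hsm HL.
rewrite -(cube_cell _ rho0) (_ : thr q M s C4 (l `^ s) = C5 * l);last first.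
 rewrite /thr /C5 -[RHS]mulrA;congr (_ * _).
 rewrite (powRM s^-1 (mulr_ge0 (ler0n R 2) (ltW d0)) (powR_ge0 l s));congr (_ * _).
 by apply:powRK;[exact:ltW|rewrite gt_eqF].
by rewrite mulrA.
Qed.

(** Three ranges of [v] are treated. Up to [C1 (b + eta l1)] the bound is pointwise; between this
    and [C5 l1] the set has small weight by [Hlow] and [Hsm1]; above [C5 l1] the good lambda
    inequality is summed over the levels [l1 2^j]. *)
Lemma local_bound : (\I_(x in Q1) (v x `^ q * w x) <=
 ((2 * C1) `^ q * b `^ q * W1 + ((2 * C1) `^ q * eta `^ q * dd `^ (2 * q / s) +
  C5 `^ q * (kw1 * dd) * dd `^ (2 * q / s) +
  kw * dd * dd * (2 * C5) `^ q * (2 `^ (q - s) / (2 `^ (q - s) - 1))) * J)%:E)%E.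
have mset c : measurable [set x : E | (c < v x)%R].
 exact:measurable_gt mv.
pose S : set E := ball o rho `&` [set x : E | (C1 * (b + eta * l1) < v x)%R].
have mS : measurable S by apply:measurableI => //;exact/open_meas/ball_open.
have r30 : 0 < 3 * rho by pos.
have mB3 : measurable (ball o (3 * rho) : set E) by exact/open_meas/ball_open.
have mQ3 : measurable (bigQ o (3 * rho)) by exact:mcube.
have m3 : 1 <= 3 :> R by rewrite ler1n.
have r60 : 0 < 2 * (3 * rho) by pos.
have WQ : W1 <= wint w (bigQ o (3 * rho)).
 exact:(wint_subset Ww r60 mQ1 mQ3 (Q1_bigQ m3) sub_id).
have Zint : (\I_(x in ball o (3 * rho)) (Z x * w x) <= (l1 `^ s * wint w (bigQ o (3 * rho)))%:E)%E.
 apply:(le_via (dd%:E * \int[mu]_x (Z x * w x)%:E)%E).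
  have zw0 (x : E) : (0 <= (Z x * w x)%:E)%E by pos.
  apply:(le_via (\int[mu]_x (Z x * w x)%:E)%E).
   apply:(int_subset mu mB3 measurableT _ zw0 (@subsetT _ _)).
   exact:mEFin (mfunM mZ mw).
  rewrite -[leLHS]mul1e;apply:lee_wpmul2r;first exact:int_ge0T.
  by pos.
 by apply:(le_trans ZI);rewrite lee_fin;apply:ler_wpM2l => //;exact:powR_ge0.
have B3B : ball o (3 * rho) `<=` BIG by apply:le_ball;rewrite ler_pM2r// ler_nat.
have hv : (\I_(x in ball o (3 * rho)) (v x `^ s * w x) <= (l1 `^ s * wint w (bigQ o (3 * rho)))%:E)%E.
 apply:le_trans Zint;apply:(int_le mu mB3).
 - exact:mEFin (mfunM (mpowR s mv) mw).
 - exact:mEFin (mfunM mZ mw).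
 - by move=> x;pos.
 move=> x /B3B xB;rewrite lee_fin;apply:ler_wpM2r => //.
 by rewrite /Z /Zs indicE mem_set// mulr1 lerDl powR_ge0.
have tp : 0 <= th `^ s by exact:powR_ge0.
have hG : (\I_(x in ball o (3 * rho)) (G x `^ s * w x) <= (th `^ s * l1 `^ s * wint w (bigQ o (3 * rho)))%:E)%E.
 rewrite -mulrA EFinM;apply:le_trans (lee_wpmul2l _ Zint);last pos.
 rewrite -(ge0_integralZl_EFin mu mB3 _ _ tp);last 2 first.
 - by move=> x _;pos.
 - exact:mEFin (mfunM mZ mw).
 apply:(int_le mu mB3).
 - exact:mEFin (mfunM (mpowR s mG) mw).
 - exact:(mEFin (mfunM (measurable_cst (th `^ s)) (mfunM mZ mw))).
 - by move=> x;pos.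
 move=> x /B3B xB;rewrite -EFinM lee_fin mulrA;apply:ler_wpM2r => //.
 rewrite /Z /Zs indicE mem_set// mulr1 powR_div ?(ltW th0)//.
 rewrite mulrDr (mulrCA _ (G x `^ s)) divff ?mulr1 ?gt_eqF ?powR_gt0//.
 by rewrite lerDr mulr_ge0 ?powR_ge0.
have muS := Hlow l10 hv hG;rewrite -/S in muS.
have SQ : S `<=` bigQ o rho by move=> x [xb _];exact:ball_cube xb.
have wS : (\I_(x in Q1 `&` S) w x <= (kw1 * (dd * W1))%:E)%E.
 have mwE : mfun (fun x : E => (w x)%:E) by exact:mEFin.
 have wE0 (x : E) : (0 <= (w x)%:E)%E by pos.
 have mQS : measurable (Q1 `&` S) by exact:measurableI.
 apply:(le_trans (int_subset mu mQS mS mwE wE0 (@subIsetr _ _ _))).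
 have r2 : 0 < 2 * rho by pos.
 apply:(le_via (kw1%:E * \I_(x in bigQ o rho) w x)%E).
  by apply:(Hsm1 r2 mS SQ);rewrite mulrAC divff// mul1r.
 rewrite EFinM;apply:lee_wpmul2l;first pos.
 rewrite EFinM /W1 -(wint_fin Ww rho0 mQ1 sub_id).
 apply:(@doubling n0 _ _ _ q1 Hw _ (shiftc o (- rho)) _ (2 * rho)) => //.
 - by rewrite ler_pM2r// ler_nat.
 - exact:mcube.
 - by have := @Q1_bigQ 1 (lexx _);rewrite mul1r.
pose c1 := (C1 * (b + eta * l1)) `^ q;pose c2 := (C5 * l1) `^ q.
have c10 : 0 <= c1 by exact:powR_ge0.
have c20 : 0 <= c2 by exact:powR_ge0.
pose T : set E := [set x : E | (C5 * l1 < v x)%R].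
have mT : measurable T by exact:mset.
pose f1 x := c1 * w x;pose f2 x := c2 * (w x * \1_S x);pose f3 x := v x `^ q * w x * \1_T x.
have mf1 : mfun (f1 : E -> R) := mfunM (measurable_cst c1) mw.
have mwS : mfun (fun x : E => w x * \1_S x) := mfunM mw (measurable_indic mS).
have mf2 : mfun (f2 : E -> R) := mfunM (measurable_cst c2) mwS.
have mvq : mfun (fun x : E => v x `^ q * w x) := mfunM (mpowR q mv) mw.
have mf3 : mfun (f3 : E -> R) := mfunM mvq (measurable_indic mT).
have f10 x : 0 <= f1 x by pos.
have f20 x : 0 <= f2 x by pos.
have vq0 x : 0 <= v x `^ q * w x by pos.
have f30 x : 0 <= f3 x by pos.
apply:(le_via (\I_(x in Q1) (f1 x + (f2 x + f3 x)))%E).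
 apply:(int_le mu mQ1).
 - exact:mEFin.
 - exact:mEFin (mfunD mf1 (mfunD mf2 mf3)).
 - by move=> x;pos.
 move=> x xQ;rewrite lee_fin /f3 indicE.
 have [xT|xT] := boolP (x \in T);first by rewrite mulr1 addrA lerDr addr_ge0.
 have vT : v x <= C5 * l1 by move: xT;rewrite notin_setE /T /= => /negP;rewrite -leNgt.
 rewrite mulr0 addr0 /f1 /f2 indicE;have [xS|xS] := boolP (x \in S).
  rewrite mulr1 -mulrDl;apply:(ler_wpM2r (w0' x));apply:(le_trans (ler_powRl (ltW q0) (v0 x) vT)).
  by rewrite lerDr;exact:c10.
 rewrite mulr0 mulr0 addr0;apply:(ler_wpM2r (w0' x));apply:(ler_powRl (ltW q0) (v0 x)).
 have xb : ball o rho x.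
  rewrite (ball_box _ rho0) => i.
  by have := xQ i;rewrite !in_itv /= => /andP[h1 ->];rewrite andbT (lt_le_trans _ h1)// ltrBlDr ltrDl.
 by rewrite leNgt;apply/negP => h;move: xS;rewrite notin_setE;apply.
rewrite (integralD_real mu mQ1 mf1 (mfunD mf2 mf3) f10);last by move=> x;rewrite addr_ge0.
rewrite (integralD_real mu mQ1 mf2 mf3 f20 f30).
have i1 : (\I_(x in Q1) f1 x = (c1 * W1)%:E)%E.
 under eq_integral do rewrite EFinM.
 rewrite (ge0_integralZl_EFin mu mQ1 _ _ c10);last 2 first.
 - by move=> x _;pos.
 - exact:mEFin.
 by rewrite (wint_fin Ww rho0 mQ1 sub_id).
have i2 : (\I_(x in Q1) f2 x <= (c2 * (kw1 * (dd * W1)))%:E)%E.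
 under eq_integral do rewrite EFinM.
 rewrite (ge0_integralZl_EFin mu mQ1 _ _ c20);last 2 first.
 - by move=> x _;pos.
 - exact:mEFin.
 rewrite integral_mul_indicR EFinM;apply:lee_wpmul2l;[by pos|exact:wS].
have i3 : (\I_(x in Q1) f3 x <= (kw * dd * dd * (2 * C5) `^ q * (2 `^ (q - s) / (2 `^ (q - s) - 1)) * J)%:E)%E.
 by rewrite (integral_mul_indicR Q1 T (fun x => v x `^ q * w x));exact:high.
rewrite i1;apply:(le_trans (leeD (lexx _) (leeD i2 i3))).
rewrite -!EFinD lee_fin.
have e1 : c1 * W1 <= (2 * C1) `^ q * (b `^ q * W1 + eta `^ q * (dd `^ (2 * q / s) * J)).
 rewrite -l1q mulrA -mulrDl mulrA;apply:ler_wpM2r;first exact:ltW.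
 have el0 : 0 <= eta * l1 := mulr_ge0 (ltW eta0) (ltW l10).
 rewrite /c1 (powRM q (ltW C10) (addr_ge0 b0 el0)) (powRM q (ler0n R 2) (ltW C10)).
 rewrite -(powRM q (ltW eta0) (ltW l10)) [2 `^ q * _]mulrC -mulrA.
 by apply:ler_wpM2l;[exact:powR_ge0|exact:powR_sum_le b0 el0 (ltW q0)].
have e2 : c2 * (kw1 * (dd * W1)) = C5 `^ q * (kw1 * dd) * (dd `^ (2 * q / s) * J).
 have -> : c2 = C5 `^ q * l1 `^ q := (powRM q (ltW C50) (ltW l10)).
 rewrite -l1q;exact:lb_real1.
rewrite e2;apply:(le_trans (lerD e1 (lexx _))).
by rewrite lb_real2.
Qed.

End local_bound.

(** * The local estimate with a small factor *)

Section local_reverse.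
Hypothesis n0 : (0 < n)%N.

Lemma small_set_int (C g kap : R) (w : V -> R) : weight w -> 0 <= C -> 0 < g -> 0 <= kap ->
 (forall o r (A : set E), 0 < r -> measurable A -> A `<=` cube o r ->
   wint w A <= C * (fine (mu A) / r ^+ n) `^ g * wint w (cube o r)) ->
 forall c (r : R) (A : set E), 0 < r -> measurable A -> A `<=` cube c r ->
 (mu A <= (kap * r ^+ n)%:E)%E ->
 (\I_(x in A) w x <= (C * kap `^ g)%:E * \I_(x in cube c r) w x)%E.
move=> Ww C0 g0 k0 H c r A r0 mA Ac hA.
have mC : measurable (cube c r : set E) by exact:mcube.
rewrite (wint_fin Ww r0 mA Ac) (wint_fin Ww r0 mC sub_id) -EFinM lee_fin.
apply:(le_trans (H c r A r0 mA Ac));apply:ler_wpM2r;first exact:wint_ge0.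
apply:ler_wpM2l => //;have [e /andP[f0 _]] := weight_mu r0 mA Ac.
have rn : 0 < r ^+ n by pos.
apply:(ler_powRl (ltW g0));first pos.
by rewrite ler_pdivrMr// -lee_fin -e.
Qed.

(** Jensen's inequality lowers the exponent from [q] to [s]; then [sub_weight_bound] is used with an
    indicator as [a] and with [al = 1]. *)
Lemma mean_bound (q M : R) : 1 < q -> 1 <= M -> exists2 C : R, 0 < C &
 forall w, cube_Aq q M w -> forall (u : V -> R) (o : V) (rho J : R), Lint u -> 0 < rho -> 0 <= J ->
 (\I_(x in ball o (4 * rho)) (`|u x| `^ q * w x) <= J%:E)%E ->
 ig (fun x : E => `|u x| * \1_(ball o (3 * rho) : set E) x) <=
  (C * (J / W1 w rho o) `^ q^-1) * rho ^+ n.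
move=> q1 M1;have [s [g [C [/andP[s1 sq] g0 C0 SW]]]] := @sub_weight_bound R n q M q1 M1.
pose dd := dbl q M;have d1 : 1 <= dd := dbl_ge1 q1 M1.
have d0 : 0 < dd by exact:lt_le_trans d1.
exists (C * dd `^ s^-1 * 6 ^+ n);first pos.
move=> w Hw u o rho J ui rho0 J0 hJ;have [Ww _ _] := Hw.
have s0 : 0 < s by exact:lt_trans s1.
have r30 : 0 < 3 * rho by pos.
have r60 : 0 < 2 * (3 * rho) by pos.
pose B : set E := ball o (3 * rho);pose Q := bigQ o (3 * rho).
have mB : measurable B by have [] := Lint_ball o r30.
have mQ : measurable Q by exact:mcube.
have BQ : B `<=` Q by exact:ball_cube.
pose U x := `|u x|.
have mU := Lint_meas (Lint_abs ui).
have mUs : mfun (fun x : E => U x `^ s) by exact:mpowR.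
have U0 x : 0 <= U x by exact:normr_ge0.
have Us0 x : 0 <= U x `^ s by exact:powR_ge0.
have p1 : 1 < q / s by rewrite ltr_pdivlMr// mul1r.
have mw : mfun (w : E -> R) by have [] := Ww.
have w0 x : 0 <= w x by have [_ h _] := Ww;exact:ltW.
have hJ' : (\I_(x in ball o (4 * rho)) ((U x `^ s) `^ (q / s) * w x) <= J%:E)%E.
 apply:le_trans hJ;apply:le_of_eq;apply:eq_integral => x _.
 by rewrite -powRrM mulrCA divff ?mulr1// gt_eqF.
have := jensen_BIG n0 q1 M1 Hw rho0 mUs Us0 p1 J0 hJ';rewrite invf_div -/dd => hI.
set W := W1 w rho o in hI *.
pose Ph := dd * (J / W) `^ (s / q).
have Ph0 : 0 <= Ph by pos.
have WQ : W <= wint w Q.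
 have m3 : 1 <= 3 :> R by rewrite ler1n.
 exact:(wint_subset Ww r60 (@mcube _ _ o rho) mQ (Q1_bigQ rho0 m3) sub_id).
have B4 : B `<=` ball o (4 * rho) by apply:le_ball;rewrite ler_pM2r// ler_nat.
have [m4 _] := Lint_ball o (mulr_gt0 (ltr0Sn R 3) rho0).
have hF : (\I_(x in Q) ((U x * \1_B x) `^ s * w x) <= (Ph * wint w Q)%:E)%E.
 have -> : (fun x : E => ((U x * \1_B x) `^ s * w x)%:E) = (fun x => ((U x `^ s * w x) * \1_B x)%:E).
  apply/funext => x;congr _%:E;rewrite indicE.
  by case: (_ \in _);rewrite ?mulr1// !mulr0 powR0 ?mul0r// gt_eqF.
 rewrite (integral_mul_indicR Q B (fun x => U x `^ s * w x)) setIC (setIidl BQ).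
 apply:(le_via (Ph * W)%:E);last by rewrite lee_fin ler_wpM2l.
 apply:le_trans hI;apply:(int_subset mu mB m4 _ _ B4).
  exact:mEFin (mfunM mUs mw).
 by move=> x;pos.
have h1 : (\I_(x in Q) (\1_B x : R) <= (1 * (2 * (3 * rho)) ^+ n)%:E)%E.
 have muQ : mu Q = ((2 * (3 * rho)) ^+ n)%:E by exact:mu_cube.
 rewrite integral_indic// mul1r -[leRHS]muQ;apply:le_measure;rewrite ?inE//.
 exact:measurableI.
have i01 x : 0 <= (\1_B x : R) <= 1 by rewrite indicE;case: (_ \in _);rewrite /= ?lexx ?ler01.
have F0 (x : E) : 0 <= U x * \1_B x by pos;have /andP[] := i01 x.
have mF := mfunM mU (measurable_indic mB).
have := SW w Hw (shiftc o (- (3 * rho))) (2 * (3 * rho)) (fun x => U x * \1_B x) \1_B Ph 1 r60 mF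
 (measurable_indic mB) F0 i01 Ph0 ler01 hF h1.
have e1 : (1 : R) `^ g = 1 by rewrite powR1.
rewrite e1 mulr1 => h2.
have h3 : (\I_(x in Q) (U x * \1_B x) <= (C * Ph `^ s^-1 * (2 * (3 * rho)) ^+ n)%:E)%E.
 apply:le_trans h2;apply:le_of_eq;apply:eq_integral => x _.
 by congr _%:E;rewrite indicE;case: (_ \in _);rewrite ?mul1r// !mulr0.
have [_] := ig_sub_cube mB mQ BQ mU U0 h3;move/le_trans;apply.
have -> : Ph `^ s^-1 = dd `^ s^-1 * (J / W) `^ q^-1.
 rewrite /Ph powRM ?powR_ge0 ?(ltW d0)// -powRrM;congr (_ * _ `^ _).
 by rewrite mulrAC divff ?mul1r// gt_eqF.
have -> : (2 * (3 * rho)) ^+ n = 6 ^+ n * rho ^+ n by rewrite mulrA -natrM exprMn.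
by apply:le_of_eq;ring.
Qed.

(** Order of the choices: [eta] makes the term with [l1] in the low range small, [x2] and [x3] bound
    the admissible densities [kap1] and [kap], and [th], with it [al], achieves these densities. The
    factor in front of [J] in [local_bound] has three terms, each given a third of [eps / two]. *)
Lemma local_reverse (lam Lam q M eps : R) : 0 < lam -> lam <= Lam -> 1 < q -> 1 <= M -> 0 < eps ->
 exists al Ce : R, [/\ 0 < al, 0 < Ce & forall w, cube_Aq q M w ->
 forall O a f D u, local_data Lam a f D u -> local_eq O a f D u ->
 forall (o : V) (rho Jv JG Ju : R), 0 < rho -> ball o (4 * rho) `<=` O ->
 (forall (z : V) (r : R), 0 < r -> ball z (3 * r) `<=` ball o (4 * rho) -> exists2 A, elliptic lam Lam A &
  ig (fun x => (\sum_j \sum_i `|A j i - a j i x|) * \1_(ball z (3 * r) : set E) x) <= al * r ^+ n) ->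
 0 <= Jv -> 0 <= JG -> 0 <= Ju ->
 (\I_(x in ball o (4 * rho)) (vnorm D x `^ q * w x) <= Jv%:E)%E ->
 (\I_(x in ball o (4 * rho)) (vnorm f x `^ q * w x) <= JG%:E)%E ->
 (\I_(x in ball o (4 * rho)) (`|u x| `^ q * w x) <= Ju%:E)%E ->
 (\I_(x in cube o rho) (vnorm D x `^ q * w x) <=
  (eps * Jv + Ce * (JG + rho `^ (- q) * Ju))%:E)%E].
move=> lam0 lL q1 M1 eps0;have q0 : 0 < q by exact:lt_trans q1.
have [s [g [C1 [C2 [C3 [sq g0 C10 C20 [C30 WL]]]]]]] := weighted_local n0 lam0 lL q1 M1.
have [g' [C' [g'0 C'0 SS]]] := @small_set_weight R n q M q0 M1.
have [Cm Cm0 MB] := mean_bound q1 M1.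
have s1 : 1 < s by case/andP: sq.
have s0 : 0 < s by exact:lt_trans s1.
have sq' : s < q by case/andP: sq.
pose dd := dbl q M;have d1 : 1 <= dd := dbl_ge1 q1 M1.
have d0 : 0 < dd by exact:lt_le_trans d1.
pose C4 := 2 * C1 * C3;have C40 : 0 < C4 by pos.
pose C5 := C4 * (2 * dd) `^ s^-1.
pose dp := dd `^ (2 * q / s).
pose cg := 2 `^ (q - s) / (2 `^ (q - s) - 1) : R.
have cg0 : 0 <= cg.
 apply:divr_ge0;first exact:powR_ge0.
 by rewrite subr_ge0 -[leLHS](powRr0 2);apply:ler_powR;rewrite ?ler1n// subr_ge0 ltW.
pose two := (2 : R) `^ (q / s).
have two0 : 0 < two by pos.
pose e3 := eps / two / 3.
have e30 : 0 < e3 by pos.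
have K10 : 0 <= (2 * C1) `^ q * dp by pos.
have K20 : 0 <= C5 `^ q * (C' * dd) * dp := (mulr_ge0 (mulr_ge0 (powR_ge0 _ _) (mulr_ge0 (ltW C'0) (ltW d0))) (powR_ge0 _ _)).
have K30 : 0 <= C' * dd * dd * (2 * C5) `^ q * cg.
 exact:(mulr_ge0 (mulr_ge0 (mulr_ge0 (mulr_ge0 (ltW C'0) (ltW d0)) (ltW d0)) (powR_ge0 _ _)) cg0).
have [eta /andP[eta0 _] heta] := powR_small K10 q0 e30.
have [x2 /andP[x20 _] hx2] := powR_small K20 g'0 e30.
have [x3 /andP[x30 x3h] hx3] := powR_small K30 g'0 e30.
(* Both densities are proportional to [th], being [kap = 2 C2 th / C3] and [kap1 = 2 C2 th / eta];
   the two bounds make them at most [x3] and [x2]. *)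
pose th := Num.min (x2 * eta / (2 * C2)) (x3 * C3 / (2 * C2)).
have C22 : 0 < 2 * C2 by pos.
have th0 : 0 < th by rewrite lt_min;apply/andP;split;rewrite divr_gt0// mulr_gt0.
pose kap := 2 * C2 * th / C3;pose kap1 := 2 * C2 * th / eta.
have kap0 : 0 < kap by pos.
have kap10 : 0 < kap1 by pos.
have kx3 : kap <= x3.
 by rewrite ler_pdivrMr// mulrC -ler_pdivlMr// ge_min lexx orbT.
have kx2 : kap1 <= x2.
 by rewrite ler_pdivrMr// mulrC -ler_pdivlMr// ge_min lexx.
have kap01 : 0 < kap < 1.
 by rewrite kap0 (le_lt_trans kx3)// (le_lt_trans x3h)// invf_lt1// ltr1n.
(* With [al^g = th] the oscillation and the datum contribute equally to the weak estimate. *)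
pose al := th `^ g^-1;have al0 : 0 < al by pos.
have alg : al `^ g = th by apply:powRVK;[exact:ltW|rewrite gt_eqF].
pose Ku := (2 * C1) `^ q * Cm `^ q.
exists al, (eps * th `^ (- q) + Ku + 1);split => //.
 by pos.
move=> w Hw O a f D u dat eqn o rho Jv JG Ju rho0 BO BMO Jv0 JG0 Ju0 hv hG hu.
have [Ww _ _] := Hw.
have [ma aL fi Di ui] := dat.
have mD : mfun (vnorm D : E -> R) by apply:mvnorm => i;exact:Lint_meas.
have mf : mfun (vnorm f : E -> R) by apply:mvnorm => i;exact:Lint_meas.
have mw : mfun (w : E -> R) by have [] := Ww.
have w0 x : 0 <= w x by have [_ h _] := Ww;exact:ltW.
pose BIG : set E := ball o (4 * rho).
have mBIG : measurable BIG by have [] := Lint_ball o (mulr_gt0 (ltr0Sn R 3) rho0).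
have W0 : 0 < W1 w rho o by exact:wint_gt0.
have SSw := SS w Ww (fun o r A r0 mA Ac => cube_Aq_lower q1 Hw r0 mA Ac).
have Hsm := small_set_int Ww (ltW C'0) g'0 (ltW kap0) SSw.
have Hsm1' := small_set_int Ww (ltW C'0) g'0 (ltW kap10) SSw.
have Hsm1 c (r : R) (A : set E) : 0 < r -> measurable A -> A `<=` cube c r ->
 (mu A <= (kap1 * (r / 2) ^+ n)%:E)%E ->
 (\I_(x in A) w x <= (C' * kap1 `^ g')%:E * \I_(x in cube c r) w x)%E.
 move=> r0 mA Ac hA;apply:Hsm1' => //;apply:(le_trans hA);rewrite lee_fin.
 apply:ler_wpM2l;first exact:ltW.
 apply:lerXn2r;rewrite ?nnegrE ?divr_ge0 ?(ltW r0)//.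
 by rewrite ler_pdivrMr// ler_peMr ?(ltW r0)// ler1n.
pose b := Cm * (Ju / W1 w rho o) `^ q^-1 / rho.
have b0 : 0 <= b by pos.
have bu : ig (fun x => `|u x| * \1_(ball o (3 * rho)) x) <= b * rho ^+ n.+1.
 apply:(le_trans (MB w Hw u o rho Ju ui rho0 Ju0 hu)).
 by rewrite exprS mulrA /b divfK// gt_eqF.
have bq : b `^ q * W1 w rho o = Cm `^ q * (rho `^ (- q) * Ju).
 have rV : rho^-1 = rho `^ (-1) by rewrite powR_inv1// ltW.
 rewrite /b rV powRM ?powR_ge0 ?mulr_ge0 ?(ltW Cm0) ?powR_ge0// powRM ?(ltW Cm0) ?powR_ge0//.
 rewrite -!powRrM mulVf ?gt_eqF// mulN1r powRr1 ?divr_ge0 ?(ltW W0)//.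
 by rewrite -!mulrA;congr (_ * _);rewrite [rho `^ _ * W1 _ _ _]mulrC mulKf ?gt_eqF// mulrC.
have HPW (z : V) (r Ph : R) : 0 < r -> ball z (3 * r) `<=` BIG -> 0 < Ph ->
  (\I_(x in ball z (3 * r)) (vnorm D x `^ s * w x) <= (Ph * wint w (bigQ z (3 * r)))%:E)%E ->
  (\I_(x in ball z (3 * r)) (vnorm f x `^ s * w x) <= (th `^ s * Ph * wint w (bigQ z (3 * r)))%:E)%E ->
  (mu (ball z r `&` [set x : E | (C4 * Ph `^ s^-1 < vnorm D x)%R]) <= (kap * r ^+ n)%:E)%E.
 move=> r0 BB Ph0 h1 h2;have [A EA hA] := BMO z r r0 BB.
 pose x := Ph `^ s^-1;have x0 : 0 < x by pos.
 have t0 : 0 < C3 * x by pos.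
 have Pf0 : 0 <= th `^ s * Ph by pos.
 have := WL w Hw O a f D u dat eqn A z r (C3 * x) (C3 * x) al Ph (th `^ s * Ph) EA r0
  (fun y yB => BO y (BB y yB)) t0 (ltW t0) (ltW al0) (ltW Ph0) Pf0 hA h1 h2 (or_introl (lexx _)).
 rewrite alg powRM ?powR_ge0 ?(ltW Ph0)// powRK ?(ltW th0) ?gt_eqF// -/x.
 rewrite ratio_real ?gt_eqF// (_ : C1 * (C3 * x + C3 * x) = C4 * x) //.
 by rewrite /C4;ring.
have Hlow (l : R) : 0 < l ->
  (\I_(x in ball o (3 * rho)) (vnorm D x `^ s * w x) <= (l `^ s * wint w (bigQ o (3 * rho)))%:E)%E ->
  (\I_(x in ball o (3 * rho)) (vnorm f x `^ s * w x) <= (th `^ s * l `^ s * wint w (bigQ o (3 * rho)))%:E)%E ->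
  (mu (ball o rho `&` [set x : E | (C1 * (b + eta * l) < vnorm D x)%R]) <= (kap1 * rho ^+ n)%:E)%E.
 move=> l0 h1 h2.
 have BB : ball o (3 * rho) `<=` ball o (4 * rho) by apply:le_ball;rewrite ler_pM2r// ler_nat.
 have [A EA hA] := BMO o rho rho0 BB.
 have t0 : 0 < eta * l by pos.
 have Ph0 : 0 <= l `^ s by exact:powR_ge0.
 have Pf0 : 0 <= th `^ s * l `^ s by pos.
 have := WL w Hw O a f D u dat eqn A o rho (eta * l) b al (l `^ s) (th `^ s * l `^ s) EA rho0
  (fun y yB => BO y (BB y yB)) t0 b0 (ltW al0) Ph0 Pf0 hA h1 h2 (or_intror bu).
 have e1 : (l `^ s) `^ s^-1 = l by apply:powRK;[exact:ltW|rewrite gt_eqF].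
 have e2 : (th `^ s * l `^ s) `^ s^-1 = th * l.
  rewrite (powRM s^-1 (powR_ge0 th s) (powR_ge0 l s)) e1;congr (_ * _).
  by apply:powRK;[exact:ltW|rewrite gt_eqF].
 rewrite alg e1 e2.
 by rewrite ratio_real ?gt_eqF.
have vD0 := vnorm_ge0 D;have vf0 := vnorm_ge0 f.
apply/lee_addgt0Pr => xi xi0.
pose B := (2 * C1) `^ q * eta `^ q * dp + C5 `^ q * (C' * kap1 `^ g' * dd) * dp +
  C' * kap `^ g' * dd * dd * (2 * C5) `^ q * cg.
have hB : B <= eps / two.
 have h1 : (2 * C1) `^ q * dp * eta `^ q <= e3 by apply:heta;rewrite (ltW eta0) lexx.
 have h2 : C5 `^ q * (C' * dd) * dp * kap1 `^ g' <= e3 by apply:hx2;rewrite (ltW kap10) kx2.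
 have h3 : C' * dd * dd * (2 * C5) `^ q * cg * kap `^ g' <= e3 by apply:hx3;rewrite (ltW kap0) kx3.
 rewrite /B;exact:three_real h1 h2 h3.
have kw0 : 0 <= C' * kap `^ g' by pos.
have kw10 : 0 <= C' * kap1 `^ g' by pos.
have B0 : 0 <= B.
 have p (x y : R) : 0 <= x `^ y by exact:powR_ge0.
 exact:(addr_ge0 (addr_ge0 (mulr_ge0 (mulr_ge0 (p _ _) (p _ _)) (p _ _))
  (mulr_ge0 (mulr_ge0 (p _ _) (mulr_ge0 kw10 (ltW d0))) (p _ _)))
  (mulr_ge0 (mulr_ge0 (mulr_ge0 (mulr_ge0 kw0 (ltW d0)) (ltW d0)) (p _ _)) cg0)).
(* The summand [xi / (B + 1)] keeps [J], hence the level [l1], positive even if all integrals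
   vanish; it contributes at most the arbitrary [xi]. *)
pose J := two * (Jv + th `^ (- q) * JG) + xi / (B + 1).
have J0 : 0 < J.
 by rewrite ltr_wpDl ?divr_gt0 ?ltr_wpDl// mulr_ge0 ?(ltW two0)// addr_ge0// mulr_ge0 ?powR_ge0.
have HJ : (\I_(x in BIG) (two * (vnorm D x `^ q + (vnorm f x / th) `^ q) * w x) <= J%:E)%E.
 pose f1 x := vnorm D x `^ q * w x;pose f2 x := vnorm f x `^ q * w x.
 have mf1 : mfun (f1 : E -> R) := mfunM (mpowR q mD) mw.
 have mf2 : mfun (f2 : E -> R) := mfunM (mpowR q mf) mw.
 have f10 x : 0 <= f1 x by pos.
 have f20 x : 0 <= f2 x by rewrite mulr_ge0 ?powR_ge0.
 have tq : 0 <= two * th `^ (- q) by pos.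
 have -> : (fun x : E => (two * (vnorm D x `^ q + (vnorm f x / th) `^ q) * w x)%:E) =
   (fun x => (two * f1 x + two * th `^ (- q) * f2 x)%:E).
  apply/funext => x;congr _%:E;rewrite /f1 /f2 powR_div ?(ltW th0)// powRN.
  by ring.
 have g10 x : 0 <= two * f1 x by pos.
 have g20 x : 0 <= two * th `^ (- q) * f2 x by pos.
 rewrite (integralD_real mu mBIG (mfunM (measurable_cst two) mf1) (mfunM (measurable_cst _) mf2) g10 g20).
 rewrite (_ : J = two * Jv + two * th `^ (- q) * JG + xi / (B + 1));last by rewrite /J;ring.
 apply:(le_via (two * Jv + two * th `^ (- q) * JG)%:E);last first.
  by rewrite lee_fin lerDl divr_ge0 ?(ltW xi0)// addr_ge0.
 have i1 : (\I_(x in BIG) (two * f1 x) <= (two * Jv)%:E)%E.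
  rewrite (integralZ_real mu mBIG mf1 f10 (ltW two0)) EFinM.
  by apply:lee_wpmul2l;[rewrite lee_fin ltW|exact:hv].
 have i2 : (\I_(x in BIG) (two * th `^ (- q) * f2 x) <= (two * th `^ (- q) * JG)%:E)%E.
  rewrite (integralZ_real mu mBIG mf2 f20 tq) (EFinM (two * _)).
  by apply:lee_wpmul2l;[rewrite lee_fin|exact:hG].
 by rewrite EFinD;apply:leeD;[exact:i1|exact:i2].
apply:(le_trans (local_bound n0 q1 M1 Hw rho0 mD mf vD0 vf0 sq th0 kap01 C40 J0 kw0 kw10 C10 b0 eta0 HPW Hsm Hlow Hsm1 HJ)).
rewrite -EFinD lee_fin -/dd -/C5 -/dp -/cg -/B -mulrA bq.
have BJ : B * J <= eps * (Jv + th `^ (- q) * JG) + xi.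
 rewrite /J mulrDr;apply:lerD.
  rewrite mulrA;apply:ler_wpM2r;first pos.
  by rewrite -ler_pdivlMr.
 rewrite mulrCA -[leRHS]mulr1;apply:ler_wpM2l;first exact:ltW.
 by rewrite ler_pdivrMr ?ltr_wpDl// mul1r lerDl.
apply:(le_trans (lerD (lexx _) BJ)).
have r1 : 0 <= rho `^ (- q) * Ju by pos.
have t1 : 0 <= eps * th `^ (- q) by pos.
have k1 : 0 <= Ku by pos.
rewrite /Ku in k1 *;exact:final_real.
Qed.

End local_reverse.

(** * Averaging over centres *)

Section ball_average.
Hypothesis n0 : (0 < n)%N.

Lemma ball_sub_radius (z o : V) (r s : R) : 0 < r -> 0 < s -> ball z r `<=` ball o s -> r <= s.
move=> r0 s0 H;rewrite leNgt;apply/negP => sr.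
pose i := Ordinal n0.
have h c : `|c| = s -> `|z 0 i + c - o 0 i| < s.
 move=> cs;have : ball o s (z + const_mx c).
  apply:H;apply/ballP;rewrite addrC addKr;apply:le_lt_trans sr.
  by apply:norm_leP => [|j];rewrite ?(ltW s0)// mxE cs.
 move/ballP => hb;apply:le_lt_trans hb.
 by have := coord_le_norm (z + const_mx c - o) i;rewrite !mxE.
have := h s (gtr0_norm s0);have := h (- s);rewrite normrN (gtr0_norm s0) => /(_ erefl).
by rewrite !ltr_norml => /andP[h1 h2] /andP[h3 h4];lra.
Qed.

Lemma measurable_ball_rel (a : R) : measurable [set p : E * E | (`|(p.1 : V) - (p.2 : V)| < a)%R].
apply:(@measurable_coords_open R n _ _ (fun p : E * E => (p.1 : V) - (p.2 : V)) [set y : V | `|y| < a]).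
 by move=> i;under eq_fun do rewrite !mxE;exact:measurable_sub_coord.
apply:(@open_comp _ _ (fun y : V => `|y|) [set t | t < a]) => [y _|];last exact:open_lt.
exact:norm_continuous.
Qed.

Definition mball_int (h : V -> R) (a : R) (z : V) : R := ig (fun x : E => h x * \1_(ball z a : set E) x).

(** Integrating a local inequality over its centre replaces a covering by small balls: by Fubini
    each point is counted with at most the volume [(2 a)^n], and with exactly this volume if all
    centres near it belong to [B]. *)
Lemma ball_average (h : V -> R) (a : R) (B : set E) : Lint h -> ge0 h -> 0 < a ->
 measurable B -> (mu B < +oo)%E ->
 Lint (fun z : E => \1_B z * mball_int h a z) /\
 (forall O' : set E, measurable O' -> (forall z x : V, B z -> `|x - z| < a -> O' x) ->
  ig (fun z : E => \1_B z * mball_int h a z) <= (2 * a) ^+ n * ig (fun x : E => h x * \1_O' x)) /\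
 (forall O : set E, measurable O -> (forall z x : V, O x -> `|x - z| < a -> B z) ->
  (2 * a) ^+ n * ig (fun x : E => h x * \1_O x) <= ig (fun z : E => \1_B z * mball_int h a z)).
move=> hi h0 a0 mB Bf.
have [Bi _] := Lint_indic_lty mB Bf.
pose S : set (E * E) := [set p | (`|(p.1 : V) - (p.2 : V)| < a)%R].
pose F (z x : E) : R := \1_B z * (h x * \1_S (z, x)).
have mS : measurable S by exact:measurable_ball_rel.
have mh := Lint_meas hi.
have mF : mfun (fun p : E * E => F p.1 p.2).
 apply:mfunM.
  exact:(mT_comp (measurable_indic mB) measurable_fst).
 apply:mfunM;first exact:(mT_comp mh measurable_snd).
 rewrite (_ : (fun p : E * E => \1_S (p.1, p.2)) = \1_S);first exact:measurable_indic.
 by apply/funext => -[].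
have Fb (z x : E) : `|F z x| <= \1_B z * h x.
 rewrite ger0_norm;last by rewrite /F !mulr_ge0// indicE.
 rewrite /F;apply:ler_wpM2l;first pos.
 by rewrite indicE;case: (_ \in _);rewrite ?mulr1// mulr0.
have [[L1 L2] E12] := leb_swap mF Fb Bi hi.
have [F1 F2] := leb_Lint mF Fb Bi hi.
have e1 (z : V) : ig (F z) = \1_B z * mball_int h a z.
 have hb : Lint (fun x => h x * \1_(ball z a) x).
  by apply:(Lint_indic hi);have [] := Lint_ball z a0.
 rewrite /mball_int -(igZ (\1_B z) hb);congr ig;apply/funext => x;rewrite /F;congr (_ * (_ * _)).
 rewrite !indicE;congr (_%:R);congr nat_of_bool;apply/idP/idP => /set_mem hx;apply/mem_set.
  by apply/ballP;rewrite distrC.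
 by move/ballP: hx;rewrite distrC.
have fe1 : (fun z => ig (F z)) = (fun z => \1_B z * mball_int h a z).
 by apply/funext => z;exact:e1.
rewrite fe1 in L1 E12.
pose k (x : V) := ig (fun z => \1_B z * \1_(ball x a : set E) z).
have bi (x : V) : Lint (fun z => \1_B z * \1_(ball x a) z).
 by apply:Lint_indic => //;have [] := Lint_ball x a0.
have e2 (x : V) : ig (F^~ x) = h x * k x.
 rewrite /k -(igZ (h x) (bi x));congr ig;apply/funext => z;rewrite /F mulrCA;congr (_ * (_ * _)).
 rewrite !indicE;congr (_%:R);congr nat_of_bool;apply/idP/idP => /set_mem hx;apply/mem_set.
  by apply/ballP;exact:hx.
 by move/ballP: hx.
have fe2 : (fun x => ig (F^~ x)) = (fun x => h x * k x).
 by apply/funext => x;exact:e2.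
rewrite fe2 in L2 E12.
have kle x : k x <= (2 * a) ^+ n.
 rewrite -(ig_ball x a0);have [_ b1] := Lint_ball x a0.
 by apply:ig_le => // z;apply:indic_mul_le;rewrite indicE.
split;first exact:L1.
split;[move=> O' mO' HO;rewrite E12|move=> O mO HO;rewrite E12].
 have l := Lint_indic hi mO'.
 rewrite -(igZ _ l);apply:ig_le => //;first exact:LintZ.
 move=> x;rewrite [\1_O' x]indicE;have [xO|xO] := boolP (x \in O').
  by rewrite mulr1 mulrC;apply:ler_wpM2r.
 have -> : k x = 0;last by rewrite !mulr0.
 rewrite /k (_ : (fun z => _) = fun=> 0) ?ig0//;apply/funext => z;rewrite !indicE.
 have [/set_mem zB|] := boolP (z \in B);last by rewrite mul0r.
 have [/set_mem/ballP zx|] := boolP (z \in _);last by rewrite mulr0.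
 by exfalso;move/negP: xO;apply;apply/mem_set;apply:(HO z x zB);rewrite distrC.
have l := Lint_indic hi mO.
rewrite -(igZ _ l);apply:ig_le => //;first exact:LintZ.
have k0 x : 0 <= k x by apply:ig_ge0 => z;rewrite mulr_ge0// indicE.
move=> x;rewrite [\1_O x]indicE;have [/set_mem xO|xO] := boolP (x \in O);last first.
 by rewrite !mulr0 mulr_ge0.
rewrite mulr1 mulrC;apply:ler_wpM2l => //.
rewrite -(ig_ball x a0) /k le_eqVlt;apply/orP;left;apply/eqP;congr ig;apply/funext => z.
rewrite [\1_B z]indicE [\1_(ball x a) z]indicE.
have [/set_mem/ballP zx|_] := boolP (z \in _);last by rewrite mulr0.
by rewrite mem_set ?mulr1//;apply:(HO z x xO);rewrite distrC.
Qed.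

End ball_average.

(** * Absorption over the radii *)

Section interior.
Hypothesis n0 : (0 < n)%N.

Lemma integral_ig (h : V -> R) (B : set E) : Lint h -> measurable B ->
 (\I_(x in B) h x = (ig (fun x : E => h x * \1_B x))%:E)%E.
move=> hi mB;rewrite -(ig_EFin (Lint_indic hi mB)).
by rewrite (int_indic h B).
Qed.

Lemma normv_sub_lt (x0 y z : V) (t a : R) : normv (z - x0) < t -> `|y - z| < a -> 0 < a ->
 normv (y - x0) < t + n%:R * a.
move=> h1 h2 a0;have -> : y - x0 = (z - x0) + (y - z) by rewrite [RHS]addrC addrA subrK.
apply:(le_lt_trans (normvD _ _));apply:(ltr_leD h1);apply:(le_trans (normv_le_norm _)).
by apply:ler_wpM2l;[exact:ler0n|exact:ltW].
Qed.

Lemma ig_le_comb (g h1 h2 h3 : E -> R) (a b c : R) :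
 Lint g -> Lint h1 -> Lint h2 -> Lint h3 ->
 (forall z, g z <= a * h1 z + (b * h2 z + c * h3 z)) ->
 ig g <= a * ig h1 + (b * ig h2 + c * ig h3).
move=> ig0 i1 i2 i3 le;have L1 := LintZ a i1;have L2 := LintZ b i2;have L3 := LintZ c i3.
apply:(le_via (ig (fun z => a * h1 z + (b * h2 z + c * h3 z)))).
 exact:(ig_le ig0 (LintD L1 (LintD L2 L3)) le).
apply:le_of_eq.
apply:(etrans (igD L1 (LintD L2 L3)));congr (_ + _);first exact:(igZ a i1).
by apply:(etrans (igD L2 L3));congr (_ + _);[exact:(igZ b i2)|exact:(igZ c i3)].
Qed.

(** [local_reverse] at scale [2 r] is averaged over centres; the balls of radius [10 r] on its
    right-hand side cost [10^n]. Halving [r] multiplies [r^-q] by [be = 2^q], so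
    [eps = 1 / (2 be 10^n)] leaves a factor whose product with [be] is [1/2], as [absorb]
    requires. *)
Lemma interior_estimate (lam Lam q M : R) : 0 < lam -> lam <= Lam -> 1 < q -> 1 <= M ->
 exists al C : R, [/\ 0 < al, 0 < C & forall w, cube_Aq q M w ->
 forall a f D u, local_data Lam a f D u -> forall x0 (d : R), 0 < d ->
 local_eq (eball x0 (2 * d)) a f D u ->
 (forall z (r : R), 0 < r -> eball z (3 * n%:R * r) `<=` eball x0 (2 * d) ->
  exists2 A, elliptic lam Lam A &
  ig (fun x => (\sum_j \sum_i `|A j i - a j i x|) * \1_(ball z (3 * r) : set E) x) <= al * r ^+ n) ->
 Lint (fun x => vnorm D x `^ q * w x) -> Lint (fun x => vnorm f x `^ q * w x) ->
 Lint (fun x => `|u x| `^ q * w x) ->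
 ig (fun x : E => vnorm D x `^ q * w x * \1_(eball x0 d : set E) x) <=
  C * (ig (fun x : E => vnorm f x `^ q * w x * \1_(eball x0 (2 * d) : set E) x) +
   d `^ (- q) * ig (fun x : E => `|u x| `^ q * w x * \1_(eball x0 (2 * d) : set E) x))].
move=> lam0 lL q1 M1;have q0 : 0 < q by exact:lt_trans q1.
have nR : 0 < n%:R :> R by pos.
pose be := (2 : R) `^ q.
have be1 : 1 <= be by rewrite -[leLHS](powRr0 2);apply:ler_powR;rewrite ?ler1n// ltW.
have be0 : 0 < be by exact:lt_le_trans be1.
pose p10 : R := 10 ^+ n;have p100 : 0 < p10 by pos.
pose eps := (2 * be * p10)^-1.
have eps0 : 0 < eps by pos.
have [al [Ce [al0 Ce0 LR]]] := local_reverse n0 lam0 lL q1 M1 eps0.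
(* Consecutive radii differ by [18 n r]: [n r] to reach the centres [z], [9 n r] from there to the
   centres of the balls where oscillation is tested, and [8 n r] for their Euclidean radius. *)
pose k18 := (18 * n%:R : R) `^ q.
have n18 : 1 <= 18 * n%:R :> R by rewrite -natrM ler1n muln_gt0.
have k181 : 1 <= k18 by rewrite -[leLHS](powRr0 (18 * n%:R));apply:ler_powR => //;exact:ltW.
pose K := Ce * p10 * k18.
have K0 : 0 < K by pos.
exists al, (2 * K);split => //;first pos.
move=> w Hw a f D u dat x0 d d0 eqn BMO hvi hGi hui.
have [Ww _ _] := Hw.
have w0 x : 0 <= w x by have [_ h _] := Ww;exact:ltW.
pose hv x := vnorm D x `^ q * w x;pose hG x := vnorm f x `^ q * w x;pose hu x := `|u x| `^ q * w x.
have hv0 x : 0 <= hv x by pos.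
have hG0 x : 0 <= hG x by rewrite mulr_ge0 ?powR_ge0.
have hu0 x : 0 <= hu x by pos.
pose ph (t : R) := ig (fun x => hv x * \1_(eball x0 t : set E) x).
pose PG := ig (fun x => hG x * \1_(eball x0 (2 * d) : set E) x).
pose Pu := ig (fun x => hu x * \1_(eball x0 (2 * d) : set E) x).
have mE t : measurable (eball x0 t : set E) by exact:meball.
have PG0 : 0 <= PG by apply:ig_ge0 => x;rewrite mulr_ge0// indicE.
have Pu0 : 0 <= Pu by apply:ig_ge0 => x;rewrite mulr_ge0// indicE.
have step (t t' r : R) : d <= t -> t < t' -> t' <= 2 * d -> 0 < r -> t' - t = 18 * n%:R * r ->
  ph t <= eps * p10 * ph t' + Ce * p10 * (PG + (2 * r) `^ (- q) * Pu).
 move=> dt tt' t'd r0 tr.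
 have [ra rb] := radius_real nR r0 tr.
 have nr0 : 0 < n%:R * r by pos.
 pose B : set E := eball x0 (t + n%:R * r).
 have mB : measurable B by exact:mE.
 have tp : 0 < t + n%:R * r by rewrite addr_gt0// (lt_le_trans d0).
 have Bf : (mu B < +oo)%E by have [b [-> _ _]] := @lebesgue_eball R n n0 x0 _ tp;exact:ltry.
 have a10 : 0 < 10 * r by pos.
 have [lv [upv _]] := ball_average hvi hv0 a10 mB Bf.
 have [lG [upG _]] := ball_average hGi hG0 a10 mB Bf.
 have [lu [upu _]] := ball_average hui hu0 a10 mB Bf.
 have [l1 [_ lowv]] := ball_average hvi hv0 r0 mB Bf.
 have near (z x : V) : B z -> `|x - z| < 10 * r -> (eball x0 t') x.
  move=> Bz xz;have := normv_sub_lt Bz xz a10;rewrite mulrCA => h;exact:lt_le_trans h ra.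
 have near2 (z x : V) : B z -> `|x - z| < 10 * r -> (eball x0 (2 * d)) x.
  by move=> Bz xz;apply:lt_le_trans t'd;exact:near Bz xz.
 have uv := upv _ (mE t') near;have uG := upG _ (mE (2 * d)) near2;have uu := upu _ (mE (2 * d)) near2.
 have lw := lowv _ (mE t) (fun z x xt xz => normv_sub_lt xt (ltac:(by rewrite distrC) : `|z - x| < r) r0).
 have pt (z : V) : B z -> mball_int hv r z <=
   eps * mball_int hv (10 * r) z + Ce * (mball_int hG (10 * r) z + (2 * r) `^ (- q) * mball_int hu (10 * r) z).
  (* Corner of the cube of side [2 r] centred at [z], which contains the ball of radius [r];
     [local_reverse] describes cubes by their corner. *)
  move=> Bz;pose o := shiftc z (- r).
  have oz : `|o - z| <= r.
   by rewrite /o /shiftc addrC addKr;apply:norm_leP => [|j];rewrite ?(ltW r0)// mxE normrN gtr0_norm.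
  have r20 : 0 < 2 * r by pos.
  have sub : ball o (4 * (2 * r)) `<=` ball z (10 * r).
   move=> x /ballP xo;apply/ballP;rewrite -(subrKA o) (_ : 10 * r = 4 * (2 * r) + 2 * r);last by ring.
   apply:(le_lt_trans (ler_normD _ _));apply:ltr_leD => //;apply:(le_trans oz).
   by rewrite mulr_natl mulr2n lerDl ltW.
  have [mz _] := Lint_ball z a10.
  have r80 : 0 < 4 * (2 * r) by pos.
  have [mo _] := Lint_ball o r80.
  have up (h : V -> R) : Lint h -> ge0 h ->
    (\I_(x in ball o (4 * (2 * r))) h x <= (mball_int h (10 * r) z)%:E)%E.
   move=> hi h0;rewrite /mball_int -(integral_ig hi mz).
   apply:(int_subset mu mo mz _ _ sub);first exact:mEFin (Lint_meas hi).
   by move=> x;pos.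
  have mb0 (h : V -> R) : ge0 h -> 0 <= mball_int h (10 * r) z.
   by move=> h0;apply:ig_ge0 => x;rewrite mulr_ge0// indicE.
  have BO : ball o (4 * (2 * r)) `<=` eball x0 (2 * d).
   by move=> x /sub /ballP xz;exact:near2 Bz xz.
  have HB (y : V) (s : R) : 0 < s -> ball y (3 * s) `<=` ball o (4 * (2 * r)) -> exists2 A, elliptic lam Lam A &
    ig (fun x => (\sum_j \sum_i `|A j i - a j i x|) * \1_(ball y (3 * s)) x) <= al * s ^+ n.
   move=> s0 ys;apply:(BMO y s s0) => x xy.
   have s30 : 0 < 3 * s by pos.
   have s8 := ball_sub_radius n0 s30 r80 ys.
   have yo : `|y - o| < 4 * (2 * r) by apply/ballP;apply:ys;exact:ballxx.
   have yz : `|y - z| < 9 * r.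
    rewrite -(subrKA o) (_ : 9 * r = 4 * (2 * r) + r);last by ring.
    by apply:(le_lt_trans (ler_normD _ _));exact:ltr_leD.
   have a90 : 0 < 9 * r by pos.
   have h9 := normv_sub_lt Bz yz a90.
   apply:(lt_le_trans _ t'd);apply:(lt_le_trans _ rb).
   rewrite -(subrKA y) addrC;apply:(le_lt_trans (normvD _ _)).
   rewrite [n%:R * (9 * r)]mulrCA in h9;apply:(ltrD h9).
   apply:(lt_le_trans xy);rewrite mulrAC (_ : 8 * (n%:R * r) = 4 * (2 * r) * n%:R);last by ring.
   exact:ler_wpM2r => //;exact:ltW.
  have h := LR w Hw _ a f D u dat eqn o (2 * r) (mball_int hv (10 * r) z) (mball_int hG (10 * r) z)
    (mball_int hu (10 * r) z) r20 BO HB (mb0 _ hv0) (mb0 _ hG0) (mb0 _ hu0) (up _ hvi hv0) (up _ hGi hG0) (up _ hui hu0).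
  have [mr _] := Lint_ball z r0.
  rewrite -lee_fin;apply:le_trans h;rewrite /mball_int -(integral_ig hvi mr).
  apply:(int_subset mu mr _ _ _ (ball_cube r0)).
  - exact:mcube.
  - exact:mEFin (Lint_meas hvi).
  - by move=> x;pos;exact:hv0.
 have T0 : 0 < (2 * r) ^+ n by pos.
 have e20 : (2 * (10 * r)) ^+ n = p10 * (2 * r) ^+ n by rewrite mulrCA exprMn.
 rewrite e20 in uv uG uu.
 apply:(step_real T0);apply:(le_trans lw).
 apply:(le_via (eps * ig (fun z => \1_B z * mball_int hv (10 * r) z) +
   (Ce * ig (fun z => \1_B z * mball_int hG (10 * r) z) +
   Ce * (2 * r) `^ (- q) * ig (fun z => \1_B z * mball_int hu (10 * r) z)))).
  refine (ig_le_comb (a := eps) (b := Ce) (c := Ce * (2 * r) `^ (- q)) l1 lv lG lu _) => z.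
  by apply:indic_step_real => /set_mem;exact:pt.
 have Ce' : 0 <= Ce * (2 * r) `^ (- q) by pos.
 apply:lerD;first by apply:ler_wpM2l;[exact:ltW|exact:uv].
 apply:lerD;first by apply:ler_wpM2l;[exact:ltW|exact:uG].
 by apply:ler_wpM2l;[exact:Ce'|exact:uu].
(* Radii increasing from [d] towards [2 d] with gaps [d / 2^(i+1)]. *)
pose ti (i : nat) := 2 * d - d / 2 ^+ i.
pose Psi := PG + d `^ (- q) * Pu.
have Psi0 : 0 <= Psi := addr_ge0 PG0 (mulr_ge0 (powR_ge0 _ _) Pu0).
have th0 : 0 <= eps * p10 by pos.
have thb : eps * p10 * be <= 2^-1 := (theta_real be0 p100).
have hF i : ph (ti i) <= ig hv.
 apply:ig_le;[exact:Lint_indic hvi (mE _)|exact:hvi|move=> x].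
 by rewrite indicE;case: (_ \in _);rewrite ?mulr1// mulr0.
have hstep i : ph (ti i) <= eps * p10 * ph (ti i.+1) + K * Psi * be ^+ i.
 pose r := d / (36 * n%:R * 2 ^+ i).
 have p2 : 0 < 2 ^+ i :> R by pos.
 have r0 : 0 < r by pos.
 have di : d / 2 ^+ i <= d by rewrite ler_pdivrMr// ler_peMr ?(ltW d0)// exprn_ege1// ler1n.
 have dSi : d / 2 ^+ i.+1 = d / 2 ^+ i / 2 by rewrite exprSr invfM mulrA.
 have dp : 0 < d / 2 ^+ i by pos.
 have h1 : d <= ti i by rewrite /ti;lra.
 have h2 : ti i < ti i.+1 by rewrite /ti dSi;lra.
 have h3 : ti i.+1 <= 2 * d by rewrite /ti dSi;lra.
 have h4 : ti i.+1 - ti i = 18 * n%:R * r.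
  rewrite /ti dSi (_ : 18 * n%:R * r = d / 2 ^+ i / 2);first by lra.
  by rewrite /r;field;rewrite !gt_eqF.
 apply:(le_trans (step _ _ _ h1 h2 h3 r0 h4));apply:lerD => //.
 have e2r : (2 * r) `^ (- q) = k18 * be ^+ i * d `^ (- q).
  have -> : 2 * r = d / (18 * n%:R * 2 ^+ i) by rewrite /r;field;rewrite !gt_eqF.
  rewrite powR_div ?mulr_ge0 ?(ltW p2) ?(ltW d0)//.
  rewrite [(_ * 2 ^+ i) `^ _]powRN invrK powRM ?(ltW p2)//.
  by rewrite powR_exprn// mulrC.
 rewrite /K -!mulrA;apply:ler_wpM2l;first exact:ltW.
 apply:ler_wpM2l;first exact:ltW.
 have kb1 : 1 <= k18 * be ^+ i by rewrite mulr_ege1// exprn_ege1.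
 by rewrite e2r;exact:psi_real kb1 PG0.
have H := absorb hF th0 be1 thb (mulr_ge0 (ltW K0) Psi0) hstep.
have e0 : ti 0%N = d by rewrite /ti expr0 divr1 mulr_natl mulr2n addrK.
by rewrite e0 mulrA in H;exact:H.
Qed.

End interior.

(** * Local integrability and vanishing against test functions *)

Section domain.
Hypothesis n0 : (0 < n)%N.

Lemma compactly_in_eball (D : set V) x0 (r s : R) : r < s -> eball x0 s `<=` D ->
 compactly_in (eball x0 r) D.
move=> rs sD;have clE : closure (eball x0 r) `<=` [set y | normv (y - x0) <= r].
 have cS : closed [set y : V | normv (y - x0) <= r].
  rewrite (_ : [set _ | _] = (fun y => normv (y - x0)) @^-1` [set t | t <= r])//.
  by apply:closed_comp;[move=> y _;exact:normv_continuous|exact:closed_le].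
 by rewrite [X in _ `<=` X]((closure_id _).1 cS);apply:closure_subset => y /ltW.
split;first exact:eball_open.
 have [_ cB _] := compactly_in_ball x0 r.
 apply:(subclosed_compact _ cB);first exact:closed_closure.
 by apply:closure_subset;exact:eball_sub_ball.
by move=> y /clE yr;apply:sD;exact:le_lt_trans rs.
Qed.

Lemma measurable_truncation (D O : set E) (h : V -> R) : measurable D -> measurable O -> O `<=` D ->
 lmeasurable D h -> mfun (fun x : E => h x * \1_O x).
move=> mD mO OD hm;have := (measurable_restrictT (h : E -> R) mO).1 (measurable_funS mD OD hm).
congr measurable_fun;apply/funext => x;rewrite patchE indicE.
by case: (_ \in _);rewrite ?mulr1// mulr0.
Qed.

(** Hoelder's inequality against the dual weight, which is integrable on the cube: this is how
    weighted [L^q] functions become integrable. *)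
Lemma weighted_Lint (q M : R) (w h : V -> R) o (r : R) : 1 < q -> cube_Aq q M w -> 0 < r ->
 mfun (h : E -> R) -> (forall x, ~ cube o r x -> h x = 0) ->
 Lint (fun x => `|h x| `^ q * w x) -> Lint h.
move=> q1 [Ww Wd _] r0 mh h0 hi;have q0 : 0 < q by exact:lt_trans q1.
have [mw w0 _] := Ww;have [md d0 _] := Wd.
have mQ : measurable (cube o r : set E) by exact:mcube.
pose f x := `|h x| * w x `^ q^-1;pose g x := w x `^ (- q^-1).
have mah : mfun (fun x : E => `|h x|) by exact:mT_comp.
have mf : mfun (f : E -> R).
 exact:(mfunM mah (mpowR q^-1 mw)).
have mg : mfun (g : E -> R) by exact:mpowR.
have fq x : f x `^ q = `|h x| `^ q * w x.
 by rewrite powRM ?powR_ge0// powRVK// ?ltW// gt_eqF.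
have p1 : 0 < q - 1 by rewrite subr_gt0.
have p0 : 0 < q / (q - 1) by rewrite divr_gt0.
have gq x : g x `^ (q / (q - 1)) = dualw q w x.
 by rewrite -powRrM /dualw mulNr mulrA mulVf ?mul1r// gt_eqF.
have fg x : f x * g x = `|h x|.
 rewrite -mulrA -powRD ?subrr ?powRr0 ?mulr1//.
 by apply/implyP => _;rewrite gt_eqF.
have pq : q^-1 + (q / (q - 1))^-1 = 1.
 by rewrite invf_div;field;rewrite gt_eqF.
have f0 x : 0 <= f x by pos.
have g0 x : 0 <= g x by pos.
have A0 : 0 <= ig (fun x => `|h x| `^ q * w x).
 by apply:ig_ge0 => x;rewrite mulr_ge0 ?powR_ge0// ltW.
have h1 : (\I_(x in cube o r) (f x `^ q) <= (ig (fun x => `|h x| `^ q * w x))%:E)%E.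
 under eq_integral do rewrite fq.
 rewrite -(ig_EFin hi);apply:(int_subset mu mQ measurableT _ _ (@subsetT _ _)).
  exact:mEFin (Lint_meas hi).
 by move=> x;pos.
have h2 : (\I_(x in cube o r) (g x `^ (q / (q - 1))) <= (wint (dualw q w) (cube o r))%:E)%E.
 under eq_integral do rewrite gq.
 by rewrite (wint_fin Wd r0 mQ sub_id).
have B0 : 0 <= wint (dualw q w) (cube o r) by exact:wint_ge0.
have H := hoelder_bound mQ mf mg f0 g0 q0 p0 pq A0 B0 h1 h2.
suff Lah : Lint (fun x => `|h x|) by refine (Lint_dom mh _ Lah) => x;exact:lexx.
apply:(Lint_lty mah);first by move=> x;exact:normr_ge0.
apply:(@le_lt_trans _ _ (\I_(x in cube o r) (f x * g x))%E);last first.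
 by apply:(le_lt_trans H);exact:ltry.
rewrite [leRHS]integral_mkcond le_eqVlt;apply/orP;left;apply/eqP;apply:eq_integral => x _.
rewrite patchE fg;case: ifPn => // /negP xQ;rewrite h0 ?normr0// => Qx.
by apply:xQ;exact:mem_set.
Qed.

(** Tested with small bumps centred at points of [A], the convolution of [G] vanishes on [A], while
    in [L^1] it is close to the mass of the bump times [G]. The kernels [P e] of the identity matrix
    serve as bumps, their masses being bounded below. *)
Lemma ae_zero_of_tests (O : set V) (G : V -> R) (N s : R) (A : set E) : 0 < N -> Lint G ->
 (forall x, N <= `|x| -> G x = 0) -> measurable A -> 0 < s ->
 (forall x y : V, A x -> `|x - y| <= s -> O y) ->
 (forall phi (z : V) (r : R), smooth phi -> (forall x : V, r < `|x - z| -> phi x = 0) ->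
   (forall x : V, `|x - z| <= r -> O x) -> ig (fun x => G x * phi x) = 0) ->
 {ae mu, forall x : V, A x -> G x = 0}.
move=> N0 Gi GN mA s0 AO test.
have [_ _ gd] := Lint_good N0 Gi GN.
have [S [CW [m0 [CP [S0 _ m00 _ ker]]]]] := kernels_exist n0 ltr01 (lexx (1 : R)).
have ell : elliptic 1 1 (1%:M : 'M[R]_n).
 split=> [i j|x];first by rewrite !mxE eq_sym.
 have rx : \row_i lin 1%:M i x = x by apply/rowP => i;rewrite mxE lin1.
 by rewrite qform_dotv rx !mul1r lexx.
have [W [P HP]] := ker _ ell.
have aGi := Lint_indic (Lint_abs Gi) mA.
have small eta : 0 < eta -> ig (fun x => `|G x| * \1_A x) <= eta.
 move=> e0;have [rho rho0 Hr] := gd eta e0.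
 pose e := Num.min rho s / S;have e0' : 0 < e by rewrite divr_gt0// lt_min rho0.
 have Se : S * e = Num.min rho s by rewrite mulrC divfK// gt_eqF.
 have [_ _ [bp mP] _ _] := HP e e0'.
 rewrite Se in bp;have [sP cP P0 Pe Pr] := bp.
 have bp' : bump rho (P e).
  by split=> // x xr;apply:Pr;rewrite (le_lt_trans _ xr)// ge_min lexx.
 have := Hr _ bp';set k := P e in sP cP P0 Pe Pr bp' mP *;move=> Hk.
 have ik0 : 0 < ig k by exact:lt_le_trans mP.
 rewrite -(ler_pM2r ik0);apply:le_trans Hk;rewrite mulrC.
 have csG : csupp G by exists N => // x /ltW;exact:GN.
 have [Lg _] := conv_gap_le bp' Gi csG.
 have -> : ig k * ig (fun x => `|G x| * \1_A x) = ig (fun x => ig k * (`|G x| * \1_A x)) by rewrite igZ.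
 apply:ig_le;[exact:LintZ aGi|exact:Lint_abs Lg|move=> x].
 rewrite indicE;have [/set_mem Ax|_] := boolP (x \in A);last by rewrite !mulr0.
 have -> : conv k G x = 0.
  apply:(test (fun y => k (x - y)) x (Num.min rho s)).
  - exact:smooth_reflect.
  - by move=> y;rewrite distrC;exact:Pr.
  - by move=> y;rewrite distrC le_min => /andP[_];exact:AO.
 by rewrite sub0r normrN normrM mulr1 gtr0_norm.
have z0 : ig (fun x => `|G x| * \1_A x) = 0.
 apply/eqP;rewrite eq_le;apply/andP;split;last by apply:ig_ge0 => x;rewrite mulr_ge0// indicE.
 by apply/ler_addgt0Pr => eta /small;rewrite add0r.
have mG : mfun (fun x : E => (G x * \1_A x)%:E).
 exact:mEFin (Lint_meas (Lint_indic Gi mA)).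
have := (ae_eq_integral_abs mu measurableT mG).1.
have -> : (\int[mu]_x `|(G x * \1_A x)%:E| = 0)%E.
 apply:(etrans _ (f_equal EFin z0));rewrite -(ig_EFin aGi).
 apply:eq_integral => x _ /=;congr _%:E;rewrite normrM indicE.
 by rewrite [X in _ * X]ger0_norm.
move=> /(_ erefl);apply:ae_imp => x /(_ I) [] + Ax.
by rewrite indicE mem_set// mulr1.
Qed.

End domain.

(** * Mean oscillation of the coefficients *)

Section oscillation.
Hypothesis n0 : (0 < n)%N.

Lemma dotv_mulv (A : 'M[R]_n) (x y : V) :
 dotv (mulv A x) y = \sum_j (\sum_i A j i * x 0 i) * y 0 j.
apply:eq_bigr => j _;congr (_ * _);rewrite /mulv mxE.
by apply:eq_bigr => i _;rewrite mxE mulrC.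
Qed.

Lemma elliptic_pointwise (lam Lam : R) (D : set V) (A : V -> 'M[R]_n) x :
 elliptic_coefficients lam Lam D A -> D x -> elliptic lam Lam (A x).
move=> [_ sym ell] Dx;split=> [i j|xi].
 by rewrite -[in LHS](sym x Dx) mxE.
rewrite (_ : qform (A x) xi = dotv (mulv (A x) xi) xi).
 by rewrite -sqr_normv;exact:ell.
by rewrite dotv_mulv;apply:eq_bigr => j _;rewrite mulrC.
Qed.

Lemma entry_le_frobenius (A : 'M[R]_n) i j : `|A i j| <= frobenius A.
rewrite -sqrtr_sqr;apply:ler_wsqrtr.
rewrite (bigD1 i)//= (bigD1 j)//= -addrA lerDl addr_ge0// sumr_ge0// => k _.
 exact:sqr_ge0.
by apply:sumr_ge0 => l _;exact:sqr_ge0.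
Qed.

Lemma measurable_sumE m (F : 'I_m -> E -> R) : (forall i, mfun (F i)) ->
 mfun (fun x => \sum_i F i x).
by move=> h;apply:measurable_sum. Qed.

Lemma measurable_frobenius (a : 'I_n -> 'I_n -> V -> R) (B : 'M[R]_n) :
 (forall i j, mfun (a i j : E -> R)) ->
 mfun (fun x : E => frobenius ((\matrix_(i, j) a i j x) - B)).
move=> ma;rewrite (_ : (fun x => _) =
 (fun x : E => (\sum_i \sum_j (a i j x - B i j) ^+ 2) `^ 2^-1));last first.
 apply/funext => x;rewrite powR12_sqrt;last first.
  by apply:sumr_ge0 => i _;apply:sumr_ge0 => j _;exact:sqr_ge0.
 by congr Num.sqrt;apply:eq_bigr => i _;apply:eq_bigr => j _;rewrite !mxE.
apply:mpowR;apply:measurable_sumE => i;apply:measurable_sumE => j.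
apply:measurable_funX;exact:(measurable_funB (ma i j) (measurable_cst _)).
Qed.

Lemma measurable_oscillation (a : 'I_n -> 'I_n -> V -> R) (B : 'M[R]_n) :
 (forall i j, mfun (a i j : E -> R)) ->
 mfun (fun x : E => \sum_j \sum_i `|B j i - a j i x|).
move=> ma;apply:measurable_sumE => j;apply:measurable_sumE => i.
exact:(mT_comp (@normr_measurable R setT) (measurable_funB (measurable_cst (B j i)) (ma j i))).
Qed.

Lemma elliptic_average (lam Lam b : R) (D : set V) (B : set E) (A : V -> 'M[R]_n) : 0 < lam ->
 elliptic_coefficients lam Lam D A -> measurable (D : set E) -> measurable B -> B `<=` D ->
 mu B = b%:E -> 0 < b -> elliptic lam Lam (mx_average B A).
move=> lam0 EA mD mB BD mb b0;have [mA _ _] := EA.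
have [Bi Be] : Lint (\1_B : E -> R) /\ ig (\1_B : E -> R) = b.
 have Bf : (mu B < +oo)%E by rewrite mb;exact:ltry.
 by have [Bi Be] := Lint_indic_lty mB Bf;split=> //;exact:(etrans Be (f_equal fine mb)).
pose a i j x := A x i j * \1_B x.
have ai i j : Lint (a i j).
 apply:(Lint_dom (measurable_truncation mD mB BD (mA i j)) _ (LintZ Lam Bi)) => x.
 rewrite indicE;have [/set_mem Bx|_] := boolP (x \in B);last by rewrite !mulr0 normr0.
 by rewrite !mulr1;exact:(elliptic_entry lam0 (elliptic_pointwise EA (BD x Bx))).
have avE i j : mx_average B A i j = ig (a i j) / b.
 rewrite mxE mb /=;congr (_ / _);apply:Rintegral_ig => x Bx.
  by rewrite /a indicE mem_set// mulr1.
 by rewrite /a indicE memNset// mulr0.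
split=> [i j|xi].
 rewrite !avE;congr (ig _ / _);apply/funext => x;rewrite /a indicE.
 have [/set_mem Bx|_] := boolP (x \in B);last by rewrite !mulr0.
 by have [-> _] := elliptic_pointwise EA (BD x Bx).
pose c i j := xi 0 i * xi 0 j.
have qE : qform (mx_average B A) xi = ig (fun x => \sum_i \sum_j c i j * a i j x) / b.
 rewrite qform_eq ig_sum2;last by move=> i j;exact:LintZ.
 rewrite mulr_suml;apply:eq_bigr => i _;rewrite mulr_suml;apply:eq_bigr => j _.
 by rewrite avE (igZ _ (ai i j)) mulrC mulrA.
have pt x : \sum_i \sum_j c i j * a i j x = qform (A x) xi * \1_B x.
 rewrite qform_eq mulr_suml;apply:eq_bigr => i _;rewrite mulr_suml;apply:eq_bigr => j _.
 by rewrite /a mulrA [c i j * _]mulrC.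
have Li : Lint (fun x => \sum_i \sum_j c i j * a i j x).
 by apply:Lint_sum => i;apply:Lint_sum => j;exact:LintZ.
have bnd x (k : R) : (B x -> lam * dotv xi xi <= qform (A x) xi <= Lam * dotv xi xi).
 by move=> /BD Dx;have [_] := elliptic_pointwise EA Dx;exact.
rewrite qE ler_pdivlMr// ler_pdivrMr// -Be -(igZ _ Bi) -(igZ _ Bi);apply/andP;split.
 apply:(ig_le (LintZ _ Bi) Li) => x;rewrite pt indicE.
 have [/set_mem Bx|_] := boolP (x \in B);last by rewrite !mulr0.
 by rewrite !mulr1;have /andP[] := bnd x 0 Bx.
apply:(ig_le Li (LintZ _ Bi)) => x;rewrite pt indicE.
have [/set_mem Bx|_] := boolP (x \in B);last by rewrite !mulr0.
by rewrite !mulr1;have /andP[] := bnd x 0 Bx.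
Qed.

Lemma BMO_oscillation (lam Lam K delta : R) (D : set V) (A : V -> 'M[R]_n) : 0 < lam ->
 elliptic_coefficients lam Lam D A -> open D -> is_BMO D delta K A ->
 forall z (rho : R), 0 < rho < K -> eball z rho `<=` D ->
 exists2 B, elliptic lam Lam B &
 forall (a : 'I_n -> 'I_n -> V -> R) (S : set E), measurable S -> S `<=` eball z rho ->
  (forall i j, mfun (a i j : E -> R)) ->
  (forall i j x, eball z rho x -> a i j x = A x i j) ->
  ig (fun x => (\sum_j \sum_i `|B j i - a j i x|) * \1_S x) <=
   n%:R ^+ 2 * (delta * (2 * rho) ^+ n).
move=> lam0 EA oD bmo z rho /andP[rho0 rhoK] BD;have mD := open_meas oD.
have mB : measurable (eball z rho : set E) by exact:meball.
have [b [mb b0 bl]] := lebesgue_eball n0 z rho0.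
exists (mx_average (eball z rho) A).
 exact:(elliptic_average lam0 EA mD mB BD mb b0).
move=> a S mS SB ma aA;set B := mx_average _ _.
have zB : eball z rho z by rewrite /eball /= subrr -[X in normv X](scale0r 0) /normv dotvZl mul0r sqrtr0.
pose h x := frobenius ((\matrix_(i, j) a i j x) - B).
have mh : mfun (h : E -> R) by exact:measurable_frobenius.
have h0 x : 0 <= h x by exact:sqrtr_ge0.
have av : (\I_(x in eball z rho) h x <= (delta * b)%:E)%E.
 have : (average (eball z rho `&` D) (fun y => (frobenius (A y - mx_average (eball z rho `&` D) A))%:E) < delta%:E)%E.
  apply:le_lt_trans bmo;apply:ereal_sup_ubound;exists (z, rho) => //=;split;last by apply/andP.
  by apply:subset_closure;exact:BD.
 rewrite (setIidl BD) /average mb.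
 have -> : (\I_(y in eball z rho) (frobenius (A y - mx_average (eball z rho) A)) =
  \I_(x in eball z rho) h x)%E.
  apply:eq_integral => x /set_mem xB;congr (frobenius (_ - _))%:E.
  by apply/matrixP => i j;rewrite mxE aA.
 by rewrite inver gt_eqF// lte_pdivrMr// => /ltW;rewrite EFinM.
pose g x := (\sum_j \sum_i `|B j i - a j i x|) * \1_S x.
have mg : mfun (g : E -> R).
 exact:(mfunM (measurable_oscillation B ma) (measurable_indic mS)).
have g0 x : 0 <= g x.
 rewrite mulr_ge0 ?indicE//;apply:sumr_ge0 => i _;apply:sumr_ge0 => j _;exact:normr_ge0.
have n20 : 0 <= n%:R ^+ 2 :> R by pos.
have gh x : g x <= n%:R ^+ 2 * h x * \1_(eball z rho) x.
 rewrite /g !indicE;have [/set_mem xS|_] := boolP (x \in S);last first.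
  by rewrite mulr0;apply:mulr_ge0 => //;exact:mulr_ge0.
 rewrite mem_set ?mulr1;last exact:SB.
 apply:(le_via (\sum_(j < n) \sum_(i < n) h x)).
  apply:ler_sum => j _;apply:ler_sum => i _;rewrite distrC.
  by have := entry_le_frobenius ((\matrix_(i, j) a i j x) - B) j i;rewrite !mxE.
 rewrite sum_ord2_const;exact:lexx.
have [] // : Lint g /\ ig g <= n%:R ^+ 2 * (delta * (2 * rho) ^+ n).
apply:ig_lty => //.
apply:(le_via (\I_(x in eball z rho) (n%:R ^+ 2 * h x))%E).
 rewrite -(int_indic (fun x => n%:R ^+ 2 * h x)).
 have mn : mfun (fun x : E => n%:R ^+ 2 * h x * \1_(eball z rho) x).
  exact:(mfunM (mfunM (measurable_cst _) mh) (measurable_indic mB)).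
 apply:(int_le mu measurableT (mEFin mg) (mEFin mn)).
  by move=> x;pos.
 by move=> x _;pos.
rewrite (integralZ_real mu mB mh h0 n20) [leRHS](EFinM (n%:R ^+ 2));apply:lee_wpmul2l;first pos.
apply:(le_trans av);rewrite lee_fin;apply:ler_wpM2l => //.
have := le_trans (int_ge0T mu (eball z rho) (fun x => ltac:(by pos;exact:h0) : (0 <= (h x)%:E)%E)) av.
by rewrite lee_fin pmulr_lge0.
Qed.

End oscillation.

(** * Truncation to a ball *)

Section truncation.
Hypothesis n0 : (0 < n)%N.

Lemma L1loc_Lint (D O : set V) (h : V -> R) : open D -> compactly_in O D -> L1loc D h ->
 Lint (fun x => h x * \1_(O : set E) x).
move=> oD cO [mh /(_ _ cO) fin];have [oO _ cl] := cO.
have mO := open_meas oO.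
have OD := subset_trans (@subset_closure _ O) cl.
have mhO := measurable_truncation (open_meas oD) mO OD mh.
have mah := mT_comp (@normr_measurable R setT) mhO.
suff La : Lint (fun x => `|h x * \1_(O) x|) by refine (Lint_dom mhO _ La) => x;exact:lexx.
apply:(Lint_lty mah) => [x|];first exact:normr_ge0.
apply:le_lt_trans fin;rewrite -(int_indic (fun x => `|h x|) O).
apply:le_of_eq;apply:eq_integral => x _ /=;congr _%:E.
by rewrite normrM indicE;congr (_ * _);rewrite ger0_norm.
Qed.

(** The cut-off turns local data into functions integrable on the whole space, as convolutions need.
    No derivative falls on the indicator, because test functions are supported inside [O]. *)
Definition trunc (O : set V) (h : V -> V) (i : 'I_n) (x : V) : R := h x 0 i * \1_(O : set E) x.

Lemma vnorm_trunc (O : set V) (h : V -> V) (q : R) x : 0 < q ->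
 vnorm (trunc O h) x `^ q = normv (h x) `^ q * \1_(O : set E) x.
move=> q0;rewrite indicE;have [/set_mem xO|xO] := boolP (x \in (O)).
 rewrite mulr1;congr (normv _ `^ q);apply/rowP => i.
 by rewrite mxE /trunc indicE mem_set// mulr1.
rewrite mulr0 /vnorm (_ : \row_k _ = 0 *: 0);last first.
 by apply/rowP => i;rewrite !mxE /trunc indicE (negbTE xO) !mulr0.
by rewrite /normv dotvZl mul0r sqrtr0 powR0// gt_eqF.
Qed.

Lemma weight_change (O : set V) (B : set E) (h w w' : V -> R) : measurable (O : set E) -> measurable B ->
 B `<=` O -> mfun (fun x : E => h x * \1_(O : set E) x) ->
 mfun (w : E -> R) -> mfun (w' : E -> R) ->
 {ae mu, forall x : V, w x = w' x} ->
 (\I_(x in B) (h x * w x) = \I_(x in B) (h x * \1_(O : set E) x * w' x))%E.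
move=> mO mB BO mh mw mw' ww.
transitivity (\I_(x in B) (h x * \1_(O) x * w x))%E.
 by apply:eq_integral => x /set_mem/BO xO;rewrite indicE mem_set// mulr1.
apply:(ae_integral_eq mB).
- exact:mEFin (mfunM mh mw).
- exact:mEFin (mfunM mh mw').
- by apply:ae_imp ww => x ->.
Qed.

Lemma weight_change_Lint (O : set V) (h w w' : V -> R) : measurable (O : set E) ->
 mfun (fun x : E => h x * \1_(O : set E) x) ->
 mfun (w : E -> R) -> mfun (w' : E -> R) ->
 {ae mu, forall x : V, w x = w' x} -> ge0 h -> (forall x, 0 <= w' x) ->
 (\I_(x in O) (h x * w x) < +oo)%E ->
 Lint (fun x => h x * \1_(O : set E) x * w' x).
move=> mO mh mw mw' ww h0 w0;rewrite (weight_change mO mO sub_id mh mw mw' ww) => fin.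
apply:(Lint_lty (mfunM mh mw')) => [x|].
 by apply:mulr_ge0 (w0 x);apply:mulr_ge0 => //;rewrite indicE.
apply:le_lt_trans fin;rewrite -(int_indic (fun x => h x * \1_(O) x * w' x) O).
apply:le_of_eq;apply:eq_integral => x _;congr _%:E.
by rewrite /= indicE;case: (_ \in _);rewrite ?mulr1// !mulr0 mul0r.
Qed.

Lemma support_out (O : set V) phi (z : V) (r : R) : (forall x : V, r < `|x - z| -> phi x = 0) ->
 (forall x : V, `|x - z| <= r -> O x) -> forall x, ~ O x -> phi x = 0 /\ forall i, partial i phi x = 0.
move=> pr rO x xO;have xr : r < `|x - z| by rewrite ltNge;apply/negP => /rO.
by split=> [|i];[exact:pr|exact:partial_out pr _ xr].
Qed.

Lemma csupp_ball phi (z : V) (r : R) : (forall x : V, r < `|x - z| -> phi x = 0) -> csupp phi.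
move=> pr;exists (`|z| + `|r| + 1);first pos.
move=> x h;apply:pr;have h1 := ler_norm r;have h2 := lerB_dist x z.
by lra.
Qed.

Lemma weak_gradient_local (D O : set V) (u : V -> R) (G : V -> V) phi (z : V) (r : R) :
 O `<=` D -> weak_gradient D u G -> smooth phi ->
 (forall x : V, r < `|x - z| -> phi x = 0) -> (forall x : V, `|x - z| <= r -> O x) -> forall i,
 ig (fun x => u x * \1_(O : set E) x * partial i phi x) = - ig (fun x => trunc O G i x * phi x).
move=> OD [_ _ eqn] sphi pr rO i;have out := support_out pr rO.
have td : test_function D phi by apply:(smooth_test_function sphi pr) => x /rO;exact:OD.
have ind (k : V -> R) x : k x = k x * \1_(O) x \/ ~ O x.
 rewrite indicE;have [/set_mem xO|xO] := boolP (x \in (O));first by left;rewrite mulr1.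
 by right => Ox;move/negP: xO;apply;exact:mem_set.
have := eqn phi td i;congr (_ = - _);apply:Rintegral_ig => x Dx.
- by have [<-//|/out[_ ->]] := ind u x;rewrite !mulr0.
- by have [_ ->] := out x (fun Ox => Dx (OD x Ox));rewrite mulr0.
- by rewrite /trunc;have [<-//|/out[-> _]] := ind (fun x => G x 0 i) x;rewrite !mulr0.
- by have [-> _] := out x (fun Ox => Dx (OD x Ox));rewrite mulr0.
Qed.

Lemma Lint_test (g : V -> R) phi : Lint g -> smooth phi -> csupp phi -> Lint (fun x => g x * phi x).
move=> gi sphi cphi;have [M hM] := csupp_bounded (smooth_cont sphi) cphi.
exact:(Lint_mulb gi (cont_meas (smooth_cont sphi)) hM).
Qed.

(** [W1qw_loc] provides some weak gradient with finite weighted norm on the ball, not the given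
    [Du]; the two are identified so that the norm of [Du] is known to be finite. *)
Lemma weak_gradient_unique x0 (s : R) (D : set V) (u : V -> R) (G H : V -> V) : 0 < s ->
 eball x0 s `<=` D ->
 weak_gradient D u G -> weak_gradient (eball x0 s) u H ->
 (forall i, Lint (trunc (eball x0 s) G i)) -> (forall i, Lint (trunc (eball x0 s) H i)) ->
 forall i, {ae mu, forall x : V, trunc (eball x0 s) G i x = trunc (eball x0 s) H i x}.
move=> s0 OD wG wH LG LH i;set O := eball x0 s in OD wH LG LH *.
pose F x := trunc O G i x - trunc O H i x.
have LF : Lint F by exact:LintB.
have Fout x : ~ O x -> F x = 0.
 by move=> xO;rewrite /F /trunc indicE memNset// !mulr0 subr0.
pose N := `|x0| + s.
have N0 : 0 < N by pos.
have FN (x : V) : N <= `|x| -> F x = 0.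
 move=> xN;apply:Fout => /eball_sub_ball/ballP xs;have h := lerB_dist x x0.
 by rewrite /N in xN;lra.
(* Points of [Ak k] keep sup-norm distance at least [1/(k+1)] from the complement of [O], the factor
   [n] converting the norms; these sets exhaust [O]. *)
pose Ak (k : nat) : set E := eball x0 (s - n%:R * k.+1%:R^-1).
have hk k : {ae mu, forall x : V, Ak k x -> F x = 0}.
 apply:(ae_zero_of_tests n0 (O := O) N0 LF FN (s := k.+1%:R^-1)) => //.
 - exact:meball.
 - move=> x y xA xy;rewrite /O /eball /= -(subrKA x);apply:(le_lt_trans (normvD _ _)).
  have h1 := normv_le_norm (y - x);rewrite distrC in xy.
  have h2 : n%:R * `|y - x| <= n%:R * k.+1%:R^-1 by apply:ler_wpM2l.
  apply:(le_lt_trans (lerD (le_trans h1 h2) (lexx _))).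
  by rewrite addrC -ltrBrDr.
 - move=> phi z r sphi pr rO;have cphi := csupp_ball pr.
  have e1 := weak_gradient_local OD wG sphi pr rO i.
  have e2 := weak_gradient_local (@subset_refl _ O) wH sphi pr rO i.
  have -> : (fun x : E => F x * phi x) = (fun x => trunc O G i x * phi x - trunc O H i x * phi x).
   by apply/funext => x;rewrite mulrBl.
  rewrite (igB (Lint_test (LG i) sphi cphi) (Lint_test (LH i) sphi cphi)).
  by apply/eqP;rewrite subr_eq0 -eqr_opp -e1 -e2.
apply:ae_imp (ae_foralln hk) => x h;apply/eqP;rewrite -subr_eq0;apply/eqP.
have [xO|xO] := pselect (O x);last exact:Fout.
have nR : 0 < n%:R :> R by pos.
have gap : normv (x - x0) / n%:R < s / n%:R by rewrite ltr_pM2r ?invr_gt0.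
have [k kp] := ltr_add_invr gap;apply:(h k);rewrite /Ak /eball /= ltrBrDr.
by rewrite -(ltr_pM2r (_ : 0 < n%:R^-1)) ?invr_gt0// mulrDl mulrAC divff ?gt_eqF// mul1r.
Qed.

Lemma truncated_problem (lam Lam : R) (D O : set V) (A : V -> 'M[R]_n) (f : V -> V) (u : V -> R)
  (Du : V -> V) : 0 < lam -> lam <= Lam -> open D -> compactly_in O D ->
 elliptic_coefficients lam Lam D A -> weak_gradient D u Du -> weak_solution D A f Du ->
 (forall i, Lint (trunc O f i)) ->
 let a i j x := A x i j * \1_(O : set E) x in
 let U x := u x * \1_(O : set E) x in
 local_data Lam a (trunc O f) (trunc O Du) U /\ local_eq O a (trunc O f) (trunc O Du) U.
move=> lam0 lL oD cO EA wg ws Lf a U;have [oO _ cl] := cO.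
have mO := open_meas oO.
have OD := subset_trans (@subset_closure _ O) cl.
have [mA _ _] := EA;have [Lu LDu _] := wg.
have ma i j : mfun (a i j : E -> R).
 exact:measurable_truncation (open_meas oD) mO OD (mA i j).
have aL i j x : `|a i j x| <= Lam.
 rewrite /a indicE;have [/set_mem xO|_] := boolP (x \in (O));last first.
  by rewrite mulr0 normr0;exact:le_trans (ltW lam0) lL.
 by rewrite mulr1;exact:(elliptic_entry lam0 (elliptic_pointwise EA (OD x xO))).
have LD i := L1loc_Lint oD cO (LDu i).
have LU := L1loc_Lint oD cO Lu.
split;first by split.
move=> phi z r sphi pr rO;have cphi := csupp_ball pr;have out := support_out pr rO;split;last first.
 by move=> i;exact:weak_gradient_local OD wg sphi pr rO i.
pose F j x := \sum_i a j i x * trunc O Du i x.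
have LF j : Lint (F j).
 apply:Lint_sum => i;have := Lint_mulb (LD i) (ma j i) (aL j i).
 by congr Lint;apply/funext => x;rewrite mulrC.
have sp j : smooth (partial j phi) by exact:smooth_partial.
have cp j : csupp (partial j phi) by exact:csupp_partial.
have L1 j := Lint_test (LF j) (sp j) (cp j);have L2 j := Lint_test (Lf j) (sp j) (cp j).
have e j : ig (fun x => (F j x - trunc O f j x) * partial j phi x) =
  ig (fun x => F j x * partial j phi x) - ig (fun x => trunc O f j x * partial j phi x).
 rewrite -(igB (L1 j) (L2 j));congr ig;apply/funext => x;exact:mulrBl.
have td : test_function D phi by apply:(smooth_test_function sphi pr) => x /rO;exact:OD.
have E1 : \int[mu]_(x in D) dotv (mulv (A x) (Du x)) (gradient phi x) =
  ig (fun x => \sum_j F j x * partial j phi x).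
 apply:Rintegral_ig;last first.
 - move=> x xD;apply:big1 => j _;have [_ ->] := out x (fun Ox => xD (OD x Ox)).
  exact:mulr0.
 - move=> x _;rewrite dotv_mulv;apply:eq_bigr => j _;rewrite mxE.
  have [xO|/out[_ ->]] := pselect (O x);last by rewrite !mulr0.
  congr (_ * _);apply:eq_bigr => i _;rewrite /a /trunc indicE mem_set//.
  by rewrite !mulr1.
have E2 : \int[mu]_(x in D) dotv (f x) (gradient phi x) =
  ig (fun x => \sum_j trunc O f j x * partial j phi x).
 apply:Rintegral_ig;last first.
 - move=> x xD;apply:big1 => j _;have [_ ->] := out x (fun Ox => xD (OD x Ox)).
  exact:mulr0.
 - move=> x _;apply:eq_bigr => j _;rewrite mxE.
  have [xO|/out[_ ->]] := pselect (O x);last by rewrite !mulr0.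
  by rewrite /trunc indicE mem_set// mulr1.
have := ws phi td;rewrite E1 E2 => E3;under eq_bigr do rewrite e;rewrite sumrB -(ig_sum L1) -(ig_sum L2).
by apply/eqP;rewrite subr_eq0;apply/eqP.
Qed.

End truncation.

(** * The estimate for weights of cube type *)

Section estimate.
Hypothesis n0 : (0 < n)%N.

Lemma measurable_trunc (O : set V) (G : V -> V) : measurable (O : set E) ->
 (forall i, lmeasurable O (fun x => G x 0 i)) -> forall i, mfun (trunc O G i : E -> R).
by move=> mO mG i;exact:(measurable_truncation mO mO (@subset_refl _ O) (mG i)). Qed.

Lemma measurable_trunc_norm (O : set V) (G : V -> V) (q : R) : 0 < q -> measurable (O : set E) ->
 (forall i, lmeasurable O (fun x => G x 0 i)) ->
 mfun (fun x : E => normv (G x) `^ q * \1_(O : set E) x).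
move=> q0 mO mG;under eq_fun do rewrite -(vnorm_trunc O G _ q0).
by apply:mpowR;apply:mvnorm;exact:measurable_trunc.
Qed.

Lemma trunc_Lint (q M : R) (w w' : V -> R) x0 (s : R) (G : V -> V) : 1 < q -> cube_Aq q M w' ->
 mfun (w : E -> R) -> {ae mu, forall x : V, w x = w' x} -> 0 < s ->
 Lqw_vec q w (eball x0 s) G ->
 Lint (fun x => vnorm (trunc (eball x0 s) G) x `^ q * w' x) /\
 forall i, Lint (trunc (eball x0 s) G i).
move=> q1 Hw mw ww s0 [mG fG];have q0 : 0 < q by exact:lt_trans q1.
have [[mw' w'0 _] _ _] := Hw.
have mO : measurable (eball x0 s : set E) by exact:meball.
have mN := measurable_trunc_norm q0 mO mG.
have LN : Lint (fun x => vnorm (trunc (eball x0 s) G) x `^ q * w' x).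
 have := weight_change_Lint mO mN mw mw' ww (fun x => powR_ge0 _ _) (fun x => ltW (w'0 x)) fG.
 by congr Lint;apply/funext => x;rewrite (vnorm_trunc _ _ _ q0).
split=> // i;have mi := measurable_trunc mO mG i.
apply:(weighted_Lint (o := shiftc x0 (- s)) (r := 2 * s) q1 Hw _ mi).
- by pos.
- move=> x xQ;rewrite /trunc indicE memNset ?mulr0// => xO;apply:xQ.
 exact/(ball_cube s0)/eball_sub_ball.
have mia : mfun (fun x : E => `|trunc (eball x0 s) G i x| `^ q * w' x).
 exact:(mfunM (mpowR q (mT_comp (@normr_measurable R setT) mi)) mw').
refine (Lint_dom mia _ LN) => x;rewrite ger0_norm;last pos.
apply:ler_wpM2r;first exact:ltW.
by apply:ler_powRl;[exact:ltW|exact:normr_ge0|exact:coord_le_vnorm].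
Qed.

Lemma ae_forall_ord (P : 'I_n -> V -> Prop) : (forall i, {ae mu, forall x : V, P i x}) ->
 {ae mu, forall x : V, forall i, P i x}.
move=> h;apply:(ae_imp (P := fun x => forall k (i : 'I_n), i = k :> nat -> P i x)).
 by move=> x hx i;exact:hx.
apply:ae_foralln => k;have [kn|kn] := ltnP k n.
 by apply:ae_imp (h (Ordinal kn)) => x hx i ik;rewrite (_ : i = Ordinal kn)//;exact:val_inj.
apply:ae_imp (h (Ordinal n0)) => x _ i ik.
by have := ltn_ord i;rewrite ik ltnNge kn.
Qed.

(** The factor [2 n + 1] exceeds 2, so the ball of radius [2 d] is compactly contained in [Omega];
    and [3 n r < (2 n + 1) d] whenever [3 r <= 2 d], so the oscillation is only taken at radii below
    [K]. *)
Lemma estimate_of_weight (lam Lam q M : R) : 0 < lam -> lam <= Lam -> 1 < q -> 1 <= M ->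
 exists delta0 C : R, [/\ 0 < delta0, 0 < C & forall (Omega : set V) (K delta : R) (w w' : V -> R)
  (A : V -> 'M[R]_n) (f Du : V -> V) (u : V -> R) (d : R) x0,
 open Omega -> mfun (w : E -> R) -> {ae mu, forall x : V, w x = w' x} ->
 cube_Aq q M w' -> elliptic_coefficients lam Lam Omega A ->
 Lqw_vec_loc q w Omega f -> W1qw_loc q w Omega u -> weak_gradient Omega u Du ->
 weak_solution Omega A f Du -> delta <= delta0 -> is_BMO Omega delta K A ->
 0 < d -> (2 * n%:R + 1) * d <= K -> eball x0 ((2 * n%:R + 1) * d) `<=` Omega ->
 (\I_(x in eball x0 d) (normv (Du x) `^ q * w x)
   <= C%:E * \I_(x in eball x0 (2 * d))
         ((normv (f x) `^ q + `|u x / d| `^ q) * w x))%E].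
move=> lam0 lL q1 M1;have q0 : 0 < q by exact:lt_trans q1.
have [al [C [al0 C0 IE]]] := interior_estimate n0 lam0 lL q1 M1.
have nR : 0 < n%:R :> R by pos.
have n1 : 1 <= n%:R :> R by rewrite ler1n.
(* With this bound on [delta], the oscillation [n^2 delta (6 n r)^n] coming from the Euclidean
   radius [3 n r] is at most [al r^n]. *)
exists (al / (n%:R ^+ 2 * (6 * n%:R) ^+ n)), C;split=> //.
 by apply:divr_gt0 => //;apply:mulr_gt0;apply:exprn_gt0 => //;exact:mulr_gt0.
move=> Omega K delta w w' A f Du u d x0 oOm mw ww Hw EA Lf W1 wg ws dd bmo d0 dK BOm.
have [[mw' w'0 _] _ _] := Hw.
have w'0' x : 0 <= w' x by pos.
have d20 : 0 < 2 * d by pos.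
have dM : 2 * d < (2 * n%:R + 1) * d by exact:double_radius_lt.
set O := eball x0 (2 * d).
have cO : compactly_in O Omega := compactly_in_eball dM BOm.
have OOm : O `<=` Omega by apply:subset_trans BOm;apply:eball_le;exact:ltW.
have mO : measurable (O : set E) by exact:meball.
have LvO := Lf O cO;have [mf _] := LvO.
have [LuO [H [wH LH]]] := W1 O cO.
have [Gi Lfi] := trunc_Lint q1 Hw mw ww d20 LvO.
have [Hi LHi] := trunc_Lint q1 Hw mw ww d20 LH.
have [_ LDu _] := wg.
have LDi i : Lint (trunc O Du i) := L1loc_Lint oOm cO (LDu i).
have uq := ae_forall_ord (weak_gradient_unique n0 d20 OOm wg wH LDi LHi).
have mDu i : lmeasurable O (fun x => Du x 0 i).
 by have [mi _] := LDu i;exact:(measurable_funS (open_meas oOm) OOm mi).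
have mND := measurable_trunc_norm q0 mO mDu.
have mvD : mfun (fun x : E => vnorm (trunc O Du) x `^ q * w' x).
 apply:(mfunM _ mw');apply:mpowR;apply:mvnorm.
 exact:measurable_trunc.
have Di : Lint (fun x => vnorm (trunc O Du) x `^ q * w' x).
 apply:(Lint_lty mvD) => [x|];first pos.
 rewrite (ae_integral_eq (g := fun x => (vnorm (trunc O H) x `^ q * w' x)%:E) measurableT).
 - by rewrite (ig_EFin Hi) ltry.
 - exact:mEFin mvD.
 - exact:mEFin (Lint_meas Hi).
 - apply:ae_imp uq => x hx;congr (normv _ `^ q * _)%:E.
  by apply/rowP => i;rewrite !mxE.
have [muO fuO] := LuO.
have mU := measurable_truncation mO mO (@subset_refl _ O) muO.
pose U x := u x * \1_(O : set E) x.
have Uq x : `|U x| `^ q = `|u x| `^ q * \1_(O) x.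
 rewrite /U indicE;case: (_ \in _);rewrite ?mulr1// !mulr0 normr0 powR0// gt_eqF//.
have mUq : mfun (fun x : E => `|u x| `^ q * \1_(O) x).
 under eq_fun do rewrite -Uq.
 exact:(mpowR q (mT_comp (@normr_measurable R setT) mU)).
have Ui : Lint (fun x => `|U x| `^ q * w' x).
 have := weight_change_Lint mO mUq mw mw' ww (fun x => powR_ge0 _ _) w'0' fuO.
 by congr Lint;apply/funext => x;rewrite Uq.
have [dat eqn] := truncated_problem lam0 lL oOm cO EA wg ws Lfi.
have BMO z (r : R) : 0 < r -> eball z (3 * n%:R * r) `<=` O ->
  exists2 B, elliptic lam Lam B &
  ig (fun x => (\sum_j \sum_i `|B j i - A x j i * \1_(O) x|) * \1_(ball z (3 * r)) x)
   <= al * r ^+ n.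
 move=> r0 zO;have r30 : 0 < 3 * r by pos.
 have bz : ball z (3 * r) `<=` eball z (3 * n%:R * r).
  by have := @ball_sub_eball R n z (3 * r) n0;rewrite mulrCA mulrA.
 have r3d : 3 * r <= 2 * d.
  apply:(ball_sub_radius n0 (z := z) (o := x0) r30 d20) => x /bz/zO;exact:eball_sub_ball.
 have rho : 0 < 3 * n%:R * r < K.
  rewrite !mulr_gt0//=;apply:lt_le_trans dK.
  exact:radius_lt.
 have [B EB HB] := BMO_oscillation n0 lam0 EA oOm bmo rho (subset_trans zO OOm).
 exists B => //;have [mb _] := Lint_ball z r30;have [ma _ _ _ _] := dat.
 apply:(le_trans (HB (fun i j x => A x i j * \1_(O) x) _ mb bz ma _)).
  by move=> i j x /zO xO;rewrite indicE mem_set// mulr1.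
 exact:delta_real.
have est := IE w' Hw _ _ _ _ dat x0 d d0 eqn BMO Di Gi Ui.
have mB : measurable (eball x0 d : set E) by exact:meball.
have BO : eball x0 d `<=` O by apply:eball_le;rewrite ler_peMl ?(ltW d0)// ler1n.
rewrite (weight_change mO mB BO mND mw mw' ww).
under eq_integral do rewrite -(vnorm_trunc O Du _ q0).
rewrite (integral_ig Di mB).
pose h2 x := normv (f x) `^ q + `|u x / d| `^ q.
have h2E x : h2 x * \1_(O) x * w' x =
  vnorm (trunc O f) x `^ q * w' x + d `^ (- q) * (`|U x| `^ q * w' x).
 rewrite Uq (vnorm_trunc O f _ q0) /h2 normrM normfV (gtr0_norm d0) powR_div ?(ltW d0)//.
 by rewrite powRN;ring.
have mh2 : mfun (fun x : E => h2 x * \1_(O) x).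
 have := mfunD (measurable_trunc_norm q0 mO mf) (mfunM (measurable_cst (d `^ (- q))) mUq).
 congr measurable_fun;apply/funext => x /=.
 by rewrite /h2 normrM normfV (gtr0_norm d0) powR_div ?(ltW d0)// powRN;ring.
rewrite (weight_change mO mO (@subset_refl _ O) mh2 mw mw' ww).
under eq_integral do rewrite h2E.
rewrite (integral_ig (LintD Gi (LintZ (d `^ (- q)) Ui)) mO) -EFinM lee_fin.
apply:(le_trans est);apply:ler_wpM2l;first exact:ltW.
have LG := Lint_indic Gi mO;have LU := Lint_indic Ui mO.
apply:le_of_eq;apply:esym.
transitivity (ig (fun x => vnorm (trunc O f) x `^ q * w' x * \1_(O) x +
 d `^ (- q) * (`|U x| `^ q * w' x * \1_(O) x))).
 by congr ig;apply/funext => x;rewrite mulrDl -!mulrA.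
by apply:(etrans (igD LG (LintZ (d `^ (- q)) LU)));congr (_ + _);exact:igZ.
Qed.

End estimate.

End euclidean_integrals.

Theorem theorem5p1 (R : realType) (n : nat) (q lam Lam M0 : R)
    (hn : (2 <= n)%N) (hq : 1 < q) (hlam : 0 < lam) (hLam : lam <= Lam)
    (hM0 : 0 < M0) :
  exists delta0 M C : R, [/\ 0 < delta0, 2 < M, 0 < C &
    forall (Omega : set 'rV[R]_n) (K : R) (w : 'rV[R]_n -> R)
      (A : 'rV[R]_n -> 'M[R]_n) (f : 'rV[R]_n -> 'rV[R]_n)
      (u : 'rV[R]_n -> R) (Du : 'rV[R]_n -> 'rV[R]_n) (delta : R),
    bounded_domain Omega ->
    0 < K ->
    Aq q w -> (Aq_const q w <= M0%:E)%E ->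
    elliptic_coefficients lam Lam Omega A ->
    Lqw_vec_loc q w Omega f ->
    W1qw_loc q w Omega u -> weak_gradient Omega u Du ->
    weak_solution Omega A f Du ->
    delta <= delta0 -> is_BMO Omega delta K A ->
    forall (d : R) (x0 : 'rV[R]_n),
    0 < d -> d <= K / M -> Omega x0 -> eball x0 (M * d) `<=` Omega ->
    (\int[@lebesgue R n]_(x in eball x0 d) (normv (Du x) `^ q * w x)%:E
     <= C%:E * \int[@lebesgue R n]_(x in eball x0 (2 * d))
                 ((normv (f x) `^ q + `|u x / d| `^ q) * w x)%:E)%E].
Proof.
have n0 : (0 < n)%N by exact:leq_trans hn.
pose M := Num.max 1 (M0 * ((2 * n%:R) ^+ n) `^ q).
have M1 : 1 <= M by rewrite le_max lexx.
have [delta0 [C [d00 C0 est]]] := estimate_of_weight n0 hlam hLam hq M1.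
have n2 : 2 <= n%:R :> R by rewrite ler_nat.
exists delta0, (2 * n%:R + 1), C;split=> //;first by lra.
move=> Omega K w A f u Du delta [oOm _ _ _] K0 Aqw Mw EA Lf W1 wg ws dd bmo d x0 d0 dK _ BOm.
have [w0 [mw _] _] := Aqw;have q0 : 0 < q by exact:lt_trans hq.
have dM : (2 * n%:R + 1) * d <= K by rewrite mulrC -ler_pdivlMr.
have [wz|[w' [ww Hw]]] := Aq_cube_Aq n0 hq (ltW hM0) Aqw Mw;last first.
 exact:est oOm mw ww Hw EA Lf W1 wg ws dd bmo d0 dM BOm.
(* The convention [0 * +oo = 0] lets a weight that vanishes almost everywhere satisfy [Aq]. In that
   case [w] may be replaced by 0 on the left-hand side, which then vanishes. *)
have mB : measurable (eball x0 d : set (euclid R n)) by exact:meball.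
have B2 : eball x0 d `<=` Omega.
 by apply:subset_trans BOm;apply:eball_le;rewrite ler_peMl ?(ltW d0)//;lra.
have [_ LDu _] := wg.
have mD i : lmeasurable (eball x0 d) (fun x => Du x 0 i).
 by have [mi _] := LDu i;exact:(measurable_funS (open_meas oOm) B2 mi).
have mN := measurable_trunc_norm q0 mB mD.
rewrite (weight_change mB mB sub_id mN mw (measurable_cst (0 : R)) wz).
under eq_integral do rewrite mulr0.
rewrite integral0;apply:mule_ge0;first pos.
by apply:integral_ge0 => x _;rewrite lee_fin mulr_ge0// addr_ge0 ?powR_ge0.
Qed.
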